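(* Let $X:\Sigma^2\to\mathbb{R}^4$ be an oriented 2-dimensional complete translating soliton, i.e. an isometric immersion of a complete oriented Riemannian surface whose mean curvature vector satisfies $H=-V_0^N$ for a fixed unit vector $V_0\in\mathbb{R}^4$, and suppose its normal curvature is nonpositive, $\kappa^\perp\le 0$ on $\Sigma$. Assume that the image of the complex phase map $J:\Sigma\to\mathbb{S}^2$ is contained in a regular ball in $\mathbb{S}^2$, i.e. a geodesic ball $B_R(q)$ disjoint from the cut locus of $q$ and with $R<\frac{\pi}{2}$. Then $\Sigma$ is an affine plane.
   Context: Let $\Sigma$ be a (connected) oriented surface isometrically immersed in $\mathbb{R}^4$. $(\cdot)^T$ and $(\cdot)^N$ denote orthogonal projections onto the tangent bundle $T\Sigma$ and the normal bundle $T^\perp\Sigma$. The second fundamental form is $B(U,W)=(\overline\nabla_U W)^N$, with $\overline\nabla$ the flat connection of $\mathbb{R}^4$, and the mean curvature vector is $H=\sum_{i=1}^2 B(e_i,e_i)$ for a local orthonormal frame $\{e_1,e_2\}$ of $\Sigma$. Hyperkähler structure: $\mathbb{R}^4$ is equipped with its flat metric and constant (parallel) orthogonal almost complex structures $J_1,J_2,J_3=J_1J_2$ satisfying $J_1^2=J_2^2=J_3^2=J_1J_2J_3=-1$. Complex phase map: an oriented immersed surface $\Sigma\subset\mathbb{R}^4$ is always hyper-Lagrangian, meaning that for each $x\in\Sigma$ there is a unit vector $(\lambda_1,\lambda_2,\lambda_3)\in\mathbb{S}^2\subset\mathbb{R}^3$ such that $\langle K\cdot,\cdot\rangle|_{T_x\Sigma}=0$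 for every $K=\sum_\alpha\mu_\alpha J_\alpha$ with $\sum_\alpha\lambda_\alpha\mu_\alpha=0$. Equivalently, $\sum_\alpha\lambda_\alpha J_\alpha$ preserves $T_x\Sigma$. The vector is determined up to sign, and the sign is fixed by the orientation: $\sum_\alpha\lambda_\alpha J_\alpha e_1=e_2$ for an oriented orthonormal basis $\{e_1,e_2\}$ of $T_x\Sigma$, i.e. $\lambda_\alpha=\langle J_\alpha e_1,e_2\rangle$. The complex phase map is $J:\Sigma\to\mathbb{S}^2$, $J(x)=(\lambda_1,\lambda_2,\lambda_3)$, where $\mathbb{S}^2$ is the round unit sphere. Normal curvature: with $\nabla$ the normal connection on $T^\perp\Sigma$ and the sign convention $R(X,Y)\mu=-\nabla_X\nabla_Y\mu+\nabla_Y\nabla_X\mu+\nabla_{[X,Y]}\mu$ for $X,Y$ tangent and $\mu$ normal, set $\kappa^\perp:=\langle R(e_1,e_2)\nu_1,\nu_2\rangle$. Here $\{e_1,e_2\}$ is a local orthonormal tangent frame and $\{\nu_1,\nu_2\}$ a local orthonormal normal frame such that $\{e_1,e_2,\nu_1,\nu_2\}$ has the same orientation as $\{e_1,\widetilde J_1e_1,\widetilde J_2e_1,\widetilde J_3e_1\}$, where $\widetilde J_\beta=\sum_\alpha a_{\beta\alpha}J_\alpha$ for a matrix $(a_{\beta\alpha})\in \mathrm{SO}(3)$ with first row $(\lambda_1,\lambda_2,\lambda_3)$. (This is the same orientation as that of $\{e_1,J_1e_1,J_2e_1,J_3e_1\}$.) ''$\Sigma$ is an affine plane'' means that $X(\Sigma)$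 is an affine 2-dimensional plane in $\mathbb{R}^4$. *)

(* Defs.v *)
From HB Require Import structures.
From mathcomp Require Import all_boot all_order all_algebra.
From mathcomp Require Import all_classical all_reals all_analysis.

Set Implicit Arguments.
Unset Strict Implicit.
Unset Printing Implicit Defensive.

Import Order.TTheory GRing.Theory Num.Theory.
Import numFieldNormedType.Exports.

Local Open Scope classical_set_scope.
Local Open Scope ring_scope.

Section Euclidean.
Variable R : realType.

Definition dot n (u v : 'rV[R]_n) : R := \sum_(i < n) u 0 i * v 0 i.

(* The library norm on matrices is the sup norm, whence a separate name. *)
Definition enorm n (u : 'rV[R]_n) : R := Num.sqrt (dot u u).

(* Points of R^n are row vectors, but endomorphisms are written in the usual
   column convention, so that [A * B] is the composite "A after B". *)
Definition act n (A : 'M[R]_n) (v : 'rV[R]_n) : 'rV[R]_n := v *m A^T.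

Definition affine_plane n (P : set 'rV[R]_n) : Prop :=
  exists (p : 'rV[R]_n) (A : 'M[R]_(2, n)),
    row_free A /\ P = [set p + w *m A | w in [set: 'rV[R]_2]].

(* Meant for U open. *)
Fixpoint Ck (V W : normedModType R) (k : nat) (U : set V) (f : V -> W) : Prop :=
  match k with
  | 0 => forall x, U x -> {for x, continuous f}
  | k'.+1 => (forall x, U x -> differentiable f x) /\
             (forall v : V, Ck k' U ('D_v f))
  end.

Definition smooth (V W : normedModType R) (U : set V) (f : V -> W) : Prop :=
  forall k, Ck k U f.

End Euclidean.

(* An oriented smooth atlas, modelled on R^2: [cmap i] is a homeomorphism from
   the open set [cdom i] onto an open set of R^2, with inverse [cinv i]; all
   four maps are total, with irrelevant values outside these sets. *)
Record oriented_atlas (R : realType) (S : topologicalType) := OrientedAtlas {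
  chart : Type ;
  cdom : chart -> set S ;
  cmap : chart -> S -> 'rV[R]_2 ;
  cinv : chart -> 'rV[R]_2 -> S ;
  cdom_open : forall i, open (cdom i) ;
  cimg_open : forall i, open (cmap i @` cdom i) ;
  cdom_cover : forall x, exists i, cdom i x ;
  cmapK : forall i x, cdom i x -> cinv i (cmap i x) = x ;
  cmap_continuous : forall i x, cdom i x -> {for x, continuous (cmap i)} ;
  cinv_continuous : forall i u, (cmap i @` cdom i) u ->
    {for u, continuous (cinv i)} ;
  transition_smooth : forall i j,
    smooth (cmap i @` (cdom i `&` cdom j)) (cmap j \o cinv i) ;
  transition_oriented : forall i j u, (cmap i @` (cdom i `&` cdom j)) u ->
    0 < \det (jacobian (cmap j \o cinv i) u)
}.

Section ImmersedSurface.
Variables (R : realType) (S : topologicalType) (A : oriented_atlas R S).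
Variable X : S -> 'rV[R]_4.

Definition surface : Prop :=
  [/\ hausdorff_space S, @second_countable S, [set: S] !=set0
    & connected [set: S]].

Definition cimg (i : chart A) : set 'rV[R]_2 := cmap i @` cdom i.

Definition local_param (i : chart A) : 'rV[R]_2 -> 'rV[R]_4 := X \o cinv i.

Definition immersion : Prop := forall i : chart A,
  smooth (cimg i) (local_param i) /\
  (forall u, cimg i u ->
     forall v : 'rV[R]_2, 'D_v (local_param i) u = 0 -> v = 0).

Definition C1_curve (c : R -> S) : Prop :=
  continuous c /\
  forall i : chart A, Ck 1 (c @^-1` cdom i) (cmap i \o c : R -> 'rV[R]_2).

(* Length of c on [0,1] for the metric induced by X. *)
Definition curve_length (c : R -> S) : R :=
  (\int[lebesgue_measure]_(t in `[0, 1]) enorm ('D_1 (X \o c : R -> 'rV[R]_4) t))%R.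

(* A piecewise C^1 curve from p to q is a chain of C^1 pieces, each
   parametrized by [0,1].  A C^1 map from [0,1] to a surface extends to a C^1
   map on R, so pieces may be taken to be defined on R. *)
Fixpoint piecewise_C1 (p q : S) (s : seq (R -> S)) : Prop :=
  match s with
  | [::] => p = q
  | c :: s' => [/\ C1_curve c, c 0 = p & piecewise_C1 (c 1) q s']
  end.

Definition riem_dist (p q : S) : \bar R :=
  ereal_inf [set (\sum_(c <- s) curve_length c)%:E
            | s in [set s | piecewise_C1 p q s]].

Definition complete_surface : Prop := forall a : nat -> S,
  (forall eps : R, 0 < eps -> exists N : nat, forall m n : nat,
     (N <= m)%N -> (N <= n)%N -> (riem_dist (a m) (a n) < eps%:E)%E) ->
  exists p : S, forall eps : R, 0 < eps -> exists N : nat, forall n : nat,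
     (N <= n)%N -> (riem_dist (a n) p < eps%:E)%E.

Definition tangent (x : S) : set 'rV[R]_4 :=
  [set w | exists (i : chart A) (v : 'rV[R]_2),
     cdom i x /\ w = 'D_v (local_param i) (cmap i x)].

Definition oriented_onb (x : S) (e1 e2 : 'rV[R]_4) : Prop :=
  [/\ dot e1 e1 = 1, dot e2 e2 = 1, dot e1 e2 = 0
    & exists (i : chart A) (v1 v2 : 'rV[R]_2),
      [/\ cdom i x, 0 < \det (col_mx v1 v2 : 'M[R]_2),
          e1 = 'D_v1 (local_param i) (cmap i x)
        & e2 = 'D_v2 (local_param i) (cmap i x)]].

End ImmersedSurface.

(* Vector fields on an open set of the parameter plane are maps
   'rV_2 -> 'rV_2; F is a local parametrization of the surface. *)
Section LocalGeometry.
Variables (R : realType) (F : 'rV[R]_2 -> 'rV[R]_4).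

Definition push (xi : 'rV[R]_2 -> 'rV[R]_2) (u : 'rV[R]_2) : 'rV[R]_4 :=
  'D_(xi u) F u.

Definition tangent_frame (U : set 'rV[R]_2)
    (e : 'I_2 -> 'rV[R]_2 -> 'rV[R]_2) : Prop :=
  (forall a, smooth U (e a)) /\
  (forall u, U u -> forall a b, dot (push (e a) u) (push (e b) u) = (a == b)%:R).

Definition normal_frame (U : set 'rV[R]_2)
    (e : 'I_2 -> 'rV[R]_2 -> 'rV[R]_2) (nu : 'I_2 -> 'rV[R]_2 -> 'rV[R]_4) :
    Prop :=
  (forall a, smooth U (nu a)) /\
  (forall u, U u -> forall a b,
     dot (nu a u) (nu b u) = (a == b)%:R /\ dot (nu a u) (push (e b) u) = 0).

Variable e : 'I_2 -> 'rV[R]_2 -> 'rV[R]_2.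

(* The projection w^N; e is an orthonormal tangent frame. *)
Definition normal_part (u : 'rV[R]_2) (w : 'rV[R]_4) : 'rV[R]_4 :=
  w - \sum_(a < 2) dot w (push (e a) u) *: push (e a) u.

Definition second_fund (xi eta : 'rV[R]_2 -> 'rV[R]_2) (u : 'rV[R]_2) :
  'rV[R]_4 := normal_part u ('D_(xi u) (push eta) u).

Definition mean_curvature (u : 'rV[R]_2) : 'rV[R]_4 :=
  \sum_(a < 2) second_fund (e a) (e a) u.

Definition normal_conn (xi : 'rV[R]_2 -> 'rV[R]_2) (mu : 'rV[R]_2 -> 'rV[R]_4)
  (u : 'rV[R]_2) : 'rV[R]_4 := normal_part u ('D_(xi u) mu u).

Definition lie_bracket (xi eta : 'rV[R]_2 -> 'rV[R]_2) (u : 'rV[R]_2) :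
  'rV[R]_2 := 'D_(xi u) eta u - 'D_(eta u) xi u.

(* Note the sign convention. *)
Definition normal_curv_tensor (xi eta : 'rV[R]_2 -> 'rV[R]_2)
    (mu : 'rV[R]_2 -> 'rV[R]_4) (u : 'rV[R]_2) : 'rV[R]_4 :=
  - normal_conn xi (normal_conn eta mu) u
  + normal_conn eta (normal_conn xi mu) u
  + normal_conn (lie_bracket xi eta) mu u.

Definition normal_curvature (nu : 'I_2 -> 'rV[R]_2 -> 'rV[R]_4)
    (u : 'rV[R]_2) : R :=
  dot (normal_curv_tensor (e 0) (e 1) (nu 0) u) (nu 1 u).

End LocalGeometry.

Section Hyperkahler.
Variables (R : realType) (J : 'I_3 -> 'M[R]_4).

(* The indices 0, 1, 2 stand for 1, 2, 3. *)
Definition hyperkahler : Prop :=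
  [/\ forall a, (J a)^T *m J a = 1%:M,
      forall a, J a * J a = -1,
      J 2 = J 0 * J 1
    & J 0 * J 1 * J 2 = -1].

Definition Jcomb (mu : 'rV[R]_3) : 'M[R]_4 := \sum_(a < 3) mu 0 a *: J a.

Definition basis_mx (v0 v1 v2 v3 : 'rV[R]_4) : 'M[R]_4 :=
  \matrix_(k < 4) nth 0 [:: v0; v1; v2; v3] k.

Definition same_orientation (M N : 'M[R]_4) : Prop := 0 < \det M * \det N.

(* {e1,e2,nu1,nu2} is oriented as {e1,J1 e1,J2 e1,J3 e1}. *)
Definition adapted (F : 'rV[R]_2 -> 'rV[R]_4) (U : set 'rV[R]_2)
    (e : 'I_2 -> 'rV[R]_2 -> 'rV[R]_2) (nu : 'I_2 -> 'rV[R]_2 -> 'rV[R]_4) :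
    Prop :=
  forall u, U u ->
    let e1 := push F (e 0) u in
    same_orientation
      (basis_mx e1 (push F (e 1) u) (nu 0 u) (nu 1 u))
      (basis_mx e1 (act (J 0) e1) (act (J 1) e1) (act (J 2) e1)).

End Hyperkahler.

Section Hypotheses.
Variables (R : realType) (S : topologicalType) (A : oriented_atlas R S).
Variable X : S -> 'rV[R]_4.

(* H = - V0^N.  Both sides do not depend on the local orthonormal frame, and
   such frames exist around every point (Gram-Schmidt). *)
Definition translating_soliton (V0 : 'rV[R]_4) : Prop :=
  forall (i : chart A) (U : set 'rV[R]_2) (e : 'I_2 -> 'rV[R]_2 -> 'rV[R]_2),
    open U -> U `<=` cimg i -> tangent_frame (local_param X i) U e ->
    forall u, U u ->
      mean_curvature (local_param X i) e u
      = - normal_part (local_param X i) e u V0.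

(* Likewise frame independent. *)
Definition normal_curvature_le0 (J : 'I_3 -> 'M[R]_4) : Prop :=
  forall (i : chart A) (U : set 'rV[R]_2) (e : 'I_2 -> 'rV[R]_2 -> 'rV[R]_2)
      (nu : 'I_2 -> 'rV[R]_2 -> 'rV[R]_4),
    open U -> U `<=` cimg i ->
    tangent_frame (local_param X i) U e ->
    normal_frame (local_param X i) U e nu ->
    adapted J (local_param X i) U e nu ->
    forall u, U u -> normal_curvature (local_param X i) e nu u <= 0.

(* These conditions determine phi x for every x. *)
Definition complex_phase_map (J : 'I_3 -> 'M[R]_4) (phi : S -> 'rV[R]_3) :
    Prop :=
  forall x : S,
    [/\ dot (phi x) (phi x) = 1,
        forall mu : 'rV[R]_3, dot (phi x) mu = 0 ->
          forall U W, tangent A X x U -> tangent A X x W ->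
            dot (act (Jcomb J mu) U) W = 0
      & forall e1 e2, oriented_onb A X x e1 e2 ->
          act (Jcomb J (phi x)) e1 = e2].

End Hypotheses.

Section Sphere.
Variable R : realType.

Definition sphere : set 'rV[R]_3 := [set p | dot p p = 1].

(* The round distance on the unit sphere is the angle. *)
Definition sphere_ball (q : 'rV[R]_3) (r : R) : set 'rV[R]_3 :=
  sphere `&` [set p | acos (dot q p) < r].

(* On the round sphere the cut locus of q is its antipode. *)
Definition cut_locus (q : 'rV[R]_3) : set 'rV[R]_3 := [set - q].

Definition regular_ball (q : 'rV[R]_3) (r : R) : Prop :=
  [/\ sphere q, 0 < r, sphere_ball q r `&` cut_locus q = set0 & r < pi / 2].

End Sphere.

(* Main.v *)
(* The phase map phi is harmonic for the drift Laplacian L of the soliton, and with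
   h = |d phi|^2, v = q.phi - c and c = cos r / 2, so that v >= c on the ball, the
   sign of the normal curvature gives L Q >= 2 c^2 Q^2 - 2 |grad Q| sqrt Q for
   Q = h / v^2.  If Q were positive somewhere, completeness would yield (by Hofer's
   point picking) a point y such that Q is at most (1 + tau) Q(y) on a ball of
   radius 1 / (32 sqrt (Q y)).  There the tangent planes turn slowly, so the
   projection P onto the tangent plane at y has a section over a disc; the function
   Q - kappa |P - P y|^2 has an interior maximum over this disc, which contradicts
   the inequality when tau is small.  So phi is constant, all tangent planes are
   parallel, and sections of P over arbitrarily large discs show that X is onto a
   plane. *)

Require Import Defs.
From HB Require Import structures.
From mathcomp Require Import all_boot all_order all_algebra.
From mathcomp Require Import all_classical all_reals all_analysis.
From mathcomp Require Import ring lra.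

Set Implicit Arguments.
Unset Strict Implicit.
Unset Printing Implicit Defensive.

Import Order.TTheory GRing.Theory Num.Theory.
Import numFieldNormedType.Exports.
Local Open Scope classical_set_scope.
Local Open Scope ring_scope.

(** * Calculus of smooth maps *)

(** The obstacle is that neither a curvature bound nor a comparison theorem for the intrinsic
    distance is at hand, so cut-off functions of the distance cannot be used. Ambient coordinates
    replace them: for L = Laplacian - V0^T one has L (p . X) = - p . V0, bounded whatever the second
    fundamental form B is. Hence |P - P y|^2 is a good barrier as soon as it is proper on a piece of
    the surface, which is the purpose of the sections of P. The sign of the normal curvature enters
    twice. It gives |B|^2 <= |d phi|^2, so that a bound on Q controls the turning of tangent planes;
    and it absorbs the Bakry-Emery curvature of L, equal to - sum_k B_ik . B_jk on a soliton, in the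
    Bochner formula of phi. The picking radius is a multiple of Q(y)^(-1/2), the scale on which B
    turns a plane by a fixed angle. The equation is not scale invariant, since |V0| = 1; this is why
    tau depends on a positive lower bound of Q(y). Local computations use graph fields given by
    Cramer's rule, and identities from which the area element has been cleared, so that they are
    polynomial. *)

Section SmoothCalculus.
Variables (R : realType) (V : normedModType R).
Implicit Types (U : set V).

Lemma diff_eps (W : normedModType R) (f : V -> W) x (e : R) :
  differentiable f x -> 0 < e ->
  \forall h \near 0, `|f (h + x) - f x - 'd f x h| <= e * `|h|.
Proof.
move=> df e0; have := diff_locally df => /eqaddoP /(_ _ e0).
apply: filterS => h /=.
by rewrite !fctE /= opprD addrA.
Qed.

Lemma diff_intro (W : normedModType R) (f : V -> W) x (df : {linear V -> W}) :
  continuous df ->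
  (forall e, 0 < e -> \forall h \near 0, `|f (h + x) - f x - df h| <= e * `|h|) ->
  differentiable f x /\ 'd f x = df :> (V -> W).
Proof.
move=> dc H.
have E : f \o shift x = cst (f x) + df +o_ 0 id.
  apply/eqaddoP => e e0; apply: filterS (H e e0) => h.
  by rewrite !fctE /= opprD addrA.
have D := diff_unique dc E; split => //.
by apply/diff_locallyP; rewrite D.
Qed.

Lemma near_eq_diff (W : normedModType R) (f g : V -> W) x :
  {near x, f =1 g} -> differentiable f x ->
  differentiable g x /\ 'd g x = 'd f x :> (V -> W).
Proof.
move=> fg df; apply: diff_intro => [|e e0]; first exact: diff_continuous.
have h1 := diff_eps df e0.
have h2 : \forall h \near 0, f (h + x) = g (h + x).
  by move: fg; rewrite (near_shift 0) subr0; apply: filterS => h; rewrite /= .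
by near=> h; rewrite -(near h2 h) // -(nbhs_singleton fg); near: h.
Unshelve. all: by end_near. Qed.

Lemma open_near_eq U (T : Type) (f g : V -> T) x : open U -> U x ->
  (forall y, U y -> f y = g y) -> {near x, f =1 g}.
Proof.
move=> oU Ux fg; near=> y; apply: fg; near: y; exact: open_nbhs_nbhs.
Unshelve. all: by end_near. Qed.

Lemma Ck_ext (W : normedModType R) k U (f g : V -> W) : open U ->
  (forall x, U x -> f x = g x) -> Ck k U f -> Ck k U g.
Proof.
move=> oU; elim: k f g => [|k IH] f g fg /=.
  move=> cf x Ux; rewrite /prop_for /continuous_at -(fg _ Ux).
  apply: cvg_trans (cf x Ux).
  by apply: near_eq_cvg; exact: open_near_eq fg.
move=> [df cf]; split=> [x Ux|v].
  by have [] := near_eq_diff (open_near_eq oU Ux fg) (df x Ux).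
apply: IH (cf v) => x Ux.
by apply: near_eq_derive; exact: open_near_eq fg.
Qed.

Lemma CkW (W : normedModType R) k U (f : V -> W) : Ck k.+1 U f -> Ck k U f.
Proof.
elim: k f => [|k IH] f /=.
  by move=> [df _] x Ux; apply: differentiable_continuous; exact: df.
by move=> [df cf]; split=> // v; apply: IH; exact: cf.
Qed.

Lemma Ck_subset (W : normedModType R) k U U' (f : V -> W) :
  U' `<=` U -> Ck k U f -> Ck k U' f.
Proof.
move=> s; elim: k f => [|k IH] f /=; first by move=> cf x /s; exact: cf.
by move=> [df cf]; split=> [x /s|v]; [exact: df|exact: IH].
Qed.

Lemma CkD (W : normedModType R) k U (f g : V -> W) : open U ->
  Ck k U f -> Ck k U g -> Ck k U (fun x => f x + g x).
Proof.
move=> oU; elim: k f g => [|k IH] f g /=.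
  by move=> cf cg x Ux; apply: cvgD; [exact: cf|exact: cg].
move=> [df cf] [dg cg]; split=> [x Ux|v].
  by apply: differentiableD; [exact: df|exact: dg].
apply: (Ck_ext oU _ (IH _ _ (cf v) (cg v))) => x Ux /=.
by rewrite deriveD //; apply: diff_derivable; [exact: df|exact: dg].
Qed.

Lemma CkN (W : normedModType R) k U (f : V -> W) : open U ->
  Ck k U f -> Ck k U (fun x => - f x).
Proof.
move=> oU; elim: k f => [|k IH] f /=.
  by move=> cf x Ux; apply: cvgN; exact: cf.
move=> [df cf]; split=> [x Ux|v].
  by apply: differentiableN; exact: df.
apply: (Ck_ext oU _ (IH _ (cf v))) => x Ux /=.
by rewrite deriveN //; apply: diff_derivable; exact: df.
Qed.

Lemma CkM k U (f g : V -> R) : open U ->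
  Ck k U f -> Ck k U g -> Ck k U (fun x => f x * g x).
Proof.
move=> oU; elim: k f g => [|k IH] f g.
  by move=> cf cg x Ux; apply: cvgM; [exact: cf|exact: cg].
move=> sf sg; have [df cf] := sf; have [dg cg] := sg; split=> [x Ux|v].
  by apply: differentiableM; [exact: df|exact: dg].
apply: (Ck_ext oU _ (CkD oU (IH _ _ (CkW sf) (cg v)) (IH _ _ (CkW sg) (cf v)))) => x Ux /=.
by rewrite deriveM //; apply: diff_derivable; [exact: df|exact: dg].
Qed.

Lemma Ck_cst (W : normedModType R) k U (a : W) : Ck k U (fun=> a).
Proof.
elim: k a => [|k IH] a /=; first by move=> x _; exact: cvg_cst.
split=> [x _|v]; first exact: differentiable_cst.
rewrite [X in Ck _ _ X](_ : _ = fun=> 0) //.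
by rewrite funeqE => x; rewrite derive_cst.
Qed.

Lemma CkV k U (f : V -> R) : open U -> (forall x, U x -> f x != 0) ->
  Ck k U f -> Ck k U (fun x => (f x)^-1).
Proof.
move=> oU f0; elim: k => [|k IH].
  by move=> cf x Ux; apply: cvgV; [exact: (f0 x Ux)|exact: (cf x Ux)].
move=> sf; have [df cf] := sf; have si := IH (CkW sf); split=> [x Ux|v].
  by apply: differentiableV; [exact: df|exact: f0].
apply: (Ck_ext oU _ (CkN oU (CkM oU (CkM oU si si) (cf v)))) => x Ux /=.
rewrite deriveV; [|exact: f0|by apply: diff_derivable; exact: df].
by rewrite scaleNr expr2 invfM.
Qed.

Lemma smooth_ext (W : normedModType R) U (f g : V -> W) : open U ->
  (forall x, U x -> f x = g x) -> smooth U f -> smooth U g.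
Proof. by move=> oU fg sf k; apply: Ck_ext (sf k). Qed.

Lemma smooth_subset (W : normedModType R) U U' (f : V -> W) :
  U' `<=` U -> smooth U f -> smooth U' f.
Proof. by move=> s sf k; apply: Ck_subset (sf k). Qed.

Lemma smoothD (W : normedModType R) U (f g : V -> W) : open U ->
  smooth U f -> smooth U g -> smooth U (fun x => f x + g x).
Proof. by move=> oU sf sg k; apply: CkD. Qed.

Lemma smoothN (W : normedModType R) U (f : V -> W) : open U ->
  smooth U f -> smooth U (fun x => - f x).
Proof. by move=> oU sf k; apply: CkN. Qed.

Lemma smoothM U (f g : V -> R) : open U ->
  smooth U f -> smooth U g -> smooth U (fun x => f x * g x).
Proof. by move=> oU sf sg k; apply: CkM. Qed.

Lemma smooth_cst (W : normedModType R) U (a : W) : smooth U (fun=> a).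
Proof. by move=> k; exact: Ck_cst. Qed.

Lemma smoothV U (f : V -> R) : open U -> (forall x, U x -> f x != 0) ->
  smooth U f -> smooth U (fun x => (f x)^-1).
Proof. by move=> oU f0 sf k; apply: CkV. Qed.

Lemma smooth_derive (W : normedModType R) U (f : V -> W) v :
  smooth U f -> smooth U ('D_v f).
Proof. by move=> sf k; have [_ /(_ v)] := sf k.+1. Qed.

Lemma smooth_differentiable (W : normedModType R) U (f : V -> W) x :
  smooth U f -> U x -> differentiable f x.
Proof. by move=> sf Ux; have [/(_ _ Ux)] := sf 1%N. Qed.

Lemma smooth_derivable (W : normedModType R) U (f : V -> W) x v :
  smooth U f -> U x -> derivable f x v.
Proof. by move=> sf Ux; apply: diff_derivable; exact: smooth_differentiable sf Ux. Qed.

Lemma smooth_continuous (W : normedModType R) U (f : V -> W) x :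
  smooth U f -> U x -> {for x, continuous f}.
Proof. by move=> sf Ux; exact: (sf 0%N). Qed.

Lemma smooth_sum (W : normedModType R) U n (f : 'I_n -> V -> W) : open U ->
  (forall i, smooth U (f i)) -> smooth U (fun x => \sum_i f i x).
Proof.
move=> oU; elim: n f => [|n IH] f sf.
  apply: smooth_ext (@smooth_cst W U 0) => // x _; first by rewrite big_ord0.
apply: smooth_ext (smoothD oU (IH _ (fun i => sf (widen_ord (leqnSn n) i))) (sf ord_max)) => // x _.
by rewrite big_ord_recr.
Qed.

(** The derivative f' / (2 sqrt f) contains sqrt f again, at one order less, which the induction
    supplies. *)
Lemma Ck_sqrt k U (f : V -> R) : open U -> (forall x, U x -> 0 < f x) ->
  Ck k U f -> Ck k U (fun x => Num.sqrt (f x)).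
Proof.
move=> oU f0; elim: k => [|k IH].
  move=> cf x Ux; apply: (@continuous_comp _ _ _ f Num.sqrt); first exact: cf.
  exact: sqrt_continuous.
move=> sf; have [df cf] := sf; have si := IH (CkW sf).
have s0 x : U x -> 2 * Num.sqrt (f x) != 0.
  by move=> Ux; rewrite mulf_neq0 ?pnatr_eq0 // gt_eqF // sqrtr_gt0 f0.
have dS x : U x -> is_diff x (Num.sqrt \o f)
  (fun v => 'd f x v * (2 * Num.sqrt (f x))^-1).
  move=> Ux.
  have [h1 h2] := is_derive1_sqrt (f0 x Ux).
  have h3 : differentiable (Num.sqrt : R -> R) (f x) by apply/derivable1_diffP.
  split; first exact: (differentiable_comp (df x Ux) h3).
  rewrite (diff_comp (df x Ux) h3) funeqE => v /=.
  rewrite deriv1E // derive1E h2 /=.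
  by [].
split=> [x Ux|v].
  by have [] := dS x Ux.
apply: (Ck_ext oU _ (CkM oU (cf v) (CkV oU s0 (CkM oU (Ck_cst k U (2 : R)) si)))) => x Ux /=.
have [h1 h2] := dS x Ux.
by rewrite (deriveE _ (h1 : differentiable (fun x => Num.sqrt (f x)) x)) h2 -deriveE //; exact: df.
Qed.

Lemma smooth_sqrt U (f : V -> R) : open U -> (forall x, U x -> 0 < f x) ->
  smooth U f -> smooth U (fun x => Num.sqrt (f x)).
Proof. by move=> oU f0 sf k; apply: Ck_sqrt. Qed.

End SmoothCalculus.

Section Lines.
Variables (R : realType) (V : normedModType R).

Lemma line_derive (W : normedModType R) (f : V -> W) x v (t : R) :
  differentiable f (x + t *: v) ->
  is_derive t (1 : R) (fun s : R => f (x + s *: v)) ('D_v f (x + t *: v)).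
Proof.
move=> df.
have h : is_diff t (fun s : R => x + s *: v) (fun s => s *: v).
  have := is_diffD (is_diff_cst x t) (is_diff_scalel t v).
  by rewrite add0r.
have [h1 h2] := h.
have h3 := @differentiable_comp _ _ _ _ (fun s : R => x + s *: v) f t h1 df.
split; first exact/derivable1_diffP.
by rewrite deriveE // (diff_comp h1 df) /= h2 scale1r deriveE.
Qed.

Lemma deriveZv (W : normedModType R) (f : V -> W) x a v : differentiable f x ->
  'D_(a *: v) f x = a *: 'D_v f x.
Proof. by move=> df; rewrite !deriveE // linearZ. Qed.

Lemma deriveDv (W : normedModType R) (f : V -> W) x v w : differentiable f x ->
  'D_(v + w) f x = 'D_v f x + 'D_w f x.
Proof. by move=> df; rewrite !deriveE // linearD. Qed.

Lemma near0_line (P : V -> Prop) (v w : V) : (\forall h \near 0, P h) ->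
  exists2 d : R, 0 < d & forall s t : R, `|s| < d -> `|t| < d -> P (s *: v + t *: w).
Proof.
move=> /nbhs_ballP[e /= e0 He].
have N0 : 0 < 1 + `|v| + `|w| by rewrite -addrA ltr_pwDl // addr_ge0.
exists (e / (1 + `|v| + `|w|)); first by rewrite divr_gt0.
move=> s t sd td; apply: He; rewrite -ball_normE /= sub0r normrN.
apply: le_lt_trans (ler_normD _ _) _; rewrite !normrZ.
apply: (@le_lt_trans _ _ ((e / (1 + `|v| + `|w|)) * (`|v| + `|w|))).
  by rewrite mulrDr lerD // ler_wpM2r // ltW.
rewrite -mulrA gtr_pMr // mulrC ltr_pdivrMr // mul1r -addrA.
by rewrite ltrDr.
Qed.

(** The mean value theorem for t |-> f (x + s w + t v) - f (x + t v) reduces the second difference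
    to a first difference of ['D_v f], so that differentiability of ['D_v f] at the single point [x]
    is enough. The estimate serves both for the symmetry of second derivatives and for the second
    derivative test. *)
Lemma second_diff (f : V -> R) x v w (e : R) : 0 < e ->
  (\forall y \near x, differentiable f y) -> differentiable ('D_v f) x ->
  exists2 d : R, 0 < d & forall s, 0 < s -> s < d ->
    `|f (x + s *: v + s *: w) - f (x + s *: v) - f (x + s *: w) + f x
      - s ^+ 2 * 'D_w ('D_v f) x| <= e * s ^+ 2.
Proof.
move=> e0 ndf ddf.
set M := 1 + `|v| + `|w|.
have M0 : 0 < M by rewrite /M -addrA ltr_pwDl // addr_ge0.
have e1 : 0 < e / (2 * M) by rewrite divr_gt0 // mulr_gt0.
have [d1 d10 Hd1] := near0_line v w (diff_eps ddf e1).
have ndf' : \forall h \near 0, differentiable f (h + x).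
  by move: ndf; rewrite (near_shift 0) subr0; apply: filterS => h.
have [d2 d20 Hd2] := near0_line v w ndf'.
exists (Num.min d1 d2); first by rewrite lt_min d10.
move=> s s0; rewrite lt_min => /andP[sd1 sd2].
pose phi t := f (x + s *: w + t *: v) - f (x + t *: v).
pose dphi t := 'D_v f (x + s *: w + t *: v) - 'D_v f (x + t *: v).
have dph t : 0 <= t -> t <= s -> is_derive t 1 phi (dphi t).
  move=> t0 ts; rewrite /phi /dphi.
  apply: is_deriveB.
    apply: line_derive; rewrite -addrA addrC [s *: w + _]addrC.
    by apply: Hd2; rewrite ger0_norm ?(le_lt_trans ts) // ltW.
  apply: line_derive; rewrite addrC -[t *: v]addr0 -(scale0r w).
  by apply: Hd2; rewrite ?normr0 // ger0_norm ?(le_lt_trans ts).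
have [t ts E] : exists2 t, t \in `[0, s]%R & phi s - phi 0 = dphi t * (s - 0).
  apply: MVT_segment; first exact: ltW.
    by move=> t /itvP ht; apply: dph; rewrite ?ht // ltW // ht.
  apply: derivable_within_continuous => t; rewrite in_itv /= => /andP[t0 t1].
  by have [] := dph t t0 t1.
have -> : f (x + s *: v + s *: w) - f (x + s *: v) - f (x + s *: w) + f x =
   s * dphi t.
  rewrite mulrC -[in RHS](subr0 s) -E /phi !scale0r !addr0 (addrAC x (s *: v)).
  by ring.
move: ts; rewrite in_itv /= => /andP[t0 ts].
have tn : `|t| < d1 by rewrite ger0_norm ?(le_lt_trans ts).
have sn : `|s| < d1 by rewrite ger0_norm // ltW.
have A := Hd1 _ _ tn sn.
have B := Hd1 _ 0 tn; rewrite normr0 scale0r addr0 in B; have {}B := B d10.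
have -> : s * dphi t - s ^+ 2 * 'D_w ('D_v f) x = s * (dphi t - s * 'D_w ('D_v f) x).
  by ring.
have -> : e * s ^+ 2 = s * (e * s) by ring.
rewrite normrM (gtr0_norm s0) ler_pM2l // /dphi.
have L : s * 'D_w ('D_v f) x = 'd ('D_v f) x (t *: v + s *: w) - 'd ('D_v f) x (t *: v).
  by rewrite deriveE // linearD /= addrC addKr linearZ.
set a := 'D_v f (x + s *: w + t *: v); set b := 'D_v f (x + t *: v).
have hx : t *: v + s *: w + x = x + s *: w + t *: v.
  by rewrite -addrA addrC [s *: w + x]addrC.
rewrite hx -/a in A.
rewrite [t *: v + x]addrC -/b in B.
rewrite L.
have -> : a - b - ('d ('D_v f) x (t *: v + s *: w) - 'd ('D_v f) x (t *: v))
  = (a - 'D_v f x - 'd ('D_v f) x (t *: v + s *: w))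
   - (b - 'D_v f x - 'd ('D_v f) x (t *: v)) by ring.
apply: (le_trans (ler_normB _ _)).
apply: (le_trans (lerD A B)).
rewrite -mulrDr.
have hN : `|t *: v + s *: w| + `|t *: v| <= s * (2 * M).
  apply: le_trans (lerD (ler_normD _ _) (lexx _)) _.
  rewrite !normrZ (gtr0_norm s0) (ger0_norm t0) /M.
  have := ler_wpM2r (normr_ge0 v) ts.
  have : 0 <= s * `|w| by rewrite mulr_ge0 // ltW.
  by move: (`|v|) (`|w|) => p q; lra.
apply: le_trans (ler_wpM2l (ltW e1) hN) _.
by rewrite [s * _]mulrC mulrA divfK // gt_eqF // mulr_gt0.
Qed.

Lemma small_pos_eq0 (c K : R) : 0 <= K ->
  (forall e, 0 < e -> `|c| <= e * K) -> c = 0.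
Proof.
move=> K0 H; apply/eqP; rewrite -normr_le0; apply/ler_addgt0Pr => e e0.
rewrite add0r; have K1 : 0 < K + 1 by rewrite ltr_wpDl.
apply: le_trans (H (e / (K + 1)) _) _; first by rewrite divr_gt0.
by rewrite -mulrA ger_pMr // mulrC ler_pdivrMr // mul1r lerDl.
Qed.

Lemma dist_of_quotient (E D1 D2 s e : R) : 0 < s ->
  `|E - s ^+ 2 * D1| <= e * s ^+ 2 -> `|E - s ^+ 2 * D2| <= e * s ^+ 2 ->
  `|D2 - D1| <= e * 2.
Proof.
move=> s0 h1 h2; have s2 : 0 < s ^+ 2 by rewrite exprn_gt0.
rewrite -(ler_pM2r s2) -{1}(gtr0_norm s2) -normrM mulrBl.
have -> : D2 * s ^+ 2 - D1 * s ^+ 2 = (E - s ^+ 2 * D1) - (E - s ^+ 2 * D2) by ring.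
apply: (le_trans (ler_normB _ _)); apply: (le_trans (lerD h1 h2)).
by rewrite mulrAC mulr_natr mulr2n.
Qed.

(** The second difference is symmetric in [v] and [w], hence approximates both iterated derivatives
    up to an arbitrarily small multiple of s^2. *)
Lemma derive_comm (U : set V) (f : V -> R) x v w : open U -> smooth U f -> U x ->
  'D_v ('D_w f) x = 'D_w ('D_v f) x.
Proof.
move=> oU sf Ux.
have ndf : \forall y \near x, differentiable f y.
  near=> y; apply: smooth_differentiable sf _; near: y.
  exact: open_nbhs_nbhs.
have d1 u : differentiable ('D_u f) x.
  exact: smooth_differentiable (smooth_derive u sf) Ux.
apply/eqP; rewrite -subr_eq0; apply/eqP; apply: (@small_pos_eq0 _ 2) => // e e0.
have [a a0 Ha] := second_diff w e0 ndf (d1 v).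
have [b b0 Hb] := second_diff v e0 ndf (d1 w).
pose s := Num.min a b / 2.
have m0 : 0 < Num.min a b by rewrite lt_min a0.
have s0 : 0 < s by rewrite divr_gt0.
have sm : s < Num.min a b by rewrite ltr_pdivrMr // ltr_pMr // ltr1n.
move: (sm); rewrite lt_min => /andP[sa sb].
have := Ha s s0 sa; have := Hb s s0 sb.
rewrite [x + s *: w + s *: v]addrAC.
have -> : f (x + s *: v + s *: w) - f (x + s *: w) - f (x + s *: v) + f x =
  f (x + s *: v + s *: w) - f (x + s *: v) - f (x + s *: w) + f x by ring.
move=> h2 h1; exact: dist_of_quotient h1 h2.
Unshelve. all: by end_near. Qed.

Lemma abs_of_scaled (s d e n : R) : 0 < s ->
  s * d <= e * s * n -> - s * d <= e * s * n -> `|d| <= e * n.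
Proof.
move=> s0 h1 h2; rewrite ler_norml; apply/andP; split; rewrite -(ler_pM2l s0); lra.
Qed.

Lemma local_max_derive (U : set V) (f : V -> R) x v : open U -> smooth U f -> U x ->
  (\forall y \near x, f y <= f x) -> 'D_v f x = 0.
Proof.
move=> oU sf Ux fmax.
have df : differentiable f x by apply: smooth_differentiable sf Ux.
have fmax' : \forall h \near 0, f (h + x) <= f x.
  by move: fmax; rewrite (near_shift 0) subr0; apply: filterS => h.
apply: (@small_pos_eq0 _ `|v|) => // e e0.
have [a a0 Ha] := near0_line v 0 (diff_eps df e0).
have [b b0 Hb] := near0_line v 0 fmax'.
pose s := Num.min a b / 2.
have m0 : 0 < Num.min a b by rewrite lt_min a0.
have s0 : 0 < s by rewrite divr_gt0.
have sm : s < Num.min a b by rewrite ltr_pdivrMr // ltr_pMr // ltr1n.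
move: (sm); rewrite lt_min => /andP[sa sb].
have H t : `|t| = s -> t * 'D_v f x <= e * s * `|v|.
  move=> ts.
  have := Ha t 0; rewrite ts normr0 sa a0 scale0r addr0 => /(_ isT isT).
  have := Hb t 0; rewrite ts normr0 sb b0 scale0r addr0 => /(_ isT isT).
  rewrite deriveE // linearZ /= normrZ ts mulrA => h1 h2.
  have /ler_normlP [h3 _] := h2; rewrite [X in _ <= X]/= in h3 *.
  rewrite [leLHS](_ : _ = t *: 'd f x v) //.
  by move: h1 h3; move: (t *: 'd f x v) (e * s * `|v|) => p q; lra.
have h1 := H s (gtr0_norm s0).
have h2 : - s * 'D_v f x <= e * s * `|v| by apply: H; rewrite normrN gtr0_norm.
exact: abs_of_scaled s0 h1 h2.
Qed.

Lemma second_test (s p q w d e : R) : 0 < s -> p <= w -> q <= w ->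
  `|w - p - q + w - s ^+ 2 * (-1 * d)| <= e * s ^+ 2 -> d <= e.
Proof.
move=> s0 h1 h2; rewrite ler_norml => /andP[_ h3].
by rewrite -(ler_pM2r (exprn_gt0 2 s0)); lra.
Qed.

(** In the direction w = - v the second difference is 2 f(x) - f(x + s v) - f(x - s v), which is
    nonnegative at a maximum and approximates - s^2 times the second derivative. *)
Lemma local_max_derive2 (U : set V) (f : V -> R) x v : open U -> smooth U f -> U x ->
  (\forall y \near x, f y <= f x) -> 'D_v ('D_v f) x <= 0.
Proof.
move=> oU sf Ux fmax.
have ndf : \forall y \near x, differentiable f y.
  near=> y; apply: smooth_differentiable sf _; near: y.
  exact: open_nbhs_nbhs.
have d1 : differentiable ('D_v f) x.
  exact: smooth_differentiable (smooth_derive v sf) Ux.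
have fmax' : \forall h \near 0, f (h + x) <= f x.
  by move: fmax; rewrite (near_shift 0) subr0; apply: filterS => h.
apply/ler_addgt0Pr => e e0; rewrite add0r.
have [a a0 Ha] := second_diff (- v) e0 ndf d1.
have [b b0 Hb] := near0_line v 0 fmax'.
pose s := Num.min a b / 2.
have m0 : 0 < Num.min a b by rewrite lt_min a0.
have s0 : 0 < s by rewrite divr_gt0.
have sm : s < Num.min a b by rewrite ltr_pdivrMr // ltr_pMr // ltr1n.
move: (sm); rewrite lt_min => /andP[sa sb].
have H t : `|t| = s -> f (x + t *: v) <= f x.
  move=> ts; have := Hb t 0; rewrite ts normr0 sb b0 scale0r addr0.
  by rewrite addrC; apply.
have h1 := H s (gtr0_norm s0).
have h2 : f (x + s *: - v) <= f x.
  by rewrite scalerN -scaleNr; apply: H; rewrite normrN gtr0_norm.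
have := Ha s s0 sa.
have -> : x + s *: v + s *: - v = x by rewrite scalerN addrK.
have -> : 'D_(- v) ('D_v f) x = -1 * 'D_v ('D_v f) x by rewrite -scaleN1r deriveZv.
move=> h3.
exact: second_test s0 h1 h2 h3.
Unshelve. all: by end_near. Qed.

End Lines.

Section MatrixComponents.
Variables (R : realType) (V : normedModType R) (m n : nat).
Implicit Types (f : V -> 'M[R]_(m, n)) (U : set V).

Lemma differentiable_mxP f x :
  (forall i j, differentiable (fun y => f y i j : R) x) -> differentiable f x.
Proof.
move=> df.
have -> : f = fun y => \sum_(i < m) \sum_(j < n) f y i j *: delta_mx i j.
  by rewrite funeqE => y; exact: matrix_sum_delta.
have h i j : differentiable (fun y => f y i j *: (delta_mx i j : 'M[R]_(m, n))) x.
  exact: differentiableZl.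
have sumE k (g : 'I_k -> V -> 'M[R]_(m, n)) : (fun y => \sum_(i < k) g i y) = \sum_(i < k) g i.
  by rewrite funeqE => y; rewrite fct_sumE.
rewrite sumE; apply: differentiable_sum => i; rewrite sumE.
exact: differentiable_sum.
Qed.

Lemma differentiable_comp_coord f x i j :
  differentiable f x -> differentiable (fun y => f y i j : R) x.
Proof.
move=> df; apply: (@differentiable_comp _ _ _ _ f (fun N : 'M[R]_(m, n) => N i j : R)) => //.
exact: differentiable_coord.
Qed.

Lemma derive_coord f x v i j : derivable f x v ->
  ('D_v f x) i j = 'D_v (fun y => f y i j : R) x.
Proof. by move=> df; rewrite derive_mx // mxE. Qed.

Lemma Ck_coord k U f i j : open U -> Ck k U f -> Ck k U (fun y => f y i j : R).
Proof.
move=> oU; elim: k f => [|k IH] f /=.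
  move=> cf x Ux; apply: (@continuous_comp _ _ _ f (fun N : 'M[R]_(m, n) => N i j : R)).
    exact: cf.
  exact: coord_continuous.
move=> [df cf]; split=> [x Ux|v]; first exact/differentiable_comp_coord/df.
apply: Ck_ext (IH _ (cf v)) => // x Ux.
by rewrite derive_coord //; apply/diff_derivable/df.
Qed.

Lemma Ck_mx k U f : open U -> (forall i j, Ck k U (fun y => f y i j : R)) -> Ck k U f.
Proof.
move=> oU; elim: k f => [|k IH] f cf.
  move=> x Ux; apply/cvgrPdist_le => /= e e0; near=> y.
  rewrite /Num.Def.normr/= mx_normrE (bigmax_le _ (ltW e0))//= => i _.
  rewrite !mxE/=; move: i; near: y; apply: filter_forall => /= i.
  exact: (((cvgrPdist_le _ _).1 (cf i.1 i.2 x Ux))).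
split=> [x Ux|v].
  by apply: differentiable_mxP => i j; have [/(_ x Ux)] := cf i j.
apply: IH => i j; have [d /(_ v)] := cf i j; apply: Ck_ext => // x Ux.
rewrite derive_coord //; apply/diff_derivable/differentiable_mxP => i' j'.
by have [/(_ x Ux)] := cf i' j'.
Unshelve. all: by end_near. Qed.

Lemma smooth_coord U f i j : open U -> smooth U f -> smooth U (fun y => f y i j : R).
Proof. by move=> oU sf k; apply: Ck_coord. Qed.

Lemma smooth_mx U f : open U -> (forall i j, smooth U (fun y => f y i j : R)) -> smooth U f.
Proof. by move=> oU sf k; apply: Ck_mx => // i j; apply: sf. Qed.

End MatrixComponents.

(** * The quaternionic structure *)

Section Dot.
Variables (R : realType) (n : nat).
Implicit Types u v w : 'rV[R]_n.

Lemma dotC u v : dot u v = dot v u.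
Proof. by apply: eq_bigr => i _; rewrite mulrC. Qed.

Lemma dotDl u v w : dot (u + v) w = dot u w + dot v w.
Proof. by rewrite -big_split; apply: eq_bigr => i _; rewrite mxE mulrDl. Qed.

Lemma dotZl a u v : dot (a *: u) v = a * dot u v.
Proof. by rewrite /dot mulr_sumr; apply: eq_bigr => i _; rewrite mxE mulrA. Qed.

Lemma dotDr u v w : dot w (u + v) = dot w u + dot w v.
Proof. by rewrite !(dotC w) dotDl. Qed.

Lemma dotZr a u v : dot v (a *: u) = a * dot v u.
Proof. by rewrite !(dotC v) dotZl. Qed.

Lemma dotNl u v : dot (- u) v = - dot u v.
Proof. by rewrite -scaleN1r dotZl mulN1r. Qed.

Lemma dotNr u v : dot v (- u) = - dot v u.
Proof. by rewrite !(dotC v) dotNl. Qed.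

Lemma dotBl u v w : dot (u - v) w = dot u w - dot v w.
Proof. by rewrite dotDl dotNl. Qed.

Lemma dotBr u v w : dot w (u - v) = dot w u - dot w v.
Proof. by rewrite dotDr dotNr. Qed.

Lemma dot0l u : dot 0 u = 0.
Proof. by rewrite -(scale0r 0) dotZl mul0r. Qed.

Lemma dot0r u : dot u 0 = 0.
Proof. by rewrite dotC dot0l. Qed.

Lemma dot_ge0 u : 0 <= dot u u.
Proof. by apply: sumr_ge0 => i _; rewrite -expr2 sqr_ge0. Qed.

Lemma dot_eq0 u : (dot u u == 0) = (u == 0).
Proof.
apply/idP/eqP => [|->]; last by rewrite dot0l.
rewrite psumr_eq0 => [/allP h|i _]; last by rewrite -expr2 sqr_ge0.
apply/rowP => i; rewrite mxE; have := h i (mem_index_enum i).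
by rewrite /= mulf_eq0 orbb => /eqP.
Qed.

Lemma dot_gt0 u : u != 0 -> 0 < dot u u.
Proof. by move=> u0; rewrite lt_neqAle dot_ge0 eq_sym dot_eq0 u0. Qed.

Lemma dot_CS u v : dot u v ^+ 2 <= dot u u * dot v v.
Proof.
have [->|v0] := eqVneq v 0; first by rewrite !dot0r mulr0 expr0n.
have := dot_ge0 (dot v v *: u - dot u v *: v).
rewrite !dotBl !dotBr !dotZl !dotZr (dotC v u) => h.
rewrite -(ler_pM2r (dot_gt0 v0)).
by move: h; move: (dot u u) (dot u v) (dot v v) => a b c; lra.
Qed.

Lemma enorm_ge0 u : 0 <= enorm u.
Proof. exact: sqrtr_ge0. Qed.

Lemma enorm_sq u : enorm u ^+ 2 = dot u u.
Proof. by rewrite sqr_sqrtr // dot_ge0. Qed.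

Lemma enormZ a u : enorm (a *: u) = `|a| * enorm u.
Proof.
by rewrite /enorm dotZl dotZr mulrA -expr2 sqrtrM ?sqr_ge0 // sqrtr_sqr.
Qed.

Lemma dot_le_enorm u v : `|dot u v| <= enorm u * enorm v.
Proof.
rewrite -(@ler_pXn2r _ 2) ?nnegrE ?mulr_ge0 ?enorm_ge0 // exprMn !enorm_sq.
by rewrite real_normK ?num_real // dot_CS.
Qed.

End Dot.

Lemma lift3_1 : lift ord0 (ord0 : 'I_2) = 1 :> 'I_3. Proof. exact: val_inj. Qed.

Lemma lift3_2 : lift ord0 (lift ord0 (ord0 : 'I_1)) = 2 :> 'I_3.
Proof. exact: val_inj. Qed.

Lemma dot2E (R : realType) (u v : 'rV[R]_2) : dot u v = u 0 0 * v 0 0 + u 0 1 * v 0 1.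
Proof. by rewrite /dot !big_ord_recl big_ord0 addr0 (_ : lift _ _ = 1) //; apply: val_inj. Qed.

Lemma dot3E (R : realType) (u v : 'rV[R]_3) :
  dot u v = u 0 0 * v 0 0 + u 0 1 * v 0 1 + u 0 2 * v 0 2.
Proof.
rewrite /dot !big_ord_recl big_ord0 addr0 addrA.
by rewrite lift3_1 lift3_2.
Qed.

Lemma row3P (R : realType) (u v : 'rV[R]_3) :
  u 0 0 = v 0 0 -> u 0 1 = v 0 1 -> u 0 2 = v 0 2 -> u = v.
Proof.
by move=> h0 h1 h2; apply/rowP => -[[|[|[|//]]] i];
  [move: h0|move: h1|move: h2]; congr (_ = _); congr (_ _ _); apply: val_inj.
Qed.

Section Act.
Variables (R : realType) (n : nat).
Implicit Types (A B : 'M[R]_n) (u v w : 'rV[R]_n).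

Lemma actDr A u v : act A (u + v) = act A u + act A v.
Proof. by rewrite /act mulmxDl. Qed.

Lemma actZr A a u : act A (a *: u) = a *: act A u.
Proof. by rewrite /act scalemxAl. Qed.

Lemma actDl A B u : act (A + B) u = act A u + act B u.
Proof. by rewrite /act linearD /= mulmxDr. Qed.

Lemma actZl A a u : act (a *: A) u = a *: act A u.
Proof. by rewrite /act linearZ /= -scalemxAr. Qed.

Lemma act_mul A B u : act (A *m B) u = act A (act B u).
Proof. by rewrite /act trmx_mul mulmxA. Qed.

Lemma dot_mulmx u v : dot u v = (u *m v^T) 0 0.
Proof. by rewrite mxE; apply: eq_bigr => i _; rewrite mxE. Qed.

Lemma dot_actl A u v : dot (act A u) v = dot u (act A^T v).
Proof. by rewrite !dot_mulmx /act trmx_mul !trmxK mulmxA. Qed.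

End Act.

Section Quaternions.
Variables (R : realType) (J : 'I_3 -> 'M[R]_4).
Hypothesis HK : hyperkahler J.
Implicit Types (a b : 'rV[R]_3) (U W : 'rV[R]_4).

Definition crossp a b : 'rV[R]_3 :=
  \row_i nth 0 [:: a 0 1 * b 0 2 - a 0 2 * b 0 1;
                   a 0 2 * b 0 0 - a 0 0 * b 0 2;
                   a 0 0 * b 0 1 - a 0 1 * b 0 0] i.

Definition K a U := act (Jcomb J a) U.

Lemma J_skew i : (J i)^T = - J i.
Proof.
have [h1 h2 _ _] := HK.
have : (J i)^T *m J i *m J i = J i by rewrite h1 mul1mx.
rewrite -mulmxA (h2 i : J i *m J i = -1%:M) mulmxN mulmx1 => h.
by rewrite -[in RHS]h opprK.
Qed.

Lemma J01 : J 0 *m J 1 = J 2. Proof. by have [_ _ -> _] := HK. Qed.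

Lemma J10 : J 1 *m J 0 = - J 2.
Proof.
by rewrite -J_skew -J01 trmx_mul !J_skew mulNmx mulmxN opprK.
Qed.

Lemma JJ i : J i *m J i = - 1%:M. Proof. by have [_ h _ _] := HK; exact: h. Qed.

Lemma J12 : J 1 *m J 2 = J 0.
Proof. by rewrite -J01 mulmxA J10 -J01 !mulNmx -mulmxA JJ mulmxN mulmx1 opprK. Qed.

Lemma J21 : J 2 *m J 1 = - J 0.
Proof. by rewrite -J_skew -J12 trmx_mul !J_skew mulNmx mulmxN opprK. Qed.

Lemma J20 : J 2 *m J 0 = J 1.
Proof. by rewrite -[J 2]opprK -J10 mulNmx -mulmxA JJ mulmxN mulmx1 opprK. Qed.

Lemma J02 : J 0 *m J 2 = - J 1.
Proof. by rewrite -J_skew -J20 trmx_mul !J_skew mulNmx mulmxN opprK. Qed.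

Lemma JcombE a : Jcomb J a = a 0 0 *: J 0 + a 0 1 *: J 1 + a 0 2 *: J 2.
Proof.
rewrite /Jcomb !big_ord_recl big_ord0 addr0 addrA.
by rewrite lift3_1 lift3_2.
Qed.

(** The product of two imaginary quaternions. After this section the multiplication table is used
    only through this rule and its consequences. *)
Lemma Jcomb_mul a b : Jcomb J a *m Jcomb J b = - (dot a b)%:M + Jcomb J (crossp a b).
Proof.
rewrite !JcombE !mulmxDl !mulmxDr -!scalemxAl -!scalemxAr.
rewrite !JJ J01 J02 J10 J12 J20 J21 dot3E !mxE /=.
rewrite -scalemx1.
apply/matrixP => i j; rewrite !mxE.
by ring.
Qed.

Lemma KK a b U : K a (K b U) = - (dot a b) *: U + K (crossp a b) U.
Proof.
by rewrite /K -act_mul Jcomb_mul actDl -scalemx1 -scaleNr actZl /act trmx1 mulmx1.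
Qed.

Lemma K_skew a U W : dot (K a U) W = - dot U (K a W).
Proof.
have JT : (Jcomb J a)^T = -1 *: Jcomb J a.
  rewrite JcombE !linearD !linearZ /= !J_skew.
  by apply/matrixP => i j; rewrite !mxE; ring.
by rewrite /K dot_actl JT actZl scaleN1r dotNr.
Qed.

Lemma KDr a U W : K a (U + W) = K a U + K a W. Proof. exact: actDr. Qed.
Lemma KZr a k U : K a (k *: U) = k *: K a U. Proof. exact: actZr. Qed.

Lemma KZl k a U : K (k *: a) U = k *: K a U.
Proof.
rewrite /K -actZl !JcombE; congr act.
by apply/matrixP => i j; rewrite !mxE; ring.
Qed.

Lemma crossC a b : crossp b a = - crossp a b.
Proof. by apply/rowP => -[[|[|[|//]]] i]; rewrite !mxE /=; ring. Qed.

Lemma crossxx a : crossp a a = 0.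
Proof. by apply/rowP => -[[|[|[|//]]] i]; rewrite !mxE /=; ring. Qed.

Lemma dot_crossl a b : dot a (crossp a b) = 0.
Proof. by rewrite dot3E !mxE /=; ring. Qed.

Lemma dot_crossr a b : dot b (crossp a b) = 0.
Proof. by rewrite dot3E !mxE /=; ring. Qed.

Lemma dot_cross a b :
  dot (crossp a b) (crossp a b) = dot a a * dot b b - dot a b ^+ 2.
Proof. by rewrite !dot3E !mxE /=; ring. Qed.

Lemma cross_crossl a b : crossp a (crossp a b) = dot a b *: a - dot a a *: b.
Proof. by rewrite !dot3E; apply: row3P; rewrite !mxE /= ?mxE /=; ring. Qed.

Lemma K0l U : K 0 U = 0.
Proof. by rewrite -(scale0r 0) KZl scale0r. Qed.

Lemma dot_Kxx a U : dot (K a U) U = 0.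
Proof.
have := K_skew a U U; rewrite [dot U _]dotC.
by move: (dot _ _) => x h; lra.
Qed.

Lemma dot_KK a b U : dot (K a U) (K b U) = dot a b * dot U U.
Proof.
rewrite K_skew KK dotDr dotZr [dot U (K _ _)]dotC dot_Kxx.
by rewrite addr0 mulNr opprK.
Qed.

End Quaternions.

Section VectorDerivatives.
Variables (R : realType) (V : normedModType R).
Implicit Types (U : set V).

Lemma derM (f g : V -> R) x v : differentiable f x -> differentiable g x ->
  'D_v (fun y => f y * g y) x = f x * 'D_v g x + 'D_v f x * g x.
Proof.
move=> df dg; rewrite [LHS](_ : _ = f x *: 'D_v g x + g x *: 'D_v f x).
  by congr (_ + _); rewrite mulrC.
by rewrite -deriveM //; exact: diff_derivable.
Qed.

Lemma derD (W : normedModType R) (f g : V -> W) x v :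
  differentiable f x -> differentiable g x ->
  'D_v (fun y => f y + g y) x = 'D_v f x + 'D_v g x.
Proof. by move=> df dg; rewrite -deriveD //; exact: diff_derivable. Qed.

Lemma derB (W : normedModType R) (f g : V -> W) x v :
  differentiable f x -> differentiable g x ->
  'D_v (fun y => f y - g y) x = 'D_v f x - 'D_v g x.
Proof. by move=> df dg; rewrite -deriveB //; exact: diff_derivable. Qed.

Lemma derZ (f : V -> R) k x v :
  differentiable f x -> 'D_v (fun y => k * f y) x = k * 'D_v f x.
Proof. by move=> df; rewrite -[RHS]deriveZ //; exact: diff_derivable. Qed.

Lemma der_sum n (f : 'I_n -> V -> R) x v : (forall i, differentiable (f i) x) ->
  'D_v (fun y => \sum_i f i y) x = \sum_i 'D_v (f i) x.
Proof.
move=> df; rewrite -derive_sum; last by move=> i; exact/diff_derivable.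
by congr derive; rewrite funeqE => y; rewrite fct_sumE.
Qed.

Lemma diff_sum n (f : 'I_n -> V -> R) x : (forall i, differentiable (f i) x) ->
  differentiable (fun y => \sum_i f i y) x.
Proof.
move=> df; have -> : (fun y => \sum_i f i y) = \sum_i f i.
  by rewrite funeqE => y; rewrite fct_sumE.
exact: differentiable_sum.
Qed.

Lemma diff_mul (f g : V -> R) x : differentiable f x -> differentiable g x ->
  differentiable (fun y => f y * g y) x.
Proof. exact: differentiableM. Qed.

Section Dots.
Variables (n : nat).
Implicit Types (f g : V -> 'rV[R]_n).

Lemma diff_dot f g x : differentiable f x -> differentiable g x ->
  differentiable (fun y => dot (f y) (g y)) x.
Proof.
by move=> df dg; apply: diff_sum => i; apply: diff_mul; exact: differentiable_comp_coord.
Qed.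

Lemma der_dot f g x v : differentiable f x -> differentiable g x ->
  'D_v (fun y => dot (f y) (g y)) x = dot ('D_v f x) (g x) + dot (f x) ('D_v g x).
Proof.
move=> df dg; rewrite /dot der_sum => [|i]; last first.
  by apply: diff_mul; exact: differentiable_comp_coord.
rewrite -big_split; apply: eq_bigr => i _ /=.
rewrite derM; try exact: differentiable_comp_coord.
by rewrite (derive_coord 0 i (@diff_derivable _ _ _ _ _ v df)) (derive_coord 0 i (@diff_derivable _ _ _ _ _ v dg)) addrC.
Qed.

Lemma der_dotc f (p : 'rV[R]_n) x v : differentiable f x ->
  'D_v (fun y => dot p (f y)) x = dot p ('D_v f x).
Proof.
move=> df; rewrite (der_dot v (differentiable_cst p x) df) derive_cst dot0l.
by rewrite add0r.
Qed.

Lemma smooth_dot U f g : open U -> smooth U f -> smooth U g ->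
  smooth U (fun y => dot (f y) (g y)).
Proof.
by move=> oU sf sg; apply: smooth_sum => // i; apply: smoothM => //; exact: smooth_coord.
Qed.

Lemma smooth_scale U (k : V -> R) f : open U -> smooth U k -> smooth U f ->
  smooth U (fun y => k y *: f y).
Proof.
move=> oU sk sf; apply: smooth_mx => // i j.
apply: (smooth_ext oU _ (smoothM oU sk (smooth_coord i j oU sf))) => x _.
by rewrite mxE.
Qed.

Lemma diff_scale (k : V -> R) f x : differentiable k x -> differentiable f x ->
  differentiable (fun y => k y *: f y) x.
Proof.
move=> dk df; apply: differentiable_mxP => i j.
have -> : (fun y => (k y *: f y) i j) = (fun y => k y * f y i j).
  by rewrite funeqE => y; rewrite mxE.
by apply: diff_mul => //; exact: differentiable_comp_coord.
Qed.

Lemma der_scale (k : V -> R) f x v : differentiable k x -> differentiable f x ->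
  'D_v (fun y => k y *: f y) x = k x *: 'D_v f x + 'D_v k x *: f x.
Proof.
move=> dk df; apply/rowP => j; rewrite derive_coord; last first.
  by apply/diff_derivable/diff_scale.
have -> : (fun y => (k y *: f y) 0 j) = (fun y => k y * f y 0 j).
  by rewrite funeqE => y; rewrite mxE.
rewrite derM //; last exact: differentiable_comp_coord.
by rewrite !mxE (derive_coord 0 j (@diff_derivable _ _ _ _ _ v df)).
Qed.

Lemma smooth_act U (A : 'M[R]_n) f : open U -> smooth U f ->
  smooth U (fun y => act A (f y)).
Proof.
move=> oU sf; apply: smooth_mx => // i j.
have E y : act A (f y) i j = \sum_k f y i k * A j k.
  by rewrite mxE; apply: eq_bigr => k _; rewrite mxE.
apply: (smooth_ext oU (fun y _ => esym (E y))).
apply: smooth_sum => // k; apply: smoothM => //; first exact: smooth_coord.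
exact: smooth_cst.
Qed.

Lemma der_act (A : 'M[R]_n) f x v : differentiable f x ->
  differentiable (fun y => act A (f y)) x /\
  'D_v (fun y => act A (f y)) x = act A ('D_v f x).
Proof.
move=> df.
have E y i j : act A (f y) i j = \sum_k A j k * f y i k.
  by rewrite mxE; apply: eq_bigr => k _; rewrite mxE mulrC.
have Ef i j : (fun y => act A (f y) i j) = (fun y => \sum_k A j k * f y i k).
  by rewrite funeqE => y; rewrite E.
have d1 i j k : differentiable (fun y => A j k * f y i k) x.
  by apply: diff_mul; [exact: differentiable_cst|exact: differentiable_comp_coord].
have d : differentiable (fun y => act A (f y)) x.
  by apply: differentiable_mxP => i j; rewrite Ef; exact: diff_sum.
split => //; apply/rowP => j; rewrite derive_coord; last exact: diff_derivable.
rewrite Ef der_sum // mxE; apply: eq_bigr => k _.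
rewrite derZ; last exact: differentiable_comp_coord.
by rewrite mxE (derive_coord 0 k (@diff_derivable _ _ _ _ _ v df)) mulrC.
Qed.

End Dots.
End VectorDerivatives.

Lemma near_derive (R : realType) (V W : normedModType R) (U : set V)
  (f g : V -> W) x v : open U -> U x -> (forall y, U y -> f y = g y) ->
  'D_v f x = 'D_v g x.
Proof. by move=> oU Ux fg; apply: near_eq_derive; exact: open_near_eq fg. Qed.

Lemma derive_commv (R : realType) (V : normedModType R) n (U : set V)
  (f : V -> 'rV[R]_n) x v w : open U -> smooth U f -> U x ->
  'D_v ('D_w f) x = 'D_w ('D_v f) x.
Proof.
move=> oU sf Ux.
have H a b j : ('D_a ('D_b f) x) 0 j = 'D_a ('D_b (fun y => f y 0 j : R)) x.
  rewrite derive_coord; last exact: smooth_derivable (smooth_derive _ sf) Ux.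
  apply: (near_derive _ oU Ux) => y Uy.
  by rewrite derive_coord //; exact: smooth_derivable sf Uy.
apply/rowP => j.
refine (etrans (H v w j) _).
refine (etrans _ (esym (H w v j))).
exact: (derive_comm v w oU (smooth_coord 0 j oU sf) Ux).
Qed.

(* Unification between two different directional derivatives would otherwise unfold the
   limits defining them. *)
HB.lock Definition dd (R : realType) (V W : normedModType R) (v : V) (f : V -> W) (x : V) : W :=
  'D_v f x.

Section LockedDerivative.
Variables (R : realType) (V : normedModType R).
Implicit Types (U : set V).

Lemma ddE (W : normedModType R) (f : V -> W) v : dd v f = 'D_v f.
Proof. by rewrite funeqE => x; rewrite dd.unlock. Qed.

Lemma smooth_dd (W : normedModType R) U (f : V -> W) v : smooth U f -> smooth U (dd v f).
Proof. by rewrite ddE; exact: smooth_derive. Qed.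

Lemma smooth_diff (W : normedModType R) U (f : V -> W) x : smooth U f -> U x -> differentiable f x.
Proof. exact: smooth_differentiable. Qed.

Lemma dd_cst (W : normedModType R) (a : W) (x v : V) : dd v (fun=> a) x = 0.
Proof. by rewrite ddE derive_cst. Qed.

Lemma dd_mul (f g : V -> R) x v : differentiable f x -> differentiable g x ->
  dd v (fun y => f y * g y) x = f x * dd v g x + dd v f x * g x.
Proof. by move=> df dg; rewrite !ddE derM. Qed.

Lemma dd_add (W : normedModType R) (f g : V -> W) x v :
  differentiable f x -> differentiable g x ->
  dd v (fun y => f y + g y) x = dd v f x + dd v g x.
Proof. by move=> df dg; rewrite !ddE derD. Qed.

Lemma dd_sub (W : normedModType R) (f g : V -> W) x v :
  differentiable f x -> differentiable g x ->
  dd v (fun y => f y - g y) x = dd v f x - dd v g x.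
Proof. by move=> df dg; rewrite !ddE derB. Qed.

Lemma dd_scal (f : V -> R) k x v :
  differentiable f x -> dd v (fun y => k * f y) x = k * dd v f x.
Proof. by move=> df; rewrite !ddE derZ. Qed.

Lemma dd_dot n (f g : V -> 'rV[R]_n) x v : differentiable f x -> differentiable g x ->
  dd v (fun y => dot (f y) (g y)) x = dot (dd v f x) (g x) + dot (f x) (dd v g x).
Proof. by move=> df dg; rewrite !ddE (der_dot v df dg). Qed.

Lemma dd_dotc n (f : V -> 'rV[R]_n) (p : 'rV[R]_n) x v : differentiable f x ->
  dd v (fun y => dot p (f y)) x = dot p (dd v f x).
Proof. by move=> df; rewrite !ddE (der_dotc p v df). Qed.

Lemma dd_scale n (k : V -> R) (f : V -> 'rV[R]_n) x v :
  differentiable k x -> differentiable f x ->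
  dd v (fun y => k y *: f y) x = k x *: dd v f x + dd v k x *: f x.
Proof. by move=> dk df; rewrite !ddE (der_scale v dk df). Qed.

Lemma diff_act n (A : 'M[R]_n) (f : V -> 'rV[R]_n) x : differentiable f x ->
  differentiable (fun y => act A (f y)) x.
Proof. by move=> df; have [] := der_act A 0 df. Qed.

Lemma dd_act n (A : 'M[R]_n) (f : V -> 'rV[R]_n) x v : differentiable f x ->
  dd v (fun y => act A (f y)) x = act A (dd v f x).
Proof. by move=> df; rewrite !ddE; have [] := der_act A v df. Qed.

Lemma dd_coord n (f : V -> 'rV[R]_n) x v j : differentiable f x ->
  (dd v f x) 0 j = dd v (fun y => f y 0 j : R) x.
Proof. by move=> df; rewrite !ddE; apply: derive_coord; exact: diff_derivable. Qed.

Lemma dd_near (W : normedModType R) U (f g : V -> W) x v :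
  open U -> U x -> (forall y, U y -> f y = g y) -> dd v f x = dd v g x.
Proof. by move=> oU Ux fg; rewrite !ddE (near_derive v oU Ux fg). Qed.

Lemma dd_comm n U (f : V -> 'rV[R]_n) x v w : open U -> smooth U f -> U x ->
  dd v (dd w f) x = dd w (dd v f) x.
Proof. by move=> oU sf Ux; rewrite !ddE (derive_commv v w oU sf Ux). Qed.

Lemma dd_comm1 U (f : V -> R) x v w : open U -> smooth U f -> U x ->
  dd v (dd w f) x = dd w (dd v f) x.
Proof. by move=> oU sf Ux; rewrite !ddE (derive_comm v w oU sf Ux). Qed.

Lemma dd_scalev (W : normedModType R) (f : V -> W) x a v : differentiable f x ->
  dd (a *: v) f x = a *: dd v f x.
Proof. by move=> df; rewrite !ddE deriveZv. Qed.

Lemma dd_addv (W : normedModType R) (f : V -> W) x v w : differentiable f x ->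
  dd (v + w) f x = dd v f x + dd w f x.
Proof. by move=> df; rewrite !ddE deriveDv. Qed.

Lemma dd_comb (W : normedModType R) (f : V -> W) x (a b : R) v w : differentiable f x ->
  dd (a *: v + b *: w) f x = a *: dd v f x + b *: dd w f x.
Proof. by move=> df; rewrite dd_addv // !dd_scalev. Qed.

(** Differentiability and value travel together, so that the derivative of a composite expression is
    built by structural recursion, with differentiability of the atoms as the only side
    condition. *)
Definition isdd (W : normedModType R) (f : V -> W) x v d := differentiable f x /\ dd v f x = d.

Lemma isdd_diff (W : normedModType R) (f : V -> W) x v : differentiable f x -> isdd f x v (dd v f x).
Proof. by []. Qed.

Lemma isdd_cst (W : normedModType R) (a : W) (x v : V) : isdd (fun=> a) x v 0.
Proof. by split; [exact: differentiable_cst|exact: dd_cst]. Qed.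

Lemma isdd_add (W : normedModType R) (f g : V -> W) x v a b : isdd f x v a -> isdd g x v b ->
  isdd (fun y => f y + g y) x v (a + b).
Proof.
by move=> [df <-] [dg <-]; split; [exact: differentiableD|exact: dd_add].
Qed.

Lemma isdd_sub (W : normedModType R) (f g : V -> W) x v a b : isdd f x v a -> isdd g x v b ->
  isdd (fun y => f y - g y) x v (a - b).
Proof.
by move=> [df <-] [dg <-]; split; [exact: differentiableB|exact: dd_sub].
Qed.

Lemma isdd_mul (f g : V -> R) x v a b : isdd f x v a -> isdd g x v b ->
  isdd (fun y => f y * g y) x v (f x * b + a * g x).
Proof. by move=> [df <-] [dg <-]; split; [exact: diff_mul|exact: dd_mul]. Qed.

Lemma isdd_mulc (f : V -> R) x v k a : isdd f x v a -> isdd (fun y => k * f y) x v (k * a).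
Proof.
by move=> [df <-]; split; [apply: diff_mul => //; exact: differentiable_cst|exact: dd_scal].
Qed.

Lemma isdd_dot n (f g : V -> 'rV[R]_n) x v a b : isdd f x v a -> isdd g x v b ->
  isdd (fun y => dot (f y) (g y)) x v (dot a (g x) + dot (f x) b).
Proof. by move=> [df <-] [dg <-]; split; [exact: diff_dot|exact: dd_dot]. Qed.

Lemma isdd_dotc n (g : V -> 'rV[R]_n) p x v b : isdd g x v b ->
  isdd (fun y => dot p (g y)) x v (dot p b).
Proof.
by move=> [dg <-]; split; [exact: diff_dot (differentiable_cst _ _) dg|exact: dd_dotc].
Qed.

Lemma isdd_scale n (k : V -> R) (f : V -> 'rV[R]_n) x v a b : isdd k x v a -> isdd f x v b ->
  isdd (fun y => k y *: f y) x v (k x *: b + a *: f x).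
Proof. by move=> [df <-] [dg <-]; split; [exact: diff_scale|exact: dd_scale]. Qed.

Lemma isdd_scalec n k (f : V -> 'rV[R]_n) x v b : isdd f x v b ->
  isdd (fun y => k *: f y) x v (k *: b).
Proof.
move=> h; have [d e] := isdd_scale (isdd_cst k x v) h.
by split => //; rewrite e scale0r addr0.
Qed.

Lemma isdd_act n (A : 'M[R]_n) (f : V -> 'rV[R]_n) x v a : isdd f x v a ->
  isdd (fun y => act A (f y)) x v (act A a).
Proof. by move=> [df <-]; split; [exact: diff_act|exact: dd_act]. Qed.

Lemma isdd_near (W : normedModType R) U (f g : V -> W) x v a b :
  open U -> U x -> (forall y, U y -> f y = g y) -> isdd f x v a -> isdd g x v b -> a = b.
Proof. by move=> oU Ux fg [_ <-] [_ <-]; exact: dd_near oU Ux fg. Qed.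

End LockedDerivative.

(** Cases with a constant factor come before the general products, which keeps zero derivatives of
    constants out of the result. An unrecognised function is treated as an atom. *)
Ltac isdd_step :=
  match goal with
  | |- isdd (fun y => ?a * @?f y) _ _ _ => refine (isdd_mulc _ _)
  | |- isdd (fun y => @?f y + - @?g y) _ _ _ => refine (isdd_sub _ _)
  | |- isdd (fun y => @?f y + @?g y) _ _ _ => refine (isdd_add _ _)
  | |- isdd (fun y => @?f y * @?g y) _ _ _ => refine (isdd_mul _ _)
  | |- isdd (fun y => dot ?p (@?g y)) _ _ _ => refine (isdd_dotc _ _)
  | |- isdd (fun y => dot (@?f y) (@?g y)) _ _ _ => refine (isdd_dot _ _)
  | |- isdd (fun y => act _ (@?g y)) _ _ _ => refine (isdd_act _ _)
  | |- isdd (fun y => K _ _ (@?g y)) _ _ _ => refine (isdd_act _ _)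
  | |- isdd (fun y => ?p *: (@?g y)) _ _ _ => refine (isdd_scalec _ _)
  | |- isdd (fun y => (@?f y) *: (@?g y)) _ _ _ => refine (isdd_scale _ _)
  | |- isdd (fun y => ?a) _ _ _ => refine (isdd_cst _ _ _)
  | |- isdd _ _ _ _ => refine (isdd_diff _ _)
  end.
Ltac isdd_tac := repeat isdd_step.
(* Adds to the context the derivative at u in the direction v of the identity E, valid on
   the open set U. *)
Ltac derive_identity h oU Uu E v :=
  eassert (h : _ = _);
  [refine (isdd_near (v := v) oU Uu E _ _); isdd_tac|].

Definition det2 (R : realType) (v w : 'rV[R]_2) : R := v 0 0 * w 0 1 - v 0 1 * w 0 0.

Lemma det_mx22 (R : comRingType) (M : 'M[R]_2) :
  \det M = M 0 0 * M 1 1 - M 0 1 * M 1 0.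
Proof.
rewrite (expand_det_row _ ord0) !big_ord_recl big_ord0 addr0 /cofactor !det_mx11.
have L0 (i : 'I_1) : lift (ord0 : 'I_2) i = 1.
  by apply: val_inj; case: i => -[].
have L1 (i : 'I_1) : lift (1 : 'I_2) i = 0.
  by apply: val_inj; case: i => -[].
by rewrite !mxE !L0 !L1 /= expr0 mul1r expr1 mulN1r mulrN.
Qed.

Lemma det_col2 (R : realType) (v w : 'rV[R]_2) :
  \det (col_mx v w : 'M[R]_2) = det2 v w.
Proof.
rewrite det_mx22 /det2.
have E0 j : (col_mx v w : 'M[R]_2) 0 j = v 0 j.
  by rewrite mxE; case: splitP => // k _; rewrite (ord1 k).
have E1 j : (col_mx v w : 'M[R]_2) 1 j = w 0 j.
  by rewrite mxE; case: splitP => [[[|m] hm]|k _] //; rewrite (ord1 k).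
by rewrite !E0 !E1.
Qed.

(** * Surfaces with a phase map *)

Section Bases.
Variable R : realType.

(** The square matrix [M] of the family satisfies M M^T = 1, hence M^T M = 1, which is the
    completeness relation. *)
Lemma onb_parseval n (e : 'I_n -> 'rV[R]_n) (X Y : 'rV[R]_n) :
  (forall i j, dot (e i) (e j) = (i == j)%:R) ->
  dot X Y = \sum_i dot X (e i) * dot Y (e i).
Proof.
move=> he; pose M : 'M[R]_n := \matrix_(i < n) e i.
have Mi i : row i M = e i by rewrite rowK.
have MM : M *m M^T = 1%:M.
  apply/matrixP => i j; rewrite !mxE -he; apply: eq_bigr => k _.
  by rewrite !mxE.
have /mulmx1C MM' := MM.
have XM (Z : 'rV[R]_n) i : (Z *m M^T) 0 i = dot Z (e i).
  by rewrite mxE; apply: eq_bigr => k _; rewrite !mxE.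
have -> : dot X Y = dot (X *m M^T) (Y *m M^T).
  by rewrite !dot_mulmx trmx_mul trmxK mulmxA -(mulmxA X) MM' mulmx1.
by apply: eq_bigr => i _; rewrite !XM.
Qed.

Lemma basis3 (l m X Y : 'rV[R]_3) : dot l l = 1 -> dot m m = 1 -> dot l m = 0 ->
  dot X Y = dot X l * dot Y l + dot X m * dot Y m +
            dot X (crossp l m) * dot Y (crossp l m).
Proof.
move=> ll mm lm.
have ln := dot_crossl l m; have mn := dot_crossr l m.
have nn := dot_cross l m; rewrite ll mm lm expr0n subr0 mulr1 in nn.
pose e (i : 'I_3) := nth 0 [:: l; m; crossp l m] i.
rewrite (@onb_parseval 3 e); last first.
  move=> [[|[|[|//]]] i] [[|[|[|//]]] j]; rewrite /e -val_eqE /=;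
  by rewrite ?ll ?mm ?lm ?ln ?mn ?nn // dotC.
by rewrite !big_ord_recl big_ord0 addr0 addrA.
Qed.

Lemma basis4 (e1 e2 f1 f2 X Y : 'rV[R]_4) :
  dot e1 e1 = 1 -> dot e2 e2 = 1 -> dot f1 f1 = 1 -> dot f2 f2 = 1 ->
  dot e1 e2 = 0 -> dot e1 f1 = 0 -> dot e1 f2 = 0 -> dot e2 f1 = 0 ->
  dot e2 f2 = 0 -> dot f1 f2 = 0 ->
  dot X Y = dot X e1 * dot Y e1 + dot X e2 * dot Y e2
          + dot X f1 * dot Y f1 + dot X f2 * dot Y f2.
Proof.
move=> h11 h22 h33 h44 h12 h13 h14 h23 h24 h34.
pose e (i : 'I_4) := nth 0 [:: e1; e2; f1; f2] i.
rewrite (@onb_parseval 4 e); last first.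
  move=> [[|[|[|[|//]]]] i] [[|[|[|[|//]]]] j]; rewrite /e -val_eqE /=;
  by rewrite ?h11 ?h22 ?h33 ?h44 ?h12 ?h13 ?h14 ?h23 ?h24 ?h34 // dotC.
by rewrite !big_ord_recl big_ord0 addr0 !addrA.
Qed.

End Bases.

Section Patch.
Variables (R : realType) (J : 'I_3 -> 'M[R]_4) (V0 : 'rV[R]_4).
Implicit Types (U : set 'rV[R]_2) (F : 'rV[R]_2 -> 'rV[R]_4) (lam : 'rV[R]_2 -> 'rV[R]_3).

(** The pair consists of parameter vectors and not of tangent vectors in R^4, so that both can serve
    as directions of differentiation. *)
Definition onb_at F u v1 v2 := [/\ 0 < det2 v1 v2,
  dot (dd v1 F u) (dd v1 F u) = 1, dot (dd v2 F u) (dd v2 F u) = 1 &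
  dot (dd v1 F u) (dd v2 F u) = 0].

(** For normal [nu] this is a coefficient of the second fundamental form. The directions may be
    frozen: another extension of [w] to a field changes the second derivative by a tangent vector
    only. *)
Definition sff F u nu v w := dot (dd v (dd w F) u) nu.

Record phase_patch U F lam : Prop := PhasePatch {
  p_open : open U ;
  p_smooth : smooth U F ;
  p_imm : forall u, U u -> forall v, dd v F u = 0 -> v = 0 ;
  p_unit : forall u, U u -> dot (lam u) (lam u) = 1 ;
  p_phase : forall u v1 v2, U u -> onb_at F u v1 v2 ->
    K J (lam u) (dd v1 F u) = dd v2 F u }.

(** The hypotheses in pointwise form, free of frame fields. [p_soliton] says that the normal part of
    H + V0 vanishes; the expression in [p_curv] is the normal curvature by Ricci's equation, in the
    normal frame obtained from the first tangent vector by [K J m] and [K J (crossp (lam u) m)]. *)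
Record soliton_patch U F lam : Prop := SolitonPatch {
  p_phase_patch :> phase_patch U F lam ;
  p_soliton : forall u v1 v2, U u -> onb_at F u v1 v2 ->
    let W := dd v1 (dd v1 F) u + dd v2 (dd v2 F) u + V0 in
    W = dot W (dd v1 F u) *: dd v1 F u + dot W (dd v2 F u) *: dd v2 F u ;
  p_curv : forall u v1 v2 m, U u -> onb_at F u v1 v2 ->
    dot m m = 1 -> dot (lam u) m = 0 ->
    let h1 := sff F u (K J m (dd v1 F u)) in
    let h2 := sff F u (K J (crossp (lam u) m) (dd v1 F u)) in
    h1 v1 v1 * h2 v1 v2 + h1 v1 v2 * h2 v2 v2
    - h2 v1 v1 * h1 v1 v2 - h2 v1 v2 * h1 v2 v2 <= 0 }.

Definition gram F u w1 w2 :=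
  dot (dd w1 F u) (dd w1 F u) * dot (dd w2 F u) (dd w2 F u)
  - dot (dd w1 F u) (dd w2 F u) ^+ 2.

(** The trace, for the metric induced by [F], of the form pulled back by [f], multiplied by the Gram
    determinant. Keeping the determinant apart makes the identities to be differentiated
    polynomial. *)
Definition enum_at n F (f : 'rV[R]_2 -> 'rV[R]_n) u w1 w2 :=
  dot (dd w2 F u) (dd w2 F u) * dot (dd w1 f u) (dd w1 f u)
  - 2 * dot (dd w1 F u) (dd w2 F u) * dot (dd w1 f u) (dd w2 f u)
  + dot (dd w1 F u) (dd w1 F u) * dot (dd w2 f u) (dd w2 f u).

Definition b0 : 'rV[R]_2 := delta_mx 0 0.
Definition b1 : 'rV[R]_2 := delta_mx 0 1.

(* Energy density of f for the metric induced by F. *)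
Definition energy n F (f : 'rV[R]_2 -> 'rV[R]_n) u :=
  enum_at F f u b0 b1 / gram F u b0 b1.

Lemma vec2E (w : 'rV[R]_2) : w = w 0 0 *: b0 + w 0 1 *: b1.
Proof.
apply/rowP => -[[|[|//]] i]; rewrite !mxE -!val_eqE /= ?mulr1 ?mulr0 ?addr0 ?add0r;
  by congr (w _ _); apply: val_inj.
Qed.

Section InPatch.
Variables (U : set 'rV[R]_2) (F : 'rV[R]_2 -> 'rV[R]_4) (lam : 'rV[R]_2 -> 'rV[R]_3).
Hypothesis HK : hyperkahler J.
Hypothesis Pt : phase_patch U F lam.

Let oU := p_open Pt.
Let sF := p_smooth Pt.

Lemma pdiff u : U u -> differentiable F u.
Proof. by move=> Uu; exact: smooth_differentiable sF Uu. Qed.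

Lemma smoothD_F v : smooth U (dd v F).
Proof. exact: smooth_dd. Qed.

Lemma pdiffD u v : U u -> differentiable (dd v F) u.
Proof. by move=> Uu; exact: smooth_differentiable (smoothD_F v) Uu. Qed.

Lemma DF_gt0 u v : U u -> v != 0 -> 0 < dot (dd v F u) (dd v F u).
Proof.
move=> Uu v0; apply: dot_gt0; apply: contra_neq v0; exact: p_imm Pt _ Uu _.
Qed.

Lemma det2_neq0l (w1 w2 : 'rV[R]_2) : 0 < det2 w1 w2 -> w1 != 0.
Proof. by apply: contraTneq => ->; rewrite /det2 !mxE !mul0r subrr ltxx. Qed.

Lemma det2_neq0r (w1 w2 : 'rV[R]_2) t : 0 < det2 w1 w2 -> w2 + t *: w1 != 0.
Proof.
apply: contraTneq => /eqP; rewrite addr_eq0 => /eqP ->.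
by rewrite /det2 !mxE -leNgt; apply/eqP/eqP; rewrite le_eqVlt (_ : _ - _ = 0) ?eqxx //; ring.
Qed.

(** The triangular shape stays in the statement because the inverse metric is later read off the
    three coefficients, in [soliton_eq_coef]. *)
Lemma gram_schmidt u w1 w2 : U u -> 0 < det2 w1 w2 ->
  exists a t d, [/\ 0 < a, 0 < d & onb_at F u (a *: w1) (d *: (w2 + t *: w1))].
Proof.
move=> Uu dw; have dF := pdiff Uu.
have g1 := DF_gt0 Uu (det2_neq0l dw).
pose t := - (dot (dd w1 F u) (dd w2 F u) / dot (dd w1 F u) (dd w1 F u)).
have g2 := DF_gt0 Uu (det2_neq0r t dw).
pose a := (Num.sqrt (dot (dd w1 F u) (dd w1 F u)))^-1.
set w := w2 + t *: w1 in g2 *.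
pose d := (Num.sqrt (dot (dd w F u) (dd w F u)))^-1.
have a0 : 0 < a by rewrite invr_gt0 sqrtr_gt0; exact: g1.
have d0 : 0 < d by rewrite invr_gt0 sqrtr_gt0; exact: g2.
have inv_sq (x : R) : 0 < x -> (Num.sqrt x)^-1 * ((Num.sqrt x)^-1 * x) = 1.
  move=> x0; rewrite mulrA -expr2 exprVn sqr_sqrtr ?ltW // mulVf // gt_eqF //.
have aE := inv_sq _ g1; rewrite -/a in aE.
have dE := inv_sq _ g2; rewrite -/d in dE.
clearbody a d.
exists a, t, d; split; [exact: a0|exact: d0|split].
- have -> : det2 (a *: w1) (d *: w) = a * d * det2 w1 w2.
    by rewrite /det2 !mxE; ring.
  by apply: mulr_gt0 dw; apply: mulr_gt0 a0 d0.
- by rewrite (dd_scalev _ _ dF) dotZl dotZr aE.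
- by rewrite (dd_scalev _ _ dF) dotZl dotZr dE.
- rewrite !(dd_scalev _ _ dF) dotZl dotZr /w (dd_addv _ _ dF) (dd_scalev _ _ dF) dotDr dotZr.
  rewrite /t mulNr divfK; last by move: g1; rewrite lt_def => /andP[].
  by rewrite subrr !mulr0.
Qed.

Lemma exists_onb u : U u -> exists v1 v2, onb_at F u v1 v2.
Proof.
move=> Uu.
have [|a [t [d [_ _ h]]]] := @gram_schmidt u b0 b1 Uu; last by exists (a *: b0), (d *: (b1 + t *: b0)).
by rewrite /det2 !mxE /= mulr1 mulr0 subr0 ltr01.
Qed.

Lemma phase_alg (e1 e2 F1 F2 : 'rV[R]_4) (l b : 'rV[R]_3) (a d t : R) :
  0 < a -> 0 < d -> e1 = a *: F1 -> e2 = d *: (F2 + t *: F1) ->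
  dot e1 e1 = 1 -> dot e2 e2 = 1 -> dot e1 e2 = 0 -> K J l e1 = e2 ->
  let G := dot F1 F1 * dot F2 F2 - dot F1 F2 ^+ 2 in
  0 < G /\ dot (K J b F1) F2 = Num.sqrt G * dot b l.
Proof.
move=> a0 d0 Ee1 Ee2 h11 h22 h12 ph G.
have E1 : F1 = a^-1 *: e1 by rewrite Ee1 scalerA mulVf ?scale1r // gt_eqF.
have E2 : F2 = d^-1 *: e2 - t *: F1.
  by rewrite Ee2 scalerA mulVf ?gt_eqF // scale1r addrK.
clear Ee1 Ee2; rewrite {}/G {}E2 {}E1.
have -> : dot (a^-1 *: e1) (a^-1 *: e1) * dot (d^-1 *: e2 - t *: (a^-1 *: e1)) (d^-1 *: e2 - t *: (a^-1 *: e1))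
  - dot (a^-1 *: e1) (d^-1 *: e2 - t *: (a^-1 *: e1)) ^+ 2 = (a^-1 * d^-1) ^+ 2.
  rewrite !(dotBl, dotBr, dotZl, dotZr) h11 h22 (dotC e2) h12.
  by ring.
split; first by rewrite exprn_gt0 // mulr_gt0 ?invr_gt0.
rewrite sqrtr_sqr ger0_norm; last by rewrite ltW // mulr_gt0 ?invr_gt0.
rewrite !KZr !(dotBl, dotBr, dotZl, dotZr) dot_Kxx // -ph dot_KK //.
by rewrite h11; ring.
Qed.

(** On an oriented orthonormal pair the skew form (X, Y) |-> K b X . Y has the value b . lam, since
    there the second vector is K lam of the first. Another positive pair multiplies it by its area,
    the square root of the Gram determinant. The phase map is thus expressed by first derivatives of
    [F]. *)
Lemma phase_pair u w1 w2 b : U u -> 0 < det2 w1 w2 ->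
  0 < gram F u w1 w2 /\
  dot (K J b (dd w1 F u)) (dd w2 F u) = Num.sqrt (gram F u w1 w2) * dot b (lam u).
Proof.
move=> Uu dw; have dF := pdiff Uu.
have [a [t [d [a0 d0 o]]]] := gram_schmidt Uu dw.
have ph := p_phase Pt Uu o; have [_ h11 h22 h12] := o.
apply: (phase_alg b a0 d0 _ _ h11 h22 h12 ph); first exact: dd_scalev.
by rewrite (dd_scalev _ _ dF) (dd_addv _ _ dF) (dd_scalev _ _ dF).
Qed.

Lemma gram_gt0 u w1 w2 : U u -> 0 < det2 w1 w2 -> 0 < gram F u w1 w2.
Proof. by move=> Uu dw; have [] := phase_pair 0 Uu dw. Qed.

Lemma det_b01 : 0 < det2 b0 b1.
Proof. by rewrite /det2 !mxE /= mulr1 mulr0 subr0 ltr01. Qed.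

Lemma gram_smooth w1 w2 : smooth U (fun u => gram F u w1 w2).
Proof.
have s11 v w : smooth U (fun u => dot (dd v F u) (dd w F u)).
  by apply: smooth_dot => //; exact: smoothD_F.
apply: smoothD => //; first exact: smoothM.
by apply: smoothN => //; rewrite /=; under eq_fun do rewrite expr2; exact: smoothM.
Qed.

(** Regularity of the phase map comes from [phase_pair], which gives each coordinate as a quotient
    of smooth functions of the first derivatives of [F]. *)
Lemma lam_smooth : smooth U lam.
Proof.
apply: smooth_mx => // i j; rewrite (ord1 i).
pose b : 'rV[R]_3 := delta_mx 0 j.
have E u : U u -> dot (K J b (dd b0 F u)) (dd b1 F u) / Num.sqrt (gram F u b0 b1) = lam u 0 j.
  move=> Uu; have [g ->] := phase_pair b Uu det_b01.
  rewrite mulrAC mulfV ?mul1r ?gt_eqF ?sqrtr_gt0 // dotC.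
  rewrite /dot (bigD1 j) //= mxE !eqxx mulr1 big1 ?addr0 // => k kj.
  by rewrite mxE (negbTE kj) andbF mulr0.
apply: (smooth_ext oU E); apply: smoothM => //.
  apply: smooth_dot => //; last exact: smoothD_F.
  by apply: smooth_act => //; exact: smoothD_F.
apply: smoothV => // [u Uu|].
  by rewrite gt_eqF // sqrtr_gt0; apply: gram_gt0 => //; exact: det_b01.
apply: smooth_sqrt => // [u Uu|]; first by apply: gram_gt0 => //; exact: det_b01.
exact: gram_smooth.
Qed.

End InPatch.
End Patch.

(** * Pointwise inequalities for second-order jets of a soliton *)

Section RealAlgebra.
Variable R : realType.

(* Here S_ij = l_i . l_j and C = S - BB; in complex notation for the normal bundle
   the squares are 2 |conj(c) u - c conj(w)|^2, where c is half the mean curvature and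
   u, w are the two components of the traceless second fundamental form. *)
Lemma cross_term_ge0 (a b c d e f : R) :
  a * e + b * f - d * b - e * c <= 0 ->
  let S11 := (b + d) ^+ 2 + (e - a) ^+ 2 in
  let S12 := (b + d) * (c + e) + (e - a) * (f - b) in
  let S22 := (c + e) ^+ 2 + (f - b) ^+ 2 in
  let BB11 := a ^+ 2 + b ^+ 2 + (d ^+ 2 + e ^+ 2) in
  let BB12 := a * b + b * c + (d * e + e * f) in
  let BB22 := b ^+ 2 + c ^+ 2 + (e ^+ 2 + f ^+ 2) in
  BB11 * S11 + 2 * BB12 * S12 + BB22 * S22 <= S11 ^+ 2 + 2 * S12 ^+ 2 + S22 ^+ 2.
Proof.
move=> k /=.
set S11 := (b + d) ^+ 2 + _; set S12 := _ + (e - a) * (f - b); set S22 := (c + e) ^+ 2 + _.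
set BB11 := a ^+ 2 + _ + _; set BB12 := a * b + _ + _; set BB22 := b ^+ 2 + _ + _.
pose H1 := a + c; pose H2 := d + f.
rewrite -subr_ge0.
have -> : S11 ^+ 2 + 2 * S12 ^+ 2 + S22 ^+ 2 - (BB11 * S11 + 2 * BB12 * S12 + BB22 * S22)
  = - (a * e + b * f - d * b - e * c) * (S11 + S22 + H1 ^+ 2 + H2 ^+ 2)
    + (2 * (H2 * b - H1 * e) ^+ 2 + (H1 * (d - f) - H2 * (a - c)) ^+ 2 / 2).
  by rewrite /S11 /S12 /S22 /BB11 /BB12 /BB22 /H1 /H2; field.
apply: addr_ge0.
  apply: mulr_ge0; first by rewrite oppr_ge0.
  by rewrite !addr_ge0 ?sqr_ge0 // /S11 /S22 addr_ge0 ?sqr_ge0.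
by apply: addr_ge0; [apply: mulr_ge0|apply: divr_ge0]; rewrite ?sqr_ge0 ?ler0n.
Qed.

Lemma CS4 (x1 x2 x3 x4 y1 y2 y3 y4 : R) :
  (x1 * y1 + x2 * y2 + x3 * y3 + x4 * y4) ^+ 2 <=
  (x1 ^+ 2 + x2 ^+ 2 + x3 ^+ 2 + x4 ^+ 2) * (y1 ^+ 2 + y2 ^+ 2 + y3 ^+ 2 + y4 ^+ 2).
Proof.
rewrite -subr_ge0.
have -> : (x1 ^+ 2 + x2 ^+ 2 + x3 ^+ 2 + x4 ^+ 2) * (y1 ^+ 2 + y2 ^+ 2 + y3 ^+ 2 + y4 ^+ 2)
   - (x1 * y1 + x2 * y2 + x3 * y3 + x4 * y4) ^+ 2 =
   (x1 * y2 - x2 * y1) ^+ 2 + (x1 * y3 - x3 * y1) ^+ 2 + (x1 * y4 - x4 * y1) ^+ 2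
   + (x2 * y3 - x3 * y2) ^+ 2 + (x2 * y4 - x4 * y2) ^+ 2 + (x3 * y4 - x4 * y3) ^+ 2 by ring.
by rewrite !addr_ge0 ?sqr_ge0.
Qed.

(* The Bochner formula for n = |d lam|^2 combined with the equation L v = - n (v + c)
   and Kato's inequality; T_i is the gradient of Q = n / v^2. *)
Lemma bochner_ratio (n1 n2 Q v c v1 v2 T1 T2 MQ Mn tr n SS BS t2 : R) :
  0 < Q -> 0 < v -> n = Q * v ^+ 2 ->
  n1 = T1 * v ^+ 2 + 2 * Q * v * v1 -> n2 = T2 * v ^+ 2 + 2 * Q * v * v2 ->
  n1 ^+ 2 + n2 ^+ 2 <= 4 * n * t2 -> BS <= SS ->
  Mn = 2 * n * tr - 2 * BS + 2 * (t2 + SS) - 2 * n ^+ 2 ->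
  v ^+ 2 * MQ + 4 * v * (T1 * v1 + T2 * v2)
    + Q * (2 * (v1 ^+ 2 + v2 ^+ 2) - 2 * v * (n * (v + c))) + 2 * n * tr = Mn ->
  2 * c * v ^+ 2 * Q ^+ 2 - 2 * (T1 * v1 + T2 * v2) <= v * MQ.
Proof.
move=> Q0 v0 En E1 E2 kato BSle EM E.
have Qv : 0 < Q * v ^+ 2 by rewrite mulr_gt0 // exprn_gt0.
have k1 : (n1 ^+ 2 + n2 ^+ 2) <= 2 * (Q * v ^+ 2) * (2 * t2).
  by rewrite En in kato; lra.
have k2 : v ^+ 4 * (T1 ^+ 2 + T2 ^+ 2) + 4 * Q * v ^+ 3 * (T1 * v1 + T2 * v2)
   + 4 * Q ^+ 2 * v ^+ 2 * (v1 ^+ 2 + v2 ^+ 2) <= 2 * (Q * v ^+ 2) * (2 * t2).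
  by rewrite E1 E2 in k1; apply: le_trans k1; rewrite le_eqVlt; apply/orP; left; apply/eqP; ring.
(* Kato's inequality is used after dropping the nonnegative term v^4 |T|^2. *)
have k3 : 4 * Q * v ^+ 3 * (T1 * v1 + T2 * v2)
   + 4 * Q ^+ 2 * v ^+ 2 * (v1 ^+ 2 + v2 ^+ 2) <= 2 * (Q * v ^+ 2) * (2 * t2).
  apply: le_trans k2; rewrite -subr_ge0.
  have -> : v ^+ 4 * (T1 ^+ 2 + T2 ^+ 2) + 4 * Q * v ^+ 3 * (T1 * v1 + T2 * v2)
   + 4 * Q ^+ 2 * v ^+ 2 * (v1 ^+ 2 + v2 ^+ 2) - (4 * Q * v ^+ 3 * (T1 * v1 + T2 * v2)
   + 4 * Q ^+ 2 * v ^+ 2 * (v1 ^+ 2 + v2 ^+ 2)) = v ^+ 4 * (T1 ^+ 2 + T2 ^+ 2) by ring.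
  by rewrite mulr_ge0 ?exprn_ge0 ?addr_ge0 ?sqr_ge0 ?ltW.
have k4 : 2 * v * (T1 * v1 + T2 * v2) + 2 * Q * (v1 ^+ 2 + v2 ^+ 2) <= 2 * t2.
  have P : 0 < 2 * (Q * v ^+ 2) by rewrite mulr_gt0.
  rewrite -(ler_pM2l P); apply: le_trans k3.
  by rewrite le_eqVlt; apply/orP; left; apply/eqP; ring.
rewrite -(ler_pM2l v0).
have -> : v * (v * MQ) = Mn - 2 * n * tr - 4 * v * (T1 * v1 + T2 * v2)
    - Q * (2 * (v1 ^+ 2 + v2 ^+ 2) - 2 * v * (n * (v + c))) by rewrite -E; ring.
rewrite EM -subr_ge0.
have -> : 2 * n * tr - 2 * BS + 2 * (t2 + SS) - 2 * n ^+ 2 - 2 * n * tr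
  - 4 * v * (T1 * v1 + T2 * v2) - Q * (2 * (v1 ^+ 2 + v2 ^+ 2) - 2 * v * (n * (v + c)))
  - v * (2 * c * v ^+ 2 * Q ^+ 2 - 2 * (T1 * v1 + T2 * v2))
  = 2 * (SS - BS) + (2 * t2 - (2 * v * (T1 * v1 + T2 * v2) + 2 * Q * (v1 ^+ 2 + v2 ^+ 2))).
  by rewrite En; ring.
by rewrite addr_ge0 // ?mulr_ge0 // subr_ge0.
Qed.

End RealAlgebra.

Section Jets.
Variables (R : realType) (J : 'I_3 -> 'M[R]_4).
Hypothesis HK : hyperkahler J.
Variables (e1 e2 W11 W12 W22 : 'rV[R]_4) (l l1 l2 : 'rV[R]_3).

(* First and second derivatives of the immersion, and first derivatives of the
   phase map, at a point where the two coordinate vectors are orthonormal. *)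
Record soliton_jet : Prop := SolitonJet {
  j_11 : dot e1 e1 = 1 ;
  j_22 : dot e2 e2 = 1 ;
  j_12 : dot e1 e2 = 0 ;
  j_ll : dot l l = 1 ;
  j_phase : K J l e1 = e2 ;
  j_l1 : dot l1 l = 0 ;
  j_l2 : dot l2 l = 0 ;
  j_d1 : forall b, dot b l = 0 ->
    dot b l1 = dot (K J b W11) e2 + dot (K J b e1) W12 ;
  j_d2 : forall b, dot b l = 0 ->
    dot b l2 = dot (K J b W12) e2 + dot (K J b e1) W22 ;
  j_curv : forall m, dot m m = 1 -> dot l m = 0 ->
    let f1 := K J m e1 in let f2 := K J (crossp l m) e1 in
    dot W11 f1 * dot W12 f2 + dot W12 f1 * dot W22 f2
    - dot W11 f2 * dot W12 f1 - dot W12 f2 * dot W22 f1 <= 0 }.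

Hypothesis H : soliton_jet.

Lemma KNl b W : K J (- b) W = - K J b W.
Proof. by rewrite -scaleN1r KZl scaleN1r. Qed.

Lemma dot_Kphase m W : dot l m = 0 -> dot (K J m W) e2 = dot W (K J (crossp l m) e1).
Proof.
move=> lm; rewrite -(j_phase H) K_skew // KK // (dotC m) lm oppr0 scale0r add0r.
by rewrite crossC KNl dotNr opprK.
Qed.

Lemma cross_nl m : dot l m = 0 -> crossp l (crossp l m) = - m.
Proof. by move=> lm; rewrite cross_crossl lm (j_ll H) scale0r scale1r sub0r. Qed.

Section Frame.
Variable m : 'rV[R]_3.
Hypothesis mm : dot m m = 1.
Hypothesis lm : dot l m = 0.
Local Notation n := (crossp l m).
Local Notation f1 := (K J m e1).
Local Notation f2 := (K J n e1).

Lemma jet_nn : dot n n = 1.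
Proof. by rewrite dot_cross (j_ll H) mm lm expr0n subr0 mulr1. Qed.

(** Pairing d lam with [m] and with l x m gives four linear forms in the six coefficients of the
    second fundamental form. They are the entries of the sums [S11], [S12], [S22] of
    [cross_term_ge0]. *)
Lemma jet_m1 : dot m l1 = dot W11 f2 + dot W12 f1.
Proof. by rewrite (j_d1 H) ?dot_Kphase // 1?[dot m l]dotC // [dot f1 _]dotC. Qed.

Lemma jet_m2 : dot m l2 = dot W12 f2 + dot W22 f1.
Proof. by rewrite (j_d2 H) ?dot_Kphase // 1?[dot m l]dotC // [dot f1 _]dotC. Qed.

Lemma jet_n1 : dot n l1 = dot W12 f2 - dot W11 f1.
Proof.
rewrite (j_d1 H); last by rewrite dotC dot_crossl.
by rewrite dot_Kphase ?dot_crossl // cross_nl // KNl dotNr [dot f2 _]dotC addrC.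
Qed.

Lemma jet_n2 : dot n l2 = dot W22 f2 - dot W12 f1.
Proof.
rewrite (j_d2 H); last by rewrite dotC dot_crossl.
by rewrite dot_Kphase ?dot_crossl // cross_nl // KNl dotNr [dot f2 _]dotC addrC.
Qed.

Lemma jet_frame4 X Y : dot X Y = dot X e1 * dot Y e1 + dot X e2 * dot Y e2
  + dot X f1 * dot Y f1 + dot X f2 * dot Y f2.
Proof.
apply: basis4; rewrite ?(j_11 H, j_22 H, j_12 H) //; rewrite -?(j_phase H).
- by rewrite dot_KK // mm (j_11 H) mulr1.
- by rewrite dot_KK // jet_nn (j_11 H) mulr1.
- by rewrite dotC dot_Kxx.
- by rewrite dotC dot_Kxx.
- by rewrite dot_KK // lm mul0r.
- by rewrite dot_KK // dot_crossl mul0r.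
- by rewrite dot_KK // dot_crossr mul0r.
Qed.

Lemma jet_frame3 X Y : dot X l = 0 -> dot X Y = dot m X * dot m Y + dot n X * dot n Y.
Proof.
move=> Xl; rewrite (basis3 _ _ (j_ll H) mm lm) Xl mul0r add0r.
by rewrite !(dotC X) !(dotC Y).
Qed.

(* |d lam|^2 = |B|^2 - 2 kappa *)
Lemma jet_sff_le :
  dot W11 f1 ^+ 2 + 2 * dot W12 f1 ^+ 2 + dot W22 f1 ^+ 2 +
  (dot W11 f2 ^+ 2 + 2 * dot W12 f2 ^+ 2 + dot W22 f2 ^+ 2) <= dot l1 l1 + dot l2 l2.
Proof.
rewrite (jet_frame3 _ (j_l1 H)) (jet_frame3 _ (j_l2 H)) jet_m1 jet_m2 jet_n1 jet_n2.
have := j_curv H mm lm => /=.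
move: (dot W11 f1) (dot W12 f1) (dot W22 f1) (dot W11 f2) (dot W12 f2) (dot W22 f2).
by move=> a b c d e f h; lra.
Qed.

(** On a soliton the left side is minus the Bakry-Emery Ricci tensor of the drift Laplacian
    contracted with d lam: by the Gauss equation Ric_ij is H . B_ij - sum_k B_ik . B_jk, and the
    Hessian of the drift potential cancels the first term. The right side is part of the curvature
    term of the sphere, so that in the Bochner formula the one absorbs the other. *)
Lemma jet_key : dot W11 e1 = 0 -> dot W12 e1 = 0 -> dot W22 e1 = 0 ->
  dot W11 e2 = 0 -> dot W12 e2 = 0 -> dot W22 e2 = 0 ->
  (dot W11 W11 + dot W12 W12) * dot l1 l1 + 2 * (dot W11 W12 + dot W12 W22) * dot l1 l2
  + (dot W12 W12 + dot W22 W22) * dot l2 l2 <=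
  dot l1 l1 ^+ 2 + 2 * dot l1 l2 ^+ 2 + dot l2 l2 ^+ 2.
Proof.
move=> h1 h2 h3 h4 h5 h6.
rewrite !(jet_frame3 _ (j_l1 H)) (jet_frame3 _ (j_l2 H)) jet_m1 jet_m2 jet_n1 jet_n2.
rewrite (jet_frame4 W11 W11) (jet_frame4 W12 W12) (jet_frame4 W22 W22) (jet_frame4 W11 W12) (jet_frame4 W12 W22) h1 h2 h3 h4 h5 h6 !mul0r !add0r.
have := cross_term_ge0 (j_curv H mm lm) => /=.
move: (dot W11 f1) (dot W12 f1) (dot W22 f1) (dot W11 f2) (dot W12 f2) (dot W22 f2).
by move=> a b c d e f h; lra.
Qed.

End Frame.

Lemma exists_perp : exists m : 'rV[R]_3, dot m m = 1 /\ dot l m = 0.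
Proof.
have [a Ha] : exists a : 'rV[R]_3, crossp l a != 0.
  case: (eqVneq (crossp l (delta_mx 0 0)) 0) => [h0|]; last by exists (delta_mx 0 0).
  exists (delta_mx 0 1); apply/eqP => h1.
  have e1' := congr1 (fun x : 'rV_3 => x 0 1) h0; have e2' := congr1 (fun x : 'rV_3 => x 0 2) h0.
  have e3' := congr1 (fun x : 'rV_3 => x 0 2) h1.
  rewrite /= !mxE /= ?mxE /= in e1'; rewrite /= !mxE /= ?mxE /= in e2'; rewrite /= !mxE /= ?mxE /= in e3'.
  have := j_ll H; rewrite dot3E.
  have -> : l 0 0 = 0 by move: e3'; lra.
  have -> : l 0 1 = 0 by move: e2'; lra.
  have -> : l 0 2 = 0 by move: e1'; lra.
  by rewrite !mulr0 !addr0 => h; have := oner_neq0 R; rewrite -h eqxx.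
have c0 := dot_gt0 Ha.
exists ((Num.sqrt (dot (crossp l a) (crossp l a)))^-1 *: crossp l a).
split; last by rewrite dotZr dot_crossl mulr0.
rewrite dotZl dotZr mulrA -expr2 exprVn sqr_sqrtr ?ltW //.
by rewrite mulVf // gt_eqF.
Qed.

(* The derivative of the energy density of x |-> (p . F x), obtained from the
   quotient rule, when e1, e2 have derivatives X, Y. *)
Definition denergy (p X Y : 'rV[R]_4) :=
  - (2 * dot X e1) * dot p e1 ^+ 2 - (2 * dot Y e2) * dot p e2 ^+ 2
  - 2 * (dot X e2 + dot e1 Y) * (dot p e1 * dot p e2)
  + 2 * dot p e1 * dot p X + 2 * dot p e2 * dot p Y.

(** The tangential components of [X] and [Y] cancel, leaving products of a tangential and a normal
    component of [p]. After Cauchy-Schwarz the factor is the product of the squared lengths of these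
    two parts of [p], each at most 1. *)
Lemma denergy_le (m : 'rV[R]_3) p X Y : dot m m = 1 -> dot l m = 0 -> dot p p = 1 ->
  denergy p X Y ^+ 2 <= 4 * (dot X (K J m e1) ^+ 2 + dot X (K J (crossp l m) e1) ^+ 2
    + dot Y (K J m e1) ^+ 2 + dot Y (K J (crossp l m) e1) ^+ 2).
Proof.
move=> mm lm; rewrite /denergy (jet_frame4 mm lm p p) (jet_frame4 mm lm p X) (jet_frame4 mm lm p Y).
rewrite [dot e1 Y]dotC.
move: (dot p e1) (dot p e2) (dot p (K J m e1)) (dot p (K J (crossp l m) e1)) => x y z w pp.
move: (dot X (K J m e1)) (dot X (K J (crossp l m) e1)) (dot Y (K J m e1))
  (dot Y (K J (crossp l m) e1)) (dot X e1) (dot X e2) (dot Y e1) (dot Y e2) => a b c d a1 a2 c1 c2.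
have -> : - (2 * a1) * x ^+ 2 - (2 * c2) * y ^+ 2 - 2 * (a2 + c1) * (x * y)
  + 2 * x * (x * a1 + y * a2 + z * a + w * b) + 2 * y * (x * c1 + y * c2 + z * c + w * d)
  = 2 * ((x * z) * a + (x * w) * b + (y * z) * c + (y * w) * d) by ring.
rewrite exprMn (_ : 2 ^+ 2 = 4); last by rewrite expr2 -natrM.
rewrite ler_pM2l //.
apply: (le_trans (CS4 _ _ _ _ _ _ _ _)).
have S0 : 0 <= a ^+ 2 + b ^+ 2 + c ^+ 2 + d ^+ 2 by rewrite !addr_ge0 ?sqr_ge0.
apply: ler_piMl => //.
have hx := sqr_ge0 x; have hy := sqr_ge0 y; have hz := sqr_ge0 z; have hw := sqr_ge0 w.
rewrite !exprMn -!expr2 in pp *.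
have -> : x ^+ 2 * z ^+ 2 + x ^+ 2 * w ^+ 2 + y ^+ 2 * z ^+ 2 + y ^+ 2 * w ^+ 2
  = (x ^+ 2 + y ^+ 2) * (z ^+ 2 + w ^+ 2) by ring.
rewrite -[leRHS](mulr1 1); apply: ler_pM; rewrite ?addr_ge0 //; lra.
Qed.

(** The factor 16 is the 4 of [denergy_le], doubled for the square of a sum and doubled again for
    the two vectors [p1] and [p2]. Through [jet_sff_le] the sign of the curvature then replaces
    |B|^2 by |d lam|^2. *)
Lemma denergy_pair (p1 p2 : 'rV[R]_4) : dot p1 p1 = 1 -> dot p2 p2 = 1 ->
  (denergy p1 W11 W12 + denergy p2 W11 W12) ^+ 2
  + (denergy p1 W12 W22 + denergy p2 W12 W22) ^+ 2 <= 16 * (dot l1 l1 + dot l2 l2).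
Proof.
move=> pp1 pp2; have [m [mm lm]] := exists_perp.
have := jet_sff_le mm lm.
have := denergy_le W11 W12 mm lm pp1; have := denergy_le W11 W12 mm lm pp2.
have := denergy_le W12 W22 mm lm pp1; have := denergy_le W12 W22 mm lm pp2.
have sq2 (x y : R) : (x + y) ^+ 2 <= 2 * (x ^+ 2 + y ^+ 2).
  by have := sqr_ge0 (x - y); rewrite sqrrB sqrrD; lra.
have := sq2 (denergy p1 W11 W12) (denergy p2 W11 W12).
have := sq2 (denergy p1 W12 W22) (denergy p2 W12 W22).
move: (denergy p1 W11 W12) (denergy p2 W11 W12) (denergy p1 W12 W22) (denergy p2 W12 W22).
move: (dot W11 (K J m e1)) (dot W12 (K J m e1)) (dot W22 (K J m e1)).
move: (dot W11 (K J (crossp l m) e1)) (dot W12 (K J (crossp l m) e1)) (dot W22 (K J (crossp l m) e1)).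
by move: (dot l1 l1 + dot l2 l2) => h a b c d e f A B C D; lra.
Qed.

End Jets.

Section JetShift.
Variables (R : realType) (J : 'I_3 -> 'M[R]_4).
Hypothesis HK : hyperkahler J.

(** For b orthogonal to [l] the form of K b vanishes on the tangent plane, so a jet sees only normal
    components of the second derivatives. This permits the passage from frozen directions to
    fields. *)
Lemma jet_shift (e1 e2 W11 W12 W22 : 'rV[R]_4) (l l1 l2 : 'rV[R]_3) (a11 b11 a12 b12 a22 b22 : R) :
  soliton_jet J e1 e2 W11 W12 W22 l l1 l2 ->
  soliton_jet J e1 e2 (W11 + (a11 *: e1 + b11 *: e2)) (W12 + (a12 *: e1 + b12 *: e2))
    (W22 + (a22 *: e1 + b22 *: e2)) l l1 l2.
Proof.
move=> H; have [h11 h22 h12 hll hph hl1 hl2 d1 d2 curv] := H.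
have K11 b : dot (K J b e1) e1 = 0 by rewrite dot_Kxx.
have K12 b : dot b l = 0 -> dot (K J b e1) e2 = 0 by rewrite -hph dot_KK // => ->; rewrite mul0r.
have K22 b : dot (K J b e2) e2 = 0 by rewrite dot_Kxx.
have K21 b : dot b l = 0 -> dot (K J b e2) e1 = 0 by move=> bl; rewrite K_skew // dotC K12 ?oppr0.
split => //.
- move=> b bl; rewrite !KDr !KZr !(dotDl, dotDr, dotZl, dotZr) d1 // K11 K22 K12 //.
  by rewrite !(mulr0, addr0).
- move=> b bl; rewrite !KDr !KZr !(dotDl, dotDr, dotZl, dotZr) d2 // K11 K22 K12 //.
  by rewrite !(mulr0, addr0).
- move=> m mm lm /=; have := curv m mm lm => /=.
  have ml : dot m l = 0 by rewrite dotC.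
  have nl : dot (crossp l m) l = 0 by rewrite dotC dot_crossl.
  rewrite !(dotDl, dotZl) ![dot e1 (K _ _ _)]dotC ![dot e2 (K _ _ _)]dotC !K11 !K12 //.
  by rewrite !(mulr0, addr0).
Qed.

End JetShift.

Section EnergyAlgebra.
Variables (R : realType) (n : nat).

Lemma enum_change (X Y : 'rV[R]_4) (x y : 'rV[R]_n) (a b c d : R) :
  let F1 := a *: X + b *: Y in let F2 := c *: X + d *: Y in
  let f1 := a *: x + b *: y in let f2 := c *: x + d *: y in
  (dot F1 F1 * dot F2 F2 - dot F1 F2 ^+ 2 = (a * d - b * c) ^+ 2 * (dot X X * dot Y Y - dot X Y ^+ 2)) /\
  (dot F2 F2 * dot f1 f1 - 2 * dot F1 F2 * dot f1 f2 + dot F1 F1 * dot f2 f2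
   = (a * d - b * c) ^+ 2 * (dot Y Y * dot x x - 2 * dot X Y * dot x y + dot X X * dot y y)).
Proof.
rewrite /= !(dotDl, dotDr, dotZl, dotZr) (dotC Y X) (dotC y x).
move: (dot X X) (dot X Y) (dot Y Y) (dot x x) (dot x y) (dot y y) => A B C D E G.
by split; ring.
Qed.

End EnergyAlgebra.

Definition proj2 (R : realType) (p1 p2 w : 'rV[R]_4) : 'rV[R]_2 :=
  \row_(i < 2) (if i == 0 then dot p1 w else dot p2 w).

Lemma dot_proj2 (R : realType) (p1 p2 w w' : 'rV[R]_4) :
  dot (proj2 p1 p2 w) (proj2 p1 p2 w') = dot p1 w * dot p1 w' + dot p2 w * dot p2 w'.
Proof. by rewrite dot2E !mxE. Qed.

Section PatchEnergy.
Variables (R : realType) (J : 'I_3 -> 'M[R]_4) (V0 : 'rV[R]_4).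
Variables (U : set 'rV[R]_2) (F : 'rV[R]_2 -> 'rV[R]_4) (lam : 'rV[R]_2 -> 'rV[R]_3).
Hypothesis HK : hyperkahler J.
Hypothesis Pt : soliton_patch J V0 U F lam.

Let oU := p_open Pt.
Let sF := p_smooth Pt.
Let sL := lam_smooth HK Pt.

Lemma ldiff u : U u -> differentiable lam u.
Proof. by move=> Uu; exact: smooth_differentiable sL Uu. Qed.

Lemma dlam_unit u v : U u -> dot (dd v lam u) (lam u) = 0.
Proof.
move=> Uu.
have := dd_near v oU Uu (p_unit Pt).
rewrite dd_cst (dd_dot v (ldiff Uu) (ldiff Uu)) (dotC (lam u)) => h.
by move: h; move: (dot _ _) => x h; lra.
Qed.

Lemma gram_onb u v1 v2 : onb_at F u v1 v2 -> gram F u v1 v2 = 1.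
Proof.
rewrite /gram => -[_]; move: (dd v1 F u) (dd v2 F u) => a b -> -> ->.
by rewrite expr0n mulr1 subr0.
Qed.

(** The identity of [phase_pair] is differentiated; the derivative of the area element is multiplied
    by b . lam = 0. *)
Lemma dlam_phase u v1 v2 b v : U u -> onb_at F u v1 v2 -> dot b (lam u) = 0 ->
  dot b (dd v lam u) = dot (K J b (dd v (dd v1 F) u)) (dd v2 F u)
                     + dot (K J b (dd v1 F u)) (dd v (dd v2 F) u).
Proof.
move=> Uu o bl; have [dw _ _ _] := o.
have E y : U y -> dot (K J b (dd v1 F y)) (dd v2 F y) = Num.sqrt (gram F y v1 v2) * dot b (lam y).
  by move=> Uy; have [] := phase_pair HK Pt b Uy dw.
have := dd_near v oU Uu E.
have dK := diff_act (Jcomb J b) (pdiffD Pt v1 Uu).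
have DK := dd_act (Jcomb J b) v (pdiffD Pt v1 Uu).
rewrite (dd_dot v dK (pdiffD Pt v2 Uu)) DK.
have sg : smooth U (fun y => Num.sqrt (gram F y v1 v2)).
  by apply: smooth_sqrt => // [y Uy|]; [exact: (gram_gt0 HK Pt)|exact: (gram_smooth Pt)].
have db : differentiable (fun y => dot b (lam y)) u.
  exact: diff_dot (differentiable_cst _ _) (ldiff Uu).
rewrite (dd_mul v (smooth_differentiable sg Uu) db) bl mulr0 addr0.
by rewrite (gram_onb o) sqrtr1 mul1r (dd_dotc b v (ldiff Uu)) => ->.
Qed.

Lemma patch_jet u v1 v2 : U u -> onb_at F u v1 v2 ->
  soliton_jet J (dd v1 F u) (dd v2 F u) (dd v1 (dd v1 F) u) (dd v1 (dd v2 F) u)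
    (dd v2 (dd v2 F) u) (lam u) (dd v1 lam u) (dd v2 lam u).
Proof.
move=> Uu o; have [_ h11 h22 h12] := o.
split; [exact: h11|exact: h22|exact: h12|exact: (p_unit Pt)|exact: (p_phase Pt)| | | | |].
- exact: dlam_unit.
- exact: dlam_unit.
- by move=> b bl; apply: dlam_phase.
- move=> b bl; have := dlam_phase v2 Uu o bl.
  by have := dd_comm v2 v1 oU sF Uu; move: (dd v2 (dd v1 F) u) => A ->.
- by move=> m mm lm; exact: (p_curv Pt Uu o mm lm).
Qed.

Lemma energy_frame n (f : 'rV[R]_2 -> 'rV[R]_n) u w1 w2 : U u -> differentiable f u ->
  0 < det2 w1 w2 -> energy F f u = enum_at F f u w1 w2 / gram F u w1 w2.
Proof.
move=> Uu df dw; have dF := pdiff Pt Uu.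
have g0 := gram_gt0 HK Pt Uu (det_b01 R).
have := enum_change (dd (b0 R) F u) (dd (b1 R) F u) (dd (b0 R) f u) (dd (b1 R) f u)
  (w1 0 0) (w1 0 1) (w2 0 0) (w2 0 1).
rewrite -!(dd_comb _ _ _ _ dF) -!(dd_comb _ _ _ _ df) -!vec2E => -[h1 h2].
rewrite /energy [in RHS]/enum_at [in RHS]/gram h1 h2.
rewrite -/(enum_at F f u (b0 R) (b1 R)) -/(gram F u (b0 R) (b1 R)).
rewrite -[_ * _ - _ * _]/(det2 w1 w2).
move: (enum_at F f u (b0 R) (b1 R)) (gram F u (b0 R) (b1 R)) (det2 w1 w2) g0 dw => A B C B0 C0.
by field; rewrite !gt_eqF.
Qed.

Lemma energy_onb n (f : 'rV[R]_2 -> 'rV[R]_n) u v1 v2 : U u -> differentiable f u ->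
  onb_at F u v1 v2 ->
  energy F f u = dot (dd v1 f u) (dd v1 f u) + dot (dd v2 f u) (dd v2 f u).
Proof.
move=> Uu df o; have [dw h11 h22 h12] := o.
rewrite (energy_frame Uu df dw) (gram_onb o) divr1 /enum_at.
move: (dd v1 F u) (dd v2 F u) (dd v1 f u) (dd v2 f u) h11 h22 h12 => a b c d -> -> ->.
by rewrite mulr0 mul0r subr0 !mul1r.
Qed.

Lemma enum_smooth n (f : 'rV[R]_2 -> 'rV[R]_n) w1 w2 : smooth U f ->
  smooth U (fun u => enum_at F f u w1 w2).
Proof.
move=> sf.
have sd m (g : 'rV[R]_2 -> 'rV[R]_m) v w : smooth U g -> smooth U (fun u => dot (dd v g u) (dd w g u)).
  by move=> sg; apply: smooth_dot => //; exact: smooth_dd.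
apply: smoothD => //; last by apply: smoothM => //; exact: sd.
apply: smoothD => //; first by apply: smoothM => //; exact: sd.
apply: smoothN => //; apply: smoothM => //; last exact: sd.
by apply: smoothM => //; [exact: smooth_cst|exact: sd].
Qed.

Lemma energy_smooth n (f : 'rV[R]_2 -> 'rV[R]_n) : smooth U f -> smooth U (energy F f).
Proof.
move=> sf; apply: smoothM => //; first exact: enum_smooth.
apply: smoothV => // [u Uu|]; last exact: (gram_smooth Pt).
by rewrite gt_eqF // (gram_gt0 HK Pt Uu) // det_b01.
Qed.

Variables p1 p2 : 'rV[R]_4.
Hypothesis pp1 : dot p1 p1 = 1.
Hypothesis pp2 : dot p2 p2 = 1.

Definition projF u := proj2 p1 p2 (F u).

Lemma projF_smooth : smooth U projF.
Proof.
apply: smooth_mx => // i j.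
have sc p : smooth U (fun u => dot p (F u)).
  by apply: smooth_dot => //; exact: smooth_cst.
by case: (eqVneq j 0) => j0; [apply: (smooth_ext oU _ (sc p1))|apply: (smooth_ext oU _ (sc p2))] => x _;
  rewrite mxE ?j0 //= (negbTE j0).
Qed.

Lemma D_projF u v : U u -> dd v projF u = proj2 p1 p2 (dd v F u).
Proof.
move=> Uu; apply/rowP => j.
rewrite (dd_coord v j (smooth_diff projF_smooth Uu)) mxE.
by case: (eqVneq j 0) => j0; rewrite -(dd_dotc _ v (pdiff Pt Uu)); congr dd; rewrite funeqE => x;
  rewrite mxE ?j0 //= (negbTE j0).
Qed.

Lemma energy_projF_deriv u v1 v2 v : U u -> onb_at F u v1 v2 ->
  dd v (energy F projF) u =
    denergy (dd v1 F u) (dd v2 F u) p1 (dd v (dd v1 F) u) (dd v (dd v2 F) u)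
  + denergy (dd v1 F u) (dd v2 F u) p2 (dd v (dd v1 F) u) (dd v (dd v2 F) u).
Proof.
move=> Uu o; have [dw h11 h22 h12] := o.
have dP y : U y -> differentiable projF y.
  by move=> Uy; exact: smooth_differentiable projF_smooth Uy.
(* The Gram determinant is cleared before differentiating, so that no quotient rule is needed; at
   [u] it equals 1. *)
have E y : U y -> energy F projF y * (dot (dd v1 F y) (dd v1 F y) * dot (dd v2 F y) (dd v2 F y)
    - dot (dd v1 F y) (dd v2 F y) * dot (dd v1 F y) (dd v2 F y)) =
    dot (dd v2 F y) (dd v2 F y) * (dot p1 (dd v1 F y) * dot p1 (dd v1 F y) + dot p2 (dd v1 F y) * dot p2 (dd v1 F y))
  - 2 * dot (dd v1 F y) (dd v2 F y) * (dot p1 (dd v1 F y) * dot p1 (dd v2 F y) + dot p2 (dd v1 F y) * dot p2 (dd v2 F y))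
  + dot (dd v1 F y) (dd v1 F y) * (dot p1 (dd v2 F y) * dot p1 (dd v2 F y) + dot p2 (dd v2 F y) * dot p2 (dd v2 F y)).
  move=> Uy; rewrite -expr2 -/(gram F y v1 v2) (energy_frame Uy (dP y Uy) dw) divfK; last first.
    by rewrite gt_eqF // (gram_gt0 HK Pt Uy dw).
  by rewrite /enum_at !D_projF // !dot_proj2.
have d1 := pdiffD Pt v1 Uu; have d2 := pdiffD Pt v2 Uu.
have dE : differentiable (energy F projF) u.
  exact: smooth_differentiable (energy_smooth projF_smooth) Uu.
have h1 := E u Uu.
derive_identity h2 oU Uu E v.
all: try assumption.
move: h1 h2; rewrite h11 h22 h12 /denergy.
rewrite ![dot (dd v1 F u) (dd v _ u)]dotC ![dot (dd v2 F u) (dd v _ u)]dotC.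
move: (dot (dd v (dd v1 F) u) _) (dot (dd v (dd v1 F) u) _) (dot (dd v (dd v2 F) u) _)
  (dot (dd v (dd v2 F) u) _) => A11 A12 A22 A21.
move: (dot p1 (dd v1 F u)) (dot p1 (dd v2 F u)) (dot p2 (dd v1 F u)) (dot p2 (dd v2 F u)).
move: (dot p1 (dd v (dd v1 F) u)) (dot p1 (dd v (dd v2 F) u)) (dot p2 (dd v (dd v1 F) u)) (dot p2 (dd v (dd v2 F) u)).
move: (energy F projF u) (dd v _ u) => e de x1 x2 x3 x4 y1 y2 y3 y4.
rewrite !(mul1r, mulr0, subr0, mulr1, mul0r) => ->; lra.
Qed.

Lemma det2_decomp (v1 v2 v : 'rV[R]_2) : 0 < det2 v1 v2 ->
  exists a b, v = a *: v1 + b *: v2.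
Proof.
move=> d0; exists (det2 v v2 / det2 v1 v2), (det2 v1 v / det2 v1 v2).
have d1 : det2 v1 v2 != 0 by rewrite gt_eqF.
rewrite [LHS]vec2E [RHS]vec2E; congr (_ *: _ + _ *: _); rewrite !mxE; move: d1; rewrite /det2 => d1; by field.
Qed.

(** The derivatives along an orthonormal pair are bounded by [denergy_pair], and Cauchy-Schwarz
    passes to any direction. In other words the energy of a projection, which measures the position
    of the tangent plane relative to [p1] and [p2], has gradient at most 4 |d lam|. *)
Lemma energy_deriv_le u v : U u ->
  dd v (energy F projF) u ^+ 2 <= 16 * energy F lam u * dot (dd v F u) (dd v F u).
Proof.
move=> Uu; have [v1 [v2 o]] := exists_onb Pt Uu; have [dw h11 h22 h12] := o.
have [a [b ->]] := det2_decomp v dw.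
have dE : differentiable (energy F projF) u.
  exact: smooth_differentiable (energy_smooth projF_smooth) Uu.
rewrite (dd_comb a b v1 v2 dE) (dd_comb a b v1 v2 (pdiff Pt Uu)).
rewrite !(energy_projF_deriv _ Uu o) (energy_onb Uu (ldiff Uu) o).
have jt := patch_jet Uu o.
have := denergy_pair HK jt pp1 pp2.
rewrite (dd_comm v2 v1 oU sF Uu) !(dotDl, dotDr, dotZl, dotZr) (dotC (dd v2 F u) (dd v1 F u)) h11 h22 h12.
move: (dot _ _ + dot _ _) => h.
move: (denergy _ _ p1 _ _ + denergy _ _ p2 _ _) (denergy _ _ p1 _ _ + denergy _ _ p2 _ _) => y x.
rewrite /GRing.scale /= => H.
have cs : (a * x + b * y) ^+ 2 <= (a ^+ 2 + b ^+ 2) * (x ^+ 2 + y ^+ 2).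
  by have := sqr_ge0 (a * y - b * x); lra.
apply: (le_trans cs).
have ab : 0 <= a ^+ 2 + b ^+ 2 by rewrite addr_ge0 ?sqr_ge0.
by have := ler_wpM2l ab H; lra.
Qed.

End PatchEnergy.

(** * The drift Laplacian *)

Section FieldDerivatives.
Variables (R : realType) (U : set 'rV[R]_2).
Hypothesis oU : open U.
Implicit Types (c : 'rV[R]_2 -> 'rV[R]_2).

Definition fd (W : normedModType R) c (f : 'rV[R]_2 -> W) x := dd (c x) f x.

Lemma fdE (f : 'rV[R]_2 -> R) c x : differentiable f x ->
  fd c f x = c x 0 0 * dd (b0 R) f x + c x 0 1 * dd (b1 R) f x.
Proof. by move=> df; rewrite /fd {1}[c x]vec2E dd_comb. Qed.

Lemma smooth_fd1 c (f : 'rV[R]_2 -> R) : smooth U c -> smooth U f -> smooth U (fd c f).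
Proof.
move=> sc sf.
apply: (smooth_ext oU (fun x Ux => esym (fdE c (smooth_diff sf Ux)))).
by apply: smoothD => //; apply: smoothM => //; (try exact: smooth_dd); exact: smooth_coord.
Qed.

Lemma fd_coord n c (f : 'rV[R]_2 -> 'rV[R]_n) x j : differentiable f x ->
  fd c f x 0 j = fd c (fun y => f y 0 j : R) x.
Proof. by move=> df; rewrite /fd dd_coord. Qed.

Lemma smooth_fd n c (f : 'rV[R]_2 -> 'rV[R]_n) : smooth U c -> smooth U f -> smooth U (fd c f).
Proof.
move=> sc sf; apply: smooth_mx => // i j; rewrite (ord1 i).
apply: (smooth_ext oU (fun x Ux => esym (fd_coord c j (smooth_diff sf Ux)))).
by apply: smooth_fd1 => //; exact: smooth_coord.
Qed.

Lemma fd_chain1 c (f : 'rV[R]_2 -> R) x w : smooth U c -> smooth U f -> U x ->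
  dd w (fd c f) x = dd (c x) (dd w f) x + dd (dd w c x) f x.
Proof.
move=> sc sf Ux.
have dc := smooth_diff sc Ux; have df := smooth_diff sf Ux.
have dcj j := differentiable_comp_coord (0 : 'I_1) j dc.
have ddf v := smooth_diff (smooth_dd v sf) Ux.
rewrite (dd_near w oU Ux (fun y Uy => fdE c (smooth_diff sf Uy))).
rewrite dd_add; [|exact: diff_mul|exact: diff_mul].
rewrite dd_mul // dd_mul // -!(dd_coord w _ dc).
rewrite {3}[c x]vec2E [dd w c x]vec2E (dd_comb _ _ _ _ (ddf w)) (dd_comb _ _ _ _ df).
rewrite (dd_comm1 w (b0 R) oU sf Ux) (dd_comm1 w (b1 R) oU sf Ux) !mxE /=.
rewrite !mulr1 !mulr0 !addr0 !add0r.
by rewrite /GRing.scale /=; ring.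
Qed.

Lemma fd_chain n c (f : 'rV[R]_2 -> 'rV[R]_n) x w : smooth U c -> smooth U f -> U x ->
  dd w (fd c f) x = dd (c x) (dd w f) x + dd (dd w c x) f x.
Proof.
move=> sc sf Ux; apply/rowP => j; rewrite [RHS]mxE.
have df := smooth_diff sf Ux.
rewrite (dd_coord _ _ (smooth_diff (smooth_fd sc sf) Ux)).
rewrite (dd_coord _ _ (smooth_diff (smooth_dd w sf) Ux)) (dd_coord _ _ df).
rewrite (dd_near w oU Ux (fun y Uy => fd_coord c j (smooth_diff sf Uy))).
rewrite (dd_near (c x) oU Ux (fun y Uy => dd_coord w j (smooth_diff sf Uy))).
by apply: fd_chain1 => //; exact: smooth_coord.
Qed.

Section Commute.
Variables (c1 c2 : 'rV[R]_2 -> 'rV[R]_2).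
Hypothesis s1 : smooth U c1.
Hypothesis s2 : smooth U c2.
Hypothesis comm : forall x, U x -> dd (c1 x) c2 x = dd (c2 x) c1 x.

Lemma fd_comm n (f : 'rV[R]_2 -> 'rV[R]_n) x : smooth U f -> U x ->
  fd c1 (fd c2 f) x = fd c2 (fd c1 f) x.
Proof.
move=> sf Ux; rewrite /fd.
rewrite (fd_chain (c1 x) s2 sf Ux) (fd_chain (c2 x) s1 sf Ux) comm //.
by rewrite (dd_comm _ _ oU sf Ux).
Qed.

End Commute.
End FieldDerivatives.

Section GraphFields.
Variables (R : realType) (J : 'I_3 -> 'M[R]_4) (V0 : 'rV[R]_4).
Variables (U : set 'rV[R]_2) (F : 'rV[R]_2 -> 'rV[R]_4) (lam : 'rV[R]_2 -> 'rV[R]_3).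
Hypothesis HK : hyperkahler J.
Hypothesis Pt : soliton_patch J V0 U F lam.
Variables (p1 p2 : 'rV[R]_4) (c1 c2 : 'rV[R]_2 -> 'rV[R]_2).

(* The coordinate fields of the coordinates (p1 . F, p2 . F). *)
Record graph_fields : Prop := GraphFields {
  gf_s1 : smooth U c1 ;
  gf_s2 : smooth U c2 ;
  gf_det : forall x, U x -> 0 < det2 (c1 x) (c2 x) ;
  gf_11 : forall x, U x -> dot p1 (fd c1 F x) = 1 ;
  gf_12 : forall x, U x -> dot p1 (fd c2 F x) = 0 ;
  gf_21 : forall x, U x -> dot p2 (fd c1 F x) = 0 ;
  gf_22 : forall x, U x -> dot p2 (fd c2 F x) = 1 }.

Hypothesis GF : graph_fields.

Let oU := p_open Pt.
Let sF := p_smooth Pt.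
Let sL := lam_smooth HK Pt.
Let s1 := gf_s1 GF.
Let s2 := gf_s2 GF.

(** The bracket of the fields annihilates p1 . F and p2 . F, whose derivatives along both fields are
    constant; these two functions separate directions, so the bracket vanishes. The fields behave as
    coordinate fields although no change of coordinates is performed. *)
Lemma gf_comm x : U x -> dd (c1 x) c2 x = dd (c2 x) c1 x.
Proof.
move=> Ux; apply/eqP; rewrite -subr_eq0; apply/eqP; set Z := _ - _.
have dF := pdiff Pt Ux.
have bracket (p : 'rV[R]_4) k1 k2 : (forall y, U y -> dot p (fd c1 F y) = k1) ->
   (forall y, U y -> dot p (fd c2 F y) = k2) -> dot p (dd Z F x) = 0.
  move=> h1 h2.
  have a1 := dd_near (c2 x) oU Ux h1; have a2 := dd_near (c1 x) oU Ux h2.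
  rewrite dd_cst (dd_dotc p (c2 x) (smooth_diff (smooth_fd oU s1 sF) Ux)) in a1.
  rewrite dd_cst (dd_dotc p (c1 x) (smooth_diff (smooth_fd oU s2 sF) Ux)) in a2.
  rewrite (fd_chain oU (c2 x) s1 sF Ux) in a1; rewrite (fd_chain oU (c1 x) s2 sF Ux) in a2.
  move: a1 a2; rewrite !dotDr (dd_comm (c2 x) (c1 x) oU sF Ux) => a1 a2.
  rewrite /Z -scaleN1r (dd_addv _ _ dF) (dd_scalev _ _ dF) scaleN1r dotDr dotNr.
  by move: a1 a2; move: (dot p _) (dot p _) (dot p _) => r s t; lra.
have [a [b E]] := det2_decomp Z (gf_det GF Ux).
have := bracket _ _ _ (gf_11 GF) (gf_12 GF); have := bracket _ _ _ (gf_21 GF) (gf_22 GF).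
rewrite E !(dd_comb _ _ _ _ dF) !dotDr !dotZr -!/(fd _ F x).
rewrite (gf_11 GF Ux) (gf_12 GF Ux) (gf_21 GF Ux) (gf_22 GF Ux).
by rewrite !mulr0 !mulr1 addr0 add0r => -> ->; rewrite !scale0r addr0.
Qed.

Definition F1 := fd c1 F.
Definition F2 := fd c2 F.
Definition F11 := fd c1 F1.
Definition F12 := fd c1 F2.
Definition F22 := fd c2 F2.
Definition L1 := fd c1 lam.
Definition L2 := fd c2 lam.
Definition L11 := fd c1 L1.
Definition L12 := fd c1 L2.
Definition L22 := fd c2 L2.

Lemma sF1 : smooth U F1. Proof. exact: smooth_fd. Qed.
Lemma sF2 : smooth U F2. Proof. exact: smooth_fd. Qed.
Lemma sF11 : smooth U F11. Proof. by apply: smooth_fd => //; exact: sF1. Qed.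
Lemma sF12 : smooth U F12. Proof. by apply: smooth_fd => //; exact: sF2. Qed.
Lemma sF22 : smooth U F22. Proof. by apply: smooth_fd => //; exact: sF2. Qed.
Lemma sL1 : smooth U L1. Proof. exact: smooth_fd. Qed.
Lemma sL2 : smooth U L2. Proof. exact: smooth_fd. Qed.
Lemma sL11 : smooth U L11. Proof. by apply: smooth_fd => //; exact: sL1. Qed.
Lemma sL12 : smooth U L12. Proof. by apply: smooth_fd => //; exact: sL2. Qed.
Lemma sL22 : smooth U L22. Proof. by apply: smooth_fd => //; exact: sL2. Qed.

Lemma F21 x : U x -> fd c2 F1 x = F12 x.
Proof. by move=> Ux; rewrite /F12 /F2 (fd_comm oU s1 s2 gf_comm sF Ux). Qed.

Lemma L21 x : U x -> fd c2 L1 x = L12 x.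
Proof. by move=> Ux; rewrite /L12 /L2 (fd_comm oU s1 s2 gf_comm sL Ux). Qed.

Lemma F112 x : U x -> fd c1 F12 x = fd c2 F11 x.
Proof.
move=> Ux; rewrite -(fd_comm oU s1 s2 gf_comm sF1 Ux).
by apply: (dd_near _ oU Ux) => y Uy; rewrite F21.
Qed.

Lemma F122 x : U x -> fd c1 F22 x = fd c2 F12 x.
Proof. by move=> Ux; rewrite (fd_comm oU s1 s2 gf_comm sF2 Ux). Qed.

Lemma L112 x : U x -> fd c1 L12 x = fd c2 L11 x.
Proof.
move=> Ux; rewrite -(fd_comm oU s1 s2 gf_comm sL1 Ux).
by apply: (dd_near _ oU Ux) => y Uy; rewrite L21.
Qed.

Lemma L122 x : U x -> fd c1 L22 x = fd c2 L12 x.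
Proof. by move=> Ux; rewrite (fd_comm oU s1 s2 gf_comm sL2 Ux). Qed.

End GraphFields.

(** * The soliton equation in graph coordinates *)

Section SolitonEquation.
Variables (R : realType) (J : 'I_3 -> 'M[R]_4) (V0 : 'rV[R]_4).
Variables (U : set 'rV[R]_2) (F : 'rV[R]_2 -> 'rV[R]_4) (lam : 'rV[R]_2 -> 'rV[R]_3).
Hypothesis HK : hyperkahler J.
Hypothesis Pt : soliton_patch J V0 U F lam.
Variables (p1 p2 : 'rV[R]_4) (c1 c2 : 'rV[R]_2 -> 'rV[R]_2).
Hypothesis GF : graph_fields U F p1 p2 c1 c2.

Let oU := p_open Pt.
Let sF := p_smooth Pt.
Let sL := lam_smooth HK Pt.
Let s1 := gf_s1 GF.
Let s2 := gf_s2 GF.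
Local Notation f1 := (F1 F c1).
Local Notation f2 := (F2 F c2).
Local Notation f11 := (F11 F c1).
Local Notation f12 := (F12 F c1 c2).
Local Notation f22 := (F22 F c2).

Lemma dot_p_const (p : 'rV[R]_4) k (c : 'rV[R]_2 -> 'rV[R]_2) (f : 'rV[R]_2 -> 'rV[R]_4) x :
  smooth U f -> (forall y, U y -> dot p (f y) = k) -> U x -> dot p (fd c f x) = 0.
Proof.
move=> sf h Ux; have := dd_near (c x) oU Ux h.
by rewrite dd_cst (dd_dotc p (c x) (smooth_diff sf Ux)).
Qed.

(** The component of F along [p1] is itself one of the two coordinates, so its second derivatives
    vanish. *)
Lemma dot_p1_second x : U x -> [/\ dot p1 (f11 x) = 0, dot p1 (f12 x) = 0 & dot p1 (f22 x) = 0].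
Proof.
move=> Ux; split.
- exact: dot_p_const (sF1 Pt GF) (gf_11 GF) Ux.
- exact: dot_p_const (sF2 Pt GF) (gf_12 GF) Ux.
- exact: dot_p_const (sF2 Pt GF) (gf_12 GF) Ux.
Qed.

Lemma dot_p2_second x : U x -> [/\ dot p2 (f11 x) = 0, dot p2 (f12 x) = 0 & dot p2 (f22 x) = 0].
Proof.
move=> Ux; split.
- exact: dot_p_const (sF1 Pt GF) (gf_21 GF) Ux.
- exact: dot_p_const (sF2 Pt GF) (gf_22 GF) Ux.
- exact: dot_p_const (sF2 Pt GF) (gf_22 GF) Ux.
Qed.

Lemma dd2_combr (a b : R) v w w' x : U x ->
  dd v (dd (a *: w + b *: w') F) x = a *: dd v (dd w F) x + b *: dd v (dd w' F) x.
Proof.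
move=> Ux.
have d w0 := pdiffD Pt w0 Ux.
rewrite (@dd_near _ _ _ U _ (fun y => a *: dd w F y + b *: dd w' F y) x v oU Ux); last first.
  by move=> y Uy; rewrite (dd_comb _ _ _ _ (pdiff Pt Uy)).
have [_ ->] : isdd (fun y => a *: dd w F y + b *: dd w' F y) x v
   (a *: dd v (dd w F) x + b *: dd v (dd w' F) x).
  by apply: isdd_add; apply: isdd_scalec; apply: isdd_diff.
by [].
Qed.

Lemma dd2_combl (a b : R) v w w' x : U x ->
  dd (a *: w + b *: w') (dd v F) x = a *: dd w (dd v F) x + b *: dd w' (dd v F) x.
Proof. by move=> Ux; rewrite (dd_comb _ _ _ _ (pdiffD Pt v Ux)). Qed.

(* The second derivatives along the fields and along the frozen fields differ by a tangent
   vector. *)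
Lemma fd2_tangent x (c c' : 'rV[R]_2 -> 'rV[R]_2) : U x -> smooth U c' ->
  exists a b, fd c (fd c' F) x = dd (c' x) (dd (c x) F) x + (a *: f1 x + b *: f2 x).
Proof.
move=> Ux sc; have [a [b E]] := det2_decomp (dd (c x) c' x) (gf_det GF Ux).
exists a, b; rewrite /fd (fd_chain oU (c x) sc sF Ux); congr (_ + _).
by rewrite E (dd_comb _ _ _ _ (pdiff Pt Ux)).
Qed.

(** The right-hand sides are the cofactors of the Gram matrix: an orthonormal frame a w1, d (w2 + t
    w1) gives the inverse metric as the sum of the squares of its two coefficient vectors. *)
Lemma soliton_eq_coef (g11 g12 g22 a d t : R) : 0 < a -> 0 < d ->
  a * (a * g11) = 1 -> a * (d * (g12 + t * g11)) = 0 ->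
  d * (d * (g22 + t * g12 + t * (g12 + t * g11))) = 1 ->
  let G := g11 * g22 - g12 ^+ 2 in
  [/\ G * (a * a + d * (d * (t * t))) = g22, G * (d * (d * t)) = - g12 & G * (d * d) = g11].
Proof.
move=> a0 d0 h1 h2 h3.
have e12 : g12 = - (t * g11).
  have : a * d != 0 by rewrite gt_eqF // mulr_gt0.
  move/mulfI; apply; rewrite -[LHS]subr0 -h2; ring.
have e11 : g11 = (a * a)^-1.
  have aa : a * a != 0 by rewrite gt_eqF // mulr_gt0.
  by apply: (mulfI aa); rewrite mulfV // -h1 mulrA.
have e22 : g22 = (d * d)^-1 + t ^+ 2 * g11.
  have dd0 : d * d != 0 by rewrite gt_eqF // mulr_gt0.
  apply: (mulfI dd0); rewrite mulrDr mulfV // -h3 e12; ring.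
have an : a != 0 by rewrite gt_eqF. have dn : d != 0 by rewrite gt_eqF.
move=> G; rewrite /G e22 e12 e11; split; field; rewrite ?an ?dn //.
Qed.

(** The non-parametric form L F = - V0, multiplied by the Gram determinant, where L has the inverse
    metric as second-order part and drift coefficients - p1 . V0 and - p2 . V0. The tangential terms
    left by the passage from frozen directions to fields are not computed: pairing with [p1] and
    [p2], which are orthogonal to all second derivatives, determines them. *)
Lemma soliton_eq x : U x ->
  dot (f2 x) (f2 x) *: f11 x - (2 * dot (f1 x) (f2 x)) *: f12 x + dot (f1 x) (f1 x) *: f22 x
  = (dot (f1 x) (f1 x) * dot (f2 x) (f2 x) - dot (f1 x) (f2 x) * dot (f1 x) (f2 x)) *:
    (dot p1 V0 *: f1 x + dot p2 V0 *: f2 x - V0).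
Proof.
move=> Ux; have dF := pdiff Pt Ux.
have [a [t [d [a0 d0 o]]]] := gram_schmidt Pt Ux (gf_det GF Ux).
have := p_soliton Pt Ux o; have [_] := o.
have -> : d *: (c2 x + t *: c1 x) = (d * t) *: c1 x + d *: c2 x.
  by rewrite scalerDr scalerA addrC.
have -> : a *: c1 x = a *: c1 x + 0 *: c2 x by rewrite scale0r addr0.
rewrite !dd2_combr // !dd2_combl // !(dd_comb _ _ _ _ dF) /=.
have [a11 [b11 E11]] := fd2_tangent c1 Ux s1; rewrite -/(F1 F c1) -/(F11 F c1) in E11.
have [a12 [b12 E12]] := fd2_tangent c1 Ux s2; rewrite -/(F2 F c2) -/(F12 F c1 c2) in E12.
have [a22 [b22 E22]] := fd2_tangent c2 Ux s2; rewrite -/(F2 F c2) -/(F22 F c2) in E22.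
have [q11 q12 q22] := dot_p1_second Ux. have [r11 r12 r22] := dot_p2_second Ux.
have := gf_22 GF Ux; have := gf_21 GF Ux; have := gf_12 GF Ux; have := gf_11 GF Ux.
rewrite -!/(F1 F c1 x) -!/(F2 F c2 x).
rewrite (dd_comm (c1 x) (c2 x) oU sF Ux).
move: (dd (c1 x) (dd (c1 x) F) x) (dd (c2 x) (dd (c1 x) F) x) (dd (c2 x) (dd (c2 x) F) x) E11 E12 E22 => S11 S12 S22.
rewrite -[dd (c1 x) F x]/(f1 x) -[dd (c2 x) F x]/(f2 x).
move: (f1 x) (f2 x) (f11 x) (f12 x) (f22 x) q11 q12 q22 r11 r12 r22 => X Y A B C q11 q12 q22 r11 r12 r22.
move=> E11 E12 E22 x1 y1 x2 y2 h11 h22 h12.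
set W := (X in X = _ -> _); move: (dot W _) (dot W _) => t2 t1; rewrite {}/W => EW.
have [k22 k12 k11] : [/\ (dot X X * dot Y Y - dot X Y ^+ 2) * (a * a + d * (d * (t * t))) = dot Y Y,
   (dot X X * dot Y Y - dot X Y ^+ 2) * (d * (d * t)) = - dot X Y &
   (dot X X * dot Y Y - dot X Y ^+ 2) * (d * d) = dot X X].
  apply: soliton_eq_coef => //.
  - by rewrite -h11 !(dotDl, dotDr, dotZl, dotZr); ring.
  - by rewrite -h12 !(dotDl, dotDr, dotZl, dotZr); ring.
  - by rewrite -h22 !(dotDl, dotDr, dotZl, dotZr) (dotC Y X); ring.
rewrite expr2 in k22 k12 k11; move: (_ - _ * dot X Y) k22 k12 k11 => G k22 k12 k11.
have EV j : V0 0 j = t1 * (a * X 0 j) + t2 * (d * t * X 0 j + d * Y 0 j)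
  - (a * a * S11 0 j + (d * t * (d * t * S11 0 j + d * S12 0 j) + d * (d * t * S12 0 j + d * S22 0 j))).
  have /rowP /(_ j) := EW; rewrite !mxE => h; lra.
have k12' : dot X Y = - (G * (d * (d * t))) by rewrite k12 opprK.
pose r1 := G * (t1 * a + t2 * (d * t)) + (dot Y Y * a11 - 2 * dot X Y * a12 + dot X X * a22).
pose r2 := G * (t2 * d) + (dot Y Y * b11 - 2 * dot X Y * b12 + dot X X * b22).
have E : dot Y Y *: A - (2 * dot X Y) *: B + dot X X *: C = r1 *: X + r2 *: Y - G *: V0.
  apply/rowP => j; rewrite E11 E12 E22 /r1 /r2 k12' -k22 -k11 !mxE EV; ring.
have e1 : r1 = G * dot p1 V0.
  have := congr1 (dot p1) E; rewrite !(dotBr, dotDr, dotZr) q11 q12 q22 x1 y1.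
  by move=> h; lra.
have e2 : r2 = G * dot p2 V0.
  have := congr1 (dot p2) E; rewrite !(dotBr, dotDr, dotZr) r11 r12 r22 x2 y2.
  by move=> h; lra.
by rewrite E e1 e2 scalerBr scalerDr !scalerA.
Qed.

End SolitonEquation.

(** * The equation of the phase map *)

Section PhaseAlgebra.
Variables (R : realType).

(** The function behind this is w = K b F1 . F2 at a point where b . lam = 0. The letters [a1] to
    [d2] are the tangential coefficients of F11, F12 and F22, the numbers [xA] to [yC] pair their
    normal parts with F2 and F1, and [G1], [G2] are the derivatives of the Gram determinant. The two
    hypotheses on third derivatives come from the differentiated soliton equation. *)
Lemma phase_ring (g11 g12 g22 G a1 a2 b1 b2 d1 d2 xA xB xC yA yB yC
   t111 t112 t122 r112 r122 r222 v w V1 V2 : R) :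
  G = g11 * g22 - g12 * g12 ->
  let p11_1 := a1 * g11 + a2 * g12 in let p11_2 := a1 * g12 + a2 * g22 in
  let p12_1 := b1 * g11 + b2 * g12 in let p12_2 := b1 * g12 + b2 * g22 in
  let p22_1 := d1 * g11 + d2 * g12 in let p22_2 := d1 * g12 + d2 * g22 in
  let G1 := 2 * p11_1 * g22 + 2 * g11 * p12_2 - 2 * g12 * (p11_2 + p12_1) in
  let G2 := 2 * p12_1 * g22 + 2 * g11 * p22_2 - 2 * g12 * (p12_2 + p22_1) in
  G * v = g22 * xA - 2 * g12 * xB + g11 * xC ->
  G * w = g22 * yA - 2 * g12 * yB + g11 * yC ->
  g22 * t111 - 2 * g12 * t112 + g11 * t122 =
    G1 * v + G * (V1 * xA + V2 * xB) - (2 * p12_2 * xA - 2 * (p11_2 + p12_1) * xB + 2 * p11_1 * xC) ->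
  g22 * r112 - 2 * g12 * r122 + g11 * r222 =
    G2 * w + G * (V1 * yB + V2 * yC) - (2 * p22_2 * yA - 2 * (p12_2 + p22_1) * yB + 2 * p12_1 * yC) ->
  let w1 := xA + yB in let w2 := xB + yC in
  let w11 := t111 + 2 * (a1 * yB - a2 * xB - b1 * yA + b2 * xA) + r112 in
  let w12 := t112 + (a1 * yC - a2 * xC - d1 * yA + d2 * xA) + r122 in
  let w22 := t122 + 2 * (b1 * yC - b2 * xC - d1 * yB + d2 * xB) + r222 in
  G * (g22 * w11 - 2 * g12 * w12 + g11 * w22 - G * (V1 * w1 + V2 * w2))
  = g22 * (G1 * w1) - g12 * (G1 * w2 + G2 * w1) + g11 * (G2 * w2).
Proof.
move=> EG p11_1 p11_2 p12_1 p12_2 p22_1 p22_2 G1 G2 Ev Ew Et Er w1 w2 w11 w12 w22.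
have -> : G * (g22 * w11 - 2 * g12 * w12 + g11 * w22 - G * (V1 * w1 + V2 * w2)) =
  G * (g22 * t111 - 2 * g12 * t112 + g11 * t122) + G * (g22 * r112 - 2 * g12 * r122 + g11 * r222)
  + G * (g22 * (2 * (a1 * yB - a2 * xB - b1 * yA + b2 * xA))
    - 2 * g12 * (a1 * yC - a2 * xC - d1 * yA + d2 * xA)
    + g11 * (2 * (b1 * yC - b2 * xC - d1 * yB + d2 * xB)) - G * (V1 * w1 + V2 * w2)).
  by rewrite /w11 /w12 /w22; ring.
rewrite Et Er.
have -> : G * (G1 * v + G * (V1 * xA + V2 * xB) - (2 * p12_2 * xA - 2 * (p11_2 + p12_1) * xB + 2 * p11_1 * xC))
  = G1 * (G * v) + G * (G * (V1 * xA + V2 * xB) - (2 * p12_2 * xA - 2 * (p11_2 + p12_1) * xB + 2 * p11_1 * xC)) by ring.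
have -> : G * (G2 * w + G * (V1 * yB + V2 * yC) - (2 * p22_2 * yA - 2 * (p12_2 + p22_1) * yB + 2 * p12_1 * yC))
  = G2 * (G * w) + G * (G * (V1 * yB + V2 * yC) - (2 * p22_2 * yA - 2 * (p12_2 + p22_1) * yB + 2 * p12_1 * yC)) by ring.
rewrite Ev Ew /G1 /G2 /w1 /w2 /p11_1 /p11_2 /p12_1 /p12_2 /p22_1 /p22_2 EG; ring.
Qed.

(** Here w = s m, with s the area element and m = b . lam vanishing at the point. The terms in [G1]
    and [G2] match the mixed terms of the product rule, which leaves the equation for m alone. *)
Lemma phase_conclude (g11 g12 g22 G s s1 s2 m1 m2 m11 m12 m22 V1 V2 G1 G2 w1 w2 w11 w12 w22 : R) :
  0 < s -> s * s = G -> 2 * s * s1 = G1 -> 2 * s * s2 = G2 ->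
  w1 = s * m1 -> w2 = s * m2 ->
  w11 = s * m11 + 2 * s1 * m1 -> w12 = s * m12 + s2 * m1 + s1 * m2 ->
  w22 = s * m22 + 2 * s2 * m2 ->
  G * (g22 * w11 - 2 * g12 * w12 + g11 * w22 - G * (V1 * w1 + V2 * w2))
  = g22 * (G1 * w1) - g12 * (G1 * w2 + G2 * w1) + g11 * (G2 * w2) ->
  g22 * m11 - 2 * g12 * m12 + g11 * m22 - G * (V1 * m1 + V2 * m2) = 0.
Proof.
move=> s0 EG E1 E2 -> -> -> -> ->; rewrite -EG -E1 -E2 => E.
have s3 : s * s * s != 0 by rewrite gt_eqF // !mulr_gt0.
apply: (mulfI s3); rewrite mulr0; move/eqP: E; rewrite -subr_eq0 => /eqP <-; ring.
Qed.

Variable (J : 'I_3 -> 'M[R]_4).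
Hypothesis HK : hyperkahler J.

Lemma K0r b : K J b 0 = 0.
Proof. by rewrite /K /act mul0mx. Qed.

Lemma KNr b (X : 'rV[R]_4) : K J b (- X) = - K J b X.
Proof. by rewrite -scaleN1r KZr scaleN1r. Qed.

Lemma dot_KKuv b (X Y : 'rV[R]_4) : dot (K J b X) (K J b Y) = dot b b * dot X Y.
Proof.
by rewrite K_skew // KK // crossxx K0l addr0 dotZr mulNr opprK.
Qed.

(** For b orthogonal to [l], K b exchanges the tangent and the normal plane: [e1], [e2] and their
    images under the normalised K b form an orthonormal basis, in which K b of a normal vector has
    no component along the images. *)
Lemma normal_pair (e1 e2 B B' : 'rV[R]_4) (l b : 'rV[R]_3) :
  dot e1 e1 = 1 -> dot e2 e2 = 1 -> dot e1 e2 = 0 -> K J l e1 = e2 ->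
  dot b l = 0 -> dot B e1 = 0 -> dot B e2 = 0 -> dot B' e1 = 0 -> dot B' e2 = 0 ->
  dot (K J b B) B' = 0.
Proof.
move=> h11 h22 h12 ph bl B1 B2 B1' B2'.
have [->|b0] := eqVneq b 0; first by rewrite K0l dot0l.
have bb := dot_gt0 b0.
pose r := (Num.sqrt (dot b b))^-1; pose u := r *: b.
have uu : dot u u = 1.
  by rewrite dotZl dotZr mulrA -expr2 exprVn sqr_sqrtr ?ltW // mulVf // gt_eqF.
have ul : dot u l = 0 by rewrite dotZl bl mulr0.
have r0 : r != 0 by rewrite invr_eq0 gt_eqF // sqrtr_gt0.
have E : dot (K J u B) B' = 0.
  have K12 : dot (K J u e1) e2 = 0 by rewrite -ph dot_KK // ul mul0r.
  have K21 : dot e1 (K J u e2) = 0 by move: K12; rewrite K_skew // => /eqP; rewrite oppr_eq0 => /eqP.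
  rewrite (@basis4 _ e1 e2 (K J u e1) (K J u e2)) //.
  - by rewrite B1' B2' !dot_KKuv B1 B2 !(mulr0, mul0r, addr0).
  - by rewrite dot_KKuv uu h11 mulr1.
  - by rewrite dot_KKuv uu h22 mulr1.
  - by rewrite dotC dot_Kxx.
  - by rewrite dotC.
  - by rewrite dotC dot_Kxx.
  - by rewrite dot_KKuv h12 mulr0.
by move/eqP: E; rewrite KZl dotZl mulf_eq0 (negbTE r0) => /eqP.
Qed.

Lemma tangent_decomp (X Y Z : 'rV[R]_4) : 0 < dot X X * dot Y Y - dot X Y * dot X Y ->
  exists a b B, [/\ Z = a *: X + b *: Y + B, dot B X = 0 & dot B Y = 0].
Proof.
set G := _ - _ => G0; have Gn : G != 0 by rewrite gt_eqF.
pose a := (dot Z X * dot Y Y - dot Z Y * dot X Y) / G.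
pose b := (dot Z Y * dot X X - dot Z X * dot X Y) / G.
exists a, b, (Z - (a *: X + b *: Y)); split; first by rewrite addrCA subrr addr0.
  rewrite dotBl dotDl !dotZl (dotC Y X) /a /b; move: Gn; rewrite /G => Gn; by field.
rewrite dotBl dotDl !dotZl /a /b; move: Gn; rewrite /G => Gn; by field.
Qed.

Section Pairing.
Variables (b : 'rV[R]_3) (X Y : 'rV[R]_4).
Hypothesis XY : dot (K J b X) Y = 0.
Local Notation k U W := (dot (K J b U) W).

Lemma k_skew U W : k U W = - k W U.
Proof. by rewrite K_skew // dotC. Qed.

Lemma k_pair (a1 a2 b1 b2 : R) A B : k A B = 0 ->
  k (a1 *: X + a2 *: Y + A) (b1 *: X + b2 *: Y + B) =
  a1 * k X B - a2 * k B Y - b1 * k X A + b2 * k A Y.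
Proof.
move=> AB; rewrite !KDr !KZr !(dotDl, dotDr, dotZl, dotZr) AB XY !dot_Kxx //.
rewrite (k_skew Y X) XY (k_skew Y B) (k_skew A X); ring.
Qed.

Lemma k_pairl (a1 a2 : R) A : k (a1 *: X + a2 *: Y + A) Y = k A Y.
Proof. by rewrite !KDr !KZr !(dotDl, dotZl) XY dot_Kxx // !mulr0 !add0r. Qed.

Lemma k_pairr (a1 a2 : R) A : k X (a1 *: X + a2 *: Y + A) = k X A.
Proof. by rewrite !(dotDr, dotZr) XY dot_Kxx // !mulr0 !add0r. Qed.

End Pairing.

End PhaseAlgebra.

Section PhaseEquation.
Variables (R : realType) (J : 'I_3 -> 'M[R]_4) (V0 : 'rV[R]_4).
Variables (U : set 'rV[R]_2) (F : 'rV[R]_2 -> 'rV[R]_4) (lam : 'rV[R]_2 -> 'rV[R]_3).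
Hypothesis HK : hyperkahler J.
Hypothesis Pt : soliton_patch J V0 U F lam.
Variables (p1 p2 : 'rV[R]_4) (c1 c2 : 'rV[R]_2 -> 'rV[R]_2).
Hypothesis GF : graph_fields U F p1 p2 c1 c2.

Let oU := p_open Pt.
Let sF := p_smooth Pt.
Let sL := lam_smooth HK Pt.
Let s1 := gf_s1 GF.
Let s2 := gf_s2 GF.
Local Notation f1 := (F1 F c1).
Local Notation f2 := (F2 F c2).
Local Notation f11 := (F11 F c1).
Local Notation f12 := (F12 F c1 c2).
Local Notation f22 := (F22 F c2).
Local Notation l1 := (L1 lam c1).
Local Notation l2 := (L2 lam c2).
Local Notation l11 := (L11 lam c1).
Local Notation l12 := (L12 lam c1 c2).
Local Notation l22 := (L22 lam c2).

Definition gdet y := dot (f1 y) (f1 y) * dot (f2 y) (f2 y) - dot (f1 y) (f2 y) * dot (f1 y) (f2 y).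

Lemma gdet_gt0 y : U y -> 0 < gdet y.
Proof. by move=> Uy; have := gram_gt0 HK Pt Uy (gf_det GF Uy); rewrite /gram expr2. Qed.

Lemma gdet_smooth : smooth U gdet.
Proof.
have h1 := sF1 Pt GF; have h2 := sF2 Pt GF.
apply: smoothD => //; first by apply: smoothM => //; apply: smooth_dot.
by apply: smoothN => //; apply: smoothM => //; apply: smooth_dot.
Qed.

Lemma phase_pairing b y : U y ->
  dot (K J b (f1 y)) (f2 y) = Num.sqrt (gdet y) * dot b (lam y).
Proof. by move=> Uy; have [_] := phase_pair HK Pt b Uy (gf_det GF Uy); rewrite /gram expr2. Qed.

(** The component along b of the drift-harmonic map equation, from two differentiations of
    [phase_pairing]. The second derivatives of the area element disappear because b . lam vanishes
    at [x], though in general not near it. *)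
Lemma lam_tangential x b : U x -> dot b (lam x) = 0 ->
  dot (f2 x) (f2 x) * dot b (l11 x) - 2 * dot (f1 x) (f2 x) * dot b (l12 x)
  + dot (f1 x) (f1 x) * dot b (l22 x)
  - gdet x * (dot p1 V0 * dot b (l1 x) + dot p2 V0 * dot b (l2 x)) = 0.
Proof.
move=> Ux bl.
have hf1 := sF1 Pt GF; have hf2 := sF2 Pt GF; have hf11 := sF11 Pt GF.
have hf12 := sF12 Pt GF; have hf22 := sF22 Pt GF.
have hl1 := sL1 HK Pt GF; have hl2 := sL2 HK Pt GF.
pose s y := Num.sqrt (gdet y).
have ss : smooth U s by apply: smooth_sqrt => //; [exact: gdet_gt0|exact: gdet_smooth].
have ss1 := smooth_fd1 oU s1 ss; have ss2 := smooth_fd1 oU s2 ss.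
have sE y : U y -> s y * s y = gdet y.
  by move=> Uy; rewrite -expr2 sqr_sqrtr // ltW // gdet_gt0.
have I0 y : U y -> dot (K J b (f1 y)) (f2 y) = s y * dot b (lam y) by exact: phase_pairing.
have df (f : 'rV[R]_2 -> 'rV[R]_4) y : smooth U f -> U y -> differentiable f y by exact: smooth_diff.
have I1 y : U y -> dot (K J b (f11 y)) (f2 y) + dot (K J b (f1 y)) (f12 y) =
   s y * dot b (l1 y) + fd c1 s y * dot b (lam y).
  move=> Uy; derive_identity h oU Uy I0 (c1 y).
  all: try solve [exact: smooth_diff Uy].
  exact: h.
have I2 y : U y -> dot (K J b (f12 y)) (f2 y) + dot (K J b (f1 y)) (f22 y) =
   s y * dot b (l2 y) + fd c2 s y * dot b (lam y).
  move=> Uy; derive_identity h oU Uy I0 (c2 y).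
  all: try solve [exact: smooth_diff Uy].
  by rewrite -(F21 Pt GF Uy); exact: h.
have dl21 : dd (c2 x) l1 x = l12 x := L21 HK Pt GF Ux.
have df21 : dd (c2 x) f1 x = f12 x := F21 Pt GF Ux.
pose T111 := fd c1 f11 x; pose T112 := fd c2 f11 x; pose T122 := fd c2 f12 x; pose T222 := fd c2 f22 x.
have dT112 : fd c1 f12 x = T112 := F112 Pt GF Ux.
have dT122 : fd c1 f22 x = T122 := F122 Pt GF Ux.
derive_identity I11 oU Ux I1 (c1 x).
all: try solve [exact: smooth_diff Ux].
have {}I11 : dot (K J b T111) (f2 x) + dot (K J b (f11 x)) (f12 x)
  + (dot (K J b (f11 x)) (f12 x) + dot (K J b (f1 x)) (fd c1 f12 x)) =
  s x * dot b (l11 x) + fd c1 s x * dot b (l1 x)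
  + (fd c1 s x * dot b (l1 x) + fd c1 (fd c1 s) x * dot b (lam x)) by exact: I11.
derive_identity I12 oU Ux I1 (c2 x).
all: try solve [exact: smooth_diff Ux].
have {}I12 : dot (K J b T112) (f2 x) + dot (K J b (f11 x)) (f22 x)
  + (dot (K J b (f12 x)) (f12 x) + dot (K J b (f1 x)) T122) =
  s x * dot b (l12 x) + fd c2 s x * dot b (l1 x)
  + (fd c1 s x * dot b (l2 x) + fd c2 (fd c1 s) x * dot b (lam x)).
  by rewrite -dl21 -[in K J b (f12 x)]df21; exact: I12.
derive_identity I22 oU Ux I2 (c2 x).
all: try solve [exact: smooth_diff Ux].
have {}I22 : dot (K J b T122) (f2 x) + dot (K J b (f12 x)) (f22 x)
  + (dot (K J b (f12 x)) (f22 x) + dot (K J b (f1 x)) T222) =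
  s x * dot b (l22 x) + fd c2 s x * dot b (l2 x)
  + (fd c2 s x * dot b (l2 x) + fd c2 (fd c2 s) x * dot b (lam x)).
  have {}I22 : dot (K J b T122) (f2 x) + dot (K J b (f12 x)) (f22 x)
    + (dot (K J b (dd (c2 x) f1 x)) (f22 x) + dot (K J b (f1 x)) T222) =
    s x * dot b (l22 x) + fd c2 s x * dot b (l2 x)
    + (fd c2 s x * dot b (l2 x) + fd c2 (fd c2 s) x * dot b (lam x)) by exact: I22.
  by move: I22; rewrite df21.
have Es y : U y -> s y * s y = dot (f1 y) (f1 y) * dot (f2 y) (f2 y) - dot (f1 y) (f2 y) * dot (f1 y) (f2 y).
  exact: sE.
derive_identity S1 oU Ux Es (c1 x).
all: try solve [exact: smooth_diff Ux].
have {}S1 : s x * fd c1 s x + fd c1 s x * s x =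
  dot (f1 x) (f1 x) * (dot (f12 x) (f2 x) + dot (f2 x) (f12 x))
  + (dot (f11 x) (f1 x) + dot (f1 x) (f11 x)) * dot (f2 x) (f2 x)
  - (dot (f1 x) (f2 x) * (dot (f11 x) (f2 x) + dot (f1 x) (f12 x)) +
    (dot (f11 x) (f2 x) + dot (f1 x) (f12 x)) * dot (f1 x) (f2 x)) by exact: S1.
derive_identity S2 oU Ux Es (c2 x).
all: try solve [exact: smooth_diff Ux].
have {}S2 : s x * fd c2 s x + fd c2 s x * s x =
  dot (f1 x) (f1 x) * (dot (f22 x) (f2 x) + dot (f2 x) (f22 x))
  + (dot (f12 x) (f1 x) + dot (f1 x) (f12 x)) * dot (f2 x) (f2 x)
  - (dot (f1 x) (f2 x) * (dot (f12 x) (f2 x) + dot (f1 x) (f22 x)) +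
    (dot (f12 x) (f2 x) + dot (f1 x) (f22 x)) * dot (f1 x) (f2 x)).
  by rewrite -df21; exact: S2.
(* The third derivatives of F will occur only in the combinations that the soliton equation,
   differentiated once along each field, provides. *)
have ES := soliton_eq Pt GF.
derive_identity E1 oU Ux ES (c1 x).
all: try solve [exact: smooth_diff Ux].
have {}E1 : dot (f2 x) (f2 x) *: T111 + (dot (f12 x) (f2 x) + dot (f2 x) (f12 x)) *: f11 x
  - ((2 * dot (f1 x) (f2 x)) *: T112 + (2 * (dot (f11 x) (f2 x) + dot (f1 x) (f12 x))) *: f12 x)
  + (dot (f1 x) (f1 x) *: T122 + (dot (f11 x) (f1 x) + dot (f1 x) (f11 x)) *: f22 x)
  = gdet x *: (dot p1 V0 *: f11 x + dot p2 V0 *: f12 x - 0)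
   + (dot (f1 x) (f1 x) * (dot (f12 x) (f2 x) + dot (f2 x) (f12 x))
  + (dot (f11 x) (f1 x) + dot (f1 x) (f11 x)) * dot (f2 x) (f2 x)
  - (dot (f1 x) (f2 x) * (dot (f11 x) (f2 x) + dot (f1 x) (f12 x)) +
    (dot (f11 x) (f2 x) + dot (f1 x) (f12 x)) * dot (f1 x) (f2 x))) *:
   (dot p1 V0 *: f1 x + dot p2 V0 *: f2 x - V0).
  by rewrite -dT112 -dT122; exact: E1.
derive_identity E2 oU Ux ES (c2 x).
all: try solve [exact: smooth_diff Ux].
have {}E2 : dot (f2 x) (f2 x) *: T112 + (dot (f22 x) (f2 x) + dot (f2 x) (f22 x)) *: f11 x
  - ((2 * dot (f1 x) (f2 x)) *: T122 + (2 * (dot (f12 x) (f2 x) + dot (f1 x) (f22 x))) *: f12 x)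
  + (dot (f1 x) (f1 x) *: T222 + (dot (f12 x) (f1 x) + dot (f1 x) (f12 x)) *: f22 x)
  = gdet x *: (dot p1 V0 *: f12 x + dot p2 V0 *: f22 x - 0)
   + (dot (f1 x) (f1 x) * (dot (f22 x) (f2 x) + dot (f2 x) (f22 x))
  + (dot (f12 x) (f1 x) + dot (f1 x) (f12 x)) * dot (f2 x) (f2 x)
  - (dot (f1 x) (f2 x) * (dot (f12 x) (f2 x) + dot (f1 x) (f22 x)) +
    (dot (f12 x) (f2 x) + dot (f1 x) (f22 x)) * dot (f1 x) (f2 x))) *:
   (dot p1 V0 *: f1 x + dot p2 V0 *: f2 x - V0).
  by rewrite !df21 in E2; exact: E2.
have {}ES := ES x Ux; rewrite -/(gdet x) in ES.
have {}I1 := I1 x Ux; have {}I2 := I2 x Ux.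
have G0 := gdet_gt0 Ux.
have sx0 : 0 < s x by rewrite sqrtr_gt0.
have [a [t [d [a0 d0 o]]]] := gram_schmidt Pt Ux (gf_det GF Ux).
have ph := p_phase Pt Ux o; have [_ o11 o22 o12] := o.
have dF := pdiff Pt Ux.
rewrite (dd_scalev _ _ dF) (dd_scalev _ _ dF) (dd_addv _ _ dF) (dd_scalev _ _ dF) in o11 o22 o12 ph.
rewrite -[dd (c1 x) F x]/(f1 x) -[dd (c2 x) F x]/(f2 x) in o11 o22 o12 ph.
have kf12 := I0 x Ux; rewrite bl mulr0 in kf12.
rewrite bl !mulr0 !addr0 in I1 I2 I11 I12 I22.
have sEx := sE x Ux.
move: (fd c1 (fd c1 s) x) (fd c2 (fd c1 s) x) (fd c2 (fd c2 s) x) I11 I12 I22 => _ _ _ I11 I12 I22.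
rewrite dT112 in I11.
(* Once the second derivatives are split into tangential and normal parts, pairings of two normal
   parts vanish by [normal_pair], and the claim becomes an identity between real numbers. *)
have [A1 [A2 [A [EA nA1 nA2]]]] := tangent_decomp (f11 x) G0.
have [B1 [B2 [B [EB nB1 nB2]]]] := tangent_decomp (f12 x) G0.
have [C1 [C2 [C [EC nC1 nC2]]]] := tangent_decomp (f22 x) G0.
clear hf1 hf2 hf11 hf12 hf22 hl1 hl2 ss ss1 ss2 sE I0 df dl21 df21 dT112 dT122.
rewrite /gdet in sEx G0 E1 E2 ES *.
move: (f1 x) (f2 x) (f11 x) (f12 x) (f22 x) T111 T112 T122 T222 EA EB EC E1 E2 S1 S2 nA1 nA2 nB1 nB2 nC1 nC2 I11 I12 I22 I1 I2 kf12 ph o11 o22 o12 sEx sx0 ES G0.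
move: (l1 x) (l2 x) (l11 x) (l12 x) (l22 x) (s x) (fd c1 s x) (fd c2 s x).
move=> M1 M2 M11 M12 M22 sx sx1 sx2 X Y D11 D12 D22 T111 T112 T122 T222 EA EB EC E1 E2 S1 S2
  nA1 nA2 nB1 nB2 nC1 nC2 I11 I12 I22 I1 I2 kXY ph o11 o22 o12 sEx sx0 ES G0.
have np (N N' : 'rV[R]_4) : dot N X = 0 -> dot N Y = 0 -> dot N' X = 0 -> dot N' Y = 0 ->
   dot (K J b N) N' = 0.
  move=> h1 h2 h3 h4; apply: (normal_pair HK o11 o22 o12 ph bl).
  - by rewrite dotZr h1 mulr0.
  - by rewrite dotZr dotDr dotZr h1 h2 !(mulr0, addr0).
  - by rewrite dotZr h3 mulr0.
  - by rewrite dotZr dotDr dotZr h3 h4 !(mulr0, addr0).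
have AB := np A B nA1 nA2 nB1 nB2; have AC := np A C nA1 nA2 nC1 nC2.
have BC := np B C nB1 nB2 nC1 nC2.
have dots (x1 x2 : R) N : dot N X = 0 -> dot N Y = 0 ->
   (dot (x1 *: X + x2 *: Y + N) X = x1 * dot X X + x2 * dot X Y) *
   (dot (x1 *: X + x2 *: Y + N) Y = x1 * dot X Y + x2 * dot Y Y).
  by move=> h1 h2; rewrite !(dotDl, dotZl) h1 h2 (dotC Y X) !addr0.
rewrite ?(dotC X D11) ?(dotC X D12) ?(dotC X D22) ?(dotC Y D12) ?(dotC Y D22) in E1 E2 S1 S2.
have [d11X d11Y] : dot D11 X = A1 * dot X X + A2 * dot X Y /\ dot D11 Y = A1 * dot X Y + A2 * dot Y Y.
  by rewrite EA !(dots _ _ _ nA1 nA2).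
have [d12X d12Y] : dot D12 X = B1 * dot X X + B2 * dot X Y /\ dot D12 Y = B1 * dot X Y + B2 * dot Y Y.
  by rewrite EB !(dots _ _ _ nB1 nB2).
have [d22X d22Y] : dot D22 X = C1 * dot X X + C2 * dot X Y /\ dot D22 Y = C1 * dot X Y + C2 * dot Y Y.
  by rewrite EC !(dots _ _ _ nC1 nC2).
have [x11 y11] : dot (K J b D11) Y = dot (K J b A) Y /\ dot (K J b X) D11 = dot (K J b X) A.
  by rewrite EA (k_pairl HK kXY) (k_pairr HK kXY).
have [x12 y12] : dot (K J b D12) Y = dot (K J b B) Y /\ dot (K J b X) D12 = dot (K J b X) B.
  by rewrite EB (k_pairl HK kXY) (k_pairr HK kXY).
have [x22 y22] : dot (K J b D22) Y = dot (K J b C) Y /\ dot (K J b X) D22 = dot (K J b X) C.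
  by rewrite EC (k_pairl HK kXY) (k_pairr HK kXY).
have k1112 := k_pair HK kXY A1 A2 B1 B2 AB; rewrite -EA -EB in k1112.
have k1122 := k_pair HK kXY A1 A2 C1 C2 AC; rewrite -EA -EC in k1122.
have k1222 := k_pair HK kXY B1 B2 C1 C2 BC; rewrite -EB -EC in k1222.
clear EA EB EC np dots AB AC BC.
have F1 := congr1 (fun Z => dot (K J b Z) Y) E1; have F2 := congr1 (fun Z => dot (K J b X) Z) E2.
have Fv := congr1 (fun Z => dot (K J b Z) Y) ES; have Fw := congr1 (fun Z => dot (K J b X) Z) ES.
clear E1 E2 ES; move: F1 F2 Fv Fw => /=; set W := _ + _ - V0.
rewrite !(KDr, KNr, KZr) !(dotDl, dotDr, dotNl, dotNr, dotZl, dotZr) K0r !(dot0l, dot0r).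
rewrite x11 x12 x22 y11 y12 y22 d11X d11Y d12X d12Y d22X d22Y => F1 F2 Fv Fw.
rewrite d11X d11Y d12X d12Y in S1; rewrite d22Y d22X d12X d12Y in S2.
rewrite k1112 in I11; rewrite k1122 dot_Kxx // in I12; rewrite k1222 in I22.
rewrite x11 y12 in I1; rewrite x12 y22 in I2.
clear x11 x12 x22 y11 y12 y22 d11X d11Y d12X d12Y d22X d22Y k1112 k1122 k1222.
clear nA1 nA2 nB1 nB2 nC1 nC2 ph o11 o22 o12 kXY.
move: (dot p1 V0 * dot (K J b X) Y + dot p2 V0 * dot (K J b Y) Y - dot (K J b V0) Y) F1 Fv => v F1 Fv.
move: (dot p1 V0 * dot (K J b X) X + dot p2 V0 * dot (K J b X) Y - dot (K J b X) V0) F2 Fw => w F2 Fw.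
move: (dot (K J b A) Y) (dot (K J b B) Y) (dot (K J b C) Y) (dot (K J b X) A) (dot (K J b X) B)
  (dot (K J b X) C) I11 I12 I22 I1 I2 F1 F2 Fv Fw => xA xB xC yA yB yC.
move: (dot (K J b T111) Y) (dot (K J b T112) Y) (dot (K J b T122) Y) (dot (K J b X) T112)
  (dot (K J b X) T122) (dot (K J b X) T222) => t111 t112 t122 r112 r122 r222.
move: (dot b M1) (dot b M2) (dot b M11) (dot b M12) (dot b M22) => m1 m2 m11 m12 m22.
move: (dot p1 V0) (dot p2 V0) (dot X X) (dot X Y) (dot Y Y) S1 S2 sEx G0 => V1 V2 g11 g12 g22.
move EG : (g11 * g22 - g12 * g12) => G.
move=> S1 S2 sEx G0 I11 I12 I22 I1 I2 F1 F2 Fv Fw.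
pose P11_1 := A1 * g11 + A2 * g12; pose P11_2 := A1 * g12 + A2 * g22.
pose P12_1 := B1 * g11 + B2 * g12; pose P12_2 := B1 * g12 + B2 * g22.
pose P22_1 := C1 * g11 + C2 * g12; pose P22_2 := C1 * g12 + C2 * g22.
pose G1 := 2 * P11_1 * g22 + 2 * g11 * P12_2 - 2 * g12 * (P11_2 + P12_1).
pose G2 := 2 * P12_1 * g22 + 2 * g11 * P22_2 - 2 * g12 * (P12_2 + P22_1).
apply: (@phase_conclude _ g11 g12 g22 G sx sx1 sx2 m1 m2 m11 m12 m22 V1 V2 G1 G2
  (xA + yB) (xB + yC)
  (t111 + 2 * (A1 * yB - A2 * xB - B1 * yA + B2 * xA) + r112)
  (t112 + (A1 * yC - A2 * xC - C1 * yA + C2 * xA) + r122)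
  (t122 + 2 * (B1 * yC - B2 * xC - C1 * yB + C2 * xB) + r222)) => //.
- by rewrite /G1 /P11_1 /P11_2 /P12_1 /P12_2; lra.
- by rewrite /G2 /P12_1 /P12_2 /P22_1 /P22_2; lra.
- by lra.
- by lra.
- by lra.
- have Q := phase_ring (a1 := A1) (a2 := A2) (b1 := B1) (b2 := B2) (d1 := C1) (d2 := C2)
    (t111 := t111) (t112 := t112) (t122 := t122) (r112 := r112) (r122 := r122) (r222 := r222)
    (V1 := V1) (V2 := V2) (esym EG) (esym Fv) (esym Fw).
  rewrite /= -/P11_1 -/P11_2 -/P12_1 -/P12_2 -/P22_1 -/P22_2 -/G1 -/G2 in Q.
  rewrite -/P11_1 -/P11_2 -/P12_1 -/P12_2 -/P22_1 -/P22_2 in F1 F2.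
  apply: Q; [move: F1|move: F2].
    by rewrite /G1 /P11_1 /P11_2 /P12_1 /P12_2; clear => F1; lra.
  by rewrite /G2 /P12_1 /P12_2 /P22_1 /P22_2; clear => F2; lra.
Qed.

End PhaseEquation.

(** * Second derivatives along a field and the Bochner formula *)

Section SecondJets.
Variables (R : realType) (U : set 'rV[R]_2) (c : 'rV[R]_2 -> 'rV[R]_2).
Hypothesis oU : open U.
Hypothesis sc : smooth U c.

(** The second-order analogue of [isdd] along the field [c]. Smoothness on [U] belongs to the
    package because iterating [fd] needs the first derivative near the point, not just at it. *)
Definition isd2 n (f : 'rV[R]_2 -> 'rV[R]_n) u a b :=
  [/\ smooth U f, fd c f u = a & fd c (fd c f) u = b].
Definition isd2s (f : 'rV[R]_2 -> R) u (a b : R) :=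
  [/\ smooth U f, fd c f u = a & fd c (fd c f) u = b].

Lemma isd2_atom n (f : 'rV[R]_2 -> 'rV[R]_n) u : smooth U f ->
  isd2 f u (fd c f u) (fd c (fd c f) u).
Proof. by []. Qed.

Lemma isd2s_atom (f : 'rV[R]_2 -> R) u : smooth U f ->
  isd2s f u (fd c f u) (fd c (fd c f) u).
Proof. by []. Qed.

Lemma isd2s_cst (k : R) u : isd2s (fun=> k) u 0 0.
Proof.
have E : fd c (fun=> k) = fun=> 0 by rewrite funeqE => y; rewrite /fd dd_cst.
by split; [exact: smooth_cst|rewrite E|rewrite E /fd dd_cst].
Qed.

Lemma isd2s_add f g u a b a' b' : U u -> isd2s f u a b -> isd2s g u a' b' ->
  isd2s (fun y => f y + g y) u (a + a') (b + b').
Proof.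
move=> Uu [sf <- <-] [sg <- <-].
have E y : U y -> fd c (fun y => f y + g y) y = fd c f y + fd c g y.
  by move=> Uy; rewrite /fd dd_add //; exact: smooth_diff Uy.
split; [exact: smoothD|exact: E|].
rewrite {1}/fd (dd_near _ oU Uu E) dd_add //.
  exact: smooth_diff (smooth_fd1 oU sc sf) Uu.
exact: smooth_diff (smooth_fd1 oU sc sg) Uu.
Qed.

Lemma isd2s_mul f g u a b a' b' : U u -> isd2s f u a b -> isd2s g u a' b' ->
  isd2s (fun y => f y * g y) u (f u * a' + a * g u) (f u * b' + 2 * a * a' + b * g u).
Proof.
move=> Uu [sf <- <-] [sg <- <-].
have E y : U y -> fd c (fun y => f y * g y) y = f y * fd c g y + fd c f y * g y.
  by move=> Uy; rewrite /fd dd_mul //; exact: smooth_diff Uy.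
split; [exact: smoothM|exact: E|].
have df := smooth_diff sf Uu; have dg := smooth_diff sg Uu.
have df' := smooth_diff (smooth_fd1 oU sc sf) Uu.
have dg' := smooth_diff (smooth_fd1 oU sc sg) Uu.
rewrite {1}/fd (dd_near _ oU Uu E) dd_add; try exact: diff_mul.
rewrite !dd_mul // -!/(fd c _ u); ring.
Qed.

Lemma isd2s_mulc f u k a b : U u -> isd2s f u a b ->
  isd2s (fun y => k * f y) u (k * a) (k * b).
Proof.
move=> Uu h; have := isd2s_mul Uu (isd2s_cst k u) h.
by rewrite !mulr0 !mul0r !addr0.
Qed.

Lemma isd2s_sub f g u a b a' b' : U u -> isd2s f u a b -> isd2s g u a' b' ->
  isd2s (fun y => f y - g y) u (a - a') (b - b').
Proof.
move=> Uu hf hg; have := isd2s_add Uu hf (isd2s_mulc (-1) Uu hg).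
by rewrite !mulN1r; under eq_fun do rewrite mulN1r.
Qed.

Lemma isd2_dot n (f g : 'rV[R]_2 -> 'rV[R]_n) u a b a' b' : U u -> isd2 f u a b -> isd2 g u a' b' ->
  isd2s (fun y => dot (f y) (g y)) u (dot a (g u) + dot (f u) a')
    (dot b (g u) + 2 * dot a a' + dot (f u) b').
Proof.
move=> Uu [sf <- <-] [sg <- <-].
have E y : U y -> fd c (fun y => dot (f y) (g y)) y = dot (fd c f y) (g y) + dot (f y) (fd c g y).
  by move=> Uy; rewrite /fd dd_dot //; exact: smooth_diff Uy.
split; [exact: smooth_dot|exact: E|].
have df := smooth_diff sf Uu; have dg := smooth_diff sg Uu.
have df' := smooth_diff (smooth_fd oU sc sf) Uu.
have dg' := smooth_diff (smooth_fd oU sc sg) Uu.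
rewrite {1}/fd (dd_near _ oU Uu E) dd_add; try exact: diff_dot.
rewrite !dd_dot // -!/(fd c _ u); ring.
Qed.

Lemma isd2_dotc n (g : 'rV[R]_2 -> 'rV[R]_n) p u a b : U u -> isd2 g u a b ->
  isd2s (fun y => dot p (g y)) u (dot p a) (dot p b).
Proof.
move=> Uu hg.
have h : isd2 (fun=> p) u 0 0.
  have E : fd c (fun=> p) = fun=> 0 by rewrite funeqE => y; rewrite /fd dd_cst.
  by split; [exact: smooth_cst|rewrite E|rewrite E /fd dd_cst].
have := isd2_dot Uu h hg.
by rewrite !dot0l mulr0 !add0r.
Qed.

Lemma isd2s_eq f g u a b a' b' : U u -> (forall y, U y -> f y = g y) ->
  isd2s f u a b -> isd2s g u a' b' -> a = a' /\ b = b'.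
Proof.
move=> Uu fg [sf <- <-] [sg <- <-].
have E y : U y -> fd c f y = fd c g y by move=> Uy; exact: dd_near oU Uy fg.
by split; [exact: E|exact: dd_near oU Uu E].
Qed.

(** At a critical point the term with the derivative of the field vanishes, so the iterated field
    derivative is the second derivative in a frozen direction. *)
Lemma isd2s_max f u a b : U u -> isd2s f u a b -> (\forall y \near u, f y <= f u) ->
  a = 0 /\ b <= 0.
Proof.
move=> Uu [sf <- <-] fmax.
have D1 v : dd v f u = 0 by rewrite ddE; exact: local_max_derive oU sf Uu fmax.
split; first exact: D1.
rewrite {1}/fd (fd_chain1 oU _ sc sf Uu) D1 addr0 !ddE.
exact: local_max_derive2 oU sf Uu fmax.
Qed.

End SecondJets.

Ltac isd2_tac Uu :=
  repeat match goal with
  | |- isd2s _ _ (fun y => dot ?p (@?g y)) _ _ _ => refine (isd2_dotc _ _ p Uu _)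
  | |- isd2s _ _ (fun y => dot (@?f y) (@?g y)) _ _ _ => refine (isd2_dot _ _ Uu _ _)
  | |- isd2s _ _ (fun y => ?a * @?f y) _ _ _ => refine (isd2s_mulc _ _ _ Uu _)
  | |- isd2s _ _ (fun y => @?f y + - @?g y) _ _ _ => refine (isd2s_sub _ _ Uu _ _)
  | |- isd2s _ _ (fun y => @?f y + @?g y) _ _ _ => refine (isd2s_add _ _ Uu _ _)
  | |- isd2s _ _ (fun y => @?f y * @?g y) _ _ _ => refine (isd2s_mul _ _ Uu _ _)
  | |- isd2s _ _ (fun y => ?a) _ _ _ => refine (isd2s_cst _ _ _ _)
  | |- isd2s _ _ _ _ _ _ => refine (isd2s_atom _ _ _)
  | |- isd2 _ _ _ _ _ _ => refine (isd2_atom _ _ _)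
  end.

Section Bochner.
Variables (R : realType) (J : 'I_3 -> 'M[R]_4) (V0 : 'rV[R]_4).
Variables (U : set 'rV[R]_2) (F : 'rV[R]_2 -> 'rV[R]_4) (lam : 'rV[R]_2 -> 'rV[R]_3).
Hypothesis HK : hyperkahler J.
Hypothesis Pt : soliton_patch J V0 U F lam.
Variables (p1 p2 : 'rV[R]_4) (c1 c2 : 'rV[R]_2 -> 'rV[R]_2).
Hypothesis GF : graph_fields U F p1 p2 c1 c2.

Let oU := p_open Pt.
Let sF := p_smooth Pt.
Let sL := lam_smooth HK Pt.
Let s1 := gf_s1 GF.
Let s2 := gf_s2 GF.
Local Notation f1 := (F1 F c1).
Local Notation f2 := (F2 F c2).
Local Notation f11 := (F11 F c1).
Local Notation f12 := (F12 F c1 c2).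
Local Notation f22 := (F22 F c2).
Local Notation l1 := (L1 lam c1).
Local Notation l2 := (L2 lam c2).
Local Notation l11 := (L11 lam c1).
Local Notation l12 := (L12 lam c1 c2).
Local Notation l22 := (L22 lam c2).

Lemma l_perp y : U y -> dot (l1 y) (lam y) = 0 /\ dot (l2 y) (lam y) = 0.
Proof.
by move=> Uy; split; [exact: (dlam_unit HK Pt (c1 y) Uy)|exact: (dlam_unit HK Pt (c2 y) Uy)].
Qed.

Lemma l_second y : U y -> [/\ dot (l11 y) (lam y) = - dot (l1 y) (l1 y),
  dot (l12 y) (lam y) = - dot (l1 y) (l2 y) & dot (l22 y) (lam y) = - dot (l2 y) (l2 y)].
Proof.
move=> Uy.
have hl1 := sL1 HK Pt GF; have hl2 := sL2 HK Pt GF.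
have E1 z : U z -> dot (l1 z) (lam z) = 0 by move=> /l_perp[].
have E2 z : U z -> dot (l2 z) (lam z) = 0 by move=> /l_perp[].
derive_identity h11 oU Uy E1 (c1 y).
all: try solve [exact: smooth_diff Uy].
derive_identity h12 oU Uy E2 (c1 y).
all: try solve [exact: smooth_diff Uy].
derive_identity h22 oU Uy E2 (c2 y).
all: try solve [exact: smooth_diff Uy].
have {}h11 : dot (l11 y) (lam y) + dot (l1 y) (l1 y) = 0 by exact: h11.
have {}h12 : dot (l12 y) (lam y) + dot (l2 y) (l1 y) = 0 by exact: h12.
have {}h22 : dot (l22 y) (lam y) + dot (l2 y) (l2 y) = 0 by exact: h22.
rewrite (dotC (l2 y) (l1 y)) in h12.
by split; apply/eqP; rewrite -addr_eq0; apply/eqP.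
Qed.

Definition enum_fd y := dot (f2 y) (f2 y) * dot (l1 y) (l1 y)
  - 2 * dot (f1 y) (f2 y) * dot (l1 y) (l2 y) + dot (f1 y) (f1 y) * dot (l2 y) (l2 y).

(* The phase map is harmonic for the drift Laplacian; both sides carry the factor gdet. *)
Lemma phase_eq x : U x ->
  dot (f2 x) (f2 x) *: l11 x - (2 * dot (f1 x) (f2 x)) *: l12 x + dot (f1 x) (f1 x) *: l22 x
  - gdet F c1 c2 x *: (dot p1 V0 *: l1 x + dot p2 V0 *: l2 x) = - enum_fd x *: lam x.
Proof.
move=> Ux; apply/eqP; rewrite -subr_eq0 scaleNr opprK; apply/eqP.
set Z := _ + _.
have [h1 h2] := l_perp Ux; have [h11 h12 h22] := l_second Ux.
have ll := p_unit Pt Ux.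
have Zl : dot Z (lam x) = 0.
  rewrite /Z !(dotDl, dotBl, dotNl, dotZl) h1 h2 h11 h12 h22 ll /enum_fd; ring.
(* Being orthogonal to lam x, [Z] may itself serve as the test vector b; the tangential equation
   then reads Z . Z = 0. *)
have := lam_tangential HK Pt GF Ux Zl => h.
apply/eqP; rewrite -dot_eq0; apply/eqP.
rewrite {2}/Z !(dotDr, dotBr, dotNr, dotZr) Zl mulr0 addr0.
by apply: etrans h; ring.
Qed.

End Bochner.

Lemma linear_eq1 (R : comNzRingType) (L M a1 b1 : R) : a1 = b1 ->
  forall k1, L - M = k1 * (a1 - b1) -> L = M.
Proof. by move=> -> k; rewrite subrr mulr0 => /eqP; rewrite subr_eq0 => /eqP. Qed.

(** A certificate for an equation that is a combination of nine others: once the coefficients are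
    given, a ring identity remains. Nine is the number of relations combined in [bochner_point]. *)
Lemma linear_eq9 (R : comNzRingType) (L M a1 b1 a2 b2 a3 b3 a4 b4 a5 b5 a6 b6 a7 b7 a8 b8 a9 b9 : R) :
  a1 = b1 -> a2 = b2 -> a3 = b3 -> a4 = b4 -> a5 = b5 -> a6 = b6 -> a7 = b7 -> a8 = b8 -> a9 = b9 ->
  forall k1 k2 k3 k4 k5 k6 k7 k8 k9, L - M = k1 * (a1 - b1) + k2 * (a2 - b2) + k3 * (a3 - b3)
    + k4 * (a4 - b4) + k5 * (a5 - b5) + k6 * (a6 - b6) + k7 * (a7 - b7) + k8 * (a8 - b8)
    + k9 * (a9 - b9) -> L = M.
Proof.
move=> -> -> -> -> -> -> -> -> -> k1 k2 k3 k4 k5 k6 k7 k8 k9.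
by rewrite !subrr !mulr0 !addr0 => /eqP; rewrite subr_eq0 => /eqP.
Qed.

Arguments linear_eq1 {R L M a1 b1} _ k1 _.
Arguments linear_eq9 {R L M a1 b1 a2 b2 a3 b3 a4 b4 a5 b5 a6 b6 a7 b7 a8 b8 a9 b9}
  _ _ _ _ _ _ _ _ _ k1 k2 k3 k4 k5 k6 k7 k8 k9 _.

Section BochnerPoint.
Variables (R : realType) (J : 'I_3 -> 'M[R]_4) (V0 : 'rV[R]_4).
Variables (U : set 'rV[R]_2) (F : 'rV[R]_2 -> 'rV[R]_4) (lam : 'rV[R]_2 -> 'rV[R]_3).
Hypothesis HK : hyperkahler J.
Hypothesis Pt : soliton_patch J V0 U F lam.
Variables (p1 p2 : 'rV[R]_4) (c1 c2 : 'rV[R]_2 -> 'rV[R]_2).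
Hypothesis GF : graph_fields U F p1 p2 c1 c2.

Let oU := p_open Pt.
Let sF := p_smooth Pt.
Let sL := lam_smooth HK Pt.
Let s1 := gf_s1 GF.
Let s2 := gf_s2 GF.
Local Notation f1 := (F1 F c1).
Local Notation f2 := (F2 F c2).
Local Notation f11 := (F11 F c1).
Local Notation f12 := (F12 F c1 c2).
Local Notation f22 := (F22 F c2).
Local Notation l1 := (L1 lam c1).
Local Notation l2 := (L2 lam c2).
Local Notation l11 := (L11 lam c1).
Local Notation l12 := (L12 lam c1 c2).
Local Notation l22 := (L22 lam c2).

Variables (u : 'rV[R]_2).
Hypothesis Uu : U u.
Hypothesis fu1 : f1 u = p1.
Hypothesis fu2 : f2 u = p2.
Hypothesis pp1 : dot p1 p1 = 1.
Hypothesis pp2 : dot p2 p2 = 1.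
Hypothesis pp12 : dot p1 p2 = 0.

Lemma point_jet : soliton_jet J p1 p2 (f11 u) (f12 u) (f22 u) (lam u) (l1 u) (l2 u).
Proof.
have o : onb_at F u (c1 u) (c2 u).
  split; [exact: gf_det GF _ Uu| | |].
  - by rewrite -[dd (c1 u) F u]/(f1 u) fu1.
  - by rewrite -[dd (c2 u) F u]/(f2 u) fu2.
  - by rewrite -[dd (c1 u) F u]/(f1 u) -[dd (c2 u) F u]/(f2 u) fu1 fu2.
have jt := patch_jet HK Pt Uu o.
have [a11 [b11 E11]] := fd2_tangent Pt GF c1 Uu s1.
have [a12 [b12 E12]] := fd2_tangent Pt GF c1 Uu s2.
have [a22 [b22 E22]] := fd2_tangent Pt GF c2 Uu s2.
rewrite fu1 fu2 in E11 E12 E22.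
rewrite -/(F1 F c1) -/(F11 F c1) in E11; rewrite -/(F2 F c2) -/(F12 F c1 c2) in E12.
rewrite -/(F2 F c2) -/(F22 F c2) in E22.
have := jet_shift HK a11 b11 a12 b12 a22 b22 jt.
rewrite -[dd (c1 u) F u]/(f1 u) -[dd (c2 u) F u]/(f2 u) fu1 fu2.
rewrite (dd_comm (c1 u) (c2 u) oU sF Uu) -E11 -E12 -E22.
by [].
Qed.

Lemma point_second : [/\ dot (f11 u) p1 = 0, dot (f12 u) p1 = 0 & dot (f22 u) p1 = 0] /\
  [/\ dot (f11 u) p2 = 0, dot (f12 u) p2 = 0 & dot (f22 u) p2 = 0].
Proof.
have [h1 h2 h3] := dot_p1_second Pt GF Uu; have [h4 h5 h6] := dot_p2_second Pt GF Uu.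
by split; split; rewrite dotC.
Qed.

Lemma point_third (c : 'rV[R]_2 -> 'rV[R]_2) (p : 'rV[R]_4) :
  (forall y, U y -> [/\ dot p (f11 y) = 0, dot p (f12 y) = 0 & dot p (f22 y) = 0]) ->
  [/\ dot p (fd c f11 u) = 0, dot p (fd c f12 u) = 0 & dot p (fd c f22 u) = 0].
Proof.
move=> h.
have h1 y : U y -> dot p (f11 y) = 0 by move=> /h[].
have h2 y : U y -> dot p (f12 y) = 0 by move=> /h[].
have h3 y : U y -> dot p (f22 y) = 0 by move=> /h[].
split.
- exact: (dot_p_const Pt c (sF11 Pt GF) h1 Uu).
- exact: (dot_p_const Pt c (sF12 Pt GF) h2 Uu).
- exact: (dot_p_const Pt c (sF22 Pt GF) h3 Uu).
Qed.

Lemma gdet_u : gdet F c1 c2 u = 1.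
Proof. by rewrite /gdet fu1 fu2 pp1 pp2 pp12 mulr0 subr0 mulr1. Qed.

Lemma enum_fd_u : enum_fd F lam c1 c2 u = dot (l1 u) (l1 u) + dot (l2 u) (l2 u).
Proof. by rewrite /enum_fd fu1 fu2 pp1 pp2 pp12 mulr0 mul0r subr0 !mul1r. Qed.

Variables (Q v : 'rV[R]_2 -> R) (q : 'rV[R]_3) (c : R).
Hypothesis sQ : smooth U Q.
Hypothesis vE : forall y, U y -> v y = dot q (lam y) - c.
Hypothesis rel : forall y, U y -> Q y * (v y * v y) * gdet F c1 c2 y = enum_fd F lam c1 c2 y.
Hypothesis Q0 : 0 < Q u.
Hypothesis v0 : 0 < v u.

(** The relation [rel], that is Q v^2 = |d lam|^2 with the Gram determinant cleared, is
    differentiated twice along each field and summed together with the drift. Third derivatives of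
    lam are removed by differentiating the equation of the phase map, second derivatives of v by
    pairing that equation with [q]. *)
Lemma bochner_point :
  2 * c * v u ^+ 2 * Q u ^+ 2 - 2 * (fd c1 Q u * dot q (l1 u) + fd c2 Q u * dot q (l2 u))
  <= v u * (fd c1 (fd c1 Q) u + fd c2 (fd c2 Q) u - dot p1 V0 * fd c1 Q u - dot p2 V0 * fd c2 Q u).
Proof.
have hf1 := sF1 Pt GF; have hf2 := sF2 Pt GF; have hf11 := sF11 Pt GF.
have hf12 := sF12 Pt GF; have hf22 := sF22 Pt GF.
have hl1 := sL1 HK Pt GF; have hl2 := sL2 HK Pt GF.
have hl11 := sL11 HK Pt GF; have hl12 := sL12 HK Pt GF; have hl22 := sL22 HK Pt GF.
have df21 : fd c2 f1 u = f12 u := F21 Pt GF Uu.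
have dl21 : fd c2 l1 u = l12 u := L21 HK Pt GF Uu.
have df211 : fd c2 (fd c2 f1) u = fd c2 f12 u.
  by apply: (dd_near _ oU Uu) => y Uy; exact: (F21 Pt GF Uy).
have dl211 : fd c2 (fd c2 l1) u = fd c2 l12 u.
  by apply: (dd_near _ oU Uu) => y Uy; exact: (L21 HK Pt GF Uy).
have [t11 t12 t13] := point_third c1 (fun y Uy => dot_p1_second Pt GF Uy).
have [t21 t22 t23] := point_third c2 (fun y Uy => dot_p1_second Pt GF Uy).
have [t31 t32 t33] := point_third c1 (fun y Uy => dot_p2_second Pt GF Uy).
have [t41 t42 t43] := point_third c2 (fun y Uy => dot_p2_second Pt GF Uy).
have [[k11 k12 k13] [k21 k22 k23]] := point_second.
have rel' y : U y -> Q y * ((dot q (lam y) - c) * (dot q (lam y) - c)) *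
   (dot (f1 y) (f1 y) * dot (f2 y) (f2 y) - dot (f1 y) (f2 y) * dot (f1 y) (f2 y))
  = dot (f2 y) (f2 y) * dot (l1 y) (l1 y)
  - 2 * dot (f1 y) (f2 y) * dot (l1 y) (l2 y) + dot (f1 y) (f1 y) * dot (l2 y) (l2 y).
  by move=> Uy; rewrite -vE //; exact: rel.
eassert (r1 : _ /\ _).
  refine (isd2s_eq oU Uu rel' (c := c1) _ _); isd2_tac Uu.
all: try assumption.
eassert (r2 : _ /\ _).
  refine (isd2s_eq oU Uu rel' (c := c2) _ _); isd2_tac Uu.
all: try assumption.

cbv beta in r1, r2.
have [ph1 ph2] := l_perp HK Pt c1 c2 Uu.
have [hs11 hs12 hs22] := l_second HK Pt GF Uu.
(* The vector [w] is constant. Frozen values of the first derivatives of lam are put in its place,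
   so that differentiating a scalar identity once yields the third derivatives. *)
have pair (w : 'rV[R]_3) y : U y ->
  dot (f2 y) (f2 y) * dot w (l11 y) - 2 * dot (f1 y) (f2 y) * dot w (l12 y)
  + dot (f1 y) (f1 y) * dot w (l22 y)
  - (dot (f1 y) (f1 y) * dot (f2 y) (f2 y) - dot (f1 y) (f2 y) * dot (f1 y) (f2 y)) *
    (dot p1 V0 * dot w (l1 y) + dot p2 V0 * dot w (l2 y))
  = -1 * ((dot (f2 y) (f2 y) * dot (l1 y) (l1 y) - 2 * dot (f1 y) (f2 y) * dot (l1 y) (l2 y)
       + dot (f1 y) (f1 y) * dot (l2 y) (l2 y)) * dot w (lam y)).
  move=> Uy; have := congr1 (dot w) (phase_eq HK Pt GF Uy).
  rewrite /gdet /enum_fd !(dotDr, dotBr, dotNr, dotZr, scaleNr, scalerDr, scalerA).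
  move: (dot (f1 y) (f1 y)) (dot (f1 y) (f2 y)) (dot (f2 y) (f2 y)) (dot p1 V0) (dot p2 V0).
  move: (dot (l1 y) (l1 y)) (dot (l1 y) (l2 y)) (dot (l2 y) (l2 y)).
  move: (dot w (l1 y)) (dot w (l2 y)) (dot w (l11 y)) (dot w (l12 y)) (dot w (l22 y)) (dot w (lam y)).
  move=> w1 w2 w3 w4 w5 w6 a1 a2 a3 g1 g2 g3 k1 k2 h; by refine (etrans _ (etrans h _)); ring.
have PV := pair q u Uu.
have P1 y (Uy : U y) := pair (l1 u) y Uy.
have P2 y (Uy : U y) := pair (l2 u) y Uy.
eassert (d1 : _ /\ _).
  refine (isd2s_eq oU Uu P1 (c := c1) _ _); isd2_tac Uu.
all: try assumption.
eassert (d2 : _ /\ _).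
  refine (isd2s_eq oU Uu P2 (c := c2) _ _); isd2_tac Uu.
all: try assumption.
move: d1 => [d1 _]; move: d2 => [d2 _]; cbv beta in d1, d2.

have e11 : fd c1 f1 u = f11 u by []. have e12 : fd c1 f2 u = f12 u by [].
have e22 : fd c2 f2 u = f22 u by [].
have e111 : fd c1 (fd c1 f1) u = fd c1 f11 u by [].
have e112 : fd c1 (fd c1 f2) u = fd c1 f12 u by [].
have e222 : fd c2 (fd c2 f2) u = fd c2 f22 u by [].
have g1 : fd c1 lam u = l1 u by []. have g2 : fd c2 lam u = l2 u by [].
have g11 : fd c1 l1 u = l11 u by []. have g12 : fd c1 l2 u = l12 u by [].
have g22 : fd c2 l2 u = l22 u by [].
have ga : fd c1 (fd c1 lam) u = l11 u by []. have gb : fd c2 (fd c2 lam) u = l22 u by [].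
have g111 : fd c1 (fd c1 l1) u = fd c1 l11 u by [].
have g112 : fd c1 (fd c1 l2) u = fd c1 l12 u by [].
have g222 : fd c2 (fd c2 l2) u = fd c2 l22 u by [].
have m1 := L112 HK Pt GF Uu. have m2 := L122 HK Pt GF Uu.
have pp21 : dot p2 p1 = 0 by rewrite dotC.
have ph1' : dot (lam u) (l1 u) = 0 by rewrite dotC.
have ph2' : dot (lam u) (l2 u) = 0 by rewrite dotC.
have N := (dotC (l11 u) (l1 u), dotC (l12 u) (l1 u), dotC (l22 u) (l1 u), dotC (l11 u) (l2 u),
  dotC (l12 u) (l2 u), dotC (l22 u) (l2 u), dotC (l2 u) (l1 u),
  dotC (fd c1 l11 u) (l1 u), dotC (fd c2 l11 u) (l2 u), dotC (fd c2 l12 u) (l1 u), dotC (fd c2 l22 u) (l2 u),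
  dotC (fd c1 l12 u) (l2 u)).

have sw (a b : 'rV[R]_4) : dot a b = 0 -> dot b a = 0 by rewrite dotC.
have Z := (k11, k12, k13, k21, k22, k23, sw _ _ k11, sw _ _ k12, sw _ _ k13, sw _ _ k21, sw _ _ k22, sw _ _ k23).
have T1 := (t11, t12, t31, t32, sw _ _ t11, sw _ _ t12, sw _ _ t31, sw _ _ t32).
have T2 := (t22, t23, t42, t43, sw _ _ t22, sw _ _ t23, sw _ _ t42, sw _ _ t43).
have PP := (pp1, pp2, pp12, pp21).
have LP := (ph1, ph2, ph1', ph2').
have RZ := (addr0, add0r, mulr0, mul0r, subr0, mul1r, mulr1).
rewrite fu1 fu2 !PP !RZ in PV.
rewrite fu1 fu2 !(e11, e12, e111, e112) !(g1, g11, g12, g111, g112, ga) !PP !Z !T1 !RZ !N in r1.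
rewrite fu1 fu2 !(df21, df211, e22, e222) !(g2, dl21, dl211, g22, g222, gb) !PP !Z !T2 !RZ !N in r2.
rewrite fu1 fu2 !(e11, e12) !(g1, g11, g12) !PP !Z !LP !RZ ?N m2 in d1.
rewrite fu1 fu2 !(df21, e22) !(g2, dl21, g22) !PP !Z !LP !RZ ?N in d2.
rewrite m1 in r1 r2.

have jt := point_jet.
have [m [mm lm]] := exists_perp jt.
have key := jet_key HK jt mm lm k11 k12 k13 k21 k22 k23.
have fr X Y := basis3 X Y (j_ll jt) mm lm.
have n_u : dot (l1 u) (l1 u) + dot (l2 u) (l2 u) = Q u * v u ^+ 2.
  by rewrite -enum_fd_u -rel // gdet_u mulr1 expr2.
have E3 (X Y : 'rV[R]_3) : dot X (lam u) = 0 ->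
  dot X Y = dot X m * dot Y m + dot X (crossp (lam u) m) * dot Y (crossp (lam u) m).
  by move=> h; rewrite (fr X Y) h mul0r add0r.
pose t2 := dot (l11 u) m ^+ 2 + dot (l11 u) (crossp (lam u) m) ^+ 2
  + 2 * (dot (l12 u) m ^+ 2 + dot (l12 u) (crossp (lam u) m) ^+ 2)
  + (dot (l22 u) m ^+ 2 + dot (l22 u) (crossp (lam u) m) ^+ 2).
pose SS := dot (l1 u) (l1 u) ^+ 2 + 2 * dot (l1 u) (l2 u) ^+ 2 + dot (l2 u) (l2 u) ^+ 2.
have full : dot (l11 u) (l11 u) + 2 * dot (l12 u) (l12 u) + dot (l22 u) (l22 u) = t2 + SS.
  rewrite (fr (l11 u)) (fr (l12 u)) (fr (l22 u)) hs11 hs12 hs22 /t2 /SS.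
  move: (dot (l1 u) _) (dot (l1 u) _) (dot (l2 u) _) => x y z.
  move: (dot (l11 u) m) (dot (l11 u) _) (dot (l12 u) m) (dot (l12 u) _) (dot (l22 u) m) (dot (l22 u) _).
  by move=> a1 a2 a3 a4 a5 a6; ring.
have kato : (2 * (dot (l1 u) (l11 u) + dot (l2 u) (l12 u))) ^+ 2
  + (2 * (dot (l1 u) (l12 u) + dot (l2 u) (l22 u))) ^+ 2
  <= 4 * (dot (l1 u) (l1 u) + dot (l2 u) (l2 u)) * t2.
  rewrite (E3 _ (l11 u) ph1) (E3 _ (l12 u) ph1) (E3 _ (l12 u) ph2) (E3 _ (l22 u) ph2) (E3 _ (l1 u) ph1) (E3 _ (l2 u) ph2) /t2.
  set m' := crossp _ _.
  move: (dot (l1 u) m) (dot (l1 u) m') (dot (l2 u) m) (dot (l2 u) m') => x1 x2 x3 x4.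
  move: (dot (l11 u) m) (dot (l11 u) m') (dot (l12 u) m) (dot (l12 u) m') (dot (l22 u) m) (dot (l22 u) m').
  move=> a1 a2 a3 a4 a5 a6.
  have := lerD (CS4 x1 x2 x3 x4 a1 a2 a3 a4) (CS4 x1 x2 x3 x4 a3 a4 a5 a6).
  rewrite -(ler_pM2l (_ : 0 < 4)) // => /le_trans; set X := (X in _ -> X <= _).
  have -> : X = 4 * ((x1 * a1 + x2 * a2 + x3 * a3 + x4 * a4) ^+ 2
    + (x1 * a3 + x2 * a4 + x3 * a5 + x4 * a6) ^+ 2) by rewrite /X; ring.
  by apply; rewrite le_eqVlt; apply/orP; left; apply/eqP; ring.

have vw : v u = dot q (lam u) - c by exact: vE.
apply: (bochner_ratio Q0 v0 n_u _ _ kato key (tr := dot (f11 u) (f11 u) + 2 * dot (f12 u) (f12 u) + dot (f22 u) (f22 u)) (erefl _)).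
- case: r1 => r1 _; rewrite vw.
  by refine (linear_eq1 r1 (-1) _); ring.
- case: r2 => r2 _; rewrite vw.
  by refine (linear_eq1 r2 (-1) _); ring.
case: r1 r2 => r11 r12 [r21 r22]; rewrite vw in n_u *; rewrite /SS in full.
(* The first four coefficients assemble the drift Laplacian of the relation. [PV] carries minus the
   factor 2 Q v that multiplies the drift Laplacian of v, [n_u] twice the trace left by the second
   derivatives of the Gram determinant, and [d1], [d2] bring in the third derivatives. *)
refine (linear_eq9 r12 r22 r11 r21 PV n_u d1 d2 full 1 1 (- dot p1 V0) (- dot p2 V0)
  (- (2 * Q u * (dot q (lam u) - c))) (2 * (dot (f11 u) (f11 u) + 2 * dot (f12 u) (f12 u) + dot (f22 u) (f22 u))) 2 2 2 _).
ring.
Qed.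
End BochnerPoint.

(** * The maximum principle with a quadratic barrier *)

Section MaxPrinciple.
Variables (R : realType) (J : 'I_3 -> 'M[R]_4) (V0 : 'rV[R]_4).
Hypothesis HK : hyperkahler J.

Lemma patch_restrict U U' F lam : open U' -> U' `<=` U ->
  soliton_patch J V0 U F lam -> soliton_patch J V0 U' F lam.
Proof.
move=> oU' s P; split; [split=> //|..].
- exact: smooth_subset s (p_smooth P).
- by move=> u /s; exact: p_imm P u.
- by move=> u /s; exact: p_unit P u.
- by move=> u v1 v2 /s; exact: p_phase P u v1 v2.
- by move=> u v1 v2 /s; exact: p_soliton P u v1 v2.
- by move=> u v1 v2 m /s; exact: p_curv P u v1 v2 m.
Qed.

Lemma open_pos (U : set 'rV[R]_2) (f : 'rV[R]_2 -> R) : open U -> smooth U f ->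
  open (U `&` [set y | 0 < f y]).
Proof.
move=> oU sf; rewrite openE => y [Uy fy]; rewrite /interior /=.
apply: filterI; first exact: open_nbhs_nbhs.
have := smooth_continuous sf Uy; rewrite /prop_for /continuous_at => /cvgr_gt; exact.
Qed.

(** The fields solve a 2 by 2 linear system by Cramer's rule on the neighbourhood where its
    determinant [D] is positive. At [u] the matrix of the system is the identity, so the fields
    start from the given orthonormal pair. *)
Lemma exists_graph_fields U F lam u v1 v2 : soliton_patch J V0 U F lam -> U u ->
  onb_at F u v1 v2 -> exists U' c1 c2, [/\ open U', U' `<=` U, U' u,
    graph_fields U' F (dd v1 F u) (dd v2 F u) c1 c2 & c1 u = v1 /\ c2 u = v2].
Proof.
move=> P Uu [d0 h11 h22 h12]; have oU := p_open P; have sF := p_smooth P.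
set p1 := dd v1 F u in h11 h12 *; set p2 := dd v2 F u in h22 h12 *.
pose a p v y := dot p (dd v F y).
have sa p v : smooth U (a p v).
  by apply: smooth_dot => //; [exact: smooth_cst|exact: smooth_dd].
pose D y := a p1 v1 y * a p2 v2 y + - (a p1 v2 y * a p2 v1 y).
have sD : smooth U D.
  by apply: smoothD => //; [|apply: smoothN => //]; exact: smoothM.
pose U' := U `&` [set y | 0 < D y].
have oU' : open U' by exact: open_pos.
have sU' : U' `<=` U by move=> y [].
have Du : D u = 1.
  by rewrite /D /a -/p1 -/p2 h11 h22 h12 mulr1 mul0r subr0.
pose c1 y := (D y)^-1 *: (a p2 v2 y *: v1 + - (a p2 v1 y *: v2)).
pose c2 y := (D y)^-1 *: (a p1 v1 y *: v2 + - (a p1 v2 y *: v1)).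
have dF y : U' y -> differentiable F y by move=> [Uy _]; exact: smooth_diff sF Uy.
have D0 y : U' y -> D y != 0 by move=> [_ Dy]; rewrite gt_eqF.
have sDV : smooth U' (fun y => (D y)^-1).
  by apply: smoothV => //; exact: smooth_subset sU' sD.
have sav p v (w : 'rV[R]_2) : smooth U' (fun y => a p v y *: w).
  by apply: (smooth_scale (k := a p v) (f := fun=> w)) => //; [exact: smooth_subset (sa _ _)|exact: smooth_cst].
have E y : U' y -> (forall p, dot p (fd c1 F y) = (D y)^-1 * (a p2 v2 y * a p v1 y - a p2 v1 y * a p v2 y))
    /\ (forall p, dot p (fd c2 F y) = (D y)^-1 * (a p1 v1 y * a p v2 y - a p1 v2 y * a p v1 y)).
  move=> Uy; have dFy := dF y Uy; split=> p; rewrite /fd (dd_scalev _ _ dFy) (dd_addv _ _ dFy) -scaleNr;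
  by rewrite !(dd_scalev _ _ dFy) dotZr dotDr !dotZr mulNr.
exists U', c1, c2; split=> //.
- by split=> //; rewrite /= Du.
- split.
  + by apply: smooth_scale => //; apply: smoothD => //; apply: smoothN.
  + by apply: smooth_scale => //; apply: smoothD => //; apply: smoothN.
  + move=> y Uy; have -> : det2 (c1 y) (c2 y) = (D y)^-1 * det2 v1 v2.
      have := D0 y Uy; rewrite /c1 /c2 /det2 !mxE; set d := (D y)^-1 => Dy.
      transitivity (d * (d * D y) * (v1 0 0 * v2 0 1 - v1 0 1 * v2 0 0)); last first.
        by rewrite mulVf // mulr1.
      by rewrite /D; ring.
    by rewrite mulr_gt0 // invr_gt0; case: Uy.
  + move=> y Uy; have [-> _] := E y Uy; apply: (mulfI (D0 y Uy)); rewrite mulrA mulfV ?D0 // /D; ring.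
  + move=> y Uy; have [_ ->] := E y Uy; apply: (mulfI (D0 y Uy)); rewrite mulrA mulfV ?D0 //; ring.
  + move=> y Uy; have [-> _] := E y Uy; apply: (mulfI (D0 y Uy)); rewrite mulrA mulfV ?D0 //; ring.
  + move=> y Uy; have [_ ->] := E y Uy; apply: (mulfI (D0 y Uy)); rewrite mulrA mulfV ?D0 // /D; ring.
- by split; rewrite /c1 /c2 Du invr1 scale1r /a -/p1 -/p2 ?(dotC p2 p1) ?h11 ?h22 ?h12
    scale1r scale0r subr0.
Qed.

Lemma bessel2 n (p1 p2 w : 'rV[R]_n) : dot p1 p1 = 1 -> dot p2 p2 = 1 -> dot p1 p2 = 0 ->
  dot w p1 ^+ 2 + dot w p2 ^+ 2 <= dot w w.
Proof.
move=> h11 h22 h12; have := dot_ge0 (w - (dot w p1 *: p1 + dot w p2 *: p2)).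
rewrite !(dotBl, dotBr, dotDl, dotDr, dotZl, dotZr, dotNl, dotNr) h11 h22 h12 (dotC p2 p1) h12 (dotC p1 w) (dotC p2 w).
by move: (dot w w) (dot w p1) (dot w p2) => a b c; lra.
Qed.

Lemma abs_dot_le1 n (x y : 'rV[R]_n) : dot x x = 1 -> dot y y = 1 -> `|dot x y| <= 1.
Proof.
by move=> hx hy; rewrite (le_trans (dot_le_enorm x y)) // /enorm hx hy sqrtr1 mulr1.
Qed.

(** At the maximum the gradient [T1], [T2] of Q is kap times that of the barrier, and L Q is at most
    kap times L of the barrier. A squared coordinate D_i^2 contributes twice its squared gradient,
    which is at most 1, and 2 D_i L D_i with L D_i = - w_i. The gradient [x1], [x2] of v has length
    at most sqrt Q v because |d lam|^2 = Q v^2. *)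
Lemma max_principle_num (kap c v Q MQ D1 D2 w1 w2 s1 s2 t1 t2 x1 x2 n T1 T2 : R) :
  0 <= kap -> 0 < c -> c <= v -> 0 < Q -> n = Q * v ^+ 2 ->
  `|w1| <= 1 -> `|w2| <= 1 ->
  s1 ^+ 2 + t1 ^+ 2 <= 1 -> s2 ^+ 2 + t2 ^+ 2 <= 1 -> x1 ^+ 2 + x2 ^+ 2 <= n ->
  T1 = kap * (2 * D1 * s1 + 2 * D2 * s2) -> T2 = kap * (2 * D1 * t1 + 2 * D2 * t2) ->
  MQ <= kap * (2 * (s1 ^+ 2 + t1 ^+ 2) + 2 * (s2 ^+ 2 + t2 ^+ 2) - 2 * (D1 * w1 + D2 * w2)) ->
  2 * c * v ^+ 2 * Q ^+ 2 - 2 * (T1 * x1 + T2 * x2) <= v * MQ ->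
  2 * c ^+ 2 * Q ^+ 2 <= kap * (4 + 2 * (`|D1| + `|D2|) + 4 * (`|D1| + `|D2|) * Num.sqrt Q).
Proof.
move=> k0 c0 cv Q0 En hw1 hw2 hs1 hs2 hx ET1 ET2 hM key.
have v0 : 0 < v by exact: lt_le_trans cv.
have cs s t : s ^+ 2 + t ^+ 2 <= 1 -> `|s * x1 + t * x2| <= Num.sqrt Q * v.
  move=> hst; rewrite -(@ler_pXn2r _ 2) ?nnegrE ?mulr_ge0 ?sqrtr_ge0 ?(ltW v0) //.
  rewrite exprMn sqr_sqrtr ?(ltW Q0) // -En real_normK ?num_real //.
  apply: (le_trans (_ : _ <= (s ^+ 2 + t ^+ 2) * (x1 ^+ 2 + x2 ^+ 2))).
    by have := sqr_ge0 (s * x2 - t * x1); lra.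
  apply: (le_trans (ler_wpM2r _ hst)); first by rewrite addr_ge0 ?sqr_ge0.
  by rewrite mul1r.
have c1 := cs _ _ hs1; have c2 := cs _ _ hs2.
have tt : T1 * x1 + T2 * x2 <= kap * (2 * (`|D1| + `|D2|) * (Num.sqrt Q * v)).
  have -> : T1 * x1 + T2 * x2 = kap * (2 * (D1 * (s1 * x1 + t1 * x2) + D2 * (s2 * x1 + t2 * x2))).
    by rewrite ET1 ET2; ring.
  apply: ler_wpM2l => //; rewrite -mulrA ler_pM2l // mulrDl; apply: lerD;
  by rewrite (le_trans (ler_norm _)) // normrM ler_wpM2l.
have MM : MQ <= kap * (4 + 2 * (`|D1| + `|D2|)).
  apply: (le_trans hM); apply: ler_wpM2l => //.
  have a1 : - (D1 * w1) <= `|D1| by rewrite (le_trans (ler_norm _)) // normrN normrM ler_piMr.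
  have a2 : - (D2 * w2) <= `|D2| by rewrite (le_trans (ler_norm _)) // normrN normrM ler_piMr.
  by lra.
have m1 : v * MQ <= v * (kap * (4 + 2 * (`|D1| + `|D2|))) by rewrite ler_pM2l.
rewrite -(ler_pM2l v0).
have m2 : v * (2 * c ^+ 2 * Q ^+ 2) <= 2 * c * v ^+ 2 * Q ^+ 2.
  have -> : 2 * c * v ^+ 2 * Q ^+ 2 = (2 * c * v * Q ^+ 2) * v by ring.
  have -> : v * (2 * c ^+ 2 * Q ^+ 2) = (2 * c * v * Q ^+ 2) * c by ring.
  by rewrite ler_wpM2l // !mulr_ge0 ?sqr_ge0 // ltW.
apply: (le_trans m2).
have : 2 * c * v ^+ 2 * Q ^+ 2 <= v * MQ + 2 * (T1 * x1 + T2 * x2) by move: key; lra.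
move=> /le_trans; apply.
apply: (le_trans (lerD m1 (ler_wpM2l _ tt))) => //.
by rewrite le_eqVlt; apply/orP; left; apply/eqP; ring.
Qed.

Lemma max_principle U F lam u (q : 'rV[R]_3) c (r1 r2 : 'rV[R]_4) a1 a2 kap :
  soliton_patch J V0 U F lam -> U u -> dot q q = 1 -> dot V0 V0 = 1 ->
  dot r1 r1 = 1 -> dot r2 r2 = 1 -> 0 < c ->
  (forall y, U y -> c <= dot q (lam y) - c) -> 0 <= kap ->
  let Q y := energy F lam y / (dot q (lam y) - c) ^+ 2 in 0 < Q u ->
  (\forall y \near u, Q y - kap * ((dot r1 (F y) - a1) ^+ 2 + (dot r2 (F y) - a2) ^+ 2)
    <= Q u - kap * ((dot r1 (F u) - a1) ^+ 2 + (dot r2 (F u) - a2) ^+ 2)) ->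
  let D := `|dot r1 (F u) - a1| + `|dot r2 (F u) - a2| in
  2 * c ^+ 2 * Q u ^+ 2 <= kap * (4 + 2 * D + 4 * D * Num.sqrt (Q u)).
Proof.
move=> P Uu qq VV rr1 rr2 c0 cv k0 Q Q0 mx; cbv zeta.
have [v1 [v2 o]] := exists_onb P Uu.
have [U' [c1 [c2 [oU' sU U'u GF [cu1 cu2]]]]] := exists_graph_fields P Uu o.
have [_ pp1 pp2 pp12] := o.
have P' := patch_restrict oU' sU P.
have sF := p_smooth P'. have sL := lam_smooth HK P'.
have sQ : smooth U' Q.
  have sv : smooth U' (fun y => dot q (lam y) - c).
    by apply: smoothD => //; [apply: smooth_dot => //|]; exact: smooth_cst.
  have sv2 : smooth U' (fun y => ((dot q (lam y) - c) ^+ 2)^-1).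
    apply: smoothV => //; last by under eq_fun do rewrite expr2; exact: smoothM.
    by move=> y /sU/cv h; rewrite expf_neq0 // gt_eqF // (lt_le_trans c0).
  have sE := energy_smooth HK P' sL.
  exact: smoothM oU' sE sv2.
have fu1 : F1 F c1 u = dd v1 F u by rewrite /F1 /fd cu1.
have fu2 : F2 F c2 u = dd v2 F u by rewrite /F2 /fd cu2.
have rel y : U' y -> Q y * ((dot q (lam y) - c) * (dot q (lam y) - c)) * gdet F c1 c2 y = enum_fd F lam c1 c2 y.
  move=> Uy; have dv := gf_det GF Uy; rewrite /Q (energy_frame HK P' Uy (smooth_diff sL Uy) dv).
  have g0 : gram F y (c1 y) (c2 y) != 0 by rewrite gt_eqF // (gram_gt0 HK P' Uy).
  have v0 : dot q (lam y) - c != 0 by rewrite gt_eqF // (lt_le_trans c0) // cv //; exact: sU.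
  have -> : gdet F c1 c2 y = gram F y (c1 y) (c2 y) by rewrite /gdet /gram expr2.
  rewrite -[enum_fd _ _ _ _ _]/(enum_at F lam y (c1 y) (c2 y)).
  by move: (enum_at _ _ _ _ _) (gram _ _ _ _) (dot q (lam y) - c) g0 v0 => e g v g0 v0; field; rewrite ?g0 ?v0.
have v0 : 0 < dot q (lam u) - c by rewrite (lt_le_trans c0) // cv.
have key := bochner_point HK P' GF U'u fu1 fu2 pp1 pp2 pp12 sQ (fun y _ => erefl) rel Q0 v0.
have hf1 := sF1 P' GF; have hf2 := sF2 P' GF.
have s1 := gf_s1 GF; have s2 := gf_s2 GF.
eassert (M1 : _ /\ _).
  refine (isd2s_max (c := c1) oU' _ U'u _ mx); first exact: gf_s1 GF.
  under eq_fun do rewrite !expr2.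
  isd2_tac U'u.
all: try assumption.
eassert (M2 : _ /\ _).
  refine (isd2s_max (c := c2) oU' _ U'u _ mx); first exact: gf_s2 GF.
  under eq_fun do rewrite !expr2.
  isd2_tac U'u.
all: try assumption.
cbv beta in M1, M2.
have SE := soliton_eq P' GF U'u.
rewrite fu1 fu2 pp1 pp2 pp12 mulr0 mul0r subr0 mulr1 !scale1r scale0r subr0 in SE.
(* At [u] the fields are orthonormal, and the soliton equation says that the drift Laplacian of r .
   F is - r . V0. *)
have SEr (r : 'rV[R]_4) : dot r (fd c1 (fd c1 F) u) + dot r (fd c2 (fd c2 F) u)
    = dot (dd v1 F u) V0 * dot r (dd v1 F u) + dot (dd v2 F u) V0 * dot r (dd v2 F u) - dot r V0.
  by have := congr1 (dot r) SE; rewrite !(dotDr, dotBr, dotZr, dotNr).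
rewrite -[fd c1 F u]/(F1 F c1 u) fu1 in M1; rewrite -[fd c2 F u]/(F2 F c2 u) fu2 in M2.
have n_u : dot (L1 lam c1 u) (L1 lam c1 u) + dot (L2 lam c2 u) (L2 lam c2 u) = Q u * (dot q (lam u) - c) ^+ 2.
  by rewrite -(enum_fd_u lam fu1 fu2 pp1 pp2 pp12) -rel // (gdet_u fu1 fu2 pp1 pp2 pp12) mulr1 expr2.
have xx : dot q (L1 lam c1 u) ^+ 2 + dot q (L2 lam c2 u) ^+ 2 <= dot (L1 lam c1 u) (L1 lam c1 u) + dot (L2 lam c2 u) (L2 lam c2 u).
  by apply: lerD; rewrite (le_trans (dot_CS _ _)) // qq mul1r.
cbv beta in key; have SE1 := SEr r1; have SE2 := SEr r2.
have b1 := bessel2 r1 pp1 pp2 pp12; have b2 := bessel2 r2 pp1 pp2 pp12; rewrite ?rr1 ?rr2 in b1 b2.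
have h1 := abs_dot_le1 rr1 VV; have h2 := abs_dot_le1 rr2 VV.
case: M1 => T1 S1; case: M2 => T2 S2.
apply: (max_principle_num (D1 := dot r1 (F u) - a1) (D2 := dot r2 (F u) - a2) k0 c0 (cv _ Uu) Q0 n_u h1 h2 b1 b2 xx _ _ _ key).
- by move: T1; move: (dot r1 (F u) - a1) (dot r2 (F u) - a2) => D1 D2 T1; lra.
- by move: T2; move: (dot r1 (F u) - a1) (dot r2 (F u) - a2) => D1 D2 T2; lra.
have T1e := T1; have T2e := T2.
move: T1 T2 S1 S2 SE1 SE2; clear.
move: (dot r1 (F u) - a1) (dot r2 (F u) - a2) => D1 D2.
move: (fd c1 Q u) (fd c2 Q u) (fd c1 (fd c1 Q) u) (fd c2 (fd c2 Q) u) => Q1 Q2 Q11 Q22.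
move: (dot r1 (fd c1 (fd c1 F) u)) (dot r1 (fd c2 (fd c2 F) u)) (dot r2 (fd c1 (fd c1 F) u)) (dot r2 (fd c2 (fd c2 F) u)) => f1 f2 g1 g2.
move: (dot (dd v1 F u) V0) (dot (dd v2 F u) V0) (dot r1 V0) (dot r2 V0) => V1 V2 w1 w2.
move: (dot r1 (dd v1 F u)) (dot r1 (dd v2 F u)) (dot r2 (dd v1 F u)) (dot r2 (dd v2 F u)) => s1 t1 s2 t2.
rewrite !subr0 => T1 T2 S1 S2 E1 E2.
have e1 : f1 = V1 * s1 + V2 * t1 - w1 - f2 by rewrite -E1; ring.
have e2 : g1 = V1 * s2 + V2 * t2 - w2 - g2 by rewrite -E2; ring.
have eT1 : Q1 = kap * (2 * (D1 * s1 + D2 * s2)) by move: T1; lra.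
have eT2 : Q2 = kap * (2 * (D1 * t1 + D2 * t2)) by move: T2; lra.
subst f1 g1 Q1 Q2; rewrite -subr_ge0.
rewrite -oppr_ge0 in S1; rewrite -oppr_ge0 in S2.
apply: (le_trans (addr_ge0 S1 S2)); rewrite le_eqVlt; apply/orP; left; apply/eqP; ring.
Qed.
End MaxPrinciple.

(** * Local parametrizations of a soliton *)

Section Orientation.
Variable R : realType.

Lemma det_mx33 (M : 'M[R]_3) : \det M =
  M 0 0 * (M 1 1 * M 2 2 - M 1 2 * M 2 1) - M 0 1 * (M 1 0 * M 2 2 - M 1 2 * M 2 0)
  + M 0 2 * (M 1 0 * M 2 1 - M 1 1 * M 2 0).
Proof.
have Mf i j : M i j = M (inord i) (inord j) by rewrite !inord_val.
rewrite (expand_det_row _ ord0) !big_ord_recl big_ord0 addr0 /cofactor !det_mx22 !mxE.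
do 3 rewrite ?(Mf _ (lift _ _)) ?(Mf (lift _ _) _).
rewrite !(Mf 0) !(Mf 1) !(Mf 2) /=.
rewrite -[(0 + bump 0 (bump 0 0))%N]/2%N -[(0 + bump 0 0)%N]/1%N -[(0 + 0)%N]/0%N.
rewrite -[bump (bump 0 0) 0]/0%N -[bump (bump 0 0) _]/2%N.
rewrite -[bump (bump 0 (bump 0 0)) 0]/0%N -[bump (bump 0 (bump 0 0)) _]/1%N.
rewrite -[bump 0 0]/1%N -[bump 0 (1 %% 2)]/2%N.
rewrite -[((1 %% 3 + 1 %% 3) %% 3)%N]/2%N -[(1 %% 3)%N]/1%N.
rewrite expr0 expr1 expr2; ring.
Qed.

Lemma det_frame3 (l m : 'rV[R]_3) : dot l l = 1 -> dot m m = 1 -> dot l m = 0 ->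
  \det (\matrix_(i < 3) nth 0 [:: l; m; crossp l m] i) = 1.
Proof.
move=> ll mm lm; have := dot_cross l m; rewrite ll mm lm expr0n subr0 mulr1 => <-.
by rewrite det_mx33 !mxE /= !dot3E !mxE /=; ring.
Qed.

Variable J : 'I_3 -> 'M[R]_4.
Hypothesis HK : hyperkahler J.

Lemma act_delta i (w : 'rV[R]_4) : act (J i) w = K J (delta_mx 0 i) w.
Proof.
rewrite /K; congr act; rewrite /Jcomb (bigD1 i) //= mxE !eqxx scale1r big1 ?addr0 // => k ki.
by rewrite mxE (negbTE ki) andbF scale0r.
Qed.

Lemma dot_K_act (a : 'rV[R]_3) i (w : 'rV[R]_4) : dot w w = 1 -> dot (K J a w) (act (J i) w) = a 0 i.
Proof.
move=> ww; rewrite act_delta dot_KK // ww mulr1 /dot (bigD1 i) //= mxE !eqxx mulr1 big1 ?addr0 // => k ki.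
by rewrite mxE (negbTE ki) andbF mulr0.
Qed.

(** The product of the first matrix with the transpose of the second is block diagonal with blocks 1
    and the matrix with rows l, m, l x m, which has determinant 1. *)
Lemma frame_orientation (l m : 'rV[R]_3) (w : 'rV[R]_4) :
  dot l l = 1 -> dot m m = 1 -> dot l m = 0 -> dot w w = 1 ->
  same_orientation (basis_mx w (K J l w) (K J m w) (K J (crossp l m) w))
    (basis_mx w (act (J 0) w) (act (J 1) w) (act (J 2) w)).
Proof.
move=> ll mm lm ww; rewrite /same_orientation -[X in _ * X]det_tr -det_mulmx.
set B := \matrix_(i < 3) nth 0 [:: l; m; crossp l m] i.
have -> : basis_mx w (K J l w) (K J m w) (K J (crossp l m) w) *m
  (basis_mx w (act (J 0) w) (act (J 1) w) (act (J 2) w))^T = (block_mx 1%:M 0 0 B : 'M[R]_(1 + 3)).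
  apply/matrixP => i j.
  have -> (M N : 'M[R]_4) : (M *m N^T) i j = dot (row i M) (row j N).
    by rewrite mxE; apply: eq_bigr => k _; rewrite !mxE.
  rewrite !rowK; case: (@splitP 1 3 i) => i' Ei; case: (@splitP 1 3 j) => j' Ej.
  - have -> : i = lshift 3 i' by exact: val_inj.
    have -> : j = lshift 3 j' by exact: val_inj.
    refine (etrans _ (esym (@block_mxEul _ 1 3 1 3 1%:M 0 0 B i' j'))); by rewrite !ord1 mxE /= ww.
  - have -> : i = lshift 3 i' by exact: val_inj.
    have -> : j = rshift 1 j' by exact: val_inj.
    refine (etrans _ (esym (@block_mxEur _ 1 3 1 3 1%:M 0 0 B i' j'))); rewrite !ord1 mxE /=.
    by case: j' {Ej} => [[|[|[|//]]] k] /=; rewrite dotC act_delta dot_Kxx.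
  - have -> : i = rshift 1 i' by exact: val_inj.
    have -> : j = lshift 3 j' by exact: val_inj.
    refine (etrans _ (esym (@block_mxEdl _ 1 3 1 3 1%:M 0 0 B i' j'))); rewrite !ord1 mxE /=.
    by case: i' {Ei} => [[|[|[|//]]] k] /=; rewrite dot_Kxx.
  - have -> : i = rshift 1 i' by exact: val_inj.
    have -> : j = rshift 1 j' by exact: val_inj.
    refine (etrans _ (esym (@block_mxEdr _ 1 3 1 3 1%:M 0 0 B i' j'))); rewrite mxE /=.
    case: j' {Ej} => [[|[|[|//]]] k]; case: i' {Ei} => [[|[|[|//]]] k'] /=;
    by rewrite dot_K_act //; congr (_ _ _); apply: val_inj.
have -> := @det_ublock R 1 3 1%:M 0 B; by rewrite det1 mul1r det_frame3.
Qed.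

End Orientation.

Section Frames.
Variables (R : realType) (J : 'I_3 -> 'M[R]_4).
Variables (U : set 'rV[R]_2) (F : 'rV[R]_2 -> 'rV[R]_4) (lam : 'rV[R]_2 -> 'rV[R]_3).
Hypothesis HK : hyperkahler J.
Hypothesis Pt : phase_patch J U F lam.

Let oU := p_open Pt.
Let sF := p_smooth Pt.

(** The geometric hypotheses speak of frame fields, the patch conditions of a single orthonormal
    pair. Explicit Gram-Schmidt from constant vectors joins the two, since it leaves unchanged a
    pair that is already orthonormal at [u]. *)
Lemma smooth_frame u v1 v2 : U u -> onb_at F u v1 v2 -> exists e0 e1,
  [/\ smooth U e0, smooth U e1, forall y, U y -> onb_at F y (e0 y) (e1 y), e0 u = v1 & e1 u = v2].
Proof.
move=> Uu [dv h11 h22 h12].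
pose A y := dot (dd v1 F y) (dd v1 F y). pose B y := dot (dd v1 F y) (dd v2 F y).
pose G y := gram F y v1 v2.
have sd v w : smooth U (fun y => dot (dd v F y) (dd w F y)).
  by apply: smooth_dot => //; exact: smooth_dd.
have sA : smooth U A by exact: sd. have sB : smooth U B by exact: sd.
have sG : smooth U G by exact: (gram_smooth Pt).
have A0 y : U y -> 0 < A y by move=> Uy; apply: (DF_gt0 Pt) => //; exact: det2_neq0l dv.
have G0 y : U y -> 0 < G y by move=> Uy; exact: (gram_gt0 HK Pt Uy dv).
have sqA := smooth_sqrt oU A0 sA. have sqG := smooth_sqrt oU G0 sG.
have qA y : U y -> 0 < Num.sqrt (A y) by move=> Uy; rewrite sqrtr_gt0 A0.
have qG y : U y -> 0 < Num.sqrt (G y) by move=> Uy; rewrite sqrtr_gt0 G0.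
have sAV := smoothV oU (fun y Uy => lt0r_neq0 (qA y Uy)) sqA.
have sGV := smoothV oU (fun y Uy => lt0r_neq0 (qG y Uy)) sqG.
have sAi := smoothV oU (fun y Uy => lt0r_neq0 (A0 y Uy)) sA.
pose e0 y : 'rV[R]_2 := (Num.sqrt (A y))^-1 *: v1.
pose e1 y : 'rV[R]_2 := (Num.sqrt (A y) * (Num.sqrt (G y))^-1) *: (v2 + - ((B y * (A y)^-1) *: v1)).
exists e0, e1; split.
- exact: smooth_scale oU sAV (smooth_cst U v1).
- have s1 := smooth_scale oU (smoothM oU sB sAi) (smooth_cst U v1).
  have s2 := smoothD oU (smooth_cst U v2) (smoothN oU s1).
  exact: smooth_scale oU (smoothM oU sqA sGV) s2.
- move=> y Uy; have dF := pdiff Pt Uy.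
  have AE : A y = Num.sqrt (A y) ^+ 2 by rewrite sqr_sqrtr // ltW ?A0.
  have GE : A y * dot (dd v2 F y) (dd v2 F y) - B y ^+ 2 = Num.sqrt (G y) ^+ 2.
    by rewrite sqr_sqrtr // ltW ?G0.
  have := qA y Uy; have := qG y Uy.
  rewrite /onb_at (dd_scalev _ _ dF) (dd_scalev _ _ dF) (dd_addv _ _ dF) -scaleNr (dd_scalev _ _ dF).
  rewrite !(dotZl, dotZr, dotDl, dotDr) (dotC (dd v2 F y)) -/(A y) -/(B y).
  have -> : det2 (e0 y) (e1 y) = (Num.sqrt (G y))^-1 * ((Num.sqrt (A y))^-1 * Num.sqrt (A y)) * det2 v1 v2.
    by rewrite /e0 /e1 /det2 !mxE; ring.
  move: AE GE; move: (A y) (B y) (Num.sqrt (A y)) (Num.sqrt (G y)) (dot (dd v2 F y) (dd v2 F y)) => A' b a g C -> GE g0 a0.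
  have an : a != 0 by rewrite gt_eqF. have gn : g != 0 by rewrite gt_eqF.
  split.
  + by rewrite mulVf // mulr1 mulr_gt0 // invr_gt0.
  + by field; rewrite an.
  + have -> : C = (g ^+ 2 + b ^+ 2) / a ^+ 2 by rewrite -GE; field; rewrite an.
    by field; rewrite ?an ?gn.
  + by field; rewrite ?an ?gn.
- by rewrite /e0 /A h11 sqrtr1 invr1 scale1r.
- by rewrite /e1 /A /B /G /gram h11 h22 h12 expr0n subr0 mulr1 sqrtr1 invr1 mulr1 mul0r scale0r subr0 scale1r.
Qed.
End Frames.

Section PatchOfHypotheses.
Variables (R : realType) (J : 'I_3 -> 'M[R]_4) (V0 : 'rV[R]_4).
Variables (U : set 'rV[R]_2) (F : 'rV[R]_2 -> 'rV[R]_4) (lam : 'rV[R]_2 -> 'rV[R]_3).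
Hypothesis HK : hyperkahler J.
Hypothesis Pt : phase_patch J U F lam.
Variables e0 e1 : 'rV[R]_2 -> 'rV[R]_2.
Hypothesis s0 : smooth U e0.
Hypothesis s1 : smooth U e1.
Hypothesis onb : forall y, U y -> onb_at F y (e0 y) (e1 y).

Let oU := p_open Pt.
Let sF := p_smooth Pt.

Definition pair_frame (T : Type) (a b : T) (i : 'I_2) := if i == 0 then a else b.
Local Notation fr := (pair_frame e0 e1).
Local Notation E0 := (fd e0 F).
Local Notation E1 := (fd e1 F).

Let sE0 : smooth U E0 := smooth_fd oU s0 sF.
Let sE1 : smooth U E1 := smooth_fd oU s1 sF.

Lemma E00 y : U y -> dot (E0 y) (E0 y) = 1. Proof. by move=> /onb[]. Qed.
Lemma E11 y : U y -> dot (E1 y) (E1 y) = 1. Proof. by move=> /onb[]. Qed.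
Lemma E01 y : U y -> dot (E0 y) (E1 y) = 0. Proof. by move=> /onb[]. Qed.

Lemma pushE (c : 'rV[R]_2 -> 'rV[R]_2) : push F c = fd c F.
Proof. by rewrite funeqE => y; rewrite /push /fd ddE. Qed.

Lemma deriveE_dd (W : normedModType R) (f : 'rV[R]_2 -> W) y v : derive f y v = dd v f y.
Proof. by rewrite ddE. Qed.

Lemma I2_case (P : 'I_2 -> Prop) : P 0 -> P 1 -> forall i, P i.
Proof.
by move=> h0 h1 [[|[|//]] i]; [rewrite (_ : Ordinal i = 0)|rewrite (_ : Ordinal i = 1)]=> //; exact: val_inj.
Qed.

Lemma fr_tangent_frame U' : U' `<=` U -> tangent_frame F U' fr.
Proof.
move=> s; split; first by apply: I2_case; exact: smooth_subset s _.
move=> y /s Uy; apply: I2_case; apply: I2_case; rewrite /fr /= !pushE.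
- exact: E00.
- exact: E01.
- by rewrite dotC; exact: E01.
- exact: E11.
Qed.

Definition np y (w : 'rV[R]_4) := w - (dot w (E0 y) *: E0 y + dot w (E1 y) *: E1 y).

Lemma sum2 (V : nmodType) (f : 'I_2 -> V) : \sum_(a < 2) f a = f 0 + f 1.
Proof. by rewrite big_ord_recl big_ord1 (_ : lift _ _ = 1) //; exact: val_inj. Qed.

Lemma normal_partE y w : normal_part F fr y w = np y w.
Proof.
by rewrite /normal_part sum2 /np -!pushE.
Qed.

Lemma npD y w w' : np y (w + w') = np y w + np y w'.
Proof. by rewrite /np !dotDl; apply/rowP => j; rewrite !mxE; ring. Qed.

Lemma np_tangent y v : U y -> np y (dd v F y) = 0.
Proof.
move=> Uy; have [d _ _ _] := onb Uy; have dF := pdiff Pt Uy.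
have [a [b ->]] := det2_decomp v d; rewrite (dd_comb _ _ _ _ dF) -/(fd e0 F y) -/(fd e1 F y).
rewrite /np !dotDl !dotZl E00 // E11 // E01 // (dotC (E1 y)) E01 // !mulr1 !mulr0 addr0 add0r.
by rewrite subrr.
Qed.

Lemma second_fundE y (c c' : 'rV[R]_2 -> 'rV[R]_2) : U y -> smooth U c' ->
  second_fund F fr c c' y = np y (dd (c' y) (dd (c y) F) y).
Proof.
move=> Uy sc; rewrite /second_fund normal_partE pushE deriveE_dd (fd_chain oU (c y) sc sF Uy).
by rewrite npD np_tangent // addr0.
Qed.

Lemma soliton_of_mean_curvature y : U y ->
  mean_curvature F fr y = - normal_part F fr y V0 ->
  let W := dd (e0 y) (dd (e0 y) F) y + dd (e1 y) (dd (e1 y) F) y + V0 in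
  W = dot W (dd (e0 y) F y) *: dd (e0 y) F y + dot W (dd (e1 y) F y) *: dd (e1 y) F y.
Proof.
move=> Uy h W; have : np y W = 0.
  by move: h; rewrite /mean_curvature sum2 !second_fundE // normal_partE /W !npD => ->; rewrite addNr.
by move=> /eqP; rewrite subr_eq0 => /eqP.
Qed.

Variables (nu0 nu1 : 'rV[R]_2 -> 'rV[R]_4).
Local Notation nu := (pair_frame nu0 nu1).
Hypothesis NF : normal_frame F U fr nu.

(* Ricci's equation: the ambient connection is flat. *)
Lemma normal_curvatureE y : U y -> let h := sff F y in
  normal_curvature F fr nu y =
    h (nu0 y) (e0 y) (e0 y) * h (nu1 y) (e0 y) (e1 y)
    + h (nu0 y) (e0 y) (e1 y) * h (nu1 y) (e1 y) (e1 y)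
    - h (nu1 y) (e0 y) (e0 y) * h (nu0 y) (e0 y) (e1 y)
    - h (nu1 y) (e0 y) (e1 y) * h (nu0 y) (e1 y) (e1 y).
Proof.
move=> Uy h; have [snu Hnu] := NF.
have sn0 : smooth U nu0 by exact: (snu 0).
have perp0 z : U z -> dot (nu0 z) (E0 z) = 0 /\ dot (nu0 z) (E1 z) = 0.
  by move=> Uz; have [_ h0] := Hnu z Uz 0 0; have [_ h1] := Hnu z Uz 0 1; rewrite /= !pushE in h0 h1.
have perp1 z : U z -> dot (nu1 z) (E0 z) = 0 /\ dot (nu1 z) (E1 z) = 0.
  by move=> Uz; have [_ h0] := Hnu z Uz 1 0; have [_ h1] := Hnu z Uz 1 1; rewrite /= !pushE in h0 h1.
have [p10 p11] := perp1 y Uy.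
have np_nu w : dot (np y w) (nu1 y) = dot w (nu1 y).
  by rewrite /np dotBl dotDl !dotZl !(dotC _ (nu1 y)) p10 p11 !mulr0 addr0 subr0.
have NC c mu z : normal_conn F fr c mu z = np z (dd (c z) mu z).
  by rewrite /normal_conn normal_partE deriveE_dd.
have NCf c mu : normal_conn F fr c mu = fun z => np z (fd c mu z).
  by rewrite funeqE => z; rewrite NC.
have tan nn v : dot nn (E0 y) = 0 -> dot nn (E1 y) = 0 -> dot (dd v F y) nn = 0.
  move=> h0 h1; have [d _ _ _] := onb Uy; have [a [b ->]] := det2_decomp v d.
  rewrite (dd_comb _ _ _ _ (pdiff Pt Uy)) dotDl !dotZl !(dotC _ nn) -/(fd e0 F y) -/(fd e1 F y).
  by rewrite h0 h1 !mulr0 addr0.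
have dE c nn v : smooth U c -> dot nn (E0 y) = 0 -> dot nn (E1 y) = 0 ->
    dot (dd v (fd c F) y) nn = sff F y nn (c y) v.
  by move=> sc h0 h1; rewrite (fd_chain oU v sc sF Uy) dotDl (tan nn) // addr0.
have [p00 p01] := perp0 y Uy.
have dn c : dot (fd c nu0 y) (E0 y) = - sff F y (nu0 y) (e0 y) (c y) /\
    dot (fd c nu0 y) (E1 y) = - sff F y (nu0 y) (e1 y) (c y).
  have q0 z : U z -> dot (nu0 z) (E0 z) = 0 by move=> /perp0[].
  have q1 z : U z -> dot (nu0 z) (E1 z) = 0 by move=> /perp0[].
  rewrite -!dE //; split; apply/eqP; rewrite -addr_eq0.
    derive_identity z0 oU Uy q0 (c y).
    all: try solve [exact: smooth_diff Uy].
    by rewrite (dotC (dd (c y) E0 y)) z0.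
  derive_identity z1 oU Uy q1 (c y).
  all: try solve [exact: smooth_diff Uy].
  by rewrite (dotC (dd (c y) E1 y)) z1.
have key c w : smooth U c -> dot (np y (dd w (fun z => np z (fd c nu0 z)) y)) (nu1 y) =
   dot (dd w (fd c nu0) y) (nu1 y) - (dot (fd c nu0 y) (E0 y) * dot (dd w E0 y) (nu1 y)
     + dot (fd c nu0 y) (E1 y) * dot (dd w E1 y) (nu1 y)).
  move=> sc; have sn := smooth_fd oU sc sn0.
  rewrite np_nu /np.
  have [_ ->] : isdd (fun z => fd c nu0 z - (dot (fd c nu0 z) (E0 z) *: E0 z + dot (fd c nu0 z) (E1 z) *: E1 z)) y w
     (dd w (fd c nu0) y - ((dot (fd c nu0 y) (E0 y) *: dd w E0 y + (dot (dd w (fd c nu0) y) (E0 y) + dot (fd c nu0 y) (dd w E0 y)) *: E0 y)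
      + (dot (fd c nu0 y) (E1 y) *: dd w E1 y + (dot (dd w (fd c nu0) y) (E1 y) + dot (fd c nu0 y) (dd w E1 y)) *: E1 y))).
    by isdd_tac; exact: smooth_diff Uy.
  rewrite !(dotBl, dotDl, dotNl, dotZl) !(dotC (E0 y) (nu1 y)) !(dotC (E1 y) (nu1 y)) p10 p11.
  by rewrite !mulr0 !addr0.
have [d00 d01] := dn e0; have [d10 d11] := dn e1.
rewrite /normal_curvature /normal_curv_tensor /pair_frame /= !NC !NCf.
rewrite dotDl [dot (- _ + _) _]dotDl dotNl (key e1 _ s1) (key e0 _ s0) d00 d01 d10 d11.
rewrite !(dE e0 _ _ s0 p10 p11) !(dE e1 _ _ s1 p10 p11) np_nu /lie_bracket !deriveE_dd.
rewrite (fd_chain oU (e0 y) s1 sn0 Uy) (fd_chain oU (e1 y) s0 sn0 Uy).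
rewrite (dd_comm (e1 y) (e0 y) oU sn0 Uy) -(scaleN1r (dd (e1 y) e0 y)).
have dn0 := smooth_diff sn0 Uy.
rewrite (dd_addv _ _ dn0) (dd_scalev _ _ dn0) scaleN1r !dotDl dotNl.
have sy nn : sff F y nn (e1 y) (e0 y) = sff F y nn (e0 y) (e1 y).
  by rewrite /sff (dd_comm _ _ oU sF Uy).
rewrite /h !sy.
move: (dot _ _) (dot _ _) (dot _ _) => a b c.
move: (sff F y (nu0 y) (e0 y) (e0 y)) (sff F y (nu0 y) (e0 y) (e1 y)) (sff F y (nu0 y) (e1 y) (e1 y)).
move: (sff F y (nu1 y) (e0 y) (e0 y)) (sff F y (nu1 y) (e0 y) (e1 y)) (sff F y (nu1 y) (e1 y) (e1 y)).
by move=> *; ring.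
Qed.
End PatchOfHypotheses.

Section PatchOfSurface.
Variables (R : realType) (J : 'I_3 -> 'M[R]_4) (S : topologicalType) (A : oriented_atlas R S).
Variables (X : S -> 'rV[R]_4) (V0 : 'rV[R]_4) (phi : S -> 'rV[R]_3).
Hypothesis HK : hyperkahler J.
Hypothesis HI : immersion A X.
Hypothesis HT : translating_soliton A X V0.
Hypothesis HC : normal_curvature_le0 A X J.
Hypothesis HP : complex_phase_map A X J phi.

Lemma phase_patch_of_chart (i : chart A) : phase_patch J (cimg i) (local_param X i) (phi \o cinv i).
Proof.
have [sF imm] := HI i; split=> //.
- exact: cimg_open.
- by move=> u Uu v; rewrite ddE; exact: imm.
- by move=> u _; have [] := HP (cinv i u).
- move=> _ v1 v2 [x dx <-] [d h11 h22 h12]; rewrite /= cmapK //.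
  have [_ _ /(_ (dd v1 (local_param X i) (cmap i x)) (dd v2 (local_param X i) (cmap i x)))] := HP x.
  by apply; split=> //; exists i, v1, v2; rewrite det_col2 !ddE.
Qed.

Lemma phase_patch_restrict U U' F lam : open U' -> U' `<=` U ->
  phase_patch J U F lam -> phase_patch J U' F lam.
Proof.
move=> oU' s P; split=> //.
- exact: smooth_subset s (p_smooth P).
- by move=> u /s; exact: p_imm P u.
- by move=> u /s; exact: p_unit P u.
- by move=> u v1 v2 /s; exact: p_phase P u v1 v2.
Qed.

Lemma smooth_K U (a : 'rV[R]_2 -> 'rV[R]_3) (f : 'rV[R]_2 -> 'rV[R]_4) : open U ->
  smooth U a -> smooth U f -> smooth U (fun y => K J (a y) (f y)).
Proof.
move=> oU sa sf.
have s k : smooth U (fun y => a y 0 k *: act (J k) (f y)).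
  by apply: smooth_scale => //; [exact: smooth_coord|exact: smooth_act].
apply: (smooth_ext oU _ (smoothD oU (smoothD oU (s 0) (s 1)) (s 2))) => y _.
by rewrite /K JcombE !actDl !actZl.
Qed.

Lemma smooth_crossp U (a b : 'rV[R]_2 -> 'rV[R]_3) : open U ->
  smooth U a -> smooth U b -> smooth U (fun y => crossp (a y) (b y)).
Proof.
move=> oU sa sb; apply: smooth_mx => // i j; rewrite (ord1 i).
have s k l k' l' : smooth U (fun y => a y 0 k * b y 0 l - a y 0 k' * b y 0 l').
  by apply: smoothD => //; [|apply: smoothN => //]; apply: smoothM => //; exact: smooth_coord.
case: j => [[|[|[|//]]] j];
  [apply: (smooth_ext oU _ (s 1 2 2 1))|apply: (smooth_ext oU _ (s 2 0 0 2))|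
   apply: (smooth_ext oU _ (s 0 1 1 0))] => y _; by rewrite mxE.
Qed.

Lemma exists_perp_field U F lam u m : phase_patch J U F lam -> U u ->
  dot m m = 1 -> dot (lam u) m = 0 ->
  exists U' mf, [/\ open U', U' `<=` U, U' u, smooth U' mf & mf u = m /\
    forall y, U' y -> dot (mf y) (mf y) = 1 /\ dot (lam y) (mf y) = 0].
Proof.
move=> P Uu mm lm; have oU := p_open P; have sL := lam_smooth HK P.
have scm : smooth U (fun=> m) by exact: smooth_cst.
have sa : smooth U (fun y => dot (lam y) m) by exact: smooth_dot.
pose a y := dot (lam y) m; pose M y := m - a y *: lam y.
have sM : smooth U M by apply: smoothD => //; apply: smoothN => //; exact: smooth_scale.
have sn : smooth U (fun y => dot (M y) (M y)) by exact: smooth_dot.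
have oU' := open_pos oU sn.
set U' := _ `&` _ in oU'; have sU : U' `<=` U by move=> y [].
have Mu : M u = m by rewrite /M /a lm scale0r subr0.
exists U', (fun y => (Num.sqrt (dot (M y) (M y)))^-1 *: M y); split=> //.
- by split=> //=; rewrite Mu mm.
- have pos y : U' y -> 0 < dot (M y) (M y) by case.
  have s1 := smooth_sqrt oU' pos (smooth_subset sU sn).
  have s2 : smooth U' (fun y => (Num.sqrt (dot (M y) (M y)))^-1).
    by apply: smoothV => // y /pos h; rewrite gt_eqF // sqrtr_gt0.
  exact: smooth_scale oU' s2 (smooth_subset sU sM).
- rewrite Mu mm sqrtr1 invr1 scale1r; split=> // y [Uy] /= pos; split.
    rewrite dotZl dotZr mulrA -expr2 exprVn sqr_sqrtr ?(ltW pos) // mulVf //.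
    by rewrite gt_eqF.
  by rewrite dotZr (_ : dot (lam y) (M y) = 0) ?mulr0 // /M dotBr dotZr (p_unit P Uy) mulr1 subrr.
Qed.

Lemma patch_of_chart (i : chart A) : soliton_patch J V0 (cimg i) (local_param X i) (phi \o cinv i).
Proof.
have P := phase_patch_of_chart i; have oU := p_open P.
split=> //.
- move=> u v1 v2 Uu o.
  have [e0 [e1 [s0 s1 oe <- <-]]] := smooth_frame HK P Uu o.
  apply: (soliton_of_mean_curvature P s0 s1 oe Uu).
  apply: (HT oU (fun _ h => h) _ Uu).
  exact: (fr_tangent_frame s0 s1 oe (fun _ h => h)).
move=> u v1 v2 m Uu o mm lm.
have [U' [mf [oU' sU U'u smf [mu Hm]]]] := exists_perp_field P Uu mm lm.
have [e0 [e1 [s0 s1 oe eu0 eu1]]] := smooth_frame HK P Uu o.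
have P' := phase_patch_restrict oU' sU P.
have s0' := smooth_subset sU s0. have s1' := smooth_subset sU s1.
have oe' y : U' y -> onb_at (local_param X i) y (e0 y) (e1 y) by move=> /sU; exact: oe.
have sE := smooth_fd oU' s0' (p_smooth P').
have sL := lam_smooth HK P'.
set F := local_param X i in P P' sE oe' *; set lam := phi \o cinv i in P P' sL Hm lm *.
(* This is the normal frame in which [p_curv] is written. [frame_orientation] will show that it is
   adapted, so that the curvature hypothesis applies with its sign. *)
pose nu0 y := K J (mf y) (fd e0 F y).
pose nu1 y := K J (crossp (lam y) (mf y)) (fd e0 F y).
have tf := fr_tangent_frame s0' s1' oe' (fun _ h => h).
have ph y : U' y -> fd e1 F y = K J (lam y) (fd e0 F y).
  by move=> Uy; rewrite /fd -(p_phase P' Uy (oe' y Uy)).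
have NF : normal_frame F U' (pair_frame e0 e1) (pair_frame nu0 nu1).
  split.
    apply: I2_case; first exact: smooth_K.
    by apply: smooth_K => //; exact: smooth_crossp.
  move=> y Uy; have [mm1 lm1] := Hm y Uy; have e00 := E00 oe' Uy.
  have ll := p_unit P' Uy.
  have cc : dot (crossp (lam y) (mf y)) (crossp (lam y) (mf y)) = 1.
    by rewrite dot_cross ll mm1 lm1 expr0n subr0 mulr1.
  have ml1 : dot (mf y) (lam y) = 0 by rewrite dotC.
  have mc := dot_crossr (lam y) (mf y). have lc := dot_crossl (lam y) (mf y).
  have cm : dot (crossp (lam y) (mf y)) (mf y) = 0 by rewrite dotC.
  have cl : dot (crossp (lam y) (mf y)) (lam y) = 0 by rewrite dotC.
  have kk a b : dot (K J a (fd e0 F y)) (K J b (fd e0 F y)) = dot a b.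
    by rewrite dot_KK // e00 mulr1.
  have EE := (kk, mm1, ml1, mc, cm, cl, cc, dot_Kxx HK).
  by apply: I2_case; apply: I2_case; split; rewrite /pair_frame /= ?pushE ?(ph y Uy) EE.
have ad : adapted J F U' (pair_frame e0 e1) (pair_frame nu0 nu1).
  move=> y Uy; rewrite /= /pair_frame /= !pushE (ph y Uy).
  have [mm1 lm1] := Hm y Uy.
  exact: frame_orientation HK _ _ _ (p_unit P' Uy) mm1 lm1 (E00 oe' Uy).
have := HC oU' sU tf NF ad U'u.
rewrite (normal_curvatureE P' s0' s1' oe' NF U'u) /nu0 /nu1 eu0 eu1 mu /fd eu0.
by [].
Qed.

End PatchOfSurface.

(** * Curves and the intrinsic distance *)

Section RealIntegrals.
Variable R : realType.
Implicit Types (g G f h : R -> R).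
Local Notation I01 := (`[0, 1]%classic : set R).

Lemma is_derive_continuous f (x a : R) : is_derive x (1 : R) f a -> {for x, continuous f}.
Proof. by move=> h; apply: differentiable_continuous; apply/derivable1_diffP; exact: ex_derive. Qed.

Lemma mono_of_derive f df (a b : R) : a <= b ->
  (forall t : R, a <= t <= b -> is_derive t (1 : R) f (df t)) -> (forall t : R, a <= t <= b -> 0 <= df t) ->
  f a <= f b.
Proof.
rewrite le_eqVlt => /predU1P[->//|ab] fd df0.
have fd' x : x \in `]a, b[ -> is_derive x (1 : R) f (df x).
  by rewrite in_itv /= => /andP[/ltW ax /ltW xb]; apply: fd; rewrite ax.
have fc : {within `[a, b], continuous f}.
  apply: continuous_in_subspaceT => x; rewrite inE /= in_itv /= => h.
  exact: is_derive_continuous (fd _ h).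
have [c cab E] := MVT ab fd' fc.
rewrite -subr_ge0 E mulr_ge0 // ?subr_ge0 ?(ltW ab) //; apply: df0.
by move: cab; rewrite in_itv /= => /andP[/ltW -> /ltW ->].
Qed.

Lemma primitive g : continuous g -> exists G,
  forall t : R, 0 <= t <= 1 -> is_derive t (1 : R) G (g t).
Proof.
(* Integrating from -1, within the interval from -1 to 2, keeps the endpoints 0 and 1 in the
   interior, where the two-sided derivative is available. *)
move=> cg; exists (fun x => \int[lebesgue_measure]_(t in `[-1, x]) g t)%R => t /andP[t0 t1].
have ig : lebesgue_measure.-integrable `[-1, 2] (EFin \o g).
  by apply: continuous_compact_integrable; [exact: segment_compact|apply: continuous_subspaceT].
have t2 : t < 2 by rewrite (le_lt_trans t1) // ltr1n.
have tm : -1 < t by rewrite (lt_le_trans _ t0) // ltrN10.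
have [d E] := continuous_FTC1_closed t2 ig tm (cg t).
exact: DeriveDef d (etrans (esym (derive1E _ _)) E).
Qed.

Lemma FTC2_01 g G : continuous g -> (forall t : R, 0 <= t <= 1 -> is_derive t (1 : R) G (g t)) ->
  (\int[lebesgue_measure]_(t in `[0, 1]) g t)%R = G 1 - G 0.
Proof.
move=> cg dG; rewrite /Rintegral (@continuous_FTC2 R g G 0 1) //.
- by apply: continuous_subspaceT.
- split.
  + by move=> x; rewrite in_itv /= => /andP[/ltW h0 /ltW h1]; have [] := dG x; rewrite ?h0.
  + apply: cvg_at_right_filter; apply: (is_derive_continuous (dG 0 _)); by rewrite lexx ler01.
  + apply: cvg_at_left_filter; apply: (is_derive_continuous (dG 1 _)); by rewrite lexx ler01.
- move=> x; rewrite in_itv /= => /andP[/ltW h0 /ltW h1].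
  by rewrite derive1E; have [|_ ->] := dG x; rewrite ?h0.
Qed.

(** With [G] a primitive of [g], both M G + f and M G - f are nondecreasing; thus the derivative of
    [f] never has to be integrated. *)
Lemma integral_dominates g f df M : continuous g ->
  (forall t : R, 0 <= t <= 1 -> is_derive t (1 : R) f (df t)) ->
  (forall t : R, 0 <= t <= 1 -> `|df t| <= M * g t) ->
  `|f 1 - f 0| <= M * (\int[lebesgue_measure]_(t in `[0, 1]) g t)%R.
Proof.
move=> cg fd dle; have [G dG] := primitive cg; rewrite (FTC2_01 cg dG).
have h k : (k = 1) \/ (k = -1) -> M * G 0 + k * f 0 <= M * G 1 + k * f 1.
  move=> hk; apply: (@mono_of_derive (fun t => M * G t + k * f t) (fun t => M * g t + k * df t)) => // t ht.
    have := dG t ht; have := fd t ht => ? ?; apply: is_derive_eq.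
    by [].
  have := dle t ht; rewrite ler_norml => /andP[d1 d2].
  by case: hk => ->; lra.
have h1 := h 1 (or_introl erefl); have h2 := h (-1) (or_intror erefl).
by rewrite ler_norml; apply/andP; split; lra.
Qed.

(** [a] may exceed [b], which covers pieces of a curve run backwards; the sign [sg] turns the
    primitive around accordingly. *)
Lemma integral_le_sub g h (a b : R) : continuous g -> continuous h -> (forall t, 0 <= g t) ->
  0 <= a <= 1 -> 0 <= b <= 1 ->
  (forall s, h s = `|b - a| * g (a + s * (b - a))) ->
  (\int[lebesgue_measure]_(t in `[0, 1]) h t)%R <= (\int[lebesgue_measure]_(t in `[0, 1]) g t)%R.
Proof.
move=> cg ch g0 /andP[a0 a1] /andP[b0 b1] hE; have [G dG] := primitive cg.
have mono x y : 0 <= x -> x <= y -> y <= 1 -> G x <= G y.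
  move=> x0 xy y1; apply: (@mono_of_derive G g) => // t /andP[tx ty].
  by apply: dG; rewrite (le_trans x0 tx) (le_trans ty y1).
pose sg : R := if a <= b then 1 else -1.
have sgE : sg * (b - a) = `|b - a|.
  by rewrite /sg; case: (leP a b) => ab; [rewrite mul1r ger0_norm ?subr_ge0|rewrite mulN1r ltr0_norm ?subr_lt0].
have dH (t : R) : 0 <= t <= 1 -> is_derive t (1 : R) (fun s => sg * G (a + s * (b - a))) (h t).
  move=> /andP[t0 t1].
  have ht : 0 <= a + t * (b - a) <= 1.
    have -> : a + t * (b - a) = (1 - t) * a + t * b by ring.
    have u0 : 0 <= 1 - t by rewrite subr_ge0.
    rewrite addr_ge0 ?mulr_ge0 //=.
    have := ler_wpM2l u0 a1; have := ler_wpM2l t0 b1; by lra.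
  have d1 := dG _ ht.
  have d2 : is_derive t (1 : R) (fun s : R => a + s * (b - a)) (b - a).
    by apply: is_derive_eq; rewrite scaler0 !add0r mul1r /GRing.scale /= mulr1.
  have d3 := @is_derive1_comp R G (fun s : R => a + s * (b - a)) t _ _ d1 d2.
  apply: is_derive_eq; rewrite hE -sgE /GRing.scale /=.
  ring.
rewrite (FTC2_01 cg dG) (FTC2_01 ch dH).
have -> : a + 1 * (b - a) = b by ring.
have -> : a + 0 * (b - a) = a by ring.
have := mono 0 a (lexx _) a0 a1; have := mono a 1 a0 a1 (lexx _).
have := mono 0 b (lexx _) b0 b1; have := mono b 1 b0 b1 (lexx _).
move: (G a) (G b) (G 0) (G 1) => ga gb g0' g1; rewrite /sg.
by case: (leP a b) => _ h1 h2 h3 h4; rewrite ?mul1r ?mulN1r; lra.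
Qed.

End RealIntegrals.

Section Curves.
Variables (R : realType) (S : topologicalType) (A : oriented_atlas R S).
Variable X : S -> 'rV[R]_4.
Hypothesis HI : immersion A X.

Definition velocity (i : chart A) (c : R -> S) (t : R) : 'rV[R]_2 := 'D_1 (cmap i \o c : R -> 'rV[R]_2) t.

Lemma dom_open (c : R -> S) i : continuous c -> open (c @^-1` cdom (o := A) i).
Proof. by move=> cc; apply: open_comp => [t _|]; [exact: cc|exact: cdom_open]. Qed.

Lemma mem_cimg (i : chart A) x : cdom i x -> cimg i (cmap i x).
Proof. by move=> h; exists x. Qed.

Lemma curve_chain (W : normedModType R) (f : S -> W) c (i : chart A) (t : R) :
  C1_curve A c -> cdom i (c t) -> differentiable (f \o cinv i) (cmap i (c t)) ->
  is_derive t (1 : R) (f \o c) (dd (velocity i c t) (f \o cinv i) (cmap i (c t))).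
Proof.
move=> [cc c1] ct df; have [dc _] := c1 i.
have oD : open (c @^-1` cdom i) by exact: dom_open.
have du := dc _ ct.
have E : forall s, (c @^-1` cdom i) s -> ((f \o cinv i) \o (cmap i \o c)) s = (f \o c) s.
  by move=> s cs; rewrite /= cmapK.
have dcomp : differentiable ((f \o cinv i) \o (cmap i \o c)) t.
  by apply: differentiable_comp => //; exact: du.
have [dfc Ed] := near_eq_diff (open_near_eq oD ct E) dcomp.
apply: DeriveDef; first exact: diff_derivable.
rewrite deriveE // Ed diff_comp // ddE deriveE //= /velocity deriveE //.
Qed.

Definition cspeed (c : R -> S) (t : R) : R := enorm ('D_1 (X \o c : R -> 'rV[R]_4) t).

Lemma enorm_continuous n : continuous (@enorm R n).
Proof.
move=> x; apply: (@continuous_comp _ _ _ (fun v : 'rV[R]_n => dot v v) Num.sqrt); last exact: sqrt_continuous.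
by apply: differentiable_continuous; apply: diff_dot.
Qed.

Lemma cspeedE c (i : chart A) t : C1_curve A c -> cdom i (c t) ->
  cspeed c t = enorm (dd (velocity i c t) (local_param X i) (cmap i (c t))).
Proof.
move=> hc ct; have [sF _] := HI i.
by have [_ <-] := curve_chain hc ct (smooth_diff sF (mem_cimg ct)).
Qed.

Lemma cspeed_continuous c : C1_curve A c -> continuous (cspeed c).
Proof.
move=> hc t; have [cc c1] := hc; have [i ct] := cdom_cover A (c t).
have [dc vc] := c1 i; have [sF _] := HI i; have oD : open (c @^-1` cdom i) by exact: dom_open.
set F := local_param X i in sF.
pose g s : 'rV[R]_4 := velocity i c s 0 0 *: dd (b0 R) F (cmap i (c s)) + velocity i c s 0 1 *: dd (b1 R) F (cmap i (c s)).
have cu : {for t, continuous (cmap i \o c)} by exact: differentiable_continuous (dc _ ct).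
have cv k : {for t, continuous (fun s => velocity i c s 0 k)}.
  apply: (@continuous_comp _ _ _ (velocity i c) (fun M : 'rV[R]_2 => M 0 k)); first exact: (vc 1 _ ct).
  exact: coord_continuous.
have cd v : {for t, continuous (fun s => dd v F (cmap i (c s)))}.
  apply: (@continuous_comp _ _ _ (cmap i \o c) (dd v F)) => //.
  exact: smooth_continuous (smooth_dd v sF) (mem_cimg ct).
have cg : {for t, continuous g} by apply: cvgD; apply: cvgZ; [exact: cv|exact: cd|exact: cv|exact: cd].
have E : {near t, (fun s => enorm (g s)) =1 cspeed c}.
  apply: (open_near_eq oD ct) => s cs; rewrite (cspeedE hc cs) /g {3}[velocity i c s]vec2E.
  by rewrite (dd_comb _ _ _ _ (smooth_diff sF (mem_cimg cs))).
rewrite /prop_for /continuous_at -(nbhs_singleton E).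
apply: (cvg_trans (near_eq_cvg E)).
by apply: (@continuous_comp _ _ _ g (@enorm R 4)) => //; exact: enorm_continuous.
Qed.

Lemma curve_lengthE c : curve_length X c = (\int[lebesgue_measure]_(t in `[0, 1]) cspeed c t)%R.
Proof. by []. Qed.

Lemma curve_length_ge0 c : 0 <= curve_length X c.
Proof. by apply: Rintegral_ge0 => t _; exact: enorm_ge0. Qed.

Lemma curve_lipschitz (f : S -> R) M c : C1_curve A c ->
  (forall (t : R) (i : chart A), 0 <= t <= 1 -> cdom i (c t) ->
     differentiable (f \o cinv i) (cmap i (c t)) /\
     forall v, `|dd v (f \o cinv i) (cmap i (c t))| <= M * enorm (dd v (local_param X i) (cmap i (c t)))) ->
  `|f (c 1) - f (c 0)| <= M * curve_length X c.
Proof.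
move=> hc h; rewrite curve_lengthE.
apply: (integral_dominates (f := f \o c) (df := fun t => 'D_1 (f \o c) t) (cspeed_continuous hc)).
  move=> t ht; have [i ct] := cdom_cover A (c t); have [df _] := h t i ht ct.
  by have [d _] := curve_chain hc ct df; exact: DeriveDef d erefl.
move=> t ht; have [i ct] := cdom_cover A (c t); have [df dle] := h t i ht ct.
by have [_ ->] := curve_chain hc ct df; rewrite (cspeedE hc ct).
Qed.

Lemma derive_reparam (W : normedModType R) (h : R -> W) (al : R -> R) (t k v : R) :
  is_derive t (1 : R) al k -> differentiable h (al t) ->
  differentiable (h \o al) t /\ 'D_v (h \o al) t = (v * k) *: 'D_1 h (al t).
Proof.
move=> dal dh; have da : differentiable al t by apply/derivable1_diffP; exact: ex_derive.
split; first exact: differentiable_comp.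
rewrite deriveE; last exact: differentiable_comp.
have Ed : 'd al t v = v * k.
  have -> : 'd al t v = v *: 'd al t 1 by rewrite -linearZ /= /GRing.scale /= mulr1.
  by have [_ <-] := dal; rewrite deriveE.
have Eh (x : R) : 'd h (al t) x = x *: 'd h (al t) 1.
  by rewrite -linearZ /= /GRing.scale /= mulr1.
by rewrite diff_comp //= Ed Eh -deriveE.
Qed.

Lemma curve_reparam c (al dal : R -> R) : C1_curve A c ->
  (forall t : R, is_derive t (1 : R) al (dal t)) -> continuous dal ->
  C1_curve A (c \o al) /\ forall t, cspeed (c \o al) t = `|dal t| * cspeed c (al t).
Proof.
move=> hc ha cda; have [cc c1] := hc.
have ca : continuous al by move=> t; exact: is_derive_continuous (ha t).
split; last first.
  move=> t; have [i ct] := cdom_cover A (c (al t)); have [sF _] := HI i.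
  have [d _] := curve_chain hc ct (smooth_diff sF (mem_cimg ct)).
  have [_ E] := derive_reparam 1 (ha t) ((derivable1_diffP _ _).1 d).
  by rewrite /cspeed -[X \o (c \o al)]/((X \o c) \o al) E mul1r enormZ.
split; first by move=> t; apply: continuous_comp; [exact: ca|exact: cc].
move=> i; have [dc vc] := c1 i; split.
  by move=> t ct; have [] := derive_reparam 1 (ha t) (dc _ ct).
move=> v t ct; have oD : open ((c \o al) @^-1` cdom i).
  by apply: open_comp => [z _|]; [apply: continuous_comp; [exact: ca|exact: cc]|exact: cdom_open].
pose g s := (v * dal s) *: velocity i c (al s).
have E : {near t, g =1 'D_v (cmap i \o (c \o al))}.
  apply: (open_near_eq oD ct) => s cs.
  by have [_ h] := derive_reparam v (ha s) (dc _ cs); exact: esym h.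
have cg : {for t, continuous g}.
  apply: cvgZ; first by apply: cvgM; [exact: cvg_cst|exact: cda].
  by apply: (@continuous_comp _ _ _ al (velocity i c)); [exact: ca|exact: (vc 1 _ ct)].
rewrite /prop_for /continuous_at -(nbhs_singleton E).
exact: (cvg_trans (near_eq_cvg E)).
Qed.

Lemma affine_reparam c (a b : R) : C1_curve A c -> 0 <= a <= 1 -> 0 <= b <= 1 ->
  C1_curve A (fun s : R => c (a + s * (b - a))) /\
  curve_length X (fun s : R => c (a + s * (b - a))) <= curve_length X c.
Proof.
move=> hc ha hb.
have dal (s : R) : is_derive s (1 : R) (fun s : R => a + s * (b - a)) (b - a).
  by apply: is_derive_eq; rewrite scaler0 !add0r mul1r /GRing.scale /= mulr1.
have cb : continuous (fun _ : R => b - a) by move=> s; exact: cvg_cst.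
have [h1 h2] := curve_reparam hc dal cb.
split; first exact: h1.
exact: (integral_le_sub (cspeed_continuous hc) (cspeed_continuous h1)
  (fun t => enorm_ge0 _) ha hb h2).
Qed.

Lemma integral_le_of_derive (g f df : R -> R) : continuous g ->
  (forall t : R, 0 <= t <= 1 -> is_derive t (1 : R) f (df t)) ->
  (forall t : R, 0 <= t <= 1 -> g t <= df t) ->
  (\int[lebesgue_measure]_(t in `[0, 1]) g t)%R <= f 1 - f 0.
Proof.
move=> cg fd dle; have [G dG] := primitive cg; rewrite (FTC2_01 cg dG).
have : f 0 - G 0 <= f 1 - G 1.
  apply: (@mono_of_derive _ (fun t => f t - G t) (fun t => df t - g t)) => // t ht.
    by have := dG t ht; have := fd t ht => ? ?; exact: is_deriveB.
  by rewrite subr_ge0 dle.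
by lra.
Qed.

(* A C^1 map of the line onto [0, 1] fixing 0 and 1: segments traversed with this speed are
   curves defined on the whole line. *)
Definition ramp (t : R) : R := sin (pi / 2 * t) ^+ 2.
Definition dramp (t : R) : R := 2 * (sin (pi / 2 * t) * (pi / 2 * cos (pi / 2 * t))).

Lemma ramp_derive (t : R) : is_derive t (1 : R) ramp (dramp t).
Proof.
rewrite /ramp; under eq_fun do rewrite expr2.
have d1 : is_derive t (1 : R) (fun t : R => pi / 2 * t) (pi / 2).
  by apply: is_derive_eq; rewrite /GRing.scale /= mulr1.
have d2 := @is_derive1_comp R sin (fun t : R => pi / 2 * t) t _ _ (is_derive_sin _) d1.
have [d E] := is_deriveM d2 d2.
by refine (DeriveDef d (etrans E _)); rewrite /dramp /GRing.scale /=; ring.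
Qed.

Lemma dramp_continuous : continuous dramp.
Proof.
have cl : continuous (fun t : R => pi / 2 * t) by move=> t; apply: cvgM; [exact: cvg_cst|exact: cvg_id].
move=> t; apply: cvgM; first exact: cvg_cst.
apply: cvgM; first by apply: (@continuous_comp _ _ _ (fun t : R => pi / 2 * t) sin); [exact: cl|exact: continuous_sin].
apply: cvgM; first exact: cvg_cst.
by apply: (@continuous_comp _ _ _ (fun t : R => pi / 2 * t) cos); [exact: cl|exact: continuous_cos].
Qed.

Lemma ramp0 : ramp 0 = 0. Proof. by rewrite /ramp mulr0 sin0 expr0n. Qed.
Lemma ramp1 : ramp 1 = 1. Proof. by rewrite /ramp mulr1 sin_pihalf expr1n. Qed.

Lemma ramp_itv t : 0 <= ramp t <= 1.
Proof.
rewrite sqr_ge0 /=; have := cos2Dsin2 (pi / 2 * t); have := sqr_ge0 (cos (pi / 2 * t)).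
by rewrite /ramp; lra.
Qed.

Lemma dramp_ge0 (t : R) : 0 <= t <= 1 -> 0 <= dramp t.
Proof.
move=> /andP[t0 t1]; have p0 : 0 < pi / 2 :> R by rewrite divr_gt0 ?pi_gt0.
have h1 : 0 <= pi / 2 * t by rewrite mulr_ge0 // ltW.
have h2 : pi / 2 * t <= pi / 2 by rewrite ler_piMr // ltW.
have s0 : 0 <= sin (pi / 2 * t).
  by apply: sin_ge0_pi; rewrite h1 /= (le_trans h2) // ler_pdivrMr // ler_peMr ?(ltW (pi_gt0 R)) // ler1n.
have c0 : 0 <= cos (pi / 2 * t).
  by apply: cos_ge0_pihalf; rewrite h2 andbT (le_trans _ h1) // oppr_le0 ltW.
by rewrite /dramp mulr_ge0 // mulr_ge0 // mulr_ge0 // ltW.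
Qed.

(** A straight segment of a chart traversed with speed [dramp]. It is C^1 in the other charts by
    smoothness of the transition maps, and the length bound holds because [ramp] rises from 0 to 1
    with nonnegative derivative. *)
Lemma segment_curve (i : chart A) u w M :
  (forall s : R, 0 <= s <= 1 -> cimg i (u + s *: w)) ->
  (forall s : R, 0 <= s <= 1 -> enorm (dd w (local_param X i) (u + s *: w)) <= M) ->
  let c t := cinv i (u + ramp t *: w) in
  [/\ C1_curve A c, c 0 = cinv i u, c 1 = cinv i (u + w) & curve_length X c <= M].
Proof.
move=> seg spd; have [sF _] := HI i.
have cr : continuous ramp by move=> t; exact: is_derive_continuous (ramp_derive t).
have cl (s : R) : {for s, continuous (fun s : R => u + s *: w)}.
  by apply: cvgD; [exact: cvg_cst|apply: cvgZr_tmp; exact: cvg_id].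
have ccl : continuous (fun t => u + ramp t *: w).
  by move=> t; apply: (@continuous_comp _ _ _ ramp (fun s : R => u + s *: w)); [exact: cr|exact: cl].
pose c t := cinv i (u + ramp t *: w).
have cim t : cimg i (u + ramp t *: w) by exact: seg (ramp_itv t).
have cc : continuous c.
  move=> t; apply: (@continuous_comp _ _ _ (fun t => u + ramp t *: w) (cinv i)); first exact: ccl.
  exact: (cinv_continuous (cim t)).
have cmc t : cdom i (c t) /\ cmap i (c t) = u + ramp t *: w.
  by have [x dx E] := cim t; rewrite /c -E cmapK.
have hc : C1_curve A c.
  split=> // j.
  pose T := cmap j \o cinv i.
  have sT := transition_smooth i j.
  have mem t : cdom j (c t) -> (cmap i @` (cdom i `&` cdom j)) (u + ramp t *: w).
    by move=> ct; have [d1 <-] := cmc t; exists (c t).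
  have dh t : cdom j (c t) -> is_derive (ramp t) (1 : R) (fun s : R => T (u + s *: w)) ('D_w T (u + ramp t *: w)).
    by move=> ct; apply: line_derive; exact: smooth_diff sT (mem t ct).
  have dr t v : cdom j (c t) -> differentiable (cmap j \o c) t /\
     'D_v (cmap j \o c) t = (v * dramp t) *: 'D_w T (u + ramp t *: w).
    move=> ct; have [d E] := dh t ct.
    have := derive_reparam v (ramp_derive t) ((derivable1_diffP _ _).1 d).
    by rewrite E.
  split; first by move=> t ct; have [] := dr t 1 ct.
  move=> v t ct; have oD : open (c @^-1` cdom j) by exact: dom_open.
  pose g s := (v * dramp s) *: 'D_w T (u + ramp s *: w).
  have E : {near t, g =1 'D_v (cmap j \o c)}.
    by apply: (open_near_eq oD ct) => s cs; have [_ h] := dr s v cs; exact: esym h.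
  have cg : {for t, continuous g}.
    apply: cvgZ; first by apply: cvgM; [exact: cvg_cst|exact: dramp_continuous].
    apply: (@continuous_comp _ _ _ (fun t => u + ramp t *: w) ('D_w T)); first exact: ccl.
    exact: smooth_continuous (smooth_derive w sT) (mem t ct).
  rewrite /prop_for /continuous_at -(nbhs_singleton E).
  exact: (cvg_trans (near_eq_cvg E)).
split=> //.
- by rewrite ramp0 scale0r addr0.
- by rewrite ramp1 scale1r.
have sp t : cspeed c t = `|dramp t| * enorm (dd w (local_param X i) (u + ramp t *: w)).
  have d := line_derive (smooth_diff sF (cim t) : differentiable _ (u + ramp t *: w)).
  have [d' E] := d.
  have [_ E'] := derive_reparam 1 (ramp_derive t) ((derivable1_diffP _ _).1 d').
  by rewrite /cspeed -enormZ ddE -E -[in RHS](mul1r (dramp t)) -E'.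
rewrite curve_lengthE.
have := @integral_le_of_derive (cspeed c) (fun t => M * ramp t) (fun t => M * dramp t) (cspeed_continuous hc).
rewrite ramp0 ramp1 mulr1 mulr0 subr0; apply.
  move=> t _; have := ramp_derive t => ?; apply: is_derive_eq.
  by [].
move=> t ht; rewrite sp ger0_norm ?dramp_ge0 // mulrC ler_wpM2r ?dramp_ge0 //.
exact: spd (ramp_itv t).
Qed.

End Curves.

Section Distance.
Variables (R : realType) (S : topologicalType) (A : oriented_atlas R S).
Variable X : S -> 'rV[R]_4.
Hypothesis HI : immersion A X.
Implicit Types (p q : S) (s : seq (R -> S)).

Definition chain_len s : R := \sum_(c <- s) curve_length X c.

(** The distance is handled through its strict upper bounds, which chains of curves witness
    directly; [riem_lt] translates back to the infimum. *)
Definition dlt p q (e : R) := exists s, piecewise_C1 A p q s /\ chain_len s < e.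

Lemma riem_lt p q e : (riem_dist A X p q < e%:E)%E <-> dlt p q e.
Proof.
split=> [/ereal_inf_lt [_ [s sp <-]]|[s [sp le]]]; first by rewrite lte_fin; exists s.
by apply: le_lt_trans; [apply: ereal_inf_lbound; exists s; [exact: sp|reflexivity]|rewrite lte_fin].
Qed.

Lemma chain_len_ge0 s : 0 <= chain_len s.
Proof. by apply: sumr_ge0 => c _; exact: curve_length_ge0. Qed.

Lemma dlt_refl p e : 0 < e -> dlt p p e.
Proof. by move=> e0; exists [::]; rewrite /chain_len big_nil. Qed.

Lemma chain_cat p q r s s' : piecewise_C1 A p q s -> piecewise_C1 A q r s' -> piecewise_C1 A p r (s ++ s').
Proof.
by elim: s p => [|c s IH] p /=; [move=> ->|move=> [h1 h2 /IH h] /h h3].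
Qed.

Lemma dlt_trans p q r e e' : dlt p q e -> dlt q r e' -> dlt p r (e + e').
Proof.
move=> [s [h l]] [s' [h' l']]; exists (s ++ s'); split; first exact: chain_cat h'.
by rewrite /chain_len big_cat /= ltrD.
Qed.

Lemma dlt_le p q e e' : e <= e' -> dlt p q e -> dlt p q e'.
Proof. by move=> le [s [h l]]; exists s; split=> //; exact: lt_le_trans le. Qed.

Lemma dlt_curve (c : R -> S) e : C1_curve A c -> curve_length X c < e -> dlt (c 0) (c 1) e.
Proof. by move=> hc l; exists [:: c]; rewrite /chain_len big_seq1. Qed.

Lemma dlt_subcurve c (a b e : R) : C1_curve A c -> 0 <= a <= 1 -> 0 <= b <= 1 ->
  curve_length X c < e -> dlt (c a) (c b) e.
Proof.
move=> hc ha hb l; have [h1 h2] := affine_reparam HI hc ha hb.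
have := dlt_curve h1 (le_lt_trans h2 l).
by rewrite mul0r addr0 mul1r addrC subrK.
Qed.

Lemma dlt_sym p q e : dlt p q e -> dlt q p e.
Proof.
move=> [s [h l]]; suff : exists s', piecewise_C1 A q p s' /\ chain_len s' <= chain_len s.
  by move=> [s' [h' l']]; exists s'; split=> //; exact: le_lt_trans l.
elim: s p h {l} => [|c s IH] p /=; first by move=> ->; exists [::].
move=> [hc c0 /IH[s' [h' l']]].
have b1 : 0 <= (1 : R) <= 1 by rewrite ler01 lexx.
have b0 : 0 <= (0 : R) <= 1 by rewrite ler01 lexx.
have [h1 h2] := affine_reparam HI hc b1 b0.
exists (s' ++ [:: fun t : R => c (1 + t * (0 - 1))]); split.
  apply: (chain_cat h'); split=> //; first by rewrite mul0r addr0.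
  by rewrite /= mul1r addrC subrK c0.
by rewrite /chain_len big_cat /= big_seq1 big_cons addrC lerD.
Qed.

Definition grad_le (f : S -> R) M z := forall i : chart A, cdom i z ->
  differentiable (f \o cinv i) (cmap i z) /\
  forall v, `|dd v (f \o cinv i) (cmap i z)| <= M * enorm (dd v (local_param X i) (cmap i z)).

(** Every point met along a chain shorter than [e] is itself within [e] of the starting point, so a
    gradient bound on that ball suffices. *)
Lemma chain_lipschitz (f : S -> R) M p q s e : 0 <= M -> (forall z, dlt p z e -> grad_le f M z) ->
  piecewise_C1 A p q s -> chain_len s < e -> `|f q - f p| <= M * chain_len s.
Proof.
move=> M0; elim: s p e => [|c s IH] p e H /=.
  by move=> -> _; rewrite subrr normr0 mulr_ge0 // chain_len_ge0.
move=> [hc c0 h]; rewrite /chain_len big_cons -/(chain_len s) => l.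
have b1 : 0 <= (1 : R) <= 1 by rewrite ler01 lexx.
have b0 : 0 <= (0 : R) <= 1 by rewrite ler01 lexx.
have lc : curve_length X c < e by rewrite (le_lt_trans _ l) // lerDl chain_len_ge0.
have h1 : `|f (c 1) - f (c 0)| <= M * curve_length X c.
  apply: (curve_lipschitz HI hc) => t i ht ct; apply: H => //.
  by rewrite -c0; exact: dlt_subcurve.
have h2 : `|f q - f (c 1)| <= M * chain_len s.
  apply: (IH (c 1) (e - curve_length X c)) => //; last by rewrite ltrBrDl.
  move=> z [s' [hs' l']]; apply: H; exists (c :: s'); split; first by [].
  by rewrite /chain_len big_cons -/(chain_len s'); move: l'; rewrite ltrBrDl.
rewrite mulrDr -c0 (_ : f q - f (c 0) = (f (c 1) - f (c 0)) + (f q - f (c 1))); last by ring.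
by rewrite (le_trans (ler_normD _ _)) // lerD.
Qed.

Lemma grad_le_dot (w : 'rV[R]_4) z : dot w w = 1 -> grad_le (fun x => dot w (X x)) 1 z.
Proof.
move=> ww i dz; have [sF _] := HI i; have dF := smooth_diff sF (mem_cimg dz).
rewrite -[(fun x => dot w (X x)) \o cinv i]/(fun y => dot w (local_param X i y)); split.
  by apply: diff_dot => //; exact: differentiable_cst.
move=> v; rewrite dd_dotc // (le_trans (dot_le_enorm _ _)) //.
by rewrite /enorm ww sqrtr1.
Qed.

Lemma dlt_dot p q e (w : 'rV[R]_4) : dot w w = 1 -> dlt p q e -> `|dot w (X q) - dot w (X p)| < e.
Proof.
move=> ww [s [h l]]; apply: le_lt_trans l.
have := @chain_lipschitz (fun x => dot w (X x)) 1 p q s (chain_len s + 1) ler01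
  (fun z _ => @grad_le_dot w z ww) h.
by rewrite mul1r; apply; rewrite ltrDl.
Qed.

End Distance.

Section GlobalEnergy.
Variables (R : realType) (S : topologicalType) (A : oriented_atlas R S) (J : 'I_3 -> 'M[R]_4).
Variables (X : S -> 'rV[R]_4) (V0 : 'rV[R]_4) (phi : S -> 'rV[R]_3).
Hypothesis HK : hyperkahler J.
Hypothesis HPP : forall i : chart A, soliton_patch J V0 (cimg i) (local_param X i) (phi \o cinv i).

Definition chart_at (x : S) : chart A := projT1 (cid (cdom_cover A x)).

Lemma chart_atP x : cdom (chart_at x) x.
Proof. exact: (projT2 (cid (cdom_cover A x))). Qed.

Definition gsmooth (W : normedModType R) (f : S -> W) := forall i : chart A, smooth (cimg i) (f \o cinv i).

Definition genergy n (f : S -> 'rV[R]_n) (x : S) : R :=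
  energy (local_param X (chart_at x)) (f \o cinv (chart_at x)) (cmap (chart_at x) x).

Lemma overlap_near (i j : chart A) x : cdom i x -> cdom j x ->
  \forall u \near cmap i x, cimg i u /\ cdom j (cinv i u).
Proof.
move=> di dj; apply: filterI; first by apply: open_nbhs_nbhs; split; [exact: cimg_open|exact: mem_cimg].
have : nbhs (cinv i (cmap i x)) (cdom j).
  by rewrite cmapK //; apply: open_nbhs_nbhs; split; [exact: cdom_open|].
exact: (cinv_continuous (mem_cimg di)).
Qed.

Lemma dd_diff (V W : normedModType R) (h : V -> W) y v : differentiable h y -> dd v h y = 'd h y v.
Proof. by move=> dh; rewrite ddE deriveE. Qed.

Lemma transition_dd (W : normedModType R) (f : S -> W) (i j : chart A) x v :
  cdom i x -> cdom j x -> differentiable (f \o cinv j) (cmap j x) ->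
  dd v (f \o cinv i) (cmap i x) = dd (dd v (cmap j \o cinv i) (cmap i x)) (f \o cinv j) (cmap j x).
Proof.
move=> di dj df; pose T := cmap j \o cinv i.
have Tx : T (cmap i x) = cmap j x by rewrite /T /= cmapK.
have dT : differentiable T (cmap i x).
  by apply: (smooth_diff (@transition_smooth _ _ A i j)); exists x.
have E : {near cmap i x, ((f \o cinv j) \o T) =1 (f \o cinv i)}.
  by apply: filterS (overlap_near di dj) => u [_ dju]; rewrite /T /= cmapK.
have df' : differentiable (f \o cinv j) (T (cmap i x)) by rewrite Tx.
have dc := differentiable_comp dT df'.
have [d1 E1] := near_eq_diff E dc.
rewrite (dd_diff v d1) E1 (diff_comp dT df') /=.
by rewrite (dd_diff _ df) (dd_diff _ dT) Tx.
Qed.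

Lemma transition_onb (i j : chart A) x v1 v2 : cdom i x -> cdom j x ->
  onb_at (local_param X i) (cmap i x) v1 v2 ->
  onb_at (local_param X j) (cmap j x) (dd v1 (cmap j \o cinv i) (cmap i x)) (dd v2 (cmap j \o cinv i) (cmap i x)).
Proof.
move=> di dj [d h11 h22 h12].
have dF := pdiff (HPP j) (mem_cimg dj).
have E v := transition_dd v di dj dF.
split; rewrite -?E //.
have mx : (cmap i @` (cdom i `&` cdom j)) (cmap i x) by exists x.
have dT := smooth_diff (@transition_smooth _ _ A i j) mx.
have J0 := transition_oriented mx.
have Ev v : dd v (cmap j \o cinv i) (cmap i x) = v *m jacobian (cmap j \o cinv i) (cmap i x).
  by rewrite (dd_diff v dT) /jacobian mul_rV_lin1.
by rewrite !Ev -det_col2 -mul_col_mx det_mulmx det_col2 mulr_gt0.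
Qed.

(** Transition maps carry oriented orthonormal pairs to such pairs, and for such a pair the energy
    is a sum of squared lengths of derivatives which are the same in both charts. *)
Lemma genergyE n (f : S -> 'rV[R]_n) (i : chart A) x : gsmooth f -> cdom i x ->
  genergy f x = energy (local_param X i) (f \o cinv i) (cmap i x).
Proof.
move=> sf di; have dj := chart_atP x; set j := chart_at x in dj *.
have Ui := mem_cimg di; have Uj := mem_cimg dj.
have [v1 [v2 o]] := exists_onb (HPP i) Ui.
have o' := transition_onb di dj o.
have dfi := smooth_diff (sf i) Ui; have dfj := smooth_diff (sf j) Uj.
rewrite /genergy -/j (energy_onb HK (HPP i) Ui dfi o) (energy_onb HK (HPP j) Uj dfj o').
by rewrite -!(transition_dd _ di dj dfj).
Qed.

Lemma cinvK (i : chart A) u : cimg i u -> cdom i (cinv i u) /\ cmap i (cinv i u) = u.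
Proof. by move=> [x dx <-]; rewrite cmapK. Qed.

Lemma genergy_smooth n (f : S -> 'rV[R]_n) : gsmooth f -> gsmooth (genergy f).
Proof.
move=> sf i; have P := HPP i.
apply: (smooth_ext (p_open P) _ (energy_smooth HK P (sf i))) => u Uu.
by have [d E] := cinvK Uu; rewrite /= (genergyE sf d) E.
Qed.

Lemma gsmooth_continuous (W : normedModType R) (f : S -> W) : gsmooth f -> continuous f.
Proof.
move=> sf x; have [i di] := cdom_cover A x.
have E : {near x, (f \o cinv i) \o cmap i =1 f}.
  have : nbhs x (cdom i) by apply: open_nbhs_nbhs; split; [exact: cdom_open|].
  by apply: filterS => y dy /=; rewrite cmapK.
rewrite /continuous_at -(nbhs_singleton E).
apply: (cvg_trans (near_eq_cvg E)).
apply: (@continuous_comp _ _ _ (cmap i) (f \o cinv i)); first exact: cmap_continuous.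
exact: smooth_continuous (sf i) (mem_cimg di).
Qed.

End GlobalEnergy.

(** * Sections of projections to a plane *)

Section StrictDifferentiability.
Variable R : realType.

Lemma rV_norm_le n (v : 'rV[R]_n) (e : R) : 0 <= e -> (forall j, `|v 0 j| <= e) -> `|v| <= e.
Proof.
move=> e0 h; rewrite [`|v|]mx_normrE; apply: bigmax_le => // -[i j] _ /=.
by rewrite (ord1 i).
Qed.

Lemma rV_coord_le n (v : 'rV[R]_n) j : `|v 0 j| <= `|v|.
Proof. by rewrite [`|v|]mx_normrE; exact: (@le_bigmax _ _ _ 0 (fun k => `|v k.1 k.2|) (0, j)). Qed.

Lemma dot_sup n (v : 'rV[R]_n) : dot v v <= n%:R * `|v| ^+ 2.
Proof.
apply: (le_trans (_ : _ <= \sum_(i < n) `|v| ^+ 2)); last by rewrite sumr_const card_ord mulr_natl.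
apply: ler_sum => i _; rewrite -expr2 -real_normK ?num_real //.
by rewrite ler_pXn2r ?nnegrE // rV_coord_le.
Qed.

Lemma sup_dot n (v : 'rV[R]_n) : `|v| ^+ 2 <= dot v v.
Proof.
rewrite -enorm_sq ler_pXn2r ?nnegrE ?enorm_ge0 //; apply: rV_norm_le; first exact: enorm_ge0.
move=> j; rewrite -(@ler_pXn2r _ 2) ?nnegrE ?enorm_ge0 // enorm_sq real_normK ?num_real //.
rewrite /dot (bigD1 j) //= -expr2 lerDl.
by apply: sumr_ge0 => i _; rewrite -expr2 sqr_ge0.
Qed.

Lemma enormD n (v w : 'rV[R]_n) : enorm (v + w) <= enorm v + enorm w.
Proof.
rewrite -(@ler_pXn2r _ 2) ?nnegrE ?addr_ge0 ?enorm_ge0 // sqrrD !enorm_sq !(dotDl, dotDr) (dotC w v).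
have := dot_le_enorm v w; rewrite ler_norml => /andP[_ h].
by move: h; rewrite -mulr_natr; move: (dot v v) (dot v w) (dot w w) (enorm v * enorm w) => a b c d; lra.
Qed.

Variables (U : set 'rV[R]_2) (u0 : 'rV[R]_2).
Hypothesis oU : open U.
Hypothesis Uu : U u0.

Lemma near_partial n (g : 'rV[R]_2 -> 'rV[R]_n) (e : R) : smooth U g -> 0 < e ->
  exists2 d : R, 0 < d & forall z, `|z - u0| < d -> U z /\
    forall w, `|dd w g z - dd w g u0| <= e * `|w|.
Proof.
move=> sg e0.
have H v : \forall z \near u0, `|dd v g z - dd v g u0| < e / 2.
  have := smooth_continuous (smooth_dd v sg) Uu.
  rewrite /prop_for /continuous_at => /cvgrPdist_lt /(_ (e / 2)).
  by rewrite divr_gt0 // => /(_ isT); apply: filterS => z; rewrite distrC.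
have HU : \forall z \near u0, U z by apply: open_nbhs_nbhs.
have H3 : \forall z \near u0, [/\ `|dd (b0 R) g z - dd (b0 R) g u0| < e / 2,
    `|dd (b1 R) g z - dd (b1 R) g u0| < e / 2 & U z].
  by near=> z; split; near: z; [exact: H|exact: H|exact: HU].
move/nbhs_ballP: H3 => [d /= d0 Hd].
exists d => // z zd; have [|h1 h2 Uz] := Hd z; first by rewrite -ball_normE /= distrC.
split=> // w.
have dgz := smooth_diff sg Uz; have dg0 := smooth_diff sg Uu.
rewrite [X in dd X g z]vec2E [X in dd X g u0]vec2E !(dd_comb _ _ _ _ dgz) !(dd_comb _ _ _ _ dg0).
rewrite opprD addrACA -!scalerBr (le_trans (ler_normD _ _)) // !normrZ.
have k1 := ler_pM (normr_ge0 _) (normr_ge0 _) (rV_coord_le w 0) (ltW h1).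
have k2 := ler_pM (normr_ge0 _) (normr_ge0 _) (rV_coord_le w 1) (ltW h2).
by apply: (le_trans (lerD k1 k2)); rewrite -mulrDr -splitr mulrC.
Unshelve. all: by end_near. Qed.

(** The mean value theorem is applied to each coordinate; since the norm is the sup norm, no
    dimensional constant is lost. *)
Lemma strict_diff n (g : 'rV[R]_2 -> 'rV[R]_n) (e d : R) : smooth U g -> 0 <= e ->
  (forall z, `|z - u0| < d -> U z /\ forall w, `|dd w g z - dd w g u0| <= e * `|w|) ->
  forall u v, `|u - u0| < d -> `|v - u0| < d -> `|g u - g v - dd (u - v) g u0| <= e * `|u - v|.
Proof.
move=> sg e0 Hd u v ud vd; set w := u - v.
have seg (t : R) : 0 <= t <= 1 -> `|v + t *: w - u0| < d.
  move=> /andP[t0 t1].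
  have -> : v + t *: w - u0 = (1 - t) *: (v - u0) + t *: (u - u0).
    by rewrite /w; apply/rowP => j; rewrite !mxE; ring.
  apply: (le_lt_trans (ler_normD _ _)); rewrite !normrZ (ger0_norm t0) ger0_norm ?subr_ge0 //.
  have [->|tn0] := eqVneq t 0; first by rewrite subr0 mul1r mul0r addr0.
  have tp : 0 < t by rewrite lt_neqAle eq_sym tn0.
  have k1 : (1 - t) * `|v - u0| <= (1 - t) * d by rewrite ler_wpM2l ?subr_ge0 // ltW.
  have k2 : t * `|u - u0| < t * d by rewrite ltr_pM2l.
  by have := ler_ltD k1 k2; rewrite -mulrDl subrK mul1r.
apply: rV_norm_le; first by rewrite mulr_ge0.
move=> j; pose k (t : R) := g (v + t *: w) 0 j.
have dk (t : R) : 0 <= t <= 1 -> is_derive t (1 : R) k (dd w g (v + t *: w) 0 j).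
  move=> ht; have [Uz _] := Hd _ (seg t ht); have dg := smooth_diff sg Uz.
  have := line_derive (differentiable_comp_coord 0 j dg : differentiable _ (v + t *: w)).
  by rewrite deriveE_dd -dd_coord.
have kc : {within `[0, 1], continuous k}.
  apply: continuous_in_subspaceT => x; rewrite inE /= in_itv /= => h.
  exact: is_derive_continuous (dk _ h).
have dk' (x : R) : x \in `]0, 1[ -> is_derive x (1 : R) k (dd w g (v + x *: w) 0 j).
  by rewrite in_itv /= => /andP[/ltW h0 /ltW h1]; apply: dk; rewrite h0.
have [t] := MVT ltr01 dk' kc; rewrite in_itv /= => /andP[/ltW t0 /ltW t1].
rewrite /k scale1r scale0r addr0 subr0 mulr1 (_ : v + w = u); last by rewrite /w addrC subrK.
move=> E.
have [|Uz /(_ w)] := Hd (v + t *: w); first by apply: seg; rewrite t0.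
apply: le_trans; apply: le_trans (rV_coord_le _ j).
by rewrite !mxE E.
Qed.

End StrictDifferentiability.

Section LocalStructure.
Variables (R : realType) (S : topologicalType) (A : oriented_atlas R S) (J : 'I_3 -> 'M[R]_4).
Variables (X : S -> 'rV[R]_4) (V0 : 'rV[R]_4) (phi : S -> 'rV[R]_3).
Hypothesis HK : hyperkahler J.
Hypothesis HI : immersion A X.
Hypothesis HPP : forall i : chart A, soliton_patch J V0 (cimg i) (local_param X i) (phi \o cinv i).
Variables p1 p2 : 'rV[R]_4.
Hypothesis pp1 : dot p1 p1 = 1.
Hypothesis pp2 : dot p2 p2 = 1.
Hypothesis pp12 : dot p1 p2 = 0.

Definition plane_proj (x : S) : 'rV[R]_2 := proj2 p1 p2 (X x).
Local Notation P := plane_proj.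
Local Notation E := (genergy A X plane_proj).

Lemma plane_proj_smooth : gsmooth A P.
Proof. by move=> i; exact: (projF_smooth (HPP i)). Qed.

Lemma dd_plane_proj (i : chart A) u v : cimg i u ->
  dd v (P \o cinv i) u = proj2 p1 p2 (dd v (local_param X i) u).
Proof. by move=> Uu; exact: (D_projF (HPP i)). Qed.

(** For an orthonormal pair the energy is the sum of the squared lengths of the two projections. By
    Bessel the vector orthogonal to [w] of the same length contributes at most its full square, so
    [w] keeps at least the share 3/2 - 1 of its own. *)
Lemma proj2_lower (i : chart A) x w : cdom i x -> 3 / 2 < E x ->
  dot (dd w (local_param X i) (cmap i x)) (dd w (local_param X i) (cmap i x))
  <= 2 * dot (dd w (P \o cinv i) (cmap i x)) (dd w (P \o cinv i) (cmap i x)).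
Proof.
move=> dx Ex; have Ux := mem_cimg dx.
have [v1 [v2 o]] := exists_onb (HPP i) Ux; have [d h11 h22 h12] := o.
have dF := pdiff (HPP i) Ux.
have sP := plane_proj_smooth i.
move: Ex; rewrite (genergyE HK HPP plane_proj_smooth dx) (energy_onb HK (HPP i) Ux (smooth_diff sP Ux) o).
rewrite !dd_plane_proj // !dot_proj2.
have [a [b ->]] := det2_decomp w d; rewrite (dd_comb _ _ _ _ dF).
move: (dd v1 (local_param X i) (cmap i x)) (dd v2 (local_param X i) (cmap i x)) h11 h22 h12 => e1 e2 h11 h22 h12.
have := bessel2 (- b *: e1 + a *: e2) pp1 pp2 pp12.
rewrite !(dotDl, dotDr, dotZl, dotZr, dotNl, dotNr) h11 h22 h12 (dotC e2 e1) h12 !(dotC e1 p1, dotC e1 p2, dotC e2 p1, dotC e2 p2).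
move: (dot p1 e1) (dot p1 e2) (dot p2 e1) (dot p2 e2) => x1 x2 y1 y2 hb Ex.
have ab : 0 <= a ^+ 2 + b ^+ 2 by rewrite addr_ge0 ?sqr_ge0.
have := ler_wpM2l ab (ltW Ex).
by move: hb; lra.
Qed.

Lemma enorm_onb_lower (i : chart A) x : cdom i x -> exists2 m : R, 0 < m &
  forall w, m * `|w| <= enorm (dd w (local_param X i) (cmap i x)).
Proof.
move=> dx; have Ux := mem_cimg dx.
have [v1 [v2 o]] := exists_onb (HPP i) Ux; have [d h11 h22 h12] := o.
have dF := pdiff (HPP i) Ux.
have N0 : 0 < `|v1| + `|v2| by rewrite ltr_pwDl // normr_gt0 (det2_neq0l d).
exists (`|v1| + `|v2|)^-1; first by rewrite invr_gt0.
move=> w; rewrite mulrC ler_pdivrMr //.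
have [a [b ->]] := det2_decomp w d; rewrite (dd_comb _ _ _ _ dF).
set n := enorm _.
have nE : n ^+ 2 = a ^+ 2 + b ^+ 2.
  by rewrite /n enorm_sq !(dotDl, dotDr, dotZl, dotZr) (dotC (dd v2 _ _)) h11 h22 h12; ring.
have hn (c : R) : c ^+ 2 <= n ^+ 2 -> `|c| <= n.
  by move=> h; rewrite -(@ler_pXn2r _ 2) ?nnegrE ?enorm_ge0 // real_normK ?num_real.
have ha : `|a| <= n by apply: hn; rewrite nE lerDl sqr_ge0.
have hb : `|b| <= n by apply: hn; rewrite nE lerDr sqr_ge0.
rewrite (le_trans (ler_normD _ _)) // !normrZ mulrDr lerD // ler_wpM2r //.
Qed.

Lemma solve2 (y0 y1 z : 'rV[R]_2) : (forall a b, a *: y0 + b *: y1 = 0 -> a = 0 /\ b = 0) ->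
  exists a b, z = a *: y0 + b *: y1.
Proof.
move=> inj; have D0 : det2 y0 y1 != 0.
  apply/eqP => D; have h j : y1 0 j *: y0 + (- y0 0 j) *: y1 = 0.
    apply/rowP => k; rewrite !mxE; move: D; rewrite /det2 => D.
    by move: j k; apply: I2_case; apply: I2_case; lra.
  have [h1 /eqP] := inj _ _ (h 0); rewrite oppr_eq0 => /eqP h2.
  have [h3 /eqP] := inj _ _ (h 1); rewrite oppr_eq0 => /eqP h4.
  have y00 : y0 = 0 by rewrite (vec2E y0) h2 h4 !scale0r addr0.
  have [|/eqP] := inj 1 0; last by rewrite oner_eq0.
  by rewrite y00 scaler0 scale0r addr0.
exists (det2 z y1 / det2 y0 y1), (det2 y0 z / det2 y0 y1).
rewrite [LHS]vec2E [RHS]vec2E; congr (_ *: _ + _ *: _); rewrite !mxE; move: D0; rewrite /det2 => D0; by field.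
Qed.

Lemma low_num (m b a n c c' : R) : 0 <= n -> a <= m / 20 * b -> n / 2 <= c -> m * b <= n ->
  c - a <= c' -> n * (2 / 5) <= c'.
Proof. by move=> *; lra. Qed.

Lemma len_num (m b a n c : R) : a <= m / 20 * b -> c <= 2 * a -> m * b <= n ->
  c + n <= n * (11 / 10).
Proof. by move=> *; lra. Qed.

(** At the centre the projected derivative is at least half the length in the sup norm, by
    [proj2_lower] and the comparison of norms in the plane. Perturbations of m/20 leave 1/2 - 1/20
    >= 2/5 of the length for the projection and at most 1 + 2/20 = 11/10 for the curve, and 11/10
    divided by 2/5 is less than 3, the factor of the last clause. *)
Lemma good_disc (i : chart A) x : cdom i x -> 3 / 2 < E x ->
  exists d m : R, [/\ 0 < d /\ 0 < m,
    (forall u, `|u - cmap i x| < d -> cimg i u /\ 3 / 2 < E (cinv i u)),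
    (forall u v, `|u - cmap i x| < d -> `|v - cmap i x| < d ->
       m * `|u - v| <= `|P (cinv i u) - P (cinv i v)|),
    (forall u w, `|u - cmap i x| < d -> m * `|w| <= `|dd w (P \o cinv i) u|) &
    (forall u v e, `|u - cmap i x| < d -> `|v - cmap i x| < d ->
       3 * `|P (cinv i u) - P (cinv i v)| < e -> dlt A X (cinv i u) (cinv i v) e)].
Proof.
move=> dx Ex; have Ux := mem_cimg dx; have oU := p_open (HPP i).
have sP := plane_proj_smooth i; have sF := p_smooth (HPP i).
have [m m0 hm] := enorm_onb_lower dx.
have em : 0 < m / 20 by rewrite divr_gt0.
have [d1 d10 H1] := near_partial oU Ux sP em.
have [d2 d20 H2] := near_partial oU Ux sF em.
have sE := genergy_smooth HK HPP plane_proj_smooth.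
have : \forall u \near cmap i x, 3 / 2 < E (cinv i u).
  have := smooth_continuous (sE i) Ux; rewrite /prop_for /continuous_at => /cvgr_gt; apply.
  by rewrite /= cmapK.
move=> /nbhs_ballP[d3 /= d30 H3].
pose d := Num.min d1 (Num.min d2 d3).
have dle u : `|u - cmap i x| < d -> [/\ `|u - cmap i x| < d1, `|u - cmap i x| < d2 & `|u - cmap i x| < d3].
  by rewrite /d !lt_min => /andP[-> /andP[-> ->]].
set F := local_param X i in sF hm H2; set u0 := cmap i x in Ux hm H1 H2 H3 dle *.
pose N w := enorm (dd w F u0).
have low w : N w / 2 <= `|dd w (P \o cinv i) u0|.
  rewrite ler_pdivrMr // -(@ler_pXn2r _ 2) ?nnegrE ?enorm_ge0 ?mulr_ge0 // /N enorm_sq.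
  apply: (le_trans (proj2_lower w dx Ex)).
  have := dot_sup (dd w (P \o cinv i) u0); rewrite exprMn.
  move: (dot _ _) (`|_|) => s t h; rewrite (_ : 2 ^+ 2 = 4); last by rewrite expr2 -natrM.
  by lra.
have low' u w : `|u - u0| < d -> m * `|w| * (2 / 5) <= `|dd w (P \o cinv i) u|.
  move=> /dle[/H1[_ /(_ w) h] _ _]; have := low w; have := hm w; rewrite -/(N w) => k1 k2.
  have := lerB_dist (dd w (P \o cinv i) u0) (dd w (P \o cinv i) u0 - dd w (P \o cinv i) u).
  rewrite subKr [X in _ - X]distrC => k3.
  have k4 : m * `|w| * (2 / 5) <= N w * (2 / 5) by rewrite ler_wpM2r // divr_ge0.
  apply: (le_trans k4).
  exact: low_num (enorm_ge0 _) h k2 k1 k3.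
have inc u v : `|u - u0| < d -> `|v - u0| < d -> N (u - v) * (2 / 5) <= `|P (cinv i u) - P (cinv i v)|.
  move=> /dle[ud _ _] /dle[vd _ _].
  have := strict_diff sP (ltW em) H1 ud vd => /= h.
  have := low (u - v); have := hm (u - v); rewrite -/(N _) => k1 k2.
  have := lerB_dist (dd (u - v) (P \o cinv i) u0) (dd (u - v) (P \o cinv i) u0 - (P (cinv i u) - P (cinv i v))).
  rewrite subKr [X in `|_| - X <= _]distrC => k3.
  exact: low_num (enorm_ge0 _) h k2 k1 k3.
have len z w : `|z - u0| < d -> enorm (dd w F z) <= N w * (11 / 10).
  move=> /dle[_ /H2[_ /(_ w) h] _].
  rewrite -[dd w F z](subrK (dd w F u0)); apply: (le_trans (enormD _ _)).
  have k1 : enorm (dd w F z - dd w F u0) <= 2 * `|dd w F z - dd w F u0|.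
    rewrite -(@ler_pXn2r _ 2) ?nnegrE ?enorm_ge0 ?mulr_ge0 // enorm_sq exprMn.
    by rewrite (_ : 2 ^+ 2 = 4%:R) ?dot_sup // expr2 -natrM.
  have k2 := hm w; rewrite -/(N w) in k2 *.
  exact: len_num h k1 k2.
exists d, (m * (2 / 5)); split.
- by rewrite /d !lt_min d10 d20 d30 mulr_gt0 // divr_gt0.
- move=> u /dle[/H1[Uu _] _ u3]; split=> //.
  by apply: H3; rewrite -ball_normE /= distrC.
- move=> u v ud vd; apply: le_trans (inc u v ud vd).
  by rewrite mulrAC ler_wpM2r ?divr_ge0 // hm.
- by move=> u w ud; rewrite mulrAC; exact: low'.
- move=> u v e ud vd he.
  have seg (t : R) : 0 <= t <= 1 -> `|u + t *: (v - u) - u0| < d.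
    move=> /andP[t0 t1].
    have -> : u + t *: (v - u) - u0 = (1 - t) *: (u - u0) + t *: (v - u0).
      by apply/rowP => j; rewrite !mxE; ring.
    apply: (le_lt_trans (ler_normD _ _)); rewrite !normrZ (ger0_norm t0) ger0_norm ?subr_ge0 //.
    have k1 : (1 - t) * `|u - u0| <= (1 - t) * Num.max `|u - u0| `|v - u0|.
      by rewrite ler_wpM2l ?subr_ge0 // le_max lexx.
    have k2 : t * `|v - u0| <= t * Num.max `|u - u0| `|v - u0|.
      by rewrite ler_wpM2l // le_max lexx orbT.
    apply: (le_lt_trans (lerD k1 k2)); rewrite -mulrDl subrK mul1r.
    by rewrite gt_max ud vd.
  have im (s : R) : 0 <= s <= 1 -> cimg i (u + s *: (v - u)).
    by move=> /seg/dle[/H1[]].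
  have [hc c0 c1 hl] := segment_curve HI im (fun s hs => len _ (v - u) (seg s hs)).
  have := dlt_curve hc; rewrite c0 c1 (addrC u (v - u)) subrK; apply.
  apply: le_lt_trans he; apply: (le_trans hl).
  have := inc v u vd ud; rewrite distrC; move: (normr_ge0 (P (cinv i u) - P (cinv i v))).
  by move: `|_| (N _) => p n; lra.
Qed.

End LocalStructure.

Section Topology.
Variable R : realType.

Lemma disc_compact n (u0 : 'rV[R]_n) (r : R) : compact [set u : 'rV[R]_n | `|u - u0| <= r].
Proof.
have [r0|r0] := ltP r 0.
  rewrite (_ : [set u | _] = set0); first exact: compact0.
  by rewrite -subset0 => u /= h; have := le_trans (normr_ge0 _) h; rewrite leNgt r0.
rewrite (_ : [set u | _] = [set u : 'rV[R]_n | forall j, `[u0 0 j - r, u0 0 j + r]%classic (u ord0 j)]).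
  exact: (@rV_compact R n (fun j => `[u0 0 j - r, u0 0 j + r]%classic) (fun j => @segment_compact R _ _)).
rewrite eqEsubset; split=> u /= h.
  move=> j; have := le_trans (rV_coord_le (u - u0) j) h.
  by rewrite !mxE ler_distl in_itv.
apply: rV_norm_le => // j; have := h j.
by rewrite !mxE ler_distl in_itv.
Qed.

Lemma open_disc n (u0 : 'rV[R]_n) (r : R) : open [set u : 'rV[R]_n | `|u - u0| < r].
Proof.
rewrite openE => u /= h; rewrite /interior; apply/nbhs_ballP.
exists (r - `|u - u0|) => /=; first by rewrite subr_gt0.
move=> v; rewrite -ball_normE /= => hv.
rewrite -(subrK u v) -addrA (le_lt_trans (ler_normD _ _)) // -ltrBrDr.
by rewrite distrC.
Qed.

Lemma dist_continuous (V W : normedModType R) (f : V -> W) (x : V) (m r : R) : 0 < m -> 0 < r ->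
  (forall y, `|y - x| < r -> m * `|f x - f y| <= `|x - y|) -> {for x, continuous f}.
Proof.
move=> m0 r0 h; rewrite /prop_for /continuous_at; apply/cvgrPdist_lt => e e0; near=> y.
have h1 : `|y - x| < r.
  by rewrite distrC; near: y; apply/nbhs_ballP; exists r => // y; rewrite -ball_normE.
rewrite -(ltr_pM2l m0) (le_lt_trans (h y h1)) //.
near: y; apply/nbhs_ballP; exists (m * e) => /=; first by rewrite mulr_gt0.
by move=> y; rewrite -ball_normE.
Unshelve. all: by end_near. Qed.

End Topology.

(** * Local sections and the topology of the intrinsic distance *)

Section LocalSection.
Variables (R : realType) (S : topologicalType) (A : oriented_atlas R S) (J : 'I_3 -> 'M[R]_4).
Variables (X : S -> 'rV[R]_4) (V0 : 'rV[R]_4) (phi : S -> 'rV[R]_3).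
Hypothesis HK : hyperkahler J.
Hypothesis HI : immersion A X.
Hypothesis HS : hausdorff_space S.
Hypothesis HPP : forall i : chart A, soliton_patch J V0 (cimg i) (local_param X i) (phi \o cinv i).
Variables p1 p2 : 'rV[R]_4.
Hypothesis pp1 : dot p1 p1 = 1.
Hypothesis pp2 : dot p2 p2 = 1.
Hypothesis pp12 : dot p1 p2 = 0.
Local Notation P := (plane_proj X p1 p2).
Local Notation E := (genergy A X P).

Lemma dd_lin (g : 'rV[R]_2 -> 'rV[R]_2) u a b : differentiable g u ->
  dd (a *: b0 R + b *: b1 R) g u = a *: dd (b0 R) g u + b *: dd (b1 R) g u.
Proof. by move=> dg; rewrite (dd_comb _ _ _ _ dg). Qed.

Lemma vec2_norm0 (a b : R) : `|a *: b0 R + b *: b1 R| = 0 -> a = 0 /\ b = 0.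
Proof.
move=> /eqP; rewrite normr_eq0 => /eqP/rowP h; have := h 0; have := h 1.
by rewrite !mxE /= !mulr0 !mulr1 addr0 add0r.
Qed.

(* The squared distance to w has an interior minimum, which is a solution by nondegeneracy. *)
Lemma disc_onto (U : set 'rV[R]_2) (g : 'rV[R]_2 -> 'rV[R]_2) u0 (d m : R) w : open U -> smooth U g ->
  0 < d -> 0 < m -> (forall u, `|u - u0| < d -> U u) ->
  (forall u v, `|u - u0| < d -> `|v - u0| < d -> m * `|u - v| <= `|g u - g v|) ->
  (forall u v, `|u - u0| < d -> m * `|v| <= `|dd v g u|) ->
  `|w - g u0| < m * d / 8 -> exists u, `|u - u0| < d /\ g u = w.
Proof.
move=> oU sg d0 m0 dU inj low hw.
pose f u := dot (g u - w) (g u - w); pose C := [set u : 'rV[R]_2 | `|u - u0| <= d / 2].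
have dC u : C u -> `|u - u0| < d by move=> h; apply: (le_lt_trans h); rewrite ltr_pdivrMr // ltr_pMr // ltr1n.
have sf : smooth U f.
  have s : smooth U (fun u => g u - w) by apply: smoothD => //; exact: smooth_cst.
  exact: smooth_dot.
have C0 : C u0 by rewrite /C /= subrr normr0 divr_ge0 // ltW.
have cf : {within C, continuous f}.
  by apply: continuous_in_subspaceT => u; rewrite inE => /dC/dU Uu; exact: smooth_continuous sf Uu.
have cC : compact C := @disc_compact R 2 u0 (d / 2).
have Cn0 : C !=set0 by exists u0.
have [u1] := compact_EVT_min Cn0 cC cf.
rewrite inE => Cu1 mn.
have u1d := dC _ Cu1; have Uu1 := dU _ u1d.
have md : 0 < m * d / 8 by rewrite divr_gt0 // mulr_gt0.
have f0 : f u0 <= 2 * (m * d / 8) ^+ 2.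
  apply: (le_trans (dot_sup _)); rewrite ler_pM2l //.
  by rewrite ler_pXn2r ?nnegrE // ?(ltW md) // distrC ltW.
(* On the boundary the distance from [g u1] to [w] is at least m d / 2 - m d / 8 = 3 (m d / 8), so
   [f] is at least 9 (m d / 8)^2; at the centre it is at most 2 (m d / 8)^2, the 2 being the number
   of coordinates. *)
have inner : `|u1 - u0| < d / 2.
  rewrite lt_neqAle Cu1 andbT; apply/eqP => eqd.
  have h1 := inj u1 u0 u1d (dC _ C0); rewrite eqd in h1.
  have h2 : 3 * (m * d / 8) <= `|g u1 - w|.
    have e1 : (g u1 - g u0) - (w - g u0) = g u1 - w by rewrite opprB addrA subrK.
    have := lerB_dist (g u1 - g u0) (w - g u0); rewrite e1.
    by move: h1 hw; move: `|g u1 - g u0| `|w - g u0| `|g u1 - w| => a b c; lra.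
  have h3 : (3 * (m * d / 8)) ^+ 2 <= f u1.
    have h30 : 0 <= 3 * (m * d / 8) by rewrite mulr_ge0 // ltW.
    by apply: (le_trans _ (sup_dot _)); rewrite ler_pXn2r ?nnegrE.
  have := mn u0; rewrite inE => /(_ C0) h4.
  have := le_trans (le_trans h3 h4) f0; rewrite exprMn (_ : 3 ^+ 2 = 9); last by rewrite expr2 -natrM.
  have : 0 < (m * d / 8) ^+ 2 by rewrite exprn_gt0.
  by move: (_ ^+ 2) => k; lra.
have crit v : dd v f u1 = 0.
  have sN : smooth U (fun u => - f u) by exact: smoothN.
  have mx : \forall y \near u1, - f y <= - f u1.
    have : nbhs u1 [set u | `|u - u0| < d / 2] by apply: open_nbhs_nbhs; split; [exact: open_disc|].
    by apply: filterS => y /= hy; rewrite lerN2; apply: mn; rewrite inE; exact: ltW.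
  have := local_max_derive v oU sN Uu1 mx; rewrite deriveE_dd => h.
  have E0 u : U u -> f u + - f u = 0 by rewrite subrr.
  have := dd_near v oU Uu1 E0; rewrite dd_cst dd_add ?h ?addr0 //; first exact: smooth_diff sf Uu1.
  exact: smooth_diff sN Uu1.
have dg := smooth_diff sg Uu1.
have crit' v : dot (dd v g u1) (g u1 - w) = 0.
  have dgw : differentiable (fun u => g u - w) u1.
    have s : smooth U (fun u => g u - w) by apply: smoothD => //; exact: smooth_cst.
    exact: smooth_diff s Uu1.
  have e2 : dd v (fun u => g u - w) u1 = dd v g u1.
    by rewrite (dd_sub v dg (differentiable_cst w u1)) dd_cst subr0.
  have := crit v; rewrite /f (dd_dot v dgw dgw) e2 (dotC (g u1 - w)).
  by move: (dot _ _) => k h; lra.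
have [|a [b E1]] := @solve2 R (dd (b0 R) g u1) (dd (b1 R) g u1) (g u1 - w).
  move=> a b h; apply: vec2_norm0.
  have := low u1 (a *: b0 R + b *: b1 R) u1d; rewrite dd_lin // h normr0.
  by rewrite pmulr_rle0 // normr_le0 => /eqP ->; rewrite normr0.
exists u1; split=> //; apply/eqP; rewrite -subr_eq0 -dot_eq0 {1}E1 -dd_lin //.
by rewrite crit'.
Qed.

(** A quantitative inverse function theorem for the projection. The factor 3 between intrinsic
    distance and distance of projections is the same at all points, which is what continuation over
    large discs requires. *)
Lemma local_section x : 3 / 2 < E x -> exists N : set S,
  [/\ nbhs x N, (forall z z', N z -> N z' -> P z = P z' -> z = z'),
    (forall z z' e, N z -> N z' -> 3 * `|P z - P z'| < e -> dlt A X z z' e),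
    (forall z, N z -> 3 / 2 < E z) &
    exists (r : R) (Phi : 'rV[R]_2 -> S), [/\ 0 < r, Phi (P x) = x &
      forall w, `|w - P x| < r -> [/\ P (Phi w) = w, N (Phi w) & {for w, continuous Phi}]]].
Proof.
move=> Ex; have [i dx] := cdom_cover A x; have Ux := mem_cimg dx.
have [d [m [[d0 m0] dU inj low len]]] := good_disc HK HI HPP pp1 pp2 pp12 dx Ex.
have sP := plane_proj_smooth HPP p1 p2 i.
set u0 := cmap i x in Ux dU inj low len *.
have x0 : cinv i u0 = x by rewrite cmapK.
pose N := [set z | cdom i z /\ `|cmap i z - u0| < d].
have NE u : `|u - u0| < d -> N (cinv i u).
  by move=> ud; have [Uu _] := dU _ ud; have [d1 E1] := cinvK Uu; rewrite /N /= E1.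
exists N; split.
- apply: filterI; first by apply: open_nbhs_nbhs; split; [exact: cdom_open|].
  have := cmap_continuous dx; rewrite /prop_for /continuous_at => /(_ [set u | `|u - u0| < d]); apply.
  by apply: open_nbhs_nbhs; split; [exact: open_disc|rewrite /= subrr normr0].
- move=> z z' [dz hz] [dz' hz'] Pz.
  have := inj _ _ hz hz'; rewrite !cmapK // Pz subrr normr0 pmulr_rle0 // normr_le0 subr_eq0 => /eqP h.
  by rewrite -(cmapK dz) h cmapK.
- move=> z z' e [dz hz] [dz' hz'] he; rewrite -(cmapK dz) -(cmapK dz').
  by apply: len => //; rewrite !cmapK.
- by move=> z [dz hz]; have [_] := dU _ hz; rewrite cmapK.
pose r := m * d / 8; have r0 : 0 < r by rewrite divr_gt0 // mulr_gt0.
have onto w : `|w - P x| < r -> exists u, `|u - u0| < d /\ P (cinv i u) = w.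
  move=> hw; apply: (disc_onto (cimg_open (o := A) (i := i)) sP d0 m0 _ inj low) => //.
  - by move=> u /dU[].
  - by rewrite /= x0.
pose sol (w : 'rV[R]_2) : 'rV[R]_2 := xget u0 [set u | `|u - u0| < d /\ P (cinv i u) = w].
have solP w : `|w - P x| < r -> `|sol w - u0| < d /\ P (cinv i (sol w)) = w.
  by move=> /onto[u hu]; exact: (@xgetPex _ u0 [set u | `|u - u0| < d /\ P (cinv i u) = w] (ex_intro _ u hu)).
have cs (w : 'rV[R]_2) : `|w - P x| < r -> {for w, continuous sol}.
  move=> hw; have [h1 h2] := solP w hw.
  apply: (dist_continuous (m := m) (r := r - `|w - P x|)) => //; first by rewrite subr_gt0.
  move=> w'; rewrite ltrBrDr => hw'.
  have [k1 k2] : `|sol w' - u0| < d /\ P (cinv i (sol w')) = w'.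
    apply: solP; apply: le_lt_trans hw'; apply: le_trans (ler_normD _ _).
    by rewrite addrA subrK.
  by have := inj _ _ h1 k1; rewrite h2 k2.
exists r, (fun w => cinv i (sol w)); split=> //.
  have hP : `|P x - P x| < r by rewrite subrr normr0.
  have h0 : `|u0 - u0| < d by rewrite subrr normr0.
  have [h1 h2] := solP _ hP.
  have := inj _ _ h1 h0; rewrite h2 x0 subrr normr0 pmulr_rle0 // normr_le0 subr_eq0 => /eqP ->.
  by [].
move=> w hw; have [h1 h2] := solP w hw; split=> //; first exact: NE.
apply: (@continuous_comp _ _ _ sol (cinv i)); first exact: cs.
by have [Uu _] := dU _ h1; exact: cinv_continuous.
Qed.

(** If no point of C outside V were met, then V and C would have the same preimage in [0, 1] under
    the first curve that ends outside V; this preimage would be open, closed and nonempty, hence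
    everything. *)
Lemma chain_cross (V C : set S) s p z e : open V -> closed C -> V `<=` C -> V p -> ~ V z ->
  piecewise_C1 A p z s -> chain_len X s < e -> exists x, [/\ C x, ~ V x & dlt A X p x e].
Proof.
move=> oV cC VC Vp Vz; elim: s p e Vp => [|c s IH] p e Vp /=; first by move=> pz; rewrite -pz in Vz.
move=> [hc c0 h]; rewrite /chain_len big_cons -/(chain_len X s) => l; have [cc _] := hc.
have lc : curve_length X c < e by rewrite (le_lt_trans _ l) // lerDl chain_len_ge0.
have [V1|V1] := pselect (V (c 1)).
  have [|x [Cx Vx dx]] := IH (c 1) (e - curve_length X c) V1 h; first by rewrite ltrBrDl.
  exists x; split=> //; have [s' [hs' l']] := dx.
  exists (c :: s'); split; first by [].
  by rewrite /chain_len big_cons -/(chain_len X s'); move: l'; rewrite ltrBrDl.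
have b0 : 0 <= (0 : R) <= 1 by rewrite ler01 lexx.
apply: contrapT => nx; apply: V1.
have no (t : R) : 0 <= t <= 1 -> C (c t) -> V (c t).
  move=> ht Ct; apply: contrapT => Vt; apply: nx; exists (c t); split=> //.
  by rewrite -c0; exact: dlt_subcurve.
have con := @segment_connected R 0 1.
pose B := [set t : R | 0 <= t <= 1 /\ V (c t)].
have BE : B = `[0, 1]%classic.
  apply: con.
  - by exists 0; split=> //; rewrite c0.
  - exists (c @^-1` V); first by apply: open_comp => // t _; exact: cc.
    by rewrite eqEsubset; split=> t /=; rewrite in_itv.
  - exists (c @^-1` C); first by apply: closed_comp => // t _; exact: cc.
    rewrite eqEsubset; split=> t /=; rewrite in_itv /=.
      by move=> [h1 h2]; split=> //; exact: VC.
    by move=> [h1 h2]; split=> //; exact: no.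
have : B 1 by rewrite BE /= in_itv /= ler01 lexx.
by case.
Qed.

(** A chain leaving a small chart disc meets its boundary, where the projection differs from P x by
    at least [m * k]; the coordinates p1 . X and p2 . X being 1-Lipschitz, its length is at least as
    large. The closed disc is closed in S as a compact subset of a Hausdorff space. *)
Lemma dlt_nbhs x O : 3 / 2 < E x -> nbhs x O -> exists2 e : R, 0 < e & forall z, dlt A X z x e -> O z.
Proof.
move=> Ex nO; have [i dx] := cdom_cover A x; have Ux := mem_cimg dx.
have [d [m [[d0 m0] dU inj low len]]] := good_disc HK HI HPP pp1 pp2 pp12 dx Ex.
set u0 := cmap i x in Ux dU inj low len *.
have x0 : cinv i u0 = x by rewrite cmapK.
have : nbhs u0 (cinv i @^-1` O) by apply: (cinv_continuous Ux); rewrite x0.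
move=> /nbhs_ballP[d1 /= d10 H1].
pose k := Num.min d d1 / 2.
have k0 : 0 < k by rewrite divr_gt0 // lt_min d0.
have mn0 : 0 < Num.min d d1 by rewrite lt_min d0.
have k_lt : k < Num.min d d1 by rewrite /k ltr_pdivrMr // ltr_pMr ?ltr1n.
have kd : k < d by apply: (lt_le_trans k_lt); rewrite ge_min lexx.
have kd1 : k < d1 by apply: (lt_le_trans k_lt); rewrite ge_min lexx orbT.
pose V := cdom i `&` [set z | `|cmap i z - u0| < k].
pose C := cinv i @` [set u | `|u - u0| <= k].
have oV : open V.
  rewrite openE => z [dz hz]; apply: filterI; first by apply: open_nbhs_nbhs; split; [exact: cdom_open|].
  have := cmap_continuous dz; rewrite /prop_for /continuous_at => /(_ [set u | `|u - u0| < k]); apply.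
  by apply: open_nbhs_nbhs; split; [exact: open_disc|].
have cC : closed C.
  apply: compact_closed => //; apply: continuous_compact; last exact: (@disc_compact R 2 u0 k).
  apply: continuous_in_subspaceT => u; rewrite inE /= => hu.
  by have [|Uu _] := dU u; [exact: le_lt_trans kd|exact: cinv_continuous].
have VC : V `<=` C by move=> z [dz hz]; exists (cmap i z); [exact: ltW|rewrite cmapK].
have Vx : V x by split=> //=; rewrite subrr normr0.
exists (m * k); first by rewrite mulr_gt0.
move=> z /(dlt_sym HI)[s [hs l]].
have [[dz hz]|nV] := pselect (V z).
  rewrite -(cmapK dz); apply: H1; rewrite -ball_normE /= distrC.
  exact: lt_trans kd1.
have [y [[u hu <-] nVy dy]] := chain_cross oV cC VC Vx nV hs l.
exfalso; apply: nVy.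
have ud : `|u - u0| < d by exact: le_lt_trans kd.
have [Uu _] := dU _ ud; have [du Eu] := cinvK Uu.
split=> //=; rewrite Eu -(ltr_pM2l m0).
apply: (le_lt_trans (inj u u0 ud _)); first by rewrite subrr normr0.
rewrite x0; have h1 := dlt_dot HI pp1 dy; have h2 := dlt_dot HI pp2 dy.
have hmx : `|P (cinv i u) - P x| <= Num.max `|dot p1 (X (cinv i u)) - dot p1 (X x)| `|dot p2 (X (cinv i u)) - dot p2 (X x)|.
  apply: rV_norm_le; first by rewrite le_max normr_ge0.
  by apply: I2_case; rewrite !mxE /= le_max lexx ?orbT.
by apply: (le_lt_trans hmx); rewrite gt_max h1 h2.
Qed.

End LocalSection.

(** Continuity induction on [0, 1]. It is used along segments, for the uniqueness and the length of
    lifts, and on the radius of the disc, for the existence of sections. *)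
Lemma real_induction (R : realType) (Pr : R -> Prop) : Pr 0 ->
  (forall t, 0 <= t < 1 -> Pr t -> exists2 d, 0 < d & forall s, t < s < t + d -> s <= 1 -> Pr s) ->
  (forall t, 0 < t <= 1 -> (forall s, 0 <= s < t -> Pr s) -> Pr t) -> Pr 1.
Proof.
move=> P0 ext lim; pose B := [set t | 0 <= t <= 1 /\ forall s, 0 <= s <= t -> Pr s].
have B0 : B 0 by split; [rewrite lexx ler01|move=> s; rewrite -eq_le => /eqP <-].
have Bub : ubound B 1 by move=> t [/andP[]].
have sB : has_sup B by split; [exists 0|exists 1].
set m := sup B.
have m0 : 0 <= m by exact: (sup_upper_bound sB B0).
have m1 : m <= 1 by apply: ge_sup => //; exists 0.
have lt_m s : 0 <= s < m -> Pr s.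
  move=> /andP[s0 sm]; have ms : 0 < m - s by rewrite subr_gt0.
  have [t [_ Bt] st] := sup_adherent ms sB.
  apply: Bt; rewrite s0 /=; apply: ltW; apply: le_lt_trans st.
  by rewrite /m subKr.
have Pm : Pr m.
  by move: m0; rewrite le_eqVlt => /predU1P[<-//|mp]; apply: lim; rewrite ?mp.
move: m1; rewrite le_eqVlt => /predU1P[<-//|ml].
have [|d d0 Hd] := ext m _ Pm; first by rewrite m0.
exfalso; pose t := Num.min (m + d / 2) 1.
have mt : m < t by rewrite /t lt_min ml ltrDl divr_gt0.
have : B t.
  split; first by rewrite (le_trans m0 (ltW mt)) /= /t ge_min lexx orbT.
  move=> s /andP[s0 st]; have [sm|sm|->//] := ltgtP s m; first by apply: lt_m; rewrite s0.
  apply: Hd; last by rewrite (le_trans st) // /t ge_min lexx orbT.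
  rewrite sm /= (le_lt_trans st) // /t gt_min ltrD2l ltr_pdivrMr // ltr_pMr // ltr1n //.
by move=> /(sup_upper_bound sB); rewrite leNgt mt.
Qed.

Section Shrink.
Variables (R : realType) (V : normedModType R) (c0 : V).

(** The maximum of r and |u - c0|, written with absolute values so that its continuity is that of
    the norm. *)
Definition maxd (r : R) (u : V) : R := (r + `|u - c0| + `|r - `|u - c0| |) / 2.

Lemma maxdE r u : maxd r u = Num.max r `|u - c0|.
Proof.
rewrite /maxd; case: (leP r `|u - c0|) => h.
  by rewrite ler0_norm ?subr_le0 //; field.
by rewrite gtr0_norm ?subr_gt0 //; field.
Qed.

(** The radial retraction onto the closed disc of radius [r] about [c0]. *)
Definition shrink r u : V := c0 + (r * (maxd r u)^-1) *: (u - c0).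

Lemma shrink_continuous r u : 0 < r -> {for u, continuous (shrink r)}.
Proof.
move=> r0; have cs : {for u, continuous (fun u : V => u - c0)}.
  by apply: cvgB; [exact: cvg_id|exact: cvg_cst].
have cn : {for u, continuous (fun u : V => `|u - c0|)} by exact: cvg_norm cs.
have cm : {for u, continuous (maxd r)}.
  rewrite /maxd; apply: cvgM; last exact: cvg_cst.
  apply: cvgD; first by apply: cvgD; [exact: cvg_cst|exact: cn].
  have h : (fun u : V => r - `|u - c0|) x @[x --> u] --> r - `|u - c0|.
    by apply: cvgB; [exact: cvg_cst|exact: cn].
  exact: cvg_norm h.
have ci : {for u, continuous (fun u => r * (maxd r u)^-1)}.
  apply: cvgM; first exact: cvg_cst.
  by apply: cvgV => //; rewrite maxdE gt_eqF // lt_max r0.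
apply: cvgD; first exact: cvg_cst.
exact: cvgZ ci cs.
Qed.

End Shrink.

(** * Continuation of sections of a local homeomorphism by completeness *)

Section Sections.
Variables (R : realType) (S : topologicalType).
Local Notation V := ('rV[R]_2).
Variables (P : S -> V) (G : set S) (dl : S -> S -> R -> Prop).
Hypothesis HS : hausdorff_space S.
Hypothesis cP : continuous P.
Hypothesis dl_trans : forall p q r e e', dl p q e -> dl q r e' -> dl p r (e + e').
Hypothesis dl_refl : forall p e, 0 < e -> dl p p e.
Hypothesis loc : forall x, G x -> exists N : set S,
  [/\ nbhs x N, (forall z z', N z -> N z' -> P z = P z' -> z = z'),
    (forall z z' e, N z -> N z' -> 3 * `|P z - P z'| < e -> dl z z' e), N `<=` G &
    exists (r : R) (Phi : V -> S), [/\ 0 < r, Phi (P x) = x &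
      forall w : V, `|w - P x| < r -> [/\ P (Phi w) = w, N (Phi w) & {for w, continuous Phi}]]].

Definition psect (c : V) r (Psi : V -> S) := forall u : V, `|u - c| < r ->
  [/\ P (Psi u) = u, {for u, continuous Psi} & G (Psi u)].

Lemma disc_convex (c u v : V) r (t : R) : `|u - c| < r -> `|v - c| < r -> 0 <= t <= 1 ->
  `|u + t *: (v - u) - c| < r.
Proof.
move=> ud vd /andP[t0 t1].
have -> : u + t *: (v - u) - c = (1 - t) *: (u - c) + t *: (v - c).
  by apply/rowP => j; rewrite !mxE; ring.
apply: (le_lt_trans (ler_normD _ _)); rewrite !normrZ (ger0_norm t0) ger0_norm ?subr_ge0 //.
have k1 : (1 - t) * `|u - c| <= (1 - t) * Num.max `|u - c| `|v - c|.
  by rewrite ler_wpM2l ?subr_ge0 // le_max lexx.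
have k2 : t * `|v - c| <= t * Num.max `|u - c| `|v - c|.
  by rewrite ler_wpM2l // le_max lexx orbT.
apply: (le_lt_trans (lerD k1 k2)); rewrite -mulrDl subrK mul1r.
by rewrite gt_max ud vd.
Qed.

Lemma seg_continuous (u w : V) (t : R) : {for t, continuous (fun s : R => u + s *: w)}.
Proof. by apply: cvgD; [exact: cvg_cst|apply: cvgZr_tmp; exact: cvg_id]. Qed.

Lemma seg_near (u w : V) (t : R) (Psi : V -> S) (N : set S) : {for u + t *: w, continuous Psi} ->
  nbhs (Psi (u + t *: w)) N -> exists2 d : R, 0 < d & forall s, `|s - t| < d -> N (Psi (u + s *: w)).
Proof.
move=> cPsi nN.
have : nbhs t [set s : R | N (Psi (u + s *: w))].
  have cc : {for t, continuous (Psi \o (fun s : R => u + s *: w))}.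
    by apply: continuous_comp; [exact: seg_continuous|exact: cPsi].
  exact: (cc N nN).
move=> /nbhs_ballP[d /= d0 Hd]; exists d => // s hs; apply: Hd.
by rewrite -ball_normE /= distrC.
Qed.

(** The local bounds of [loc] add up along the segment from [u] to [v], because the projected
    lengths of its subsegments add up. *)
Lemma psect_lip c r Psi u v e : psect c r Psi -> `|u - c| < r -> `|v - c| < r ->
  3 * `|u - v| < e -> dl (Psi u) (Psi v) e.
Proof.
move=> hP ud vd he; pose w := v - u.
have sd (t : R) : 0 <= t <= 1 -> `|u + t *: w - c| < r by exact: disc_convex.
have main : forall e, 3 * (1 * `|w|) < e -> dl (Psi u) (Psi (u + 1 *: w)) e.
  pose Pr (t : R) := forall e, 3 * (t * `|w|) < e -> dl (Psi u) (Psi (u + t *: w)) e.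
  have step (s t : R) (N : set S) : 0 <= s <= 1 -> 0 <= t <= 1 -> s <= t -> Pr s ->
      (forall z z' e, N z -> N z' -> 3 * `|P z - P z'| < e -> dl z z' e) ->
      N (Psi (u + s *: w)) -> N (Psi (u + t *: w)) -> Pr t.
    move=> hs ht st Ps hN Ns Nt e' he'.
    (* The bounds being strict, the slack is shared equally between the part already covered and the
       new piece. *)
    pose eta := (e' - 3 * (t * `|w|)) / 2.
    have eta0 : 0 < eta by rewrite divr_gt0 // subr_gt0.
    have -> : e' = (3 * (s * `|w|) + eta) + (3 * ((t - s) * `|w|) + eta) by rewrite /eta; field.
    apply: dl_trans; first by apply: Ps; rewrite ltrDl.
    apply: hN => //; have [-> _ _] := hP _ (sd s hs); have [-> _ _] := hP _ (sd t ht).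
    have -> : u + s *: w - (u + t *: w) = - ((t - s) *: w) by apply/rowP => j; rewrite !mxE; ring.
    by rewrite normrN normrZ ger0_norm ?subr_ge0 // ltrDl.
  apply: (@real_induction R Pr).
  - by move=> e'; rewrite mul0r mulr0 scale0r addr0; exact: dl_refl.
  - move=> t /andP[t0 t1] Pt; have ht : 0 <= t <= 1 by rewrite t0 ltW.
    have [_ ct Gt] := hP _ (sd t ht); have [N [nN _ hN _ _]] := loc Gt.
    have [d d0 Hd] := seg_near ct nN; exists d => // s /andP[ts std] s1.
    apply: (step t s N) => //; rewrite ?(ltW ts) ?s1 ?(le_trans t0 (ltW ts)) //.
      exact: nbhs_singleton.
    by apply: Hd; rewrite ger0_norm ?subr_ge0 ?(ltW ts) // ltrBlDl.
  - move=> t /andP[t0 t1] Ps; have ht : 0 <= t <= 1 by rewrite ltW.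
    have [_ ct Gt] := hP _ (sd t ht); have [N [nN _ hN _ _]] := loc Gt.
    have [d d0 Hd] := seg_near ct nN.
    pose s := Num.max 0 (t - d / 2).
    have s0 : 0 <= s by rewrite /s le_max lexx.
    have st : s < t by rewrite /s gt_max t0 ltrBlDr ltrDl divr_gt0.
    apply: (step s t N) => //; rewrite ?(ltW st) ?s0 ?(le_trans (ltW st) t1) //.
    + by apply: Ps; rewrite s0.
    + apply: Hd; rewrite ltr0_norm ?subr_lt0 // opprB ltrBlDr -ltrBlDl /s lt_max ltrD2l.
      by rewrite ltrN2 ltr_pdivrMr // ltr_pMr // ltr1n orbT.
    + exact: nbhs_singleton.
have -> : Psi v = Psi (u + 1 *: w) by rewrite scale1r /w addrC subrK.
by apply: main; rewrite mul1r /w distrC.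
Qed.

(** Agreement propagates along the segment: it is open by local injectivity of P, and closed because
    S is Hausdorff. *)
Lemma psect_unique c r Psi c' r' Phi u v : psect c r Psi -> psect c' r' Phi ->
  `|u - c| < r -> `|v - c| < r -> `|u - c'| < r' -> `|v - c'| < r' ->
  Psi u = Phi u -> Psi v = Phi v.
Proof.
move=> h1 h2 uc vc uc' vc' E; pose w := v - u.
have sd (t : R) : 0 <= t <= 1 -> `|u + t *: w - c| < r by exact: disc_convex.
have sd' (t : R) : 0 <= t <= 1 -> `|u + t *: w - c'| < r' by exact: disc_convex.
have -> : v = u + 1 *: w by rewrite scale1r /w addrC subrK.
apply: (@real_induction R (fun t => Psi (u + t *: w) = Phi (u + t *: w))).
- by rewrite scale0r addr0.
- move=> t /andP[t0 t1] Et; have ht : 0 <= t <= 1 by rewrite t0 ltW.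
  have [_ c1 Gt] := h1 _ (sd t ht); have [_ c2 _] := h2 _ (sd' t ht).
  have [N [nN inj _ _ _]] := loc Gt.
  have [d1 d10 Hd1] := seg_near c1 nN.
  have [|d2 d20 Hd2] := seg_near c2 (N := N); first by rewrite -Et.
  exists (Num.min d1 d2); first by rewrite lt_min d10.
  move=> s /andP[ts std] s1; have hs : 0 <= s <= 1 by rewrite s1 (le_trans t0 (ltW ts)).
  have : `|s - t| < Num.min d1 d2 by rewrite ger0_norm ?subr_ge0 ?(ltW ts) // ltrBlDl.
  rewrite lt_min => /andP[/Hd1 n1 /Hd2 n2]; apply: inj => //.
  by have [-> _ _] := h1 _ (sd s hs); have [-> _ _] := h2 _ (sd' s hs).
- move=> t /andP[t0 t1] Es; have ht : 0 <= t <= 1 by rewrite ltW.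
  have [_ c1 _] := h1 _ (sd t ht); have [_ c2 _] := h2 _ (sd' t ht).
  apply: HS => O1 O2 nO1 nO2.
  have [d1 d10 Hd1] := seg_near c1 nO1; have [d2 d20 Hd2] := seg_near c2 nO2.
  pose d := Num.min d1 d2; have d0 : 0 < d by rewrite lt_min d10.
  pose s := Num.max 0 (t - d / 2).
  have s0 : 0 <= s by rewrite /s le_max lexx.
  have st : s < t by rewrite /s gt_max t0 ltrBlDr ltrDl divr_gt0.
  have : `|s - t| < d.
    rewrite ltr0_norm ?subr_lt0 // opprB ltrBlDr -ltrBlDl /s lt_max ltrD2l.
    by rewrite ltrN2 ltr_pdivrMr // ltr_pMr // ltr1n orbT.
  rewrite lt_min => /andP[/Hd1 n1 /Hd2 n2]; exists (Psi (u + s *: w)); split=> //.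
  by rewrite Es ?s0.
Qed.

Lemma inv_small (e : R) : 0 < e -> exists N, forall n, (N <= n)%N -> (n.+1%:R : R)^-1 < e.
Proof. by move=> e0; have [N _ H] := near_infty_natSinv_lt (PosNum e0); exists N => n /H. Qed.

Lemma psect_le c r r' Psi : r <= r' -> psect c r' Psi -> psect c r Psi.
Proof. by move=> le h u hu; apply: h; exact: lt_le_trans le. Qed.

Lemma psect_sub c r c' r' Psi : (forall u : V, `|u - c| < r -> `|u - c'| < r') -> psect c' r' Psi -> psect c r Psi.
Proof. by move=> le h u /le; exact: h. Qed.

Variables (y0 : S) (rho rho' : R).
Hypothesis rho_gt0 : 0 < rho.
Hypothesis rho_lt : 3 * rho < rho'.
Hypothesis far : forall x, dl y0 x rho' -> G x.
Hypothesis complete : forall a : nat -> S,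
  (forall e : R, 0 < e -> exists N : nat, forall m n : nat, (N <= m)%N -> (N <= n)%N -> dl (a m) (a n) e) ->
  exists p, forall e : R, 0 < e -> exists N : nat, forall n : nat, (N <= n)%N -> dl (a n) p e.
Hypothesis top : forall x O, G x -> nbhs x O -> exists2 e : R, 0 < e & forall z, dl z x e -> O z.

Local Notation c0 := (P y0).

Definition is_sect r Psi := Psi c0 = y0 /\ psect c0 r Psi.

(** Radial approximation of [w] from inside, which stays in the open disc even if [w] lies on its
    boundary; for n = 0 it is the centre. *)
Definition apr (w : V) (n : nat) : V := c0 + (1 - n.+1%:R^-1) *: (w - c0).

Lemma apr_dist w n : w - apr w n = n.+1%:R^-1 *: (w - c0).
Proof. by apply/rowP => j; rewrite !mxE; ring. Qed.

Lemma apr_dist2 w m n : apr w m - apr w n = (n.+1%:R^-1 - m.+1%:R^-1) *: (w - c0).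
Proof. by apply/rowP => j; rewrite !mxE; ring. Qed.

Lemma inv_itv n : 0 < (n.+1%:R : R)^-1 <= 1.
Proof. by rewrite invr_gt0 ltr0Sn /= invf_le1 ?ltr0Sn // ler1n. Qed.

Lemma apr_lt w n r : 0 < r -> `|w - c0| <= r -> `|apr w n - c0| < r.
Proof.
move=> r0 h; have /andP[i0 i1] := inv_itv n.
rewrite /apr addrC addKr normrZ ger0_norm ?subr_ge0 //.
have [w0|w0] := eqVneq `|w - c0| 0; first by rewrite w0 mulr0.
apply: lt_le_trans h.
have wp : 0 < `|w - c0| by rewrite lt_neqAle eq_sym w0 normr_ge0.
have h1 : 1 - n.+1%:R^-1 < 1 :> R by rewrite ltrBlDr ltrDl.
by move: h1; rewrite -(ltr_pM2r wp) mul1r.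
Qed.

(** By [psect_lip] the lifts of a radial sequence are Cauchy. Their limit is within [rho'] of [y0],
    since 3 rho < rho', and so stays in the good set [G], where [top] turns metric convergence into
    topological convergence. *)
Lemma limit_point r Psi w : 0 < r -> r <= rho -> is_sect r Psi -> `|w - c0| <= r ->
  exists p, [/\ G p, P p = w & forall O, nbhs p O -> exists N, forall n, (N <= n)%N -> O (Psi (apr w n))].
Proof.
move=> r0 rr [E0 hP] hw.
have al n : `|apr w n - c0| < r by exact: apr_lt.
have [|p hp] := complete (a := fun n => Psi (apr w n)).
  move=> e e0; have er : 0 < e / (3 * r) by rewrite divr_gt0 // mulr_gt0.
  have [N hN] := inv_small er; exists N => m n Nm Nn.
  apply: (psect_lip hP (al m) (al n)).
  have /andP[m0 _] := inv_itv m; have /andP[n0 _] := inv_itv n.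
  have hm := hN m Nm; have hn := hN n Nn.
  rewrite apr_dist2 normrZ.
  have k1 : `|n.+1%:R^-1 - m.+1%:R^-1| < e / (3 * r).
    move: m0 n0 hm hn; move: (m.+1%:R^-1 : R) (n.+1%:R^-1 : R) (e / (3 * r)) => a b k a0 b0 ak bk.
    by rewrite ltr_norml; apply/andP; split; lra.
  apply: (le_lt_trans (_ : _ <= 3 * (`|n.+1%:R^-1 - m.+1%:R^-1| * r))).
    by rewrite ler_pM2l // ler_wpM2l.
  by rewrite mulrCA -ltr_pdivlMr // mulr_gt0.
have Gp : G p.
  have e0 : 0 < rho' - 3 * rho by rewrite subr_gt0.
  have [N hN] := hp _ e0.
  have := hN N (leqnn _) => h; apply: far.
  have -> : rho' = 3 * rho + (rho' - 3 * rho) by ring.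
  apply: dl_trans h; rewrite -E0; apply: (psect_lip hP) => //; first by rewrite subrr normr0.
  by rewrite ltr_pM2l // distrC (lt_le_trans (al N)).
have tp O : nbhs p O -> exists N, forall n, (N <= n)%N -> O (Psi (apr w n)).
  by move=> /(top Gp)[e /hp[N hN] H]; exists N => n /hN; exact: H.
exists p; split=> //.
apply/eqP; rewrite -subr_eq0 -normr_le0; apply/ler_addgt0Pr => e e0; rewrite add0r.
have e2 : 0 < e / 2 by rewrite divr_gt0.
have nP : nbhs p [set z | `|P z - P p| < e / 2].
  have := cP (x := p) => /(_ [set u | `|u - P p| < e / 2]); apply.
  by apply: open_nbhs_nbhs; split; [exact: open_disc|rewrite /= subrr normr0].
have [N1 h1] := tp _ nP; have er : 0 < e / 2 / r by rewrite divr_gt0.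
have [N2 h2] := inv_small er; pose n := maxn N1 N2.
have {}h1 := h1 n (leq_maxl _ _); have {}h2 := h2 n (leq_maxr _ _).
have [PE _ _] := hP _ (al n); rewrite /= PE in h1.
have k2 : `|w - apr w n| <= e / 2.
  have /andP[n0 _] := inv_itv n.
  rewrite apr_dist normrZ gtr0_norm //; apply: (le_trans (_ : _ <= n.+1%:R^-1 * r)); first by rewrite ler_pM2l.
  by rewrite -ler_pdivlMr // ltW.
have -> : P p - w = (P p - apr w n) + (apr w n - w) by rewrite addrA subrK.
rewrite (le_trans (ler_normD _ _)) // [e]splitr lerD //; first by rewrite distrC ltW.
by rewrite distrC.
Qed.

Lemma topological_limit_unique (a : nat -> S) (p p' : S) :
  (forall O, nbhs p O -> exists N, forall n, (N <= n)%N -> O (a n)) ->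
  (forall O, nbhs p' O -> exists N, forall n, (N <= n)%N -> O (a n)) -> p = p'.
Proof.
move=> h h'; apply: HS => O O' /h[N hN] /h'[N' hN'].
by exists (a (maxn N N')); split; [apply: hN; exact: leq_maxl|apply: hN'; exact: leq_maxr].
Qed.

Lemma apr_cvg w O : nbhs w O -> exists N, forall n, (N <= n)%N -> O (apr w n).
Proof.
move=> /nbhs_ballP[d /= d0 Hd].
have e0 : 0 < d / (`|w - c0| + 1) by rewrite divr_gt0 // ltr_wpDl.
have [N hN] := inv_small e0; exists N => n /hN hn; apply: Hd; rewrite -ball_normE /= apr_dist.
have /andP[n0 _] := inv_itv n; rewrite normrZ gtr0_norm //.
move: hn; rewrite ltr_pdivlMr ?ltr_wpDl // => hn; apply: le_lt_trans hn.
by rewrite ler_pM2l // lerDl.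
Qed.

(** The local section through the limit point agrees with Psi at a point of the approximating
    sequence, hence by uniqueness on the whole overlap of the two discs; it therefore also gives the
    limits over neighbouring boundary points. *)
Lemma limit_section r Psi w p : 0 < r -> r <= rho -> is_sect r Psi -> `|w - c0| <= r -> G p -> P p = w ->
  (forall O, nbhs p O -> exists N, forall n, (N <= n)%N -> O (Psi (apr w n))) ->
  exists m Phi, [/\ 0 < m, psect w m Phi, Phi w = p &
    (forall u, `|u - c0| < r -> `|u - w| < m -> Psi u = Phi u) /\
    (forall (w' : V) (p' : S), `|w' - c0| <= r -> `|w' - w| < m ->
      (forall O, nbhs p' O -> exists N, forall n, (N <= n)%N -> O (Psi (apr w' n))) -> p' = Phi w')].
Proof.
move=> r0 rr [E0 hP] hw Gp Pp tp.
have [N [nN inj _ NG [m [Phi [m0 Ew hPhi]]]]] := loc Gp.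
rewrite Pp in Ew hPhi.
have pPhi : psect w m Phi by move=> u /hPhi[h1 h2 h3]; split=> //; exact: NG.
have ww : `|w - w| < m by rewrite subrr normr0.
have agree u : `|u - c0| < r -> `|u - w| < m -> Psi u = Phi u.
  move=> uc uw; have nm : nbhs w [set u | `|u - w| < m].
    by apply: open_nbhs_nbhs; split; [exact: open_disc|].
  have [N1 h1] := apr_cvg nm; have [N2 h2] := tp _ nN.
  pose n := maxn N1 N2; have {}h1 := h1 n (leq_maxl _ _); have {}h2 := h2 n (leq_maxr _ _).
  have an := apr_lt n r0 hw.
  apply: (psect_unique hP pPhi an uc h1 uw).
  have [P1 N3 _] := hPhi _ h1; have [P2 _ _] := hP _ an.
  by apply: inj => //; rewrite P1.
exists m, Phi; split=> //; split=> // w' p' hw' ww' tp'.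
have [_ cPhi _] := pPhi _ ww'.
apply: (topological_limit_unique tp') => O nO.
have nO' : nbhs w' (Phi @^-1` O `&` [set u | `|u - w| < m]).
  apply: filterI; first exact: cPhi.
  by apply: open_nbhs_nbhs; split; [exact: open_disc|].
have [M hM] := apr_cvg nO'; exists M => n /hM[h1 h2].
by rewrite agree //; exact: apr_lt.
Qed.

Lemma near_eq_continuous (f g : V -> S) u : (\forall v \near u, f v = g v) ->
  {for u, continuous f} -> {for u, continuous g}.
Proof.
move=> E; rewrite /prop_for /continuous_at (nbhs_singleton E) => cf.
by apply: cvg_trans cf; exact: (near_eq_cvg E).
Qed.

Local Notation maxd := (@maxd R V c0).
Local Notation shrink := (@shrink R V c0).

Lemma shrink_in r u : 0 < r -> `|shrink r u - c0| <= r.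
Proof.
move=> r0; have m0 : 0 < maxd r u by rewrite maxdE lt_max r0.
rewrite /shrink addrC addKr normrZ ger0_norm; last by rewrite divr_ge0 // ltW.
rewrite mulrAC ler_pdivrMr // ler_pM2l //.
by rewrite maxdE le_max lexx orbT.
Qed.

Lemma shrink_dist r u m : 0 < r -> 0 < m -> `|u - c0| < r + m -> `|u - shrink r u| < m.
Proof.
move=> r0 m0 h; have -> : u - shrink r u = (1 - r / maxd r u) *: (u - c0).
  by rewrite /shrink; apply/rowP => j; rewrite !mxE; ring.
rewrite normrZ maxdE; case: (leP r `|u - c0|) => hr; last by rewrite divff ?gt_eqF // subrr normr0 mul0r.
have n0 : 0 < `|u - c0| by exact: lt_le_trans hr.
rewrite ger0_norm ?subr_ge0 ?ler_pdivrMr ?mul1r // mulrBl mul1r mulfVK ?gt_eqF //.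
by rewrite ltrBlDl.
Qed.

(** [bar] extends Psi to the closed disc by limits. Compactness of that disc gives local sections of
    one common radius [m], and a point of the larger disc uses the one centred at its radial
    retraction. *)
Lemma extend_section r Psi : 0 < r -> r <= rho -> is_sect r Psi ->
  exists m Psi', 0 < m /\ is_sect (r + m) Psi'.
Proof.
move=> r0 rr hPsi; have [E0 hP] := hPsi.
have [bar hbar] : exists bar : V -> S, forall w, `|w - c0| <= r ->
    [/\ G (bar w), P (bar w) = w & forall O, nbhs (bar w) O -> exists N, forall n, (N <= n)%N -> O (Psi (apr w n))].
  have H w : {p | `|w - c0| <= r -> [/\ G p, P p = w & forall O, nbhs p O -> exists N, forall n, (N <= n)%N -> O (Psi (apr w n))]}.
    apply: cid; have [hw|hw] := pselect (`|w - c0| <= r); last by exists y0.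
    by have [p hp] := limit_point r0 rr hPsi hw; exists p.
  by exists (fun w => sval (H w)) => w; exact: (svalP (H w)).
pose Q (m : R) (w : V) := exists Phi : V -> S, psect w m Phi /\
   forall w', `|w' - c0| <= r -> `|w' - w| < m -> Phi w' = bar w'.
have [m m0 hm] : exists2 m : R, 0 < m & forall w, `|w - c0| <= r -> Q m w.
  have cov := (compact_near_coveringP _).1 (@disc_compact R 2 c0 r) R (0^'+) Q.
  have H w : `|w - c0| <= r -> \forall x' \near w & i \near 0^'+, Q i x'.
    move=> hw; have [Gb Pb Lb] := hbar w hw.
    have [m1 [Phi [m10 pPhi _ [_ h3]]]] := limit_section r0 rr hPsi hw Gb Pb Lb.
    (* Halving the radius keeps the disc about a nearby centre inside the disc about [w], so the
       same local section serves for it. *)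
    exists ([set w' | `|w' - w| < m1 / 2], [set m | m < m1 / 2]).
      split=> /=; last by apply: nbhs_right_lt; rewrite divr_gt0.
      by apply: open_nbhs_nbhs; split; [exact: open_disc|rewrite /= subrr normr0 divr_gt0].
    move=> [w' m] /= [hw' hm]; exists Phi.
    have sub u : `|u - w'| < m -> `|u - w| < m1.
      move=> hu; rewrite -(subrK w' u) -addrA (le_lt_trans (ler_normD _ _)) // [m1]splitr.
      by rewrite ltrD // (lt_trans hu).
    split; first exact: psect_sub sub pPhi.
    move=> w'' hw'' /sub h; have [_ _ Lb''] := hbar _ hw''.
    by rewrite (h3 w'' (bar w'')).
  have FF := @filter_filter _ _ (at_right_proper_filter (0 : R)).
  have nQ := cov FF H.
  have PF := at_right_proper_filter (0 : R).
  have [m [m0 hm]] := @filter_ex _ _ PF _ (@filterI _ _ (@filter_filter _ _ PF) _ _ (nbhs_right_gt 0) nQ).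
  by exists m.
have [Fs hFs] : exists Fs : V -> V -> S, forall w, `|w - c0| <= r -> psect w m (Fs w) /\
   forall w', `|w' - c0| <= r -> `|w' - w| < m -> Fs w w' = bar w'.
  have H w : {Phi : V -> S | `|w - c0| <= r -> psect w m Phi /\ forall w', `|w' - c0| <= r -> `|w' - w| < m -> Phi w' = bar w'}.
    apply: cid; have [hw|hw] := pselect (`|w - c0| <= r); last by exists (fun=> y0).
    by have [Phi hPhi] := hm w hw; exists Phi.
  by exists (fun w => sval (H w)) => w; exact: (svalP (H w)).
have ww (w : V) : `|w - w| < m by rewrite subrr normr0.
(* The choice of [Fs] is arbitrary. Continuity holds because two local sections with close centres
   agree, at the centre of one of them with [bar] and then, by uniqueness, throughout the common
   part of their discs. *)
exists m, (fun u => Fs (shrink r u) u); split=> //.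
have near_u u0 : `|u0 - c0| < r + m -> \forall u \near u0, Fs (shrink r u0) u = Fs (shrink r u) u.
  move=> hu0; have hs0 := shrink_in u0 r0.
  have n1 : nbhs u0 [set u | `|u - c0| < r + m] by apply: open_nbhs_nbhs; split; [exact: open_disc|].
  have n2 : nbhs u0 [set u | `|u - shrink r u0| < m].
    by apply: open_nbhs_nbhs; split; [exact: open_disc|exact: shrink_dist].
  have n3 : nbhs u0 [set u | `|shrink r u - shrink r u0| < m].
    have := @shrink_continuous R V c0 r u0 r0 => /(_ [set v | `|v - shrink r u0| < m]); apply.
    by apply: open_nbhs_nbhs; split; [exact: open_disc|exact: ww].
  apply: filterS (filterI n1 (filterI n2 n3)) => u [h1 [h2 h3]].
  have hs := shrink_in u r0; have [pu bu] := hFs _ hs; have [p0 b0] := hFs _ hs0.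
  have k3 : `|shrink r u0 - shrink r u| < m by rewrite distrC; exact: h3.
  have k4 := shrink_dist r0 m0 h1.
  have e : Fs (shrink r u0) (shrink r u0) = Fs (shrink r u) (shrink r u0).
    exact: (etrans (b0 _ hs0 (ww _)) (esym (bu _ hs0 k3))).
  exact: (psect_unique p0 pu (ww _) h2 k3 k4 e).
split.
  have s0 : shrink r c0 = c0 by rewrite /shrink subrr scaler0 addr0.
  rewrite s0; have cc : `|c0 - c0| <= r by rewrite subrr normr0 ltW.
  have [_ b0] := hFs _ cc; rewrite b0 //; have [_ _ L0] := hbar _ cc.
  apply: (topological_limit_unique L0) => O nO; exists 0%N => n _.
  by rewrite /apr subrr scaler0 addr0 E0; exact: nbhs_singleton.
move=> u0 hu0; have hs0 := shrink_in u0 r0; have [p0 b0] := hFs _ hs0.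
have [Pu cu Gu] := p0 u0 (shrink_dist r0 m0 hu0).
by split=> //; exact: near_eq_continuous (near_u u0 hu0) cu.
Qed.

Lemma section_exists : exists Psi, is_sect rho Psi.
Proof.
have Gy0 : G y0.
  by apply: far; apply: dl_refl; apply: lt_trans rho_lt; rewrite mulr_gt0.
rewrite -(mul1r rho); apply: (@real_induction R (fun t => exists Psi, is_sect (t * rho) Psi)).
- exists (fun=> y0); split=> // u; rewrite mul0r => h.
  by have := le_lt_trans (normr_ge0 _) h; rewrite ltxx.
- move=> t /andP[t0 t1] [Psi hPsi].
  have [r [Psi' [hr hP']]] : exists r Psi', t * rho < r /\ is_sect r Psi'.
    move: t0; rewrite le_eqVlt => /predU1P[<-|t0].
      have [N [nN _ _ NG [r [Phi [r0 E0 hPhi]]]]] := loc Gy0.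
      exists r, Phi; rewrite mul0r; split=> //; split=> // u /hPhi[h1 h2 h3]; split=> //; exact: NG.
    have tr : 0 < t * rho by rewrite mulr_gt0.
    have [|m [Psi' [m0 h]]] := extend_section tr _ hPsi; first by rewrite ger_pMl // ltW.
    by exists (t * rho + m), Psi'; rewrite ltrDl.
  exists (r / rho - t); first by rewrite subr_gt0 ltr_pdivlMr.
  move=> s; rewrite addrC subrK => /andP[_ hs] _; exists Psi'; split; first by have [] := hP'.
  by apply: psect_le hP'.2; rewrite -ler_pdivlMr // ltW.
move=> t /andP[t0 t1] hs.
have [Fs hFs] : exists Fs : R -> V -> S, forall s, 0 <= s < t -> is_sect (s * rho) (Fs s).
  have H s : {Psi | 0 <= s < t -> is_sect (s * rho) Psi}.
    apply: cid; have [h|h] := pselect (0 <= s < t); last by exists (fun=> y0).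
    by have [Psi hP] := hs s h; exists Psi.
  by exists (fun s => sval (H s)) => s; exact: (svalP (H s)).
(* At a limit radius each point uses a section over a smaller disc. The midpoint is below [t] and
   still leaves [u] in the interior, and the sections chosen for different points agree because all
   pass through [y0] at the centre. *)
pose sc (u : V) := (`|u - c0| / rho + t) / 2.
have sc0 u : 0 <= sc u by rewrite divr_ge0 // addr_ge0 ?divr_ge0 // ltW.
have sct u : `|u - c0| < t * rho -> sc u < t /\ `|u - c0| < sc u * rho.
  move=> h; have h1 : `|u - c0| / rho < t by rewrite ltr_pdivrMr.
  split; first by rewrite /sc ltr_pdivrMr //; lra.
  by rewrite -ltr_pdivrMr // /sc ltr_pdivlMr //; lra.
have cc (r : R) : 0 < r -> `|c0 - c0| < r by rewrite subrr normr0.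
exists (fun u => Fs (sc u) u); split.
  have [h1 h2] := sct c0 (cc _ (mulr_gt0 t0 rho_gt0)).
  by have [|] := hFs (sc c0); first by rewrite sc0.
move=> u0 hu0; have [h1 h2] := sct u0 hu0.
have [|E0 hP] := hFs (sc u0); first by rewrite sc0.
have [Pu cu Gu] := hP _ h2; split=> //.
apply: near_eq_continuous cu.
have n1 : nbhs u0 [set u | `|u - c0| < sc u0 * rho] by apply: open_nbhs_nbhs; split; [exact: open_disc|].
have n2 : nbhs u0 [set u | `|u - c0| < t * rho] by apply: open_nbhs_nbhs; split; [exact: open_disc|].
apply: filterS (filterI n1 n2) => u [k1 k2]; have [l1 l2] := sct u k2.
have [|E1 hP1] := hFs (sc u); first by rewrite sc0.
apply: (psect_unique hP hP1 (cc _ _) k1 (cc _ _) l2); first exact: le_lt_trans k1.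
  exact: le_lt_trans l2.
by rewrite E0 E1.
Qed.

Lemma sect_dist r Psi u e : is_sect r Psi -> `|u - c0| < r -> 3 * `|u - c0| < e -> dl y0 (Psi u) e.
Proof.
move=> [E0 hP] hu he; rewrite -E0; apply: (psect_lip hP) => //; last by rewrite distrC.
by rewrite subrr normr0; exact: le_lt_trans hu.
Qed.

End Sections.

(** * Point picking and rigidity *)

Section Reachability.
Variables (R : realType) (S : topologicalType) (A : oriented_atlas R S) (J : 'I_3 -> 'M[R]_4).
Variables (X : S -> 'rV[R]_4) (V0 : 'rV[R]_4) (phi : S -> 'rV[R]_3).
Hypothesis HK : hyperkahler J.
Hypothesis HI : immersion A X.
Hypothesis HS : hausdorff_space S.
Hypothesis conn : connected [set: S].
Hypothesis HPP : forall i : chart A, soliton_patch J V0 (cimg i) (local_param X i) (phi \o cinv i).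
Local Notation E p1 p2 := (genergy A X (plane_proj X p1 p2)).
Local Notation h := (genergy A X phi).

Lemma tangent_onb x : exists p1 p2, [/\ dot p1 p1 = 1, dot p2 p2 = 1, dot p1 p2 = 0 & E p1 p2 x = 2].
Proof.
have [i dx] := cdom_cover A x; have Ux := mem_cimg dx.
have [v1 [v2 o]] := exists_onb (HPP i) Ux; have [d h11 h22 h12] := o.
exists (dd v1 (local_param X i) (cmap i x)), (dd v2 (local_param X i) (cmap i x)); split; [exact: h11|exact: h22|exact: h12|].
have sP := plane_proj_smooth HPP (dd v1 (local_param X i) (cmap i x)) (dd v2 (local_param X i) (cmap i x)).
rewrite (genergyE HK HPP sP dx) (energy_onb HK (HPP i) Ux (smooth_diff (sP i) Ux) o).
rewrite !(dd_plane_proj HPP) // !dot_proj2.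
move: (dd v1 _ _) (dd v2 _ _) h11 h22 h12 => e1 e2 h11 h22 h12.
by rewrite h11 h22 h12 (dotC e2 e1) h12 !mulr0 !mulr1 addr0 add0r.
Qed.

Lemma lt32 : (3 / 2 : R) < 2.
Proof. lra. Qed.

Lemma dlt_near x : \forall z \near x, exists e, dlt A X x z e.
Proof.
have [p1 [p2 [pp1 pp2 pp12 Ex]]] := tangent_onb x.
have Ex' : 3 / 2 < E p1 p2 x by rewrite Ex; exact: lt32.
have [N [nN _ len _ _]] := local_section HK HI HPP pp1 pp2 pp12 Ex'.
apply: (filterS _ nN) => z Nz; exists (3 * `|plane_proj X p1 p2 x - plane_proj X p1 p2 z| + 1).
have Nx : N x by exact: nbhs_singleton nN.
by apply: (len _ _ _ Nx Nz); rewrite ltrDl.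
Qed.

Lemma connected_dlt y z : exists e, dlt A X y z e.
Proof.
pose B := [set z | exists e, dlt A X y z e].
have oB : open B.
  rewrite openE => x [e xe]; have := dlt_near x; apply: filterS => z' [e' h'].
  by exists (e + e'); exact: dlt_trans h'.
have cB : closed B.
  rewrite -openC openE => x nx; have := dlt_near x; apply: filterS => z' [e' h'] [e he].
  by apply: nx; exists (e + e'); apply: dlt_trans he (dlt_sym HI h').
have BT : B = [set: S].
  apply: conn; first by exists y; exists 1; exact: dlt_refl ltr01.
  - by exists B => //; rewrite setTI.
  - by exists B => //; rewrite setTI.
have : [set: S] z by [].
by rewrite -BT.
Qed.

Lemma grad0_const (f : S -> R) : (forall z, grad_le A X f 0 z) -> forall y z, f z = f y.
Proof.
move=> g0 y z; have [e [s [hs l]]] := connected_dlt y z.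
have := chain_lipschitz HI (lexx 0) (fun z _ => g0 z) hs l.
by rewrite mul0r normr_le0 subr_eq0 => /eqP.
Qed.

Lemma phi_smooth : gsmooth A phi.
Proof. by move=> i; exact: (lam_smooth HK (HPP i)). Qed.

Lemma energy_ge0 x : 0 <= h x.
Proof.
have [i dx] := cdom_cover A x; have Ux := mem_cimg dx.
have [v1 [v2 o]] := exists_onb (HPP i) Ux.
rewrite (genergyE HK HPP phi_smooth dx) (energy_onb HK (HPP i) Ux (smooth_diff (phi_smooth i) Ux) o).
by rewrite addr_ge0 // dot_ge0.
Qed.

Section Projection.
Variables p1 p2 : 'rV[R]_4.
Hypothesis pp1 : dot p1 p1 = 1.
Hypothesis pp2 : dot p2 p2 = 1.

Lemma grad_energy C z : 0 <= C -> h z <= C ^+ 2 -> grad_le A X (E p1 p2) (4 * C) z.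
Proof.
move=> C0 hz i dz; have Uz := mem_cimg dz; have oU := p_open (HPP i).
have sP := plane_proj_smooth HPP p1 p2; have sE := genergy_smooth HK HPP sP.
split; first exact: smooth_diff (sE i) Uz.
move=> v.
have e u : cimg i u -> energy (local_param X i) (projF (local_param X i) p1 p2) u = (E p1 p2 \o cinv i) u.
  by move=> /cinvK[du Eu]; rewrite /= (genergyE HK HPP sP du) Eu.
rewrite -(dd_near v oU Uz e).
have := energy_deriv_le HK (HPP i) pp1 pp2 v Uz.
rewrite (genergyE HK HPP phi_smooth dz) in hz; rewrite -enorm_sq.
move: (dd v _ _) (energy _ _ _) (enorm _) hz (enorm_ge0 (dd v (local_param X i) (cmap i z))) => t k n hk n0 ht.
have Cn : 0 <= 4 * C * n by rewrite !mulr_ge0.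
rewrite -(@ler_pXn2r _ 2) ?nnegrE // real_normK ?num_real // (le_trans ht) //.
rewrite (_ : (4 * C * n) ^+ 2 = 16 * C ^+ 2 * n ^+ 2); last by ring.
by rewrite ler_wpM2r ?sqr_ge0 // ler_pM2l.
Qed.

(** By [grad_energy] the energy varies by at most 4 C per unit length, so it cannot fall from 2 to
    3/2 within the given distance. *)
Lemma energy_near y x C e : 0 <= C -> 4 * C * e < 1 / 2 -> E p1 p2 y = 2 ->
  (forall z, dlt A X y z e -> h z <= C ^+ 2) -> dlt A X y x e -> 3 / 2 < E p1 p2 x.
Proof.
move=> C0 he Ey hz [s [hs l]].
have C4 : 0 <= 4 * C by rewrite mulr_ge0.
have := chain_lipschitz HI C4 (fun z dz => grad_energy C0 (hz z dz)) hs l.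
rewrite Ey => k; have k2 := le_trans k (ler_wpM2l C4 (ltW l)).
by have := le_lt_trans k2 he; rewrite ltr_norml => /andP[k3 _]; move: k3; lra.
Qed.

End Projection.
End Reachability.

(** The factor t / (t - 1) is the sum of the geometric series of ratio 1 / t. Step lengths k / s are
    thereby dominated by differences of one decreasing sequence, which telescope. *)
Lemma hofer_num (R : realType) (k t s s' : R) : 0 < k -> 1 < t -> 0 < s -> t * s <= s' ->
  k / s <= k * t / (t - 1) / s - k * t / (t - 1) / s'.
Proof.
move=> k0 t1 s0 ss.
have t0 : 0 < t by exact: lt_trans t1.
have t10 : 0 < t - 1 by rewrite subr_gt0.
have ts0 : 0 < t * s by rewrite mulr_gt0.
have s'0 : 0 < s' by exact: lt_le_trans ss.
have h1 : k * t / (t - 1) / s' <= k * t / (t - 1) / (t * s).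
  by rewrite ler_pM2l ?divr_gt0 ?mulr_gt0 // lef_pV2.
apply: le_trans (lerB (lexx _) h1).
have -> : k * t / (t - 1) / s - k * t / (t - 1) / (t * s) = k / s; last exact: lexx.
by field; rewrite !gt_eqF.
Qed.

(* Otherwise a sequence of points along which Q grows geometrically would be Cauchy. *)
Lemma hofer (R : realType) (S : Type) (dl : S -> S -> R -> Prop) (Q : S -> R) (k tau : R) x0 :
  (forall p q r e e', dl p q e -> dl q r e' -> dl p r (e + e')) ->
  (forall p e, 0 < e -> dl p p e) -> (forall p q e, dl p q e -> dl q p e) ->
  (forall p q e e', e <= e' -> dl p q e -> dl p q e') ->
  (forall a : nat -> S,
    (forall e : R, 0 < e -> exists N : nat, forall m n : nat, (N <= m)%N -> (N <= n)%N -> dl (a m) (a n) e) ->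
    exists p, forall e : R, 0 < e -> exists N : nat, forall n : nat, (N <= n)%N -> dl (a n) p e) ->
  (forall p, exists2 e, 0 < e & forall z, dl z p e -> Q z < Q p + 1) ->
  0 < k -> 0 < tau -> 0 < Q x0 ->
  exists y, Q x0 <= Q y /\ forall z, dl y z (k / Num.sqrt (Q y)) -> Q z <= (1 + tau) * Q y.
Proof.
move=> trans refl sym le complete cont k0 tau0 Q0; apply: contrapT => none.
have step x : {z | Q x0 <= Q x -> dl x z (k / Num.sqrt (Q x)) /\ (1 + tau) * Q x < Q z}.
  apply: cid; have [hx|hx] := pselect (Q x0 <= Q x); last by exists x.
  apply: contrapT => nz; apply: none; exists x; split=> // z dz.
  by rewrite leNgt; apply/negP => lt; apply: nz; exists z.
pose a n := iter n (fun x => sval (step x)) x0.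
(* Linear growth is enough to know that Q is unbounded along the sequence. The geometric rate is
   used separately, for the summability of the steps in [stepB]. *)
have aQ n : Q x0 * (1 + n%:R * tau) <= Q (a n).
  elim: n => [|n IH]; first by rewrite mul0r addr0 mulr1.
  have nt : 0 <= n%:R * tau by rewrite mulr_ge0 // ltW.
  have hn : Q x0 <= Q (a n) by apply: le_trans IH; rewrite ler_pMr // lerDl.
  have [_ h1] := svalP (step (a n)) hn; apply: le_trans (ltW h1).
  rewrite -natr1 mulrDl mul1r.
  have : tau * Q x0 <= tau * Q (a n) by rewrite ler_pM2l.
  by move: IH; move: (n%:R * tau) (Q (a n)) (Q x0) => b c d; lra.
have aQ0 n : Q x0 <= Q (a n).
  by apply: le_trans (aQ n); rewrite ler_pMr // lerDl mulr_ge0 // ltW.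
have ap n : 0 < Q (a n) by exact: lt_le_trans (aQ0 n).
pose t := Num.sqrt (1 + tau).
have t1 : 1 < t by rewrite -sqrtr1 /t ltr_sqrt ?ltrDl // addr_gt0.
pose K := k * t / (t - 1).
have K0 : 0 < K by rewrite divr_gt0 ?mulr_gt0 ?subr_gt0 // (lt_trans ltr01).
pose B n := K / Num.sqrt (Q (a n)).
have B0 n : 0 < B n by rewrite divr_gt0 // sqrtr_gt0.
have stepB n : dl (a n) (a n.+1) (B n - B n.+1).
  have [h1 h2] := svalP (step (a n)) (aQ0 n); apply: le h1.
  apply: hofer_num => //; first by rewrite sqrtr_gt0.
  rewrite /t -sqrtrM ?ler_sqrt ?(ltW h2) //; first exact: ltW (ap n.+1).
  by rewrite addr_ge0 // ltW.
have distB m j : dl (a m) (a (m + j.+1)%N) (B m - B (m + j.+1)%N).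
  elim: j => [|j IH]; first by rewrite addn1.
  have := trans _ _ _ _ _ IH (stepB (m + j.+1)%N); rewrite -addnS.
  by rewrite addrA subrK.
have large M : exists N, forall n, (N <= n)%N -> M < Q (a n).
  have c0 : 0 < Q x0 * tau by rewrite mulr_gt0.
  exists (Num.truncn (Num.max 0 (M / (Q x0 * tau)))).+1 => n hn.
  apply: lt_le_trans (aQ n); rewrite mulrDr mulr1.
  apply: (le_lt_trans (_ : _ <= Q x0 * (n%:R * tau))); last by rewrite ltrDr.
  rewrite mulrCA -ler_pdivrMr //.
  have m0 : 0 <= Num.max 0 (M / (Q x0 * tau)) by rewrite le_max lexx.
  have := truncnS_gt (Num.max 0 (M / (Q x0 * tau))).
  rewrite gt_max => /andP[_ h1]; rewrite ltW // (lt_le_trans h1) // ler_nat //.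
have [|p hp] := complete a.
  move=> e e0; have [N hN] := large ((K / e) ^+ 2); exists N.
  have Be n : (N <= n)%N -> B n < e.
    move=> /hN h; rewrite /B ltr_pdivrMr ?sqrtr_gt0 // mulrC -ltr_pdivrMr //.
    have hs : (K / e) ^+ 2 < Num.sqrt (Q (a n)) ^+ 2 by rewrite sqr_sqrtr // ltW.
    by move: hs; rewrite ltr_pXn2r // ?nnegrE ?sqrtr_ge0 // divr_ge0 // ltW.
  have lt m n : (N <= m)%N -> (m < n)%N -> dl (a m) (a n) e.
    move=> hm mn; have := distB m (n - m.+1)%N; rewrite addnS -addSn subnKC //.
    by apply: le; rewrite lerBlDr (le_trans (ltW (Be m hm))) // lerDl ltW.
  move=> m n hm hn; have [mn|nm|->] := ltngtP m n; [exact: lt|exact/sym/lt|exact: refl].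
have [e e0 he] := cont p; have [N1 h1] := hp e e0; have [N2 h2] := large (Q p + 1).
have := he _ (h1 (maxn N1 N2) (leq_maxl _ _)).
by rewrite ltNge ltW // h2 // leq_maxr.
Qed.

(** * A constant phase map forces a plane *)

Section Conclusion.
Variables (R : realType) (S : topologicalType) (A : oriented_atlas R S) (J : 'I_3 -> 'M[R]_4).
Variables (X : S -> 'rV[R]_4) (V0 : 'rV[R]_4) (phi : S -> 'rV[R]_3).
Hypothesis HK : hyperkahler J.
Hypothesis HI : immersion A X.
Hypothesis HS : hausdorff_space S.
Hypothesis conn : connected [set: S].
Hypothesis complete : complete_surface A X.
Hypothesis HPP : forall i : chart A, soliton_patch J V0 (cimg i) (local_param X i) (phi \o cinv i).
Local Notation E p1 p2 := (genergy A X (plane_proj X p1 p2)).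
Local Notation h := (genergy A X phi).

Lemma complete_dlt (a : nat -> S) :
  (forall e : R, 0 < e -> exists N : nat, forall m n : nat, (N <= m)%N -> (N <= n)%N -> dlt A X (a m) (a n) e) ->
  exists p, forall e : R, 0 < e -> exists N : nat, forall n : nat, (N <= n)%N -> dlt A X (a n) p e.
Proof.
move=> ha; have [|p hp] := complete (a := a).
  by move=> e /ha[N hN]; exists N => m n hm hn; apply/riem_lt; exact: hN.
by exists p => e /hp[N hN]; exists N => n hn; apply/riem_lt; exact: hN.
Qed.

Lemma plane_section p1 p2 y (rho rho' : R) : dot p1 p1 = 1 -> dot p2 p2 = 1 -> dot p1 p2 = 0 ->
  0 < rho -> 3 * rho < rho' -> (forall x, dlt A X y x rho' -> 3 / 2 < E p1 p2 x) ->
  exists Psi, is_sect (plane_proj X p1 p2) [set x | 3 / 2 < E p1 p2 x] y rho Psi.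
Proof.
move=> pp1 pp2 pp12 r0 rr far.
exact: (section_exists HS (gsmooth_continuous (plane_proj_smooth HPP p1 p2)) (@dlt_trans R S A X) (@dlt_refl R S A X)
  (local_section HK HI HPP pp1 pp2 pp12) r0 rr far complete_dlt (fun x O => dlt_nbhs HK HI HS HPP pp1 pp2 pp12 (x := x) (O := O))).
Qed.

(** Bessel bounds each of the two squared projections by 1, so the sum 2 forces equality in both. *)
Lemma residual0 (p1 p2 e1 e2 : 'rV[R]_4) : dot p1 p1 = 1 -> dot p2 p2 = 1 -> dot p1 p2 = 0 ->
  dot e1 e1 = 1 -> dot e2 e2 = 1 ->
  dot p1 e1 * dot p1 e1 + dot p2 e1 * dot p2 e1 + (dot p1 e2 * dot p1 e2 + dot p2 e2 * dot p2 e2) = 2 ->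
  e1 = dot p1 e1 *: p1 + dot p2 e1 *: p2.
Proof.
move=> pp1 pp2 pp12 h1 h2 hs; apply/eqP; rewrite -subr_eq0 -dot_eq0.
have b1 := bessel2 e1 pp1 pp2 pp12; have b2 := bessel2 e2 pp1 pp2 pp12.
rewrite h1 in b1; rewrite h2 in b2.
rewrite !(dotBl, dotBr, dotDl, dotDr, dotZl, dotZr) pp1 pp2 pp12 (dotC p2 p1) pp12 h1.
move: b1 b2 hs; rewrite !(dotC e1 p1, dotC e1 p2, dotC e2 p1, dotC e2 p2).
move: (dot p1 e1) (dot p2 e1) (dot p1 e2) (dot p2 e2) => a b c d b1 b2 hs.
by apply/eqP; lra.
Qed.

Lemma I2_rows (p1 p2 : 'rV[R]_4) (w : 'rV[R]_2) :
  w *m (\matrix_(k < 2) (if k == 0 then p1 else p2)) = w 0 0 *: p1 + w 0 1 *: p2.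
Proof.
rewrite mulmx_sum_row !big_ord_recl big_ord0 addr0 !rowK /=.
by rewrite (_ : lift ord0 ord0 = 1) //; apply: val_inj.
Qed.

Lemma onb_row_free (p1 p2 : 'rV[R]_4) : dot p1 p1 = 1 -> dot p2 p2 = 1 -> dot p1 p2 = 0 ->
  row_free (\matrix_(k < 2) (if k == 0 then p1 else p2)).
Proof.
move=> pp1 pp2 pp12; pose M := \matrix_(k < 2) (if k == 0 then p1 else p2); rewrite -/M.
apply/row_freeP; exists M^T; apply/matrixP => i j.
have -> : (M *m M^T) i j = dot (if i == 0 then p1 else p2) (if j == 0 then p1 else p2).
  by rewrite mxE; apply: eq_bigr => k _; rewrite !mxE.
rewrite mxE; move: i j; apply: I2_case; apply: I2_case => /=; by rewrite ?pp1 ?pp2 ?pp12 // dotC.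
Qed.

Lemma plane_of_flat (y : S) : (forall x, h x = 0) -> affine_plane (range X).
Proof.
move=> h0; have [p1 [p2 [pp1 pp2 pp12 Ey]]] := tangent_onb HK HPP y.
(* Where |d phi| vanishes so does the gradient of the projection energy. The constant value 2 is the
   extreme case of Bessel, in which tangent planes coincide with the span of [p1] and [p2]. *)
have E2 x : E p1 p2 x = 2.
  rewrite -Ey; apply: (grad0_const HK HI conn HPP) => z.
  have := grad_energy HK HPP pp1 pp2 (lexx 0) (z := z); rewrite mulr0; apply.
  by rewrite h0 expr0n.
have tang (i : chart A) (u v : 'rV[R]_2) : cimg i u ->
    dd v (local_param X i) u = dot p1 (dd v (local_param X i) u) *: p1 + dot p2 (dd v (local_param X i) u) *: p2.
  move=> Uu; have [dx xE] := cinvK Uu.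
  have [v1 [v2 o]] := exists_onb (HPP i) Uu; have [d h11 h22 h12] := o.
  have sP := plane_proj_smooth HPP p1 p2; have := E2 (cinv i u).
  rewrite (genergyE HK HPP sP dx) xE (energy_onb HK (HPP i) Uu (smooth_diff (sP i) Uu) o).
  rewrite !(dd_plane_proj HPP) // !dot_proj2 => hs.
  have [a [b ->]] := det2_decomp v d; rewrite (dd_comb _ _ _ _ (pdiff (HPP i) Uu)).
  move: (dd v1 _ _) (dd v2 _ _) h11 h22 hs => e1 e2 h11 h22 hs.
  have k1 := residual0 pp1 pp2 pp12 h11 h22 hs; rewrite addrC in hs.
  have k2 := residual0 pp1 pp2 pp12 h22 h11 hs.
  rewrite {1}k1 {1}k2 !(dotDr, dotZr).
  by apply/rowP => j; rewrite !mxE; ring.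
have perp r x : dot r p1 = 0 -> dot r p2 = 0 -> dot r (X x) = dot r (X y).
  move=> r1 r2; apply: (grad0_const HK HI conn HPP (f := fun x => dot r (X x))) => z i dz.
  have Uz := mem_cimg dz; have dF := pdiff (HPP i) Uz.
  rewrite -[(fun x => dot r (X x)) \o cinv i]/(fun y => dot r (local_param X i y)); split.
    by apply: diff_dot => //; exact: differentiable_cst.
  by move=> v; rewrite dd_dotc // (tang i _ v Uz) dotDr !dotZr r1 r2 !mulr0 addr0 normr0 mul0r.
have onto w : exists x, plane_proj X p1 p2 x = w.
  pose rho := `|w - plane_proj X p1 p2 y| + 1.
  have r0 : 0 < rho by rewrite ltr_wpDl.
  have r3 : 3 * rho < 4 * rho by rewrite ltr_pM2r // ltr_nat.
  have far x : dlt A X y x (4 * rho) -> 3 / 2 < E p1 p2 x by move=> _; rewrite E2; exact: lt32.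
  have [Psi [_ hP]] := plane_section pp1 pp2 pp12 r0 r3 far.
  by have [PE _ _] := hP w (ltr_pwDr ltr01 (lexx _)); exists (Psi w).
pose p := X y - (dot p1 (X y) *: p1 + dot p2 (X y) *: p2).
have XE x : X x = p + (dot p1 (X x) *: p1 + dot p2 (X x) *: p2).
  have [D DE] : exists D, D = X x - X y by exists (X x - X y).
  (* The residual is itself a vector orthogonal to [p1] and [p2], so [perp] applies to it and gives
     r . r = r . (X x - X y) = 0. *)
  pose r := D - (dot p1 D *: p1 + dot p2 D *: p2).
  have r1 : dot r p1 = 0.
    by rewrite /r dotBl dotDl !dotZl pp1 (dotC p2 p1) pp12 mulr0 mulr1 addr0 dotC subrr.
  have r2 : dot r p2 = 0.
    by rewrite /r dotBl dotDl !dotZl pp2 pp12 mulr0 mulr1 add0r dotC subrr.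
  have : dot r r == 0.
    by rewrite {2}/r dotBr dotDr !dotZr r1 r2 !mulr0 addr0 subr0 DE dotBr (perp r x r1 r2) subrr.
  rewrite dot_eq0 => /eqP rE; apply/eqP; rewrite -subr_eq0 -rE /r /p DE !dotBr; apply/eqP.
  by apply/rowP => j; rewrite !mxE; ring.
exists p, (\matrix_(k < 2) (if k == 0 then p1 else p2)); split; first exact: onb_row_free.
rewrite eqEsubset; split=> z /=.
  move=> [x _ <-]; exists (plane_proj X p1 p2 x) => //.
  by rewrite I2_rows !mxE /= -XE.
move=> [w _ <-]; have [x <-] := onto w; exists x => //.
by rewrite I2_rows !mxE /= -XE.
Qed.

End Conclusion.

(** With radius 1 / (256 s) one has 2 D <= 1 / s0 and 4 D t <= 1/16, so the parenthesis is at most 5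
    + 1 / s0. The value of [tau] makes kap (5 + 1 / s0) equal to c^2 s^4, half of the lower bound 2
    c^2 s^4 of the left side. *)
Lemma final_num (R : realType) (n c tau s s0 Q kap D t : R) : n = 256 -> 0 < c -> 0 < s0 -> s0 <= s ->
  tau = c ^+ 2 / (2 * n ^+ 2 * (5 + s0^-1)) -> kap = 2 * tau * s ^+ 2 / (1 / n / s) ^+ 2 ->
  s ^+ 2 <= Q -> D <= 2 * (1 / n / s) -> 0 <= t -> t <= 2 * s -> 0 <= D ->
  2 * c ^+ 2 * Q ^+ 2 <= kap * (4 + 2 * D + 4 * D * t) -> False.
Proof.
move=> nE c0 s00 ss tE kE Qs hD t0 ts D0 H.
have n0 : 0 < n by rewrite nE ltr0n.
have sp : 0 < s by exact: lt_le_trans ss.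
have kE' : kap = 2 * n ^+ 2 * tau * s ^+ 4 by rewrite kE; field; rewrite !gt_eqF.
have s0i : 0 < s0^-1 by rewrite invr_gt0.
have M0 : 0 < 2 * n ^+ 2 * (5 + s0^-1) by rewrite !mulr_gt0 ?exprn_gt0 // addr_gt0.
have tau0 : 0 < tau by rewrite tE divr_gt0 // exprn_gt0.
have h1 : 2 * D <= s0^-1.
  have : s^-1 <= s0^-1 by rewrite lef_pV2.
  have : 0 < s^-1 by rewrite invr_gt0.
  by move: hD; rewrite nE; move: (s^-1) (s0^-1) => a b; lra.
have h2 : D * t <= 1 / 64.
  apply: (le_trans (_ : _ <= 2 * (1 / n / s) * (2 * s))); first exact: ler_pM.
  rewrite (_ : 2 * (1 / n / s) * (2 * s) = 4 / n); last by field; rewrite !gt_eqF.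
  by rewrite nE; lra.
have s4 : 0 < s ^+ 4 by rewrite exprn_gt0.
have k0 : 0 < kap by rewrite kE' !mulr_gt0.
have h3 : kap * (4 + 2 * D + 4 * D * t) <= kap * (5 + s0^-1).
  by rewrite ler_pM2l //; move: h1 h2; rewrite -mulrA; move: (D * t) (s0^-1) => a b; lra.
have h4 : kap * (5 + s0^-1) = c ^+ 2 * s ^+ 4.
  by rewrite kE' tE; field; rewrite !gt_eqF // addr_gt0 // mulr_gt0.
have h5 : s ^+ 4 <= Q ^+ 2.
  rewrite (_ : s ^+ 4 = (s ^+ 2) ^+ 2); last by rewrite -exprM.
  by rewrite ler_pXn2r // nnegrE ?sqr_ge0 // (le_trans (sqr_ge0 s)).
have c2 : 0 < c ^+ 2 by rewrite exprn_gt0.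
have h6 : 2 * c ^+ 2 * s ^+ 4 <= 2 * c ^+ 2 * Q ^+ 2 by rewrite ler_pM2l // mulr_gt0.
have h7 : 0 < c ^+ 2 * s ^+ 4 by rewrite mulr_gt0.
have := le_trans (le_trans h6 H) h3; rewrite h4 -mulrA.
by move: h7; move: (c ^+ 2 * s ^+ 4) => k; lra.
Qed.

(** * Vanishing of the energy of the phase map *)

Section PhaseEnergy.
Variables (R : realType) (S : topologicalType) (A : oriented_atlas R S) (J : 'I_3 -> 'M[R]_4).
Variables (X : S -> 'rV[R]_4) (V0 : 'rV[R]_4) (phi : S -> 'rV[R]_3).
Hypothesis HK : hyperkahler J.
Hypothesis HI : immersion A X.
Hypothesis HS : hausdorff_space S.
Hypothesis complete : complete_surface A X.
Hypothesis HPP : forall i : chart A, soliton_patch J V0 (cimg i) (local_param X i) (phi \o cinv i).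
Hypothesis VV : dot V0 V0 = 1.
Variables (q : 'rV[R]_3) (c : R).
Hypothesis qq : dot q q = 1.
Hypothesis c0 : 0 < c.
Hypothesis hc : forall x, c <= dot q (phi x) - c.
Local Notation E p1 p2 := (genergy A X (plane_proj X p1 p2)).
Local Notation h := (genergy A X phi).

Let Q x := h x / (dot q (phi x) - c) ^+ 2.

Let pen p1 p2 a1 a2 x := (dot p1 (X x) - a1) ^+ 2 + (dot p2 (X x) - a2) ^+ 2.

Let v_gt0 x : 0 < dot q (phi x) - c.
Proof. exact: lt_le_trans c0 (hc x). Qed.

Let unit_phi x : dot (phi x) (phi x) = 1.
Proof.
have [i dx] := cdom_cover A x; have := p_unit (HPP i) (mem_cimg dx).
by rewrite /= cmapK.
Qed.

Let v_le1 x : dot q (phi x) - c <= 1.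
Proof.
have := abs_dot_le1 qq (unit_phi x); rewrite ler_norml => /andP[_ h1].
by rewrite lerBlDr (le_trans h1) // lerDl ltW.
Qed.

Let Q_smooth : gsmooth A Q.
Proof.
move=> i; have oU := p_open (HPP i).
have sv : smooth (cimg i) (fun u => dot q (phi (cinv i u)) - c).
  apply: smoothD => //; last by exact: smooth_cst.
  apply: smooth_dot => //; first exact: smooth_cst.
  exact: (phi_smooth HK HPP).
have sh := genergy_smooth HK HPP (phi_smooth HK HPP) i.
have s2 := smoothM oU sv sv.
apply: (smoothM oU sh (smoothV oU _ s2)) => u _.
by rewrite gt_eqF // mulr_gt0.
Qed.

Let pen_smooth p1 p2 a1 a2 kap : gsmooth A (fun x => Q x - kap * pen p1 p2 a1 a2 x).
Proof.
move=> i; have oU := p_open (HPP i); have sF := p_smooth (HPP i).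
have s p a : smooth (cimg i) (fun u => dot p (local_param X i u) - a).
  apply: smoothD => //; last by exact: smooth_cst.
  by apply: smooth_dot => //; exact: smooth_cst.
have s2 p a := smoothM oU (s p a) (s p a).
exact: (smoothD oU (@Q_smooth i) (smoothN oU (smoothM oU (smooth_cst _ kap) (smoothD oU (s2 p1 a1) (s2 p2 a2))))).
Qed.

Let energy_le_Q x : h x <= Q x.
Proof.
rewrite /Q ler_pdivlMr ?exprn_gt0 // ler_piMr ?(energy_ge0 HK HPP) //.
by rewrite expr_le1 // ltW.
Qed.

(** The image of a section is open in the surface, so a maximum of a function over the disc is a
    local maximum on the surface itself. *)
Let section_near p1 p2 y rho r1 Psi u : dot p1 p1 = 1 -> dot p2 p2 = 1 -> dot p1 p2 = 0 ->
  let P := plane_proj X p1 p2 in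
  is_sect P [set x | 3 / 2 < E p1 p2 x] y rho Psi -> r1 < rho -> `|u - P y| < r1 ->
  \forall z \near Psi u, `|P z - P y| < r1 /\ z = Psi (P z).
Proof.
move=> pp1 pp2 pp12 P [_ hP] rr hu; have [Pu cu Gu] := hP u (lt_trans hu rr).
have [N [nN inj _ _ _]] := local_section HK HI HPP pp1 pp2 pp12 Gu.
have cP := gsmooth_continuous (plane_proj_smooth HPP p1 p2) (x := Psi u).
have n1 : nbhs (P (Psi u)) [set w | `|w - P y| < r1].
  by rewrite Pu; apply: open_nbhs_nbhs; split; [exact: open_disc|].
have n2 : nbhs (P (Psi u)) (Psi @^-1` N) by rewrite Pu; exact: cu.
apply: filterS (filterI nN (filterI (cP _ n1) (cP _ n2))) => z [Nz [h1 h2]].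
split; first exact: h1.
have [PE _ _] := hP (P z) (lt_trans h1 rr).
exact: (inj _ _ Nz h2 (esym PE)).
Qed.

Lemma phase_energy0 x : h x = 0.
Proof.
apply/eqP; rewrite eq_le (energy_ge0 HK HPP) andbT leNgt; apply/negP => hx.
have Qx : 0 < Q x by apply: lt_le_trans (energy_le_Q x).
have s00 : 0 < Num.sqrt (Q x) by rewrite sqrtr_gt0.
have [n nE] : exists n : R, n = 256 by exists 256.
have n0 : 0 < n by rewrite nE ltr0n.
(* The point y to be picked depends on [tau], so [tau] may involve only the initial value Q x; as Q
   x <= Q y, it bounds the contribution of V0, which does not scale with Q. *)
pose tau := c ^+ 2 / (2 * n ^+ 2 * (5 + (Num.sqrt (Q x))^-1)).
have M0 : 0 < 5 + (Num.sqrt (Q x))^-1 by rewrite addr_gt0 // invr_gt0.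
have tau0 : 0 < tau by rewrite divr_gt0 ?mulr_gt0 ?exprn_gt0.
have tau1 : tau <= 1.
  have c1 : c <= 1 by rewrite (le_trans (hc x)) // v_le1.
  have n1 : 1 <= n by rewrite nE ler1n.
  have n2 : 1 <= n ^+ 2 by exact: exprn_ege1.
  rewrite ler_pdivrMr ?mulr_gt0 ?exprn_gt0 // mul1r (le_trans (exprn_ile1 _ (ltW c0) c1)) //.
  apply: (le_trans n2); rewrite mulrAC ler_peMl ?exprn_ge0 ?ltW //.
  have : 0 < (Num.sqrt (Q x))^-1 by rewrite invr_gt0.
  by move: (_^-1) => k k0; lra.
have k32 : 0 < 1 / 32 :> R by rewrite divr_gt0.
have [p|y [Qy pick]] := hofer (@dlt_trans R S A X) (@dlt_refl R S A X) (@dlt_sym R S A X HI) (@dlt_le R S A X)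
  (complete_dlt complete) (_ : forall p, exists2 e, 0 < e & forall z, dlt A X z p e -> Q z < Q p + 1) k32 tau0 Qx.
  have [p1 [p2 [pp1 pp2 pp12 Ep]]] := tangent_onb HK HPP p.
  have Ep' : 3 / 2 < E p1 p2 p by rewrite Ep; exact: lt32.
  apply: (dlt_nbhs HK HI HS HPP pp1 pp2 pp12 Ep').
  have := gsmooth_continuous Q_smooth (x := p) => cQ; apply: (cQ [set r : R | r < Q p + 1]).
  by apply: lt_nbhsl; rewrite ltrDl.
set s := Num.sqrt (Q y) in pick.
have Q0 : 0 < Q y by exact: lt_le_trans Qy.
have sp : 0 < s by rewrite sqrtr_gt0.
have s2 : s ^+ 2 = Q y by rewrite sqr_sqrtr // ltW.
have ss : Num.sqrt (Q x) <= s by apply: ler_wsqrtr.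
have pick2 z : dlt A X y z (1 / 32 / s) -> Q z <= (2 * s) ^+ 2.
  move=> /pick hz; apply: (le_trans hz); rewrite exprMn s2.
  apply: ler_wpM2r; first exact: ltW.
  by move: tau1; lra.
have [p1 [p2 [pp1 pp2 pp12 Ey]]] := tangent_onb HK HPP y.
pose P := plane_proj X p1 p2.
have C0 : 0 <= 2 * s by rewrite mulr_ge0 // ltW.
(* On the picked ball |d phi| <= 2 s, so the projection energy, which is 2 at y, drops by at most
   1/4 and stays above 3/2. *)
have hC : 4 * (2 * s) * (1 / 32 / s) < 1 / 2.
  have -> : 4 * (2 * s) * (1 / 32 / s) = 1 / 4 by field; rewrite gt_eqF.
  by rewrite !div1r ltf_pV2 ?posrE ?ltr0n // ltr_nat.
have far z : dlt A X y z (1 / 32 / s) -> 3 / 2 < E p1 p2 z.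
  apply: (energy_near HK HI HPP pp1 pp2 C0 hC Ey) => w hw.
  exact: le_trans (energy_le_Q w) (pick2 w hw).
have si : 0 < s^-1 by rewrite invr_gt0.
(* Lifting increases lengths by a factor of at most 3, and 3/128 < 1/32 keeps the section in the
   picked ball. The maximum is taken over the closed disc of half this radius, where the section is
   continuous. *)
have rho0 : 0 < 1 / 128 / s by rewrite div1r mulr_gt0 // invr_gt0.
have rr : 3 * (1 / 128 / s) < 1 / 32 / s by move: si; move: (s^-1) => k; lra.
have r10 : 0 < 1 / n / s by rewrite div1r mulr_gt0 // invr_gt0.
have r1r : 1 / n / s < 1 / 128 / s by rewrite nE; move: si; move: (s^-1) => k; lra.
have r13 : 3 * (1 / n / s) < 1 / 32 / s by rewrite nE; move: si; move: (s^-1) => k; lra.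
have [Psi hPsi] := plane_section HK HI HS complete HPP pp1 pp2 pp12 rho0 rr far.
have [Psi0 hP] := hPsi.
set r1 := 1 / n / s in r10 r1r r13.
(* On the boundary of the disc the penalty is at least kap r1^2 = 2 tau Q(y), twice the increase tau
   Q(y) that Q may have on the ball; this forces the maximum into the interior. *)
have [kap kapE] : exists kap, kap = 2 * tau * s ^+ 2 / r1 ^+ 2 by exists (2 * tau * s ^+ 2 / r1 ^+ 2).
have kap0 : 0 < kap.
  rewrite kapE; apply: divr_gt0; last exact: exprn_gt0 r10.
  apply: mulr_gt0; last exact: exprn_gt0 sp.
  by apply: mulr_gt0 tau0; rewrite ltr0n.
pose M z := Q z - kap * pen p1 p2 (dot p1 (X y)) (dot p2 (X y)) z.
pose D := [set u : 'rV[R]_2 | `|u - P y| <= r1].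
have penE z : pen p1 p2 (dot p1 (X y)) (dot p2 (X y)) z = dot (P z - P y) (P z - P y).
  by rewrite dot2E !mxE /= /pen !expr2.
have cM : {within D, continuous (M \o Psi)}.
  apply: continuous_in_subspaceT => u; rewrite inE => hu.
  have [_ cu _] := hP u (le_lt_trans hu r1r).
  apply: continuous_comp; first exact: cu.
  exact: (gsmooth_continuous (pen_smooth p1 p2 (dot p1 (X y)) (dot p2 (X y)) kap)).
have Dy : D (P y) by rewrite /D /= subrr normr0 ltW.
have [u] := compact_EVT_max (ex_intro _ _ Dy) (@disc_compact R 2 (P y) r1) cM.
rewrite inE => Du mxu; have [Pu cu Gu] := hP u (le_lt_trans Du r1r).
have near_u : Q (Psi u) <= (1 + tau) * Q y.
  apply: pick; apply: (sect_dist (@dlt_trans R S A X) (@dlt_refl R S A X) (local_section HK HI HPP pp1 pp2 pp12) hPsi (le_lt_trans Du r1r)).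
  by apply: le_lt_trans r13; rewrite ler_pM2l.
have M1 : Q y <= M (Psi u).
  have := mxu (P y); rewrite inE => /(_ Dy); rewrite /= Psi0 {1}/M penE subrr.
  by rewrite dot0l mulr0 subr0.
have pen0 : 0 <= pen p1 p2 (dot p1 (X y)) (dot p2 (X y)) (Psi u) by rewrite penE dot_ge0.
have QyQu : Q y <= Q (Psi u).
  by apply: (le_trans M1); rewrite /M lerBlDr lerDl mulr_ge0 // ltW.
have Du' : `|u - P y| < r1.
  rewrite lt_neqAle Du andbT; apply/eqP => eqr.
  have := sup_dot (u - P y); rewrite eqr => h1.
  have Pu' : P (Psi u) = u by exact: Pu.
  move: M1; rewrite /M penE Pu' => M1.
  have h2 : kap * r1 ^+ 2 <= kap * dot (u - P y) (u - P y) by rewrite ler_pM2l.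
  have h3 : kap * r1 ^+ 2 = 2 * (tau * Q y) by rewrite mulrA kapE s2 mulfVK // gt_eqF // exprn_gt0.
  have h4 : 0 < tau * Q y by rewrite mulr_gt0.
  move: M1 h2 h3 h4 near_u; rewrite [(1 + tau) * _]mulrDl mul1r.
  by move: (tau * Q y) (kap * r1 ^+ 2) (kap * dot _ _) (Q y) (Q (Psi u)) => *; lra.
have locmax : \forall z \near Psi u, M z <= M (Psi u).
  apply: filterS (section_near pp1 pp2 pp12 hPsi r1r Du') => z [h1 ->].
  by apply: mxu; rewrite inE; exact: ltW.
set w := Psi u in Pu Gu near_u M1 pen0 QyQu locmax.
have [i dw] := cdom_cover A w; have Uw := mem_cimg dw.
have hcU z : cimg i z -> c <= dot q ((phi \o cinv i) z) - c by move=> _; exact: hc.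
have QE z : cimg i z -> energy (local_param X i) (phi \o cinv i) z / (dot q ((phi \o cinv i) z) - c) ^+ 2 = Q (cinv i z).
  by move=> /cinvK[dz zE]; rewrite /Q (genergyE HK HPP (phi_smooth HK HPP) dz) zE.
have wE : cinv i (cmap i w) = w by rewrite cmapK.
have Qw : 0 < Q w by exact: lt_le_trans QyQu.
have QU : 0 < energy (local_param X i) (phi \o cinv i) (cmap i w) / (dot q ((phi \o cinv i) (cmap i w)) - c) ^+ 2.
  by rewrite (QE _ Uw) wE.
have XE : local_param X i (cmap i w) = X w by rewrite /local_param /= wE.
have nU : nbhs (cmap i w) (cimg i) by apply: open_nbhs_nbhs; split; [exact: cimg_open|].
have near_i : nbhs (cmap i w) (cinv i @^-1` [set z | M z <= M w]).
  by apply: (cinv_continuous Uw); rewrite wE; exact: locmax.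
have nearU : \forall z \near cmap i w,
    energy (local_param X i) (phi \o cinv i) z / (dot q ((phi \o cinv i) z) - c) ^+ 2
      - kap * ((dot p1 (local_param X i z) - dot p1 (X y)) ^+ 2 + (dot p2 (local_param X i z) - dot p2 (X y)) ^+ 2)
    <= energy (local_param X i) (phi \o cinv i) (cmap i w) / (dot q ((phi \o cinv i) (cmap i w)) - c) ^+ 2
      - kap * ((dot p1 (local_param X i (cmap i w)) - dot p1 (X y)) ^+ 2 + (dot p2 (local_param X i (cmap i w)) - dot p2 (X y)) ^+ 2).
  apply: filterS (filterI nU near_i) => z [Uz hz].
  by rewrite (QE z Uz) (QE _ Uw) XE wE; exact: hz.
have := max_principle HK (HPP i) Uw qq VV pp1 pp2 c0 hcU (ltW kap0) QU nearU.
cbv beta zeta; rewrite (QE _ Uw) XE wE => mp.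
have coord (j : 'I_2) : `|(P w - P y) 0 j| <= r1.
  by apply: le_trans (rV_coord_le _ j) _; rewrite (_ : P w = u) //; exact: ltW.
have d1 : `|dot p1 (X w) - dot p1 (X y)| <= r1 by have := coord 0; rewrite !mxE.
have d2 : `|dot p2 (X w) - dot p2 (X y)| <= r1 by have := coord 1; rewrite !mxE.
apply: (final_num nE c0 s00 ss (erefl tau) kapE _ _ (sqrtr_ge0 (Q w)) _ _ mp).
- by rewrite s2.
- by rewrite mulr_natl mulr2n; exact: lerD.
- have h1 : Q w <= (2 * s) ^+ 2.
    apply: (le_trans near_u); rewrite exprMn s2; apply: ler_wpM2r; first exact: ltW.
    by move: tau1; lra.
  by have := ler_wsqrtr h1; rewrite sqrtr_sqr ger0_norm.
- exact: addr_ge0 (normr_ge0 _) (normr_ge0 _).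
Qed.

End PhaseEnergy.

Lemma regular_ball_cos (R : realType) (q : 'rV[R]_3) r p : regular_ball q r -> sphere_ball q r p ->
  0 < cos r /\ cos r < dot q p.
Proof.
move=> [qq r0 _ rpi] [pp hp]; have hr : - (pi / 2) < r < pi / 2.
  by rewrite rpi andbT (lt_trans _ r0) // oppr_lt0 divr_gt0 // pi_gt0.
split; first exact: cos_gt0_pihalf.
have := abs_dot_le1 qq pp; rewrite ler_norml => hd.
have hd' : dot q p \in `[-1, 1] by rewrite in_itv.
rewrite -(acosK hd') ltr_cos ?in_itv /= ?acos_ge0 ?acos_lepi //.
rewrite (ltW r0) /= (le_trans (ltW rpi)) // ler_pdivrMr // ler_pMr ?pi_gt0 //.
by rewrite ler1n.
Qed.

Theorem theorem2 (R : realType) (J : 'I_3 -> 'M[R]_4)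
  (S : topologicalType) (A : oriented_atlas R S) (X : S -> 'rV[R]_4)
  (V0 : 'rV[R]_4) (phi : S -> 'rV[R]_3) (q : 'rV[R]_3) (r : R) :
  hyperkahler J ->
  surface S ->
  immersion A X ->
  complete_surface A X ->
  dot V0 V0 = 1 ->
  translating_soliton A X V0 ->
  normal_curvature_le0 A X J ->
  complex_phase_map A X J phi ->
  regular_ball q r ->
  range phi `<=` sphere_ball q r ->
  affine_plane (range X).
Proof.
move=> HK [HS _ [y _] conn] HI complete VV HT HC HP ball sub.
have HPP := patch_of_chart HK HI HT HC HP.
have hcos x : 0 < cos r /\ cos r < dot q (phi x).
  by apply: regular_ball_cos ball _; apply: sub; exists x.
have [qq _ _ _] := ball.
have c0 : 0 < cos r / 2 by have [c0 _] := hcos y; exact: divr_gt0.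
apply: (plane_of_flat HK HI HS conn complete HPP y) => x.
apply: (phase_energy0 HK HI HS complete HPP VV qq c0) => z.
by have [_] := hcos z; move: (cos r) (dot _ _) => a b; lra.
Qed.
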